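(* Let $(M,\eta,G)$ be a compact homogeneous contact manifold such that $M=\mathcal{Q}_{P}/\mathbb{Z}_{\ell}$ for some parabolic Lie subgroup $P\subset G^{\mathbb{C}}$ and some $\ell\in\mathbb Z_{>0}$, and let $n=\dim_{\mathbb C}X_P$. Then the cone $\mathscr{C}(M)=\mathbb R^+\times M$ admits a Calabi–Yau metric with Kähler form $\omega_{\mathscr{C}}=\frac12 d\Phi$ such that locally $$\Phi=-\frac{r^{2}\sqrt{-1}}{2(n+1)}\big(\partial-\overline{\partial}\big)\log\big\|s_{U}v_{\delta_{P}}^{+}\big\|^{2}+\frac{r^{2}I(X_{P})}{\ell(n+1)}\,d\theta_{U},$$ for some local section $s_{U}\colon U\subset X_{P}\to G^{\mathbb{C}}$, where $v_{\delta_{P}}^{+}$ is the highest weight vector of the irreducible $\mathfrak{g}^{\mathbb{C}}$-module $V(\delta_{P})$ of highest weight $\delta_P$.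
   Context: A contact structure on a connected manifold $M$ of dimension $2n+1$ ($n\ge1$) is a $1$-form $\eta$ with $\eta\wedge(d\eta)^{n}\neq0$ everywhere. A homogeneous contact manifold $(M,\eta,G)$ is a contact manifold with a connected Lie group $G$ acting transitively and effectively by diffeomorphisms preserving $\eta$; $G$ is taken compact semisimple, the action being understood up to a finite covering of $G$. Flag manifolds: $G^{\mathbb{C}}$ is the connected, simply connected complex Lie group with Lie algebra $\mathfrak{g}^{\mathbb{C}}$ (the complexification of $\mathrm{Lie}(G)$), with Cartan subalgebra $\mathfrak h$, root system $\Pi=\Pi^+\cup\Pi^-$, simple roots $\Sigma$. For $\Theta\subset\Sigma$, $\langle\Theta\rangle^{\pm}$ denotes the positive/negative roots spanned by $\Theta$, and $P=P_\Theta$ is the parabolic subgroup with Lie algebra $\mathfrak n^+\oplus\mathfrak h\oplus\sum_{\alpha\in\langle\Theta\rangle^-}\mathfrak g_\alpha$, where $\mathfrak n^+=\sum_{\alpha\in\Pi^+}\mathfrak g_\alpha$. $X_P=G^{\mathbb C}/P$. Put $\delta_P=\sum_{\alpha\in\Pi^+\setminus\langle\Theta\rangle^+}\alpha$, a dominant integral weight; $V(\delta_P)$ carries a norm $\|\cdot\|$ induced by an inner product invariant under the compact real form of $G^{\mathbb{C}}$. $I(X_P)$ is the Fano index: the largest integer with $\frac{1}{I(X_P)}c_1(X_P)\in H^2(X_P,\mathbb Z)$; $K_{X_P}^{\otimes 1/I(X_P)}$ is the line bundle whose $I(X_P)$-th power is the canonical bundle. For a Hermitian line bundle $(L,H)$,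 $Q(L)=\{u\in L\mid\sqrt{H(u,u)}=1\}$. Set $\mathcal Q_P=Q\big(K_{X_P}^{\otimes 1/I(X_P)}\big)$; then $\mathcal Q_P/\mathbb Z_\ell=Q\big(K_{X_P}^{\otimes\ell/I(X_P)}\big)$, with $\mathbb Z_\ell\subset\mathrm U(1)$ the $\ell$-th roots of unity, and $\pi\colon M\to X_P$ is the projection. Local data: local sections $s_U$ of $G^{\mathbb C}\to X_P$ are holomorphic. $L=K_{X_P}^{\otimes \ell/I(X_P)}$ is $G^{\mathbb C}\times_P\mathbb C$ where $p\in P$ acts on $\mathbb{C}$ by the character $\chi_\mu(p)$ with differential $\mu=\frac{\ell}{I(X_P)}\delta_P$; $s_U$ induces the frame $\sigma_U=[s_U,1]$, with $H(\sigma_U,\sigma_U)=\|s_Uv_{\delta_P}^+\|^{2\ell/I(X_P)}$. $\theta_U$ (modulo $2\pi$) is the fibre angle: $u=e^{\sqrt{-1}\theta_U}\sigma_U/\sqrt{H(\sigma_U,\sigma_U)}$; forms on $U$ are pulled back to $M|_U$ and to the cone. Cone: $r$ is the coordinate on $\mathbb R^+$. Let $\overline\eta=\frac{I(X_P)}{\ell(n+1)}\Big(-\frac{\ell\sqrt{-1}}{2I(X_P)}(\partial-\overline\partial)\log\|s_Uv_{\delta_P}^+\|^2+d\theta_U\Big)$ (a global form on $M$), $\xi=\frac{\ell(n+1)}{I(X_P)}\frac{\partial}{\partial\theta}$, and let $\phi$ be the endomorphism of $TM$ with $\phi(\xi)=0$ and $\phi(X)$ = lift to $\ker\overline\eta$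 of $J\pi_*X$ for $X\in\ker\overline\eta$, with $J$ the complex structure of $X_P$. The complex structure on $\mathscr C(M)$ is $J_{\mathscr C}(Y)=\phi(Y)-\overline\eta(Y)\,r\frac{d}{dr}$ for $Y\in TM$, $J_{\mathscr C}(r\frac{d}{dr})=\xi$. A Calabi–Yau metric here means a Ricci-flat Kähler metric (no completeness required); its Kähler form is $\omega_{\mathscr C}=g_{\mathscr C}(J_{\mathscr C}\otimes\mathrm{id})$. *)

(* Defs.v *)
From HB Require Import structures.
From mathcomp Require Import all_boot all_order all_algebra all_fingroup.
From mathcomp Require Import complex.
From mathcomp Require Import all_classical all_reals all_analysis.

Set Implicit Arguments.
Unset Strict Implicit.
Unset Printing Implicit Defensive.

Import Order.TTheory GRing.Theory Num.Theory.
Import numFieldNormedType.Exports.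

Local Open Scope classical_set_scope.
Local Open Scope ring_scope.
Local Open Scope complex_scope.

Section Manifolds.
Context {K : numFieldType}.

(* C^oo when K is the field of real numbers; when K is the field of complex
   numbers the derivatives are K-linear, and this is holomorphy. *)
Definition smooth_on {V W : normedModType K} (U : set V) (f : V -> W) : Prop :=
  forall (vs : seq V) (x : V), U x ->
    differentiable (foldr (fun v g => 'D_v g) f vs) x.

Record chart (m : nat) (T : topologicalType) := Chart {
  dom : set T ;
  coord : T -> 'rV[K]_m ;
  param : 'rV[K]_m -> T
}.

Definition img m T (c : chart m T) : set 'rV[K]_m := coord c @` dom c.

Definition chart_ok m T (c : chart m T) : Prop :=
  [/\ open (dom c), open (img c),
      forall p, dom c p -> param c (coord c p) = p,
      {within dom c, continuous (coord c)} &
      {within img c, continuous (param c)}].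

Definition overlap m T (c d : chart m T) : set 'rV[K]_m :=
  coord c @` (dom c `&` dom d).

Definition trans m T (c d : chart m T) : 'rV[K]_m -> 'rV[K]_m :=
  fun x => coord d (param c x).

Definition compatible m T (c d : chart m T) : Prop :=
  smooth_on (overlap c d) (trans c d) /\ smooth_on (overlap d c) (trans d c).

(* [atlas] is the maximal atlas. *)
Record manifold (m : nat) := Manifold {
  mcarrier :> topologicalType ;
  atlas : set (chart m mcarrier) ;
  manifold_hausdorff : hausdorff_space mcarrier ;
  manifold_second_countable : @second_countable mcarrier ;
  atlas_cover : forall p, exists2 c, atlas c & dom c p ;
  atlas_maximal : forall c,
    atlas c <-> chart_ok c /\ forall d, atlas d -> compatible c d
}.

Definition smooth_map a b (M : manifold a) (N : manifold b) (U : set M)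
    (f : M -> N) : Prop :=
  {within U, continuous f} /\
  forall c d, atlas c -> atlas d ->
    smooth_on (coord c @` (dom c `&` U `&` f @^-1` dom d))
              (fun x => coord d (f (param c x))).

Definition smooth_map2 a b q (M : manifold a) (N : manifold b) (Q : manifold q)
    (f : M -> N -> Q) : Prop :=
  continuous (fun p : (M * N)%type => f p.1 p.2) /\
  forall c d e, @atlas a M c -> @atlas b N d -> @atlas q Q e ->
    smooth_on
      [set x | exists p p', [/\ dom c p, dom d p', dom e (f p p') &
                                x = row_mx (coord c p) (coord d p')]]
      (fun x : 'rV[K]_(a + b) =>
         coord e (f (param c (lsubmx x)) (param d (rsubmx x)))).

(* The tangent space at 1 is identified with 'rV[K]_m through [echart]. *)
Record lie_group (m : nat) := LieGroup {
  gcarrier :> manifold m ;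
  gmul : gcarrier -> gcarrier -> gcarrier ;
  gone : gcarrier ;
  ginv : gcarrier -> gcarrier ;
  echart : chart m gcarrier ;
  gmulA : associative gmul ;
  gmul1 : left_id gone gmul ;
  gmulV : left_inverse gone ginv gmul ;
  gmul_smooth : smooth_map2 gmul ;
  ginv_smooth : smooth_map setT ginv ;
  echart_atlas : atlas echart ;
  echart_one : dom echart gone
}.

Section LieAlgebra.
Context {m : nat} (G : lie_group m).

(* The antisymmetrized mixed second derivative of the multiplication at (1, 1):
   for a matrix group, u v - v u. *)
Definition lie_bracket (u v : 'rV[K]_m) : 'rV[K]_m :=
  let e := echart G in
  let x0 := coord e (gone G) in
  let mu x y := coord e (gmul (param e x) (param e y)) in
  'D_u (fun x => 'D_v (fun y => mu x y) x0) x0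
  - 'D_v (fun x => 'D_u (fun y => mu x y) x0) x0.

Definition semisimple : Prop :=
  forall W : {vspace 'rV[K]_m},
    (forall x y, y \in W -> lie_bracket x y \in W) ->
    (forall x y, x \in W -> y \in W -> lie_bracket x y = 0) ->
    W = 0%VS.

Definition subgroup (H : set G) : Prop :=
  [/\ H (gone G), forall x y, H x -> H y -> H (gmul x y) &
      forall x, H x -> H (ginv x)].

(* The one-parameter subgroup t |-> exp (t v). *)
Definition one_param (gam : K -> G) (v : 'rV[K]_m) : Prop :=
  [/\ continuous gam, forall s t, gam (s + t) = gmul (gam s) (gam t) &
      is_derive (0 : K) (1 : K) (fun t : K => coord (echart G) (gam t)) v].

End LieAlgebra.
End Manifolds.

Arguments chart K m T : clear implicits.
Arguments manifold K m : clear implicits.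
Arguments lie_group K m : clear implicits.

(* A tensor field is given by its components in the charts [ch i], i in A, of
   an atlas; vectors are rows. A 1-form a has a(w) = w *m a, an endomorphism
   field E has E(w) = w *m E, and a bilinear form b has
   b(u, w) = u *m b *m w^T. *)
Section Tensors.
Context {R : realType} {m : nat} {T : topologicalType} {I : Type}.
Variables (A : set I) (ch : I -> chart R m T).

Let changes (rel : forall (i j : I) (x y : 'rV[R]_m) (D : 'M[R]_m), Prop) :=
  forall i j x, A i -> A j -> overlap (ch i) (ch j) x ->
    rel i j x (trans (ch i) (ch j) x) ('J (trans (ch i) (ch j)) x).

Definition one_form (a : I -> 'rV[R]_m -> 'cV[R]_m) : Prop :=
  (forall i, A i -> smooth_on (img (ch i)) (a i)) /\
  changes (fun i j x y D => a i x = D *m a j y).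

Definition vector_field (xi : I -> 'rV[R]_m -> 'rV[R]_m) : Prop :=
  (forall i, A i -> smooth_on (img (ch i)) (xi i)) /\
  changes (fun i j x y D => xi j y = xi i x *m D).

Definition endo_field (E : I -> 'rV[R]_m -> 'M[R]_m) : Prop :=
  (forall i, A i -> smooth_on (img (ch i)) (E i)) /\
  changes (fun i j x y D => E i x *m D = D *m E j y).

Definition riemannian_metric (g : I -> 'rV[R]_m -> 'M[R]_m) : Prop :=
  [/\ forall i, A i -> smooth_on (img (ch i)) (g i),
      changes (fun i j x y D => g i x = D *m g j y *m D^T),
      forall i x, A i -> img (ch i) x -> (g i x)^T = g i x &
      forall i x (w : 'rV[R]_m), A i -> img (ch i) x -> w != 0 ->
        0 < (w *m g i x *m w^T) 0 0].

Definition pderiv {W : normedModType R} (i : 'I_m) (f : 'rV[R]_m -> W)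
    (x : 'rV[R]_m) : W := 'D_(delta_mx 0 i) f x.

Definition extd (a : 'rV[R]_m -> 'cV[R]_m) (x : 'rV[R]_m) : 'M[R]_m :=
  \matrix_(i, j) (pderiv i (fun y => a y j 0 : R) x
                  - pderiv j (fun y => a y i 0 : R) x).

Definition closed_at (om : 'rV[R]_m -> 'M[R]_m) (x : 'rV[R]_m) : Prop :=
  forall i j k, pderiv i (fun y => om y j k : R) x
              + pderiv j (fun y => om y k i : R) x
              + pderiv k (fun y => om y i j : R) x = 0.

Definition christoffel (g : 'rV[R]_m -> 'M[R]_m) (k i j : 'I_m)
    (x : 'rV[R]_m) : R :=
  2^-1 * \sum_l invmx (g x) k l *
    (pderiv i (fun y => g y j l : R) x + pderiv j (fun y => g y i l : R) x
     - pderiv l (fun y => g y i j : R) x).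

Definition ricci (g : 'rV[R]_m -> 'M[R]_m) (x : 'rV[R]_m) : 'M[R]_m :=
  \matrix_(j, k) \sum_i
    (pderiv i (christoffel g i j k) x - pderiv k (christoffel g i j i) x
     + \sum_p (christoffel g i i p x * christoffel g p j k x
               - christoffel g i k p x * christoffel g p j i x)).

Definition ricci_flat (g : I -> 'rV[R]_m -> 'M[R]_m) : Prop :=
  forall i x, A i -> img (ch i) x -> ricci (g i) x = 0.

(* Multiplication by the imaginary unit, for (x, y) identified with x + i y. *)
Definition stdJ (a : nat) : 'M[R]_(a + a) := block_mx 0 1%:M (- 1%:M) 0.

(* An almost complex structure admitting local holomorphic coordinates [z]. *)
Definition complex_structure (a : nat) (J : I -> 'rV[R]_m -> 'M[R]_m) : Prop :=
  [/\ endo_field J,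
      forall i x, A i -> img (ch i) x -> J i x *m J i x = - 1%:M &
      forall i x, A i -> img (ch i) x ->
        exists (V : set 'rV[R]_m) (z : 'rV[R]_m -> 'rV[R]_(a + a)),
          [/\ open V, V x, smooth_on V z,
              forall y, V y -> J i y *m 'J z y = 'J z y *m stdJ a &
              row_free ('J z x) && row_full ('J z x)]].

Definition kaehler_form (J g : I -> 'rV[R]_m -> 'M[R]_m) :
    I -> 'rV[R]_m -> 'M[R]_m :=
  fun i x => J i x *m g i x.

Definition kaehler_metric (a : nat) (J g : I -> 'rV[R]_m -> 'M[R]_m) : Prop :=
  [/\ complex_structure a J, riemannian_metric g,
      forall i x, A i -> img (ch i) x -> J i x *m g i x *m (J i x)^T = g i x &
      forall i x, A i -> img (ch i) x -> closed_at (kaehler_form J g i) x].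

Definition calabi_yau_metric (a : nat) (J g : I -> 'rV[R]_m -> 'M[R]_m) : Prop :=
  kaehler_metric a J g /\ ricci_flat g.

End Tensors.

Section Contact.
Context {R : realType}.

(* eta /\ (d eta)^n, evaluated up to a nonzero constant on the coordinate
   frame ordered as 0, 1, n+1, 2, n+2, ..., n, 2n. *)
Definition contact_form n (M : manifold R (1 + (n + n)))
    (eta : chart R (1 + (n + n)) M -> 'rV[R]_(1 + (n + n)) ->
           'cV[R]_(1 + (n + n))) : Prop :=
  one_form (@atlas _ _ M) id eta /\
  forall c x, atlas c -> img c x ->
    \sum_(s : 'S_(1 + (n + n)))
      (-1) ^+ (odd_perm s) * eta c x (s (lshift (n + n) 0)) 0 *
      \prod_(i < n) extd (eta c) x (s (rshift 1 (lshift n i)))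
                                   (s (rshift 1 (rshift n i))) != 0.

(* The kernel is only required to be finite, since the action is considered up
   to a finite covering of G. *)
Definition homogeneous_contact n k (M : manifold R (1 + (n + n)))
    (eta : chart R (1 + (n + n)) M -> 'rV[R]_(1 + (n + n)) ->
           'cV[R]_(1 + (n + n)))
    (G : lie_group R k) (act : G -> M -> M) : Prop :=
  [/\ connected [set: M], contact_form eta, smooth_map2 act,
      (forall p, act (gone G) p = p) /\
      (forall a b p, act (gmul a b) p = act a (act b p)) &
      [/\ forall p q, exists a, act a p = q,
          finite_set [set a | forall p, act a p = p] &
          forall a c d x, atlas c -> atlas d -> img c x ->
            dom d (act a (param c x)) ->
            let f y := coord d (act a (param c y)) in
            eta c x = 'J f x *m eta d (f x)]].

(* The cone R^+ x M, with coordinates (r, x). *)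
Definition cone_chart m (M : topologicalType) (c : chart R m M) :
    chart R (1 + m) (R * M)%type :=
  @Chart R (1 + m) (R * M)%type
    [set q : R * M | 0 < q.1 /\ dom c q.2]
    (fun q => row_mx q.1%:M (coord c q.2))
    (fun y => (lsubmx y 0 0, param c (rsubmx y))).

(* J(r d/dr) = xi, and J(Y) = phi(Y) - eta(Y) r d/dr for Y tangent to M. *)
Definition cone_J m (M : topologicalType)
    (eta : chart R m M -> 'rV[R]_m -> 'cV[R]_m)
    (xi : chart R m M -> 'rV[R]_m -> 'rV[R]_m)
    (phi : chart R m M -> 'rV[R]_m -> 'M[R]_m) :
    chart R m M -> 'rV[R]_(1 + m) -> 'M[R]_(1 + m) :=
  fun c y =>
    let r := lsubmx y 0 0 in
    let x := rsubmx y in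
    block_mx 0 (r^-1 *: xi c x) (- r *: eta c x) (phi c x).

End Contact.

Section Complex.
Context {R : realType}.
Local Notation C := (R[i] : numFieldType).

Definition cexp (z : C) : C :=
  (expR (complex.Re z))%:C * (cos (complex.Im z) +i* sin (complex.Im z)).

Definition cplx n (x : 'rV[R]_(n + n)) : 'rV[C]_n :=
  \row_i (x 0 (lshift n i) +i* x 0 (rshift n i)).

Definition realify n (z : 'rV[C]_n) : 'rV[R]_(n + n) :=
  row_mx (map_mx (@complex.Re R) z) (map_mx (@complex.Im R) z).

(* The (1,0) and (0,1) parts of df, evaluated at a real tangent vector w. *)
Definition del n (f : 'rV[R]_(n + n) -> R) x w : C :=
  2^-1 * (('D_w f x)%:C - 'i * ('D_(w *m stdJ n) f x)%:C).
Definition delbar n (f : 'rV[R]_(n + n) -> R) x w : C :=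
  2^-1 * (('D_w f x)%:C + 'i * ('D_(w *m stdJ n) f x)%:C).

Definition simply_connected (T : topologicalType) : Prop :=
  connected [set: T] /\
  forall f : R -> T, continuous f -> f 0 = f 1 ->
    exists H : R * R -> T,
      [/\ continuous H, forall t, 0 <= t <= 1 -> H (0, t) = f t,
          forall t, 0 <= t <= 1 -> H (1, t) = f 0 &
          forall s, 0 <= s <= 1 -> H (s, 0) = f 0 /\ H (s, 1) = f 0].

Definition loc_const (T : topologicalType) (V : Type) (U : set T) (f : T -> V) :
    Prop :=
  forall p, U p -> \forall q \near p, U q -> f q = f p.

(* c_1(X) is the image of the class of the cocycle of det TX (the Jacobians of
   the coordinate changes) under the connecting map of the exponential sequence
   0 -> Z -> C^0(C) -> C^0(C^* ) -> 0, in Cech cohomology: it is the class of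
   h_ij + h_jk - h_ik. The condition is that, up to the coboundary of a real
   cochain e, 1/I times this cocycle is an integral cocycle d, that is,
   that c_1(X) / I in H^2(X, R) comes from H^2(X, Z). *)
Definition c1_divisible n (X : manifold C n) (I : nat) : Prop :=
  exists (S : Type) (U : S -> set X) (c : S -> chart C n X)
         (h : S -> S -> X -> C) (d : S -> S -> S -> X -> int)
         (e : S -> S -> X -> R),
    [/\ forall i, [/\ open (U i), atlas (c i) & U i `<=` dom (c i)],
        forall p, exists i, U i p,
        forall i j, {within U i `&` U j, continuous (h i j)} /\
          forall p, (U i `&` U j) p ->
            cexp ((2 * pi)%:C * 'i * h i j p) =
            \det ('J (trans (c j) (c i)) (coord (c j) p)),
        (forall i j k, loc_const (U i `&` U j `&` U k) (d i j k)) /\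
        (forall i j, loc_const (U i `&` U j) (e i j)) &
        forall i j k p, (U i `&` U j `&` U k) p ->
          (h i j p + h j k p - h i k p) / I%:R =
          (d i j k p)%:~R + (e i j p + e j k p - e i k p)%:C].

Definition fano_index n (X : manifold C n) (I : nat) : Prop :=
  [/\ (0 < I)%N, c1_divisible X I &
      forall I', (0 < I')%N -> c1_divisible X I' -> (I' <= I)%N].

(* B is the matrix of an embedding of Lie(G) in Lie(GC); it being invertible
   over C says that Lie(GC) is the complexification of the image. *)
Definition complexification k (G : lie_group R k) (GC : lie_group C k)
    (B : 'M[C]_k) : Prop :=
  let iota (u : 'rV[R]_k) : 'rV[C]_k := map_mx (fun t => t%:C) u *m B in
  B \in unitmx /\
  forall u w, iota (lie_bracket G u w) = lie_bracket GC (iota u) (iota w).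

Definition span_of k (S : set 'rV[C]_k) : set 'rV[C]_k :=
  [set x | forall W : {vspace 'rV[C]_k}, (forall y, S y -> y \in W) -> x \in W].

Section Roots.
Context {k : nat} (GC : lie_group C k) (h : {vspace 'rV[C]_k}).

(* h is a maximal abelian subalgebra consisting of ad-diagonalizable elements. *)
Definition cartan_subalgebra : Prop :=
  [/\ forall x y, x \in h -> y \in h -> lie_bracket GC x y = 0,
      forall x, (forall y, y \in h -> lie_bracket GC x y = 0) -> x \in h &
      forall x, x \in h -> exists2 B : 'M[C]_k, B \in unitmx &
        forall i, exists a : C, lie_bracket GC x (row i B) = a *: row i B].

Definition weight := 'Hom(subvs_of h, C^o).

Definition root_space (a : weight) : set 'rV[C]_k :=
  [set x | forall t : subvs_of h,
             lie_bracket GC (vsval t) x = (a t : C) *: x].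

Definition is_root (a : weight) : Prop :=
  a != 0 /\ exists2 x, x != 0 & root_space a x.

Definition nat_comb (S : seq weight) (a : weight) : Prop :=
  exists f : weight -> nat, a = \sum_(b <- S) b *+ f b.

Definition simple_roots (Sig : seq weight) : Prop :=
  [/\ free Sig, forall a, a \in Sig -> is_root a &
      forall a, is_root a -> nat_comb Sig a \/ nat_comb Sig (- a)].

Definition pos_root (Sig : seq weight) (a : weight) : Prop :=
  is_root a /\ nat_comb Sig a.

Definition neg_root (Sig : seq weight) (a : weight) : Prop :=
  is_root a /\ nat_comb Sig (- a).

Definition parabolic_algebra (Sig Theta : seq weight) : set 'rV[C]_k :=
  span_of [set x | x \in h \/
    exists2 a, pos_root Sig a \/ neg_root Theta a & root_space a x].

Definition delta (Sig Theta : seq weight) : weight :=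
  \sum_(a \in [set a | pos_root Sig a /\ ~ pos_root Theta a]) a.

End Roots.

(* H is the closed connected subgroup whose Lie algebra, as a real Lie group,
   is L. *)
Definition closed_subgroup_of k (GC : lie_group C k) (L : set 'rV[C]_k)
    (H : set GC) : Prop :=
  [/\ subgroup H, closed H, connected H &
      forall w, L w <->
        exists2 gam : C -> GC, one_param gam w & forall t : R, H (gam t%:C)].

(* B is the matrix of the embedding of Lie(G) in Lie(GC), as above. *)
Definition compact_real_form k (GC : lie_group C k) (B : 'M[C]_k)
    (Gu : set GC) : Prop :=
  compact Gu /\
  closed_subgroup_of
    [set map_mx (fun t => t%:C) u *m B | u in [set: 'rV[R]_k]] Gu.

Definition local_section k n (GC : lie_group C k) (X : manifold C n)
    (pr : GC -> X) (U : set X) (s : X -> GC) : Prop :=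
  [/\ open U, smooth_map U s & forall p, U p -> pr (s p) = p].

(* X is the complex manifold GC / P, with projection pr. *)
Definition quotient_manifold k n (GC : lie_group C k) (P : set GC)
    (X : manifold C n) (pr : GC -> X) : Prop :=
  [/\ smooth_map setT pr,
      forall a b, pr a = pr b <-> P (gmul (ginv a) b) &
      forall p : X, exists U s, local_section pr U s /\ U p].

Section Representation.
Context {k N : nat} (GC : lie_group C k).
Variable rho : GC -> 'M[C]_N.

Definition holomorphic_rep : Prop :=
  [/\ rho (gone GC) = 1%:M,
      forall a b, rho (gmul a b) = rho a *m rho b &
      forall c, @atlas _ _ GC c ->
        smooth_on (img c) (fun x => rho (param c x) : 'M[C]_(N, N))].

Definition drep (x : 'rV[C]_k) : 'M[C]_N :=
  'D_x (fun y => rho (param (echart GC) y) : 'M[C]_(N, N))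
       (coord (echart GC) (gone GC)).

(* The g^C-module induced by rho is irreducible, with highest weight lam and
   highest weight vector v. *)
Definition highest_weight_module (h : {vspace 'rV[C]_k})
    (Sig : seq (weight h)) (lam : weight h) (v : 'cV[C]_N) : Prop :=
  [/\ holomorphic_rep,
      forall W : {vspace 'cV[C]_N},
        (forall x w, w \in W -> drep x *m w \in W) ->
        W = 0%VS \/ W = fullv,
      v != 0,
      forall t : subvs_of h, drep (vsval t) *m v = (lam t : C) *: v &
      forall a x, pos_root GC Sig a -> root_space GC a x -> drep x *m v = 0].

Definition invariant_inner_product (Gu : set GC)
    (ip : 'cV[C]_N -> 'cV[C]_N -> C) : Prop :=
  [/\ forall (a : C) u w z, ip (a *: u + w) z = a * ip u z + ip w z,
      forall u w, ip u w = (ip w u)^*%C,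
      forall u, u != 0 -> 0 < ip u u &
      forall g u w, Gu g -> ip (rho g *m u) (rho g *m w) = ip u w].

Definition vnorm (ip : 'cV[C]_N -> 'cV[C]_N -> C) (w : 'cV[C]_N) : R :=
  Num.sqrt (complex.Re (ip w w)).

End Representation.

(* chi is the character of P with differential mu: P acts on C by chi, and mu
   is extended by 0 on the root spaces. *)
Definition character_of k (GC : lie_group C k) (h : {vspace 'rV[C]_k})
    (P : set GC) (mu : weight h) (chi : GC -> C) : Prop :=
  [/\ forall a, P a -> chi a != 0,
      forall a b, P a -> P b -> chi (gmul a b) = chi a * chi b &
      forall (gam : C -> GC) (t : subvs_of h) (z : 'rV[C]_k),
        span_of [set x | exists2 a : weight h, is_root GC a & root_space GC a x] z ->
        one_param gam (vsval t + z) -> (forall s, P (gam s)) ->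
        forall s, chi (gam s) = cexp (s * (mu t : C))].

Section CircleBundle.
Context {k n N : nat} (GC : lie_group C k) (P : set GC) (X : manifold C n).
Variables (pr : GC -> X) (rho : GC -> 'M[C]_N) (v : 'cV[C]_N).
Variables (ip : 'cV[C]_N -> 'cV[C]_N -> C) (chi : GC -> C).
(* q stands for l / I(X). *)
Variable q : R.

(* The point [g, z] of L = GC x_P C, where [g p, z] = [g, chi(p) z]. *)
Definition line_pt (g : GC) (z : C) : set (GC * C) :=
  [set (gmul g p, (chi p)^-1 * z) | p in P].

(* H(u, u) for u = [g, z]. *)
Definition herm (g : GC) (z : C) : R :=
  complex.Re (`|z| ^+ 2) * vnorm ip (rho g *m v) `^ (2 * q).

Definition logvnorm2 (c : chart C n X) (s : X -> GC) (x : 'rV[R]_(n + n)) : R :=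
  ln (vnorm ip (rho (s (param c (cplx x))) *m v) ^+ 2).

Variables (M : manifold R (1 + (n + n))) (j : M -> set (GC * C)).

(* In the chart e of M, with coordinates (theta, x), the point of coordinates
   (theta, x) is the unit vector exp(i theta) sigma_U / sqrt(H(sigma_U, sigma_U))
   over the point of U with complex coordinate x in c, for sigma_U = [s, 1]. *)
Definition adapted_chart (U : set X) (s : X -> GC) (c : chart C n X)
    (e : chart R (1 + (n + n)) M) : Prop :=
  [/\ chart_ok e, atlas c &
      forall y, img e y ->
        let x := cplx (rsubmx y) in
        let p := param c x in
        [/\ img c x, U p &
            j (param e y) =
            line_pt (s p) (cexp ('i * (lsubmx y 0 0)%:C)
                           / (Num.sqrt (herm (s p) 1))%:C)]].

(* j identifies M, with its smooth structure, with Q(L). *)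
Definition circle_bundle : Prop :=
  [/\ injective j,
      range j = [set A | exists g z, Num.sqrt (herm g z) = 1 /\
                                     A = line_pt g z],
      forall U s c e, local_section pr U s -> adapted_chart U s c e ->
        @atlas _ _ M e &
      forall m, exists U s c e, [/\ local_section pr U s,
        adapted_chart U s c e & dom e m]].

Definition bundle_projection (proj : M -> X) : Prop :=
  forall m g z, j m (g, z) -> proj m = pr g.

Definition is_eta_bar
    (eta : chart R (1 + (n + n)) M -> 'rV[R]_(1 + (n + n)) ->
           'cV[R]_(1 + (n + n))) : Prop :=
  one_form (@atlas _ _ M) id eta /\
  forall U s c e y (w : 'rV[R]_(1 + (n + n))),
    local_section pr U s -> adapted_chart U s c e -> img e y ->
    let f := logvnorm2 c s in
    let x := rsubmx y in
    let wx := rsubmx w in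
    let dtheta := lsubmx w 0 0 in
    ((w *m eta e y) 0 0)%:C =
    ((q * n.+1%:R)^-1)%:C *
      (- (q%:C * 'i / 2) * (del f x wx - delbar f x wx) + dtheta%:C).

Definition is_xi
    (xi : chart R (1 + (n + n)) M -> 'rV[R]_(1 + (n + n)) ->
          'rV[R]_(1 + (n + n))) : Prop :=
  vector_field (@atlas _ _ M) id xi /\
  forall U s c e y, local_section pr U s -> adapted_chart U s c e -> img e y ->
    xi e y = row_mx (q * n.+1%:R)%:M 0.

Definition is_phi (proj : M -> X)
    (eta : chart R (1 + (n + n)) M -> 'rV[R]_(1 + (n + n)) ->
           'cV[R]_(1 + (n + n)))
    (xi : chart R (1 + (n + n)) M -> 'rV[R]_(1 + (n + n)) ->
          'rV[R]_(1 + (n + n)))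
    (phi : chart R (1 + (n + n)) M -> 'rV[R]_(1 + (n + n)) ->
           'M[R]_(1 + (n + n))) : Prop :=
  endo_field (@atlas _ _ M) id phi /\
  forall e y, atlas e -> img e y ->
    xi e y *m phi e y = 0 /\
    forall w : 'rV[R]_(1 + (n + n)), w *m eta e y = 0 ->
      w *m phi e y *m eta e y = 0 /\
      forall c, atlas c -> dom c (proj (param e y)) ->
        let dproj := 'J (fun y' => realify (coord c (proj (param e y')))) y in
        w *m phi e y *m dproj = w *m dproj *m stdJ n.

(* The local expression of Phi in the coordinates (r, theta, x) of the cone. *)
Definition Phi_formula (U : set X) (s : X -> GC)
    (Phi : chart R (1 + (n + n)) M -> 'rV[R]_(1 + (1 + (n + n))) ->
           'cV[R]_(1 + (1 + (n + n)))) : Prop :=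
  forall c e y (w : 'rV[R]_(1 + (1 + (n + n)))),
    adapted_chart U s c e -> img (cone_chart e) y ->
    let f := logvnorm2 c s in
    let r := lsubmx y 0 0 in
    let x := rsubmx (rsubmx y) in
    let wx := rsubmx (rsubmx w) in
    let dtheta := lsubmx (rsubmx w) 0 0 in
    ((w *m Phi e y) 0 0)%:C =
    - ((r ^+ 2)%:C * 'i / (2 * n.+1%:R)) * (del f x wx - delbar f x wx)
    + (r ^+ 2 / (q * n.+1%:R) * dtheta)%:C.

End CircleBundle.
End Complex.

Arguments simply_connected R T : clear implicits.

(* Main.v *)
(* On the cone over an adapted chart, with z_0 the complex fibre coordinate and z_1 .. z_n base coordinates, Phi = - (1/2) J grad r^2 and r^2 = (h |exp z_0|^2)^(1/(n+1)), h a power of <W, W> with W = rho(s) v: so (1/2) d Phi is the form of the potential r^2 / 2, positive by Cauchy-Schwarz.  The determinant of its complex Hessian is |T|^2 Psi, where T is holomorphic and Psi is a multiple of Gram(rho(s) v, rho(s) drep(w_b) v) / <W, W>^n; the weights of g/p sum to -delta_P, so Psi is locally constant, and the metric is Ricci-flat. *)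
Require Import Defs.
From HB Require Import structures.
From mathcomp Require Import all_boot all_order all_algebra.
From mathcomp Require Import complex.
From mathcomp Require Import all_classical all_reals all_analysis.

Import Order.TTheory GRing.Theory Num.Theory.
Import numFieldNormedType.Exports.
Local Open Scope classical_set_scope.
Local Open Scope ring_scope.
From mathcomp Require Import ring lra zify.

Set Implicit Arguments.
Unset Strict Implicit.
Unset Printing Implicit Defensive.

Local Open Scope complex_scope.
Local Notation coord := Defs.coord.
Local Notation cnum R := (complex R : numFieldType).
Local Notation cRe := complex.Re.
Local Notation cIm := complex.Im.
Local Notation dfb f F := (differentiable f F).
Local Notation dlt i := (delta_mx 0 i).
Local Notation dfd := diff_derivable.
Local Notation onbhs := open_nbhs_nbhs.
Local Notation nmod := normedModType.
Local Notation dfdP := derivable1_diffP.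
Local Notation dfb_comp := differentiable_comp.
Local Notation numF := numFieldType.
Tactic Notation "sumext" ident(i) := apply: eq_bigr => i _.
Tactic Notation "mxext" ident(i) ident(j) := apply/matrixP => i j.
Tactic Notation "rowext" ident(i) := apply/rowP => i.
Tactic Notation "via" constr(x) := transitivity x.
Tactic Notation "fext" ident(x) := apply/funext => x.

(** Two inputs of the overview need a source. The local constancy of Psi rests on the splitting g^C
    = Ad(g^-1) u + p at every g of G^C, with u the compact form: u acts skewly and drops out, while
    l in p preserves the span of v and the w_b v with trace (n+1) lambda(l) + tr(ad l on g/p) = n
    lambda(l), since lambda is minus that trace. So the Gram determinant has n times the logarithmic
    derivative of <W, W>. That these n + 1 vectors are independent means that p is the full
    stabilizer of the line of v; this is drawn from the Killing form, which is negative on u because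
    Ad of a compact group is bounded. The obstacle is the gap between tensors given by real matrices
    in charts and holomorphic data in complex coordinates. Local functions are therefore packed into
    a commutative ring with commuting derivations, in which the Levi-Civita connection, the Chern
    connection and the determinant are pure algebra, and are then evaluated at points. The contact
    tensors are explicit in adapted charts only; they are spread over the maximal atlas once the
    change of adapted charts is computed without choosing a branch of the logarithm. *)

(** * Differentiability by order and its calculus *)

Section Smooth.
Context {K: numF}.
Implicit Types (V W: nmod K).

Lemma diff_epsE V W (f: V -> W) x: dfb f x ->
 forall eps: K, 0 < eps ->
 \forall h \near (0: V), `|f (h + x) - f x - 'd f x h| <= eps * `|h|.
move=> /diff_locallyP[_ fE] e e0.
have /eqaddoP /(_ e e0) := fE.
by apply: filterS=> h;rewrite /= opprD addrA.
Qed.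

(** The little-o definition unfolds to this estimate, and uniqueness of the differential identifies
    ['d f x] with any continuous linear candidate. *)
Lemma diff_eps V W (f: V -> W) (A: {linear V -> W}) x: continuous A ->
 (forall eps: K, 0 < eps ->
 \forall h \near (0: V), `|f (h + x) - f x - A h| <= eps * `|h|) ->
 dfb f x /\ 'd f x = A :> (V -> W).
move=> cA h.
have E: f \o shift x = cst (f x) + A +o_ (nbhs (0:V)) id.
 apply/eqaddoP=> e e0;have := h _ e0;apply: filterS=> y.
 by rewrite /= opprD addrA.
have dA:= diff_unique cA E.
split=> //;apply/diff_locallyP;rewrite dA;split=> //.
Qed.

Lemma near_eq_diff V W (f g: V -> W) x :
 (\forall y \near x, f y = g y) -> dfb f x ->
 dfb g x /\ 'd g x = 'd f x :> (V -> W).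
move=> fg df;apply: diff_eps;first exact: diff_continuous.
move=> e e0.
have fgx: f x = g x by exact: nbhs_singleton fg.
have := diff_epsE df e0.
have fg': \forall h \near (0:V), f (h + x) = g (h + x).
 have sh: (fun h: V => h + x) @ (0:V) --> x.
 rewrite -{2}[x]add0r;apply: cvgD;[exact: cvg_id| exact: cvg_cst].
 exact: (sh _ fg).
apply: filterS2 fg'=> h E;by rewrite E fgx.
Qed.

Lemma near_dfb V W (f g: V -> W) x :
 (\forall y \near x, f y = g y) -> dfb f x -> dfb g x.
by move=> fg df;have [] := near_eq_diff fg df. Qed.
Lemma open_near V (U: set V) x (P: V -> Prop) :
 open U -> U x -> (forall y, U y -> P y) -> \forall y \near x, P y.
by move=> oU Ux h;apply: filterS h _;exact: onbhs. Qed.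

Lemma differentiable_mx V m n (M: V -> 'M[K]_(m, n)) x :
 (forall i j, dfb (fun y => M y i j: K) x) -> dfb M x.
move=> h.
have -> : M = \sum_(i < m) \sum_(j < n) (fun y => M y i j *: (delta_mx i j: 'M[K]_(m, n))).
 fext y;rewrite fct_sumE [LHS]matrix_sum_delta.
 by sumext i;rewrite fct_sumE.
apply: differentiable_sum=> i;apply: differentiable_sum=> j.
exact: differentiableZl.
Qed.

Definition mxentry m n (i: 'I_m) (j: 'I_n) (A: 'M[K]_(m, n)): K := A i j.

Lemma mxentry_is_linear m n (i: 'I_m) (j: 'I_n): linear (@mxentry m n i j).
by move=> k A B;rewrite /mxentry !mxE. Qed.

HB.instance Definition _ m n i j :=
 @GRing.isLinear.Build K 'M[K]_(m, n) K _ (@mxentry m n i j) (@mxentry_is_linear m n i j).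

Lemma mxentry_continuous m n i j: continuous (@mxentry m n i j).
exact: coord_continuous. Qed.

Lemma dfb_ij V m n (M: V -> 'M[K]_(m, n)) x i j: dfb M x ->
 dfb (fun y => M y i j: K) x /\
 forall v, 'D_v (fun y => M y i j: K) x = 'D_v M x i j.
move=> dM.
have de: dfb (@mxentry m n i j) (M x).
 by apply: linear_differentiable;exact: mxentry_continuous.
have E: (fun y => M y i j) = @mxentry m n i j \o M by [].
split;first by rewrite E;exact: dfb_comp.
move=> v;rewrite deriveE;last by rewrite E;exact: dfb_comp.
rewrite E diff_comp // deriveE // /=.
by rewrite diff_lin //;exact: mxentry_continuous.
Qed.

Lemma derive_entry V m n (M: V -> 'M[K]_(m, n)) x v: dfb M x ->
 'D_v M x = \matrix_(i, j) 'D_v (fun y => M y i j: K) x.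
by move=> dM;mxext i j;rewrite mxE (dfb_ij i j dM).2. Qed.

(** Differentiability counted by order: all iterated directional derivatives of length at most [n]
    are differentiable on [U]. [smooth_on] quantifies over all lists of directions at once; the
    order gives an induction for products, inverses and compositions. *)
Fixpoint smn {V W} n (U: set V) (f: V -> W): Prop :=
 (forall x, U x -> dfb f x) /\
 if n is n'.+1 then forall v, smn n' U ('D_v f) else True.

Lemma smn_diff V W n (U: set V) (f: V -> W) x: smn n U f -> U x -> dfb f x.
by case: n=> [|n] [h _];exact: h. Qed.
Lemma smnD1 V W n (U: set V) (f: V -> W) v: smn n.+1 U f -> smn n U ('D_v f).
by move=> [_ h];exact: h. Qed.
Lemma smnS V W n (U: set V) (f: V -> W): smn n.+1 U f -> smn n U f.
elim: n f=> [|n IH] f h;first by split=> //;exact: h.1.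
by split=> [|v];[exact: h.1|apply: IH;exact: smnD1].
Qed.

Lemma smooth_onP V W (U: set V) (f: V -> W): smooth_on U f <-> forall n, smn n U f.
split=> [sf n|h vs].
 elim: n f sf=> [|n IH] f sf;first by split=> // x Ux;exact: (sf [::]).
 split=> [x Ux|v];first exact: (sf [::]).
 apply: IH=> vs x Ux;have := sf (rcons vs v) x Ux.
 by rewrite foldr_rcons.
elim/last_ind: vs f h=> [|vs v IH] f h x Ux;first exact: (smn_diff (h 0%N)).
rewrite foldr_rcons;apply: IH=> // n;exact: smnD1 (h n.+1).
Qed.

Lemma smn_eq V W n (U: set V) (f g: V -> W): open U ->
 (forall x, U x -> f x = g x) -> smn n U f -> smn n U g.
move=> oU;elim: n f g=> [|n IH] f g fg h.
 split=> // x Ux;apply: near_dfb (h.1 x Ux).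
 exact: open_near Ux _.
have fgn x: U x -> \forall y \near x, f y = g y by move=> Ux;exact: open_near Ux _.
split=> [x Ux|v];first exact: near_dfb (fgn x Ux) (h.1 x Ux).
apply: (IH ('D_v f))=> [x Ux|];last exact: smnD1.
by apply: near_eq_derive;exact: fgn.
Qed.

Lemma smn_subset V W n (U U': set V) (f: V -> W): U' `<=` U -> smn n U f -> smn n U' f.
move=> s;elim: n f=> [|n IH] f h;first by split=> // x /s /h.1.
by split=> [x /s /h.1 //|v];apply: IH;exact: smnD1.
Qed.

Lemma smn_local V W n (U: set V) (f: V -> W) :
 (forall x, U x -> exists2 U', U' x & smn n U' f) -> smn n U f.
elim: n f=> [|n IH] f h.
 by split=> // x /h[U' U'x] [+ _];exact.
split=> [x /h[U' U'x] [+ _]|v];first exact.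
by apply: IH=> x /h[U' U'x] s;exists U'=> //;exact: smnD1.
Qed.

Lemma smn_cst V W n (U: set V) (c: W): smn n U (fun=> c).
elim: n c=> [|n IH] c;split=> //;try by move=> x _;exact: differentiable_cst.
move=> v;have -> : 'D_v (fun _: V => c) = fun=> 0;last exact: IH.
by fext x;rewrite derive_cst.
Qed.

Lemma smn_D V W n (U: set V) (f g: V -> W): open U -> smn n U f -> smn n U g ->
 smn n U (fun x => f x + g x).
move=> oU;elim: n f g=> [|n IH] f g F G.
 by split=> // x Ux;apply: differentiableD;[exact: F.1|exact: G.1].
split=> [x Ux|v];first by apply: differentiableD;[exact: F.1|exact: G.1].
apply: (@smn_eq _ _ _ _ (fun x => 'D_v f x + 'D_v g x))=> //.
 by move=> x Ux;rewrite deriveD //;apply: dfd;[exact: F.1|exact: G.1].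
by apply: IH;exact: smnD1.
Qed.

Lemma smn_M V n (U: set V) (f g: V -> K): open U -> smn n U f -> smn n U g ->
 smn n U (fun x => f x * g x).
move=> oU;elim: n f g=> [|n IH] f g F G.
 by split=> // x Ux;apply: differentiableM;[exact: F.1|exact: G.1].
split=> [x Ux|v];first by apply: differentiableM;[exact: F.1|exact: G.1].
apply: (@smn_eq _ _ _ _ (fun x => f x * 'D_v g x + g x * 'D_v f x))=> //.
 move=> x Ux;rewrite deriveM //;apply: dfd;[exact: F.1|exact: G.1].
by apply: smn_D=> //;apply: IH;(exact: smnS) || (exact: smnD1).
Qed.

Lemma smn_N V W n (U: set V) (f: V -> W): open U -> smn n U f -> smn n U (fun x => - f x).
move=> oU;elim: n f=> [|n IH] f F.
 by split=> // x Ux;apply: differentiableN;exact: F.1.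
split=> [x Ux|v];first by apply: differentiableN;exact: F.1.
apply: (@smn_eq _ _ _ _ (fun x => - 'D_v f x))=> //;last by apply: IH;exact: smnD1.
by move=> x Ux;rewrite deriveN //;apply: dfd;exact: F.1.
Qed.

Lemma smn_V V n (U: set V) (f: V -> K): open U -> (forall x, U x -> f x != 0) ->
 smn n U f -> smn n U (fun x => (f x)^-1).
move=> oU f0;elim: n=> [|n IH] F.
 by split=> // x Ux;apply: differentiableV;[exact: F.1|exact: f0].
split=> [x Ux|v];first by apply: differentiableV;[exact: F.1|exact: f0].
apply: (@smn_eq _ _ _ _ (fun x => - ((f x)^-1 * (f x)^-1 * 'D_v f x)))=> //.
 move=> x Ux;rewrite deriveV ?f0 //;last by apply: dfd;exact: F.1.
 by rewrite scaleNr -exprVn expr2.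
apply: smn_N=> //;apply: smn_M=> //;last exact: smnD1.
by apply: smn_M=> //;apply: IH;exact: smnS.
Qed.

Lemma smn_mx V m k n (U: set V) (M: V -> 'M[K]_(m, k)): open U ->
 smn n U M <-> forall i j, smn n U (fun y => M y i j: K).
move=> oU;split.
 move=> h i j;elim: n M h=> [|n IH] M h.
 by split=> // x Ux;apply: (dfb_ij i j (h.1 x Ux)).1.
 split=> [x Ux|v];first by apply: (dfb_ij i j (h.1 x Ux)).1.
 apply: (@smn_eq _ _ _ _ (fun x => 'D_v M x i j))=> //.
 by move=> x Ux;rewrite (dfb_ij i j (h.1 x Ux)).2.
 by apply: IH;exact: smnD1.
elim: n M=> [|n IH] M h.
 by split=> // x Ux;apply: differentiable_mx=> i j;exact: (h i j).1.
have dM x: U x -> dfb M x.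
 by move=> Ux;apply: differentiable_mx=> i j;exact: (h i j).1.
split=> // v;apply: IH=> i j.
apply: (@smn_eq _ _ _ _ ('D_v (fun x => M x i j: K)))=> //;last exact: smnD1.
by move=> x Ux;rewrite (dfb_ij i j (dM x Ux)).2.
Qed.

Lemma diff_rV_sum m W (f: 'rV[K]_m -> W) y (w: 'rV[K]_m): dfb f y ->
 'd f y w = \sum_i w 0 i *: 'D_(dlt i) f y.
move=> df;rewrite {1}(row_sum_delta w) linear_sum.
by sumext i;rewrite linearZ /= deriveE.
Qed.

Lemma derive_comp V m W (g: V -> 'rV[K]_m) (f: 'rV[K]_m -> W) x v :
 dfb g x -> dfb f (g x) ->
 'D_v (fun y => f (g y)) x = \sum_i 'D_v (fun y => g y 0 i: K) x *: 'D_(dlt i) f (g x).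
move=> dg df;rewrite deriveE;last exact: dfb_comp.
rewrite (@diff_comp _ _ _ _ g f) //= diff_rV_sum //.
by sumext i;rewrite -(deriveE v dg) (dfb_ij 0 i dg).2.
Qed.

Lemma smn_sum V W n (I: Type) (r: seq I) (U: set V) (F: I -> V -> W): open U ->
 (forall i, smn n U (F i)) -> smn n U (fun x => \sum_(i <- r) F i x).
move=> oU h;elim: r=> [|i r IH].
 by apply: (smn_eq _ _ (smn_cst n U 0))=> // x _;rewrite big_nil.
apply: (smn_eq _ _ (smn_D oU (h i) IH))=> // x _;by rewrite big_cons.
Qed.

(** The chain rule writes the derivative as a sum of products of derivatives of [g] with
    compositions of partial derivatives of [f], all of lower order. *)
Lemma smn_comp V m n (U: set V) (O: set 'rV[K]_m) (g: V -> 'rV[K]_m)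
 (f: 'rV[K]_m -> K): open U -> (forall x, U x -> O (g x)) ->
 smn n U g -> smn n O f -> smn n U (fun x => f (g x)).
move=> oU UO;elim: n f=> [|n IH] f G F.
 by split=> // x Ux;apply: dfb_comp;[exact: G.1|apply: F.1;exact: UO].
split=> [x Ux|v];first by apply: dfb_comp;[exact: G.1|apply: F.1;exact: UO].
apply: (@smn_eq _ _ _ _ (fun x => \sum_i 'D_v (fun y => g y 0 i: K) x *
 'D_(dlt i) f (g x)))=> //.
 by move=> x Ux;rewrite derive_comp //;[exact: G.1|apply: F.1;exact: UO].
apply: smn_sum=> // i;apply: smn_M=> //.
 by apply: smnD1;apply (smn_mx _ _ oU).1.
by apply: (IH ('D_(dlt i) f));[exact: smnS|exact: smnD1].
Qed.
End Smooth.

(** * Linear approximation along lines and in finite dimension *)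

Section Eps.
Context {K: numF}.
Implicit Types (V W: nmod K).

Lemma diff_line V W (F: V -> W) p u: dfb F p -> forall e: K, 0 < e ->
 exists2 d: K, 0 < d & forall t: K, `|t| < d ->
 `|F (t *: u + p) - F p - t *: 'D_u F p| <= e * `|t|.
move=> dF e e0.
have e'0: 0 < e / (1 + `|u|) by rewrite divr_gt0 // ltr_wpDr.
have [d /= d0 h] := nbhs_norm0P.1 (diff_epsE dF e'0).
exists (d / (1 + `|u|));first by rewrite divr_gt0 // ltr_wpDr.
move=> t td;have u1: 0 < 1 + `|u| by rewrite ltr_wpDr.
have /h: `|t *: u| < d.
 rewrite normrZ;have := td;rewrite ltr_pdivlMr //.
 by apply: le_lt_trans;rewrite ler_wpM2l // lerDr.
rewrite linearZ /= -deriveE // => /le_trans;apply.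
rewrite normrZ -mulrA ler_pM2l // mulrCA -[X in _ <= X]mulr1 ler_wpM2l //.
by rewrite mulrC ler_pdivrMr // mul1r lerDr.
Qed.

(** In finite dimension the candidate differential is continuous for free: it is a sum of
    coordinates times fixed vectors. *)
Lemma diff_epsV m W (f: 'rV[K]_m -> W) (a: 'I_m -> W) x :
 (forall eps: K, 0 < eps ->
 \forall h \near (0: 'rV[K]_m), `|f (h + x) - f x - \sum_i h 0 i *: a i| <= eps * `|h|) ->
 dfb f x /\ forall w, 'D_w f x = \sum_i w 0 i *: a i.
move=> H;pose A (h: 'rV[K]_m) := \sum_i h 0 i *: a i.
have lA: linear A.
 move=> k u v;rewrite /A scaler_sumr -big_split /=;sumext i.
 by rewrite !mxE scalerDl scalerA.
pose AL: {linear 'rV[K]_m -> W} := HB.pack A (GRing.isLinear.Build K 'rV[K]_m W _ A lA).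
have cA: continuous AL.
 have E: AL = \sum_i (fun h: 'rV[K]_m => h 0 i *: a i) :> (_ -> _).
 by fext h;rewrite fct_sumE.
 move=> y;apply: differentiable_continuous;rewrite E.
 apply: differentiable_sum=> i;apply: differentiableZl.
 exact: differentiable_coord.
have [df dE] := diff_eps cA H.
by split=> // w;rewrite deriveE // dE.
Qed.

Lemma is_derive_eps W (g: K -> W) (d: W) t0 :
 (forall e: K, 0 < e -> exists2 r: K, 0 < r & forall t: K, `|t| < r ->
 `|g (t + t0) - g t0 - t *: d| <= e * `|t|) -> is_derive t0 (1:K) g d.
move=> H;pose A (h: K) := h *: d.
have lA: linear A by move=> k u v;rewrite /A scalerDl scalerA.
pose AL: {linear K -> W} := HB.pack A (GRing.isLinear.Build K K W _ A lA).
have cA: continuous AL.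
 by move=> y;apply: differentiable_continuous;apply: differentiableZl.
have [|df dE] := @diff_eps _ _ _ g AL t0 cA.
 by move=> e e0;have [r r0 h] := H _ e0;apply/nbhs_norm0P;exists r.
apply: DeriveDef;first by apply/dfdP.
by rewrite deriveE // dE /= /A scale1r.
Qed.
End Eps.

(** * Symmetry of second derivatives over the real and the complex scalars *)

Section Schwarz.
Context {R: realType}.

(** The second difference over the square of side h is h^2 b up to o(h^2): the mean value theorem
    for s |-> f s h - f s 0 leaves a difference of [p] at (c, h) and (c, 0), to which the
    differentiability of [p] at the origin applies. *)
Lemma schwarz_half (f p: R -> R -> R) (a b rho: R): 0 < rho ->
 (forall s t: R, `|s| < rho -> `|t| < rho -> is_derive s (1:R) (f ^~ t) (p s t)) ->
 (forall e: R, 0 < e -> exists2 d: R, 0 < d & forall s t: R, `|s| < d -> `|t| < d ->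
 `|p s t - p 0 0 - (s * a + t * b)| <= e * (`|s| + `|t|)) ->
 forall e: R, 0 < e -> exists2 d: R, 0 < d & forall h: R, 0 < h -> h < d ->
 `|(f h h - f 0 h) - (f h 0 - f 0 0) - h ^+ 2 * b| <= e * h ^+ 2.
(* The errors at (c, h) and (c, 0) add up to (c + h) + c, which is at most 3 h; hence [e / 3]. *)
move=> rho0 H1 H2 e e0;have e3: 0 < e / 3 by rewrite divr_gt0.
have [d d0 Hd] := H2 _ e3;exists (Num.min d rho);first by rewrite lt_min d0.
move=> h h0;rewrite lt_min=> /andP[hd hr].
have ah: `|h| = h by rewrite gtr0_norm.
have n0: `|0: R| = 0 by rewrite normr0.
have Hdr (s: R): s \in `[0, h] -> is_derive s (1:R) (fun s => f s h - f s 0) (p s h - p s 0).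
 rewrite in_itv /= => /andP[s0 sh].
 have as_: `|s| < rho by rewrite ger0_norm //;exact: le_lt_trans hr.
 apply: is_deriveB;apply: H1;rewrite ?ah ?n0 //.
have cont: {within `[0: R, h], continuous (fun s: R => f s h - f s 0: R)}.
 by apply: derivable_within_continuous=> s /Hdr;case.
pose ff (s: R): R := f s h - f s 0;pose pp (s: R): R := p s h - p s 0.
have Hdr' (x: R): x \in `]0: R, h[ -> is_derive x (1: R) ff (pp x).
 by move=> /subset_itv_oo_cc;exact: Hdr.
have [c] := MVT h0 Hdr' cont.
rewrite in_itv /= /ff /pp=> /andP[c0 ch] E.
have -> : (f h h - f 0 h) - (f h 0 - f 0 0) = (p c h - p c 0) * h.
 by move: E;rewrite subr0=> <-;ring.
have ac: `|c| = c by rewrite gtr0_norm.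
have cd: `|c| < d by rewrite ac (lt_trans ch).
have P1:= Hd c h cd;rewrite ah in P1.
have P2:= Hd c 0 cd;rewrite n0 in P2.
have {}P1 := P1 hd;have {}P2 := P2 d0.
rewrite (_: _ - _ = h * (p c h - p c 0 - h * b));last by ring.
rewrite normrM ah (_: e * _ = h * (e * h));last by ring.
rewrite ler_pM2l //.
have -> : p c h - p c 0 - h * b = (p c h - p 0 0 - (c * a + h * b)) - (p c 0 - p 0 0 - (c * a + 0 * b)).
 by ring.
apply: le_trans (ler_normB _ _) _;apply: le_trans (lerD P1 P2) _.
rewrite ac addr0;have: c <= h by exact: ltW.
move: e0 h0 c0;clear;nra.
Qed.

(** The second difference is symmetric in the two variables, and each mixed derivative is its limit
    divided by h^2. *)
Lemma schwarz2 (f p q: R -> R -> R) (a b b' c rho: R): 0 < rho ->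
 (forall s t: R, `|s| < rho -> `|t| < rho -> is_derive s (1:R) (f ^~ t) (p s t)) ->
 (forall s t: R, `|s| < rho -> `|t| < rho -> is_derive t (1:R) (f s) (q s t)) ->
 (forall e: R, 0 < e -> exists2 d: R, 0 < d & forall s t: R, `|s| < d -> `|t| < d ->
 `|p s t - p 0 0 - (s * a + t * b)| <= e * (`|s| + `|t|)) ->
 (forall e: R, 0 < e -> exists2 d: R, 0 < d & forall s t: R, `|s| < d -> `|t| < d ->
 `|q s t - q 0 0 - (s * b' + t * c)| <= e * (`|s| + `|t|)) ->
 b = b'.
move=> rho0 H1 H2 H3 H4;apply/eqP;rewrite -subr_eq0 -normr_le0.
apply/ler_addgt0Pl=> e e0;rewrite addr0.
have e2: 0 < e / 2 by rewrite divr_gt0.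
have [d d0 Hd] := schwarz_half rho0 H1 H3 e2.
have [d' d'0 Hd']: exists2 d: R, 0 < d & forall h: R, 0 < h -> h < d ->
 `|(f h h - f h 0) - (f 0 h - f 0 0) - h ^+ 2 * b'| <= e / 2 * h ^+ 2.
 apply: (@schwarz_half (fun s t => f t s) (fun s t => q t s) c b' rho rho0 _ _ _ e2).
 by move=> s t hs ht;exact: H2.
 move=> e' e'0;have [d1 d10 h1] := H4 _ e'0;exists d1=> // s t hs ht.
 by rewrite [s * c + _]addrC [`|s| + _]addrC;exact: h1.
set h: R := Num.min d d' / 2.
have m0: 0 < Num.min d d' by rewrite lt_min d0.
have h0: 0 < h by rewrite divr_gt0.
have hm: h < Num.min d d' by rewrite /h;lra.
have [hd hd']: h < d /\ h < d' by move: hm;rewrite lt_min=> /andP.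
have {}Hd := Hd h h0 hd;have {}Hd' := Hd' h h0 hd'.
have hh: 0 < h ^+ 2 by rewrite exprn_gt0.
rewrite -(ler_pM2l hh) -[X in X * `|_|]gtr0_norm // -normrM.
have -> : h ^+ 2 * (b - b') = ((f h h - f h 0) - (f 0 h - f 0 0) - h ^+ 2 * b') -
 ((f h h - f 0 h) - (f h 0 - f 0 0) - h ^+ 2 * b) by ring.
apply: le_trans (ler_normB _ _) _;apply: le_trans (lerD Hd' Hd) _.
by rewrite -mulrDl mulrC -splitr.
Qed.

Section Gen.
Context {K: numF} (iota: {rmorphism R -> K}) (phi: {additive K -> R}).
Context (iota_norm: forall t, `|iota t| = iota `|t|)
 (iota_le: forall s t, (iota s <= iota t) = (s <= t))
 (iota_pos: forall e: K, 0 < e -> exists2 d: R, 0 < d & iota d <= e)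
 (phiZ: forall t z, phi (iota t * z) = t * phi z)
 (phi_norm: forall z, iota `|phi z| <= `|z|).
Implicit Types V: nmod K.
Let iota_lt s t: (iota s < iota t) = (s < t).
by rewrite !lt_def iota_le fmorph_eq. Qed.
Let iota_gt0 t: (0 < iota t) = (0 < t).
by rewrite -iota_lt rmorph0. Qed.

Lemma line_derive V (F: V -> K) p u t0: dfb F (iota t0 *: u + p) ->
 is_derive t0 (1:R) (fun t: R => phi (F (iota t *: u + p))) (phi ('D_u F (iota t0 *: u + p))).
move=> dF;apply: is_derive_eps=> e e0.
have [|d d0 Hd] := diff_line u dF (e := iota e);first by rewrite iota_gt0.
have [r r0 rd] := iota_pos d0;exists r=> // t tr.
have := Hd (iota t);rewrite iota_norm=> /(_ _) Ht.
rewrite -iota_le rmorphM -[t *: _]/(t * _) -phiZ -!raddfB.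
apply: le_trans (phi_norm _) _.
have -> : iota (t + t0) *: u + p = iota t *: u + (iota t0 *: u + p).
 by rewrite rmorphD scalerDl addrA.
apply: Ht.
by apply: lt_le_trans rd;rewrite iota_lt.
Qed.

(** [iota] embeds the reals in the scalars and [phi] is a real-linear functional on them: the
    identities over R, the inclusion and the real part over C. Restriction to the real plane through
    [x] spanned by [u] and [v] reduces both cases to [schwarz2]. *)
Lemma schwarz_phi V (U: set V) (F: V -> K) x u v: open U -> U x -> smn 1 U F ->
 phi ('D_u ('D_v F) x) = phi ('D_v ('D_u F) x).
move=> oU Ux sF.
have /nbhs_ballP[r /= r0 rU]: nbhs x U by exact: onbhs.
have u0: 0 < 1 + `|u| + `|v| by rewrite -addrA ltr_wpDr // addr_ge0.
have [rho rho0 rhor] := iota_pos (divr_gt0 r0 u0).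
pose pt (s t: R) := iota s *: u + iota t *: v + x.
have pU (s t: R): `|s| < rho -> `|t| < rho -> U (pt s t).
 move=> hs ht;apply: rU;rewrite -ball_normE /=.
 rewrite opprD addrCA subrr addr0 normrN.
 apply: le_lt_trans (ler_normD _ _) _;rewrite !normrZ !iota_norm.
 apply: (@le_lt_trans _ _ (iota rho * `|u| + iota rho * `|v|)).
 by apply: lerD;rewrite ler_wpM2r // iota_le ltW.
 rewrite -mulrDr;move: rhor;rewrite ler_pdivlMr // => /lt_le_trans;apply.
 by rewrite ltr_pM2l ?iota_gt0 // -addrA ltrDr.
have dsF w (e: R): 0 < e -> exists2 d: R, 0 < d & forall s t: R, `|s| < d -> `|t| < d ->
 `|phi ('D_w F (pt s t)) - phi ('D_w F (pt 0 0)) -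
 (s * phi ('D_u ('D_w F) x) + t * phi ('D_v ('D_w F) x))| <= e * (`|s| + `|t|).
 move=> e0;have dd:= smn_diff (smnD1 w sF) Ux.
 have e'0: 0 < iota e / (1 + `|u| + `|v|) by rewrite divr_gt0 // iota_gt0.
 have [d /= d0 Hd] := nbhs_norm0P.1 (diff_epsE dd e'0).
 have [d1 d10 d1d] := iota_pos (divr_gt0 d0 u0).
 exists d1=> // s t hs ht.
 have nb (b: R): `|s| <= b -> `|t| <= b -> `|iota s *: u + iota t *: v| <= iota b * (`|u| + `|v|).
 move=> hsb htb;apply: le_trans (ler_normD _ _) _;rewrite !normrZ !iota_norm mulrDr.
 by apply: lerD;rewrite ler_wpM2r // iota_le.
 have /Hd: `|iota s *: u + iota t *: v| < d.
 apply: le_lt_trans (nb d1 (ltW hs) (ltW ht)) _.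
 move: d1d;rewrite ler_pdivlMr // => /lt_le_trans;apply.
 by rewrite ltr_pM2l ?iota_gt0 // -addrA ltrDr.
 have -> : pt 0 0 = x by rewrite /pt rmorph0 !scale0r !add0r.
 rewrite linearD !linearZ /= -!deriveE // => H.
 rewrite -iota_le -!phiZ -raddfD -!raddfB.
 apply: le_trans (phi_norm _) _;apply: le_trans H _.
 have hb:= nb (`|s| + `|t|);rewrite lerDl lerDr in hb.
 apply: le_trans (ler_wpM2l (ltW e'0) (hb _ _)) _=> //.
 rewrite rmorphM /= -mulrA;apply: ler_wpM2l;first by apply: ltW;rewrite iota_gt0.
 rewrite mulrCA -[X in _ <= X]mulr1;apply: ler_wpM2l.
 by rewrite -(rmorph0 iota) iota_le addr_ge0.
 by rewrite mulrC ler_pdivrMr // mul1r -addrA lerDr.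
symmetry.
apply: (@schwarz2 (fun s t => phi (F (pt s t))) (fun s t => phi ('D_u F (pt s t)))
 (fun s t => phi ('D_v F (pt s t))) (phi ('D_u ('D_u F) x)) _ _ (phi ('D_v ('D_v F) x)) rho)=> //.
- move=> s t hs ht;have := @line_derive _ F (iota t *: v + x) u s.
 rewrite addrA;move/(_ (smn_diff sF (pU _ _ hs ht))).
 by under eq_fun do rewrite addrA.
- move=> s t hs ht;have := @line_derive _ F (iota s *: u + x) v t.
 rewrite addrCA addrA;move/(_ (smn_diff sF (pU _ _ hs ht))).
 by under eq_fun do rewrite addrCA addrA.
- exact: dsF.
- exact: dsF.
Qed.
End Gen.
End Schwarz.

(** * Functions of one variable: compositions, exp, sin, cos and ln *)

Section Comp1.
Context {K: numF}.
Implicit Types V: nmod K.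

Lemma derive_K1 (f: K -> K) (x v: K): dfb f x -> 'D_v f x = v * 'D_1 f x.
move=> df;rewrite !deriveE // -[v in LHS]mulr1.
exact: (@linearZ_LR _ _ _ _ ('d f x) v 1).
Qed.

Lemma derive_comp1 V (g: V -> K) (f: K -> K) x v: dfb g x ->
 dfb f (g x) -> 'D_v (fun y => f (g y)) x = 'D_v g x * 'D_1 f (g x).
move=> dg df;rewrite deriveE;last exact: dfb_comp.
by rewrite (@diff_comp _ _ _ _ g f) //= -derive_K1 // !deriveE.
Qed.

Lemma smn_comp1 V n (U: set V) (O: set K) (g: V -> K) (f: K -> K): open U ->
 (forall x, U x -> O (g x)) -> smn n U g -> smn n O f -> smn n U (fun x => f (g x)).
move=> oU UO;elim: n f=> [|n IH] f G F.
 by split=> // x Ux;apply: dfb_comp;[exact: G.1|apply: F.1;exact: UO].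
split=> [x Ux|v];first by apply: dfb_comp;[exact: G.1|apply: F.1;exact: UO].
apply: (@smn_eq _ _ _ _ _ (fun x => 'D_v g x * 'D_1 f (g x)))=> //.
 by move=> x Ux;rewrite [RHS](@derive_comp1 V g f) //;
 [exact: smn_diff G Ux|exact: smn_diff F (UO _ Ux)].
apply: smn_M=> //;first exact: smnD1.
by apply: (IH ('D_1 f));[exact: smnS|exact: smnD1].
Qed.
End Comp1.

Section Scale.
Context {K: numF}.

Lemma smn_Zl (V: nmod K) n (U: set V) (c: K) (f: V -> K): open U ->
 smn n U f -> smn n U (fun x => c * f x).
by move=> oU sf;apply: smn_M=> //;exact: smn_cst. Qed.

Lemma derive_Zl (V: nmod K) (c: K) (f: V -> K) x v: dfb f x ->
 dfb (fun y => c * f y) x /\ 'D_v (fun y => c * f y) x = c * 'D_v f x.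
move=> df;split;first by apply: differentiableM=> //;exact: differentiable_cst.
rewrite deriveM //;last exact: dfd.
by rewrite derive_cst scaler0 addr0.
Qed.

Lemma derive2_Zl (V: nmod K) (U: set V) (c: K) (f: V -> K) x u v :
 open U -> U x -> smn 1 U f ->
 'D_u ('D_v (fun y => c * f y)) x = c * 'D_u ('D_v f) x.
move=> oU Ux sf;have ne: \forall y \near x, 'D_v (fun y => c * f y) y = c * 'D_v f y.
 apply: open_near Ux _=> // y Uy.
 exact: (derive_Zl c v (smn_diff sf Uy)).2.
rewrite (near_eq_derive u ne).
exact: (derive_Zl c u (smn_diff (smnD1 v sf) Ux)).2.
Qed.
End Scale.

Section RealFun.
Context {R: realType}.

Lemma smn1 n (U: set R) (f df: R -> R): open U ->
 (forall x: R, U x -> is_derive x (1: R) f (df x)) ->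
 (forall m, n = m.+1 -> smn m U df) -> smn n U f.
move=> oU H;have dfx x: U x -> dfb f x.
 by move=> Ux;apply/dfdP;case: (H x Ux).
case: n=> [|n] h;first by split.
split=> // v;apply: (@smn_eq _ _ _ _ _ (fun x => v * df x))=> //.
 move=> x Ux;rewrite (derive_K1 v (dfx _ Ux));congr (_ * _).
 by have [_ E] := H x Ux;rewrite -E.
by apply: smn_M=> //;[exact: smn_cst|exact: h].
Qed.

Lemma smn_expR n: smn n setT (@expR R).
elim: n=> [|n IH];apply: (@smn1 _ _ _ expR);rewrite //;try exact: openT.
by move=> m [<-].
Qed.

Lemma smn_sincos n: smn n setT (@sin R) /\ smn n setT (@cos R).
elim: n=> [|n [IHs IHc]];split.
- by apply: (@smn1 _ _ _ cos)=> //;exact: openT.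
- by apply: (@smn1 _ _ _ (fun x => - sin x))=> //;exact: openT.
- by apply: (@smn1 _ _ _ cos)=> [|m [<-]] //;exact: openT.
- apply: (@smn1 _ _ _ (fun x => - sin x))=> [|m [<-]] //;first exact: openT.
 by apply: smn_N=> //;exact: openT.
Qed.

Lemma smn_id n (U: set R): smn n U (fun x: R => x).
have di (x: R): dfb (fun x: R => x) x by case: (is_diff_id x).
case: n=> [|n];first by split.
split=> // v.
have -> : 'D_v (fun x: R => x) = fun=> v by fext x;rewrite derive_id.
exact: smn_cst.
Qed.

Lemma smn_ln n: smn n [set x: R | 0 < x] (@ln R).
have oP: open [set x: R | 0 < x] by exact: open_gt.
apply: (@smn1 _ _ _ (fun x => x^-1))=> // m _.
apply: smn_V=> //;last exact: smn_id.
by move=> x /= x0;rewrite gt_eqF.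
Qed.
End RealFun.

(** * Complex scalars, and holomorphic functions in real coordinates *)

Section ComplexReal.
Context {R: realType}.
Notation C := (cnum R).

Lemma cReM (a b: C): cRe (a * b) = cRe a * cRe b - cIm a * cIm b.
by case: a b=> [? ?] []. Qed.
Lemma cImM (a b: C): cIm (a * b) = cRe a * cIm b + cIm a * cRe b.
by case: a b=> [? ?] []. Qed.
Lemma cpx_eq (a b: C): cRe a = cRe b -> cIm a = cIm b -> a = b.
by case: a b=> [? ?] [? ?] /= -> ->. Qed.
Lemma Cpos (e: C): 0 < e -> exists2 d: R, 0 < d & e = d%:C.
rewrite ltcE /= => /andP[/eqP i0 r0];exists (cRe e)=> //.
exact: cpx_eq.
Qed.
Lemma leCR (a b: R): ((a%:C: C) <= b%:C) = (a <= b).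
by rewrite lecR. Qed.
Lemma Re_norm (z: C): ((`|cRe z|)%:C: C) <= `|z|.
exact: normc_ge_Re. Qed.
Lemma Im_norm (z: C): ((`|cIm z|)%:C: C) <= `|z|.
have := Re_norm (- 'i * z);rewrite normrM normrN normCi mul1r cReM /=.
by rewrite !oppr0 mul0r sub0r mulN1r opprK.
Qed.

Lemma norm_ReIm (z: C): `|z| <= (`|cRe z| + `|cIm z|)%:C.
rewrite {1}[z]complexE;apply: le_trans (ler_normD _ _) _.
rewrite normrM normCi mul1r !normc_def /= !expr0n !addr0 !sqrtr_sqr rmorphD /=.
exact: lexx.
Qed.

Lemma normCR (a: R): `|a%:C: C| = (`|a|)%:C.
by rewrite normc_def /= expr0n addr0 sqrtr_sqr. Qed.
Lemma Re_real (t: R) (z: C): cRe (t%:C * z) = t * cRe z.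
by rewrite cReM /= mul0r subr0. Qed.

Lemma schwarzR (V: nmod R) (U: set V) (F: V -> R) x u v :
 open U -> U x -> smn 1 U F -> 'D_u ('D_v F) x = 'D_v ('D_u F) x.
move=> oU Ux sF.
by apply: (@schwarz_phi R R idfun idfun _ _ _ _ _ V U)=> //= e e0;exists e.
Qed.

(** The real parts of F and of i F determine F, and each is covered by [schwarz_phi]. *)
Lemma schwarzC (V: nmod C) (U: set V) (F: V -> C) x u v :
 open U -> U x -> smn 1 U F -> 'D_u ('D_v F) x = 'D_v ('D_u F) x.
move=> oU Ux sF.
have S (G: V -> C): smn 1 U G -> cRe ('D_u ('D_v G) x) = cRe ('D_v ('D_u G) x).
 move=> sG;apply: (@schwarz_phi R C (@real_complex R) (@cRe R) _ _ _ _ _ V U)=> //.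
 - exact: normCR.
 - exact: leCR.
 - by move=> e /Cpos[d d0 ->];exists d.
 - exact: Re_real.
 - exact: Re_norm.
have siF:= @smn_Zl C V 1 U 'i F oU sF.
have dDD:= @derive2_Zl C V U 'i F x _ _ oU Ux sF.
apply: cpx_eq;first exact: S.
have RI (z: C): cRe ('i * z) = - cIm z by rewrite cReM /=;ring.
have J (a b: C): cRe ('i * a) = cRe ('i * b) -> cIm a = cIm b.
 by rewrite !RI=> /oppr_inj.
apply: J.
exact: etrans (esym (congr1 _ (dDD u v))) (etrans (S _ siF) (congr1 _ (dDD v u))).
Qed.

Lemma cplxD n (u v: 'rV[R]_(n + n)): cplx (u + v) = cplx u + cplx v.
by rowext i;rewrite !mxE. Qed.
Lemma cplxZ n (t: R) (v: 'rV[R]_(n + n)): cplx (t *: v) = t%:C *: cplx v.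
by rowext i;rewrite !mxE;apply: cpx_eq=> /=;ring. Qed.
Lemma cplxB n (u v: 'rV[R]_(n + n)): cplx (u - v) = cplx u - cplx v.
by rowext i;rewrite !mxE. Qed.

Lemma mxnorm_le (K: numF) m n (A: 'M[K]_(m, n)) (e: K): 0 <= e ->
 (forall i j, `|A i j| <= e) -> `|A| <= e.
move=> e0 h;have [->|A0] := eqVneq A 0;first by rewrite normr0.
have: mx_norm A != 0 by rewrite -[mx_norm A]/(`|A|) normr_eq0.
by move=> /mx_norm_neq0[ij E];rewrite -[`|A|]/(mx_norm A) E.
Qed.

Lemma coord_norm (K: numF) m n (A: 'M[K]_(m, n)) i j: `|A i j| <= `|A|.
rewrite -[leRHS]/(mx_norm A) mx_normE.
by rewrite -[leLHS]nngE num_le;exact: (le_bigmax _ _ (i, j)).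
Qed.

Lemma cplx_norm n (h: 'rV[R]_(n + n)): `|cplx h| <= (2 * `|h|)%:C.
apply: mxnorm_le=> [|i j];first by rewrite -[0]/(0%:C) lecR mulr_ge0.
rewrite mxE;apply: le_trans (norm_ReIm _) _;rewrite lecR /= mulr2n mulrDl mul1r.
by apply: lerD;exact: coord_norm.
Qed.

Lemma cplx_near n (x: 'rV[R]_(n + n)) (P: set 'rV[C]_n) :
 nbhs (cplx x) P -> nbhs x (fun y => P (cplx y)).
move=> /nbhs_ballP[e /= /Cpos[d d0 ->] h].
apply/nbhs_ballP;exists (d / 3)=> /=;first by rewrite divr_gt0.
move=> y;rewrite -ball_normE /= => xy;apply: h;rewrite -ball_normE /= -cplxB.
apply: le_lt_trans (cplx_norm _) _;rewrite ltcR;lra.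
Qed.

Lemma cplx_open n (O: set 'rV[C]_n): open O -> open (@cplx R n @^-1` O).
rewrite !openE=> oO x Ox;apply: cplx_near;exact: oO.
Qed.

(** The complex differential between [cplx] and the real part is real-linear. The complex remainder
    bounds the real one up to the factor 2 of [cplx_norm], which accounts for [e / 2]. *)
Lemma holo_Re n (F: 'rV[C]_n -> C) (x: 'rV[R]_(n + n)): dfb F (cplx x) ->
 dfb (fun y => cRe (F (cplx y)): R) x /\
 forall w, 'D_w (fun y => cRe (F (cplx y)): R) x = cRe ('D_(cplx w) F (cplx x)).
move=> dF;set D := 'd F (cplx x).
have DE (w: 'rV[R]_(n + n)): D (cplx w) = \sum_j (w 0 j)%:C * D (cplx (dlt j)).
 rewrite {1}(row_sum_delta w) (big_morph _ (@cplxD n) (_: cplx 0 = 0));last first.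
 by rowext i;rewrite !mxE;apply: cpx_eq.
 by rewrite linear_sum;sumext j;rewrite cplxZ linearZ.
have RDE w: cRe (D (cplx w)) = \sum_j w 0 j * cRe (D (cplx (dlt j))).
 by rewrite DE raddf_sum;sumext j;exact: Re_real.
have [|d1 d2] := @diff_epsV R (n + n) R (fun y => cRe (F (cplx y)))
 (fun j => cRe (D (cplx (dlt j)))) x.
 move=> e e0;have e2: 0 < ((e / 2)%:C: C) by rewrite ltcR divr_gt0.
 have H:= diff_epsE dF e2.
 have c0: cplx (0: 'rV[R]_(n + n)) = 0 by rowext i;rewrite !mxE;apply: cpx_eq.
 rewrite -c0 in H;apply: filterS (cplx_near H)=> h Hh.
 rewrite -lecR /= cplxD;rewrite -/D in Hh.
 have -> : \sum_i h 0 i *: cRe (D (cplx (dlt i))) = cRe (D (cplx h)).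
 by rewrite RDE.
 rewrite -!raddfB;apply: le_trans (Re_norm _) _;apply: le_trans Hh _.
 apply: le_trans (ler_wpM2l (ltW e2) (cplx_norm h)) _.
 by rewrite -rmorphM lecR mulrA divfK // pnatr_eq0.
by split=> // w;rewrite d2 deriveE // -/D RDE.
Qed.

Lemma smn_holo_Re m n (U: set 'rV[C]_n) (F: 'rV[C]_n -> C): open U -> smn m U F ->
 smn m (@cplx R n @^-1` U) (fun y => cRe (F (cplx y)): R).
move=> oU;have oV:= cplx_open oU;elim: m F=> [|m IH] F sF.
 by split=> // x Ux;apply: (holo_Re (smn_diff sF Ux)).1.
split=> [x Ux|v];first by apply: (holo_Re (smn_diff sF Ux)).1.
apply: (@smn_eq _ _ _ _ _ (fun y => cRe ('D_(cplx v) F (cplx y))))=> //.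
 by move=> x Ux;rewrite (holo_Re (smn_diff sF Ux)).2.
by apply: (IH ('D_(cplx v) F));exact: smnD1.
Qed.

Lemma Im_Re (z: C): cIm z = cRe (- 'i * z).
by rewrite cReM /=;ring. Qed.

Lemma holo_Im n (F: 'rV[C]_n -> C) (x: 'rV[R]_(n + n)): dfb F (cplx x) ->
 dfb (fun y => cIm (F (cplx y)): R) x /\
 forall w, 'D_w (fun y => cIm (F (cplx y)): R) x = cIm ('D_(cplx w) F (cplx x)).
move=> dF;have dG: dfb (fun z => - 'i * F z: C) (cplx x).
 exact: (@derive_Zl C _ (- 'i) F _ 0 dF).1.
have [h1 h2] := holo_Re dG.
have E: (fun y => cIm (F (cplx y))) = (fun y: 'rV[R]_(n + n) => cRe (- 'i * F (cplx y))).
 by fext y;exact: Im_Re.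
rewrite E;split=> // w;rewrite h2 Im_Re.
by rewrite (@derive_Zl C _ (- 'i) F _ _ dF).2.
Qed.

Lemma smn_holo_Im m n (U: set 'rV[C]_n) (F: 'rV[C]_n -> C): open U -> smn m U F ->
 smn m (@cplx R n @^-1` U) (fun y => cIm (F (cplx y)): R).
move=> oU sF.
have -> : (fun y => cIm (F (cplx y))) = (fun y: 'rV[R]_(n + n) => cRe (- 'i * F (cplx y))).
 by fext y;exact: Im_Re.
exact: (@smn_holo_Re m n U (fun z => - 'i * F z) oU (@smn_Zl C _ m U (- 'i) F oU sF)).
Qed.
End ComplexReal.

(** * Rings with commuting derivations: determinants, Levi-Civita connection, frames *)

Section DiffAlg.
Context {A: comNzRingType} {N: nat} (D: 'I_N -> A -> A).

Definition derivations: Prop :=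
 [/\ forall i x y, D i (x + y) = D i x + D i y,
 forall i x y, D i (x * y) = D i x * y + x * D i y &
 forall i j x, D i (D j x) = D j (D i x)].

Hypothesis HD: derivations.

Lemma derD i x y: D i (x + y) = D i x + D i y.
by case: HD. Qed.
Lemma derM i x y: D i (x * y) = D i x * y + x * D i y.
by case: HD. Qed.
Lemma derC i j x: D i (D j x) = D j (D i x).
by case: HD. Qed.
Lemma der0 i: D i 0 = 0.
by apply: (addrI (D i 0));rewrite -derD !addr0. Qed.
Lemma derN i x: D i (- x) = - D i x.
by apply: (addrI (D i x));rewrite -derD !subrr der0. Qed.
Lemma derB i x y: D i (x - y) = D i x - D i y.
by rewrite derD derN. Qed.
Lemma der1 i: D i 1 = 0.
by apply: (addrI (D i 1));rewrite addr0 -{3}[1]mulr1 derM mulr1 mul1r. Qed.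
Lemma der_sum i (I: Type) (r: seq I) (P: pred I) (f: I -> A) :
 D i (\sum_(j <- r | P j) f j) = \sum_(j <- r | P j) D i (f j).
exact: (big_morph _ (derD i) (der0 i)). Qed.

Notation Dm i := (map_mx (D i)).

Lemma DmD i m n (X Y: 'M[A]_(m, n)): Dm i (X + Y) = Dm i X + Dm i Y.
by mxext a b;rewrite !mxE derD. Qed.

Lemma DmM i m n p (X: 'M[A]_(m, n)) (Y: 'M[A]_(n, p)) :
 Dm i (X *m Y) = Dm i X *m Y + X *m Dm i Y.
mxext a b;rewrite !mxE der_sum -big_split /=.
by sumext c;rewrite derM !mxE.
Qed.
Lemma DmZ i m n (x: A) (X: 'M[A]_(m, n)): Dm i (x *: X) = D i x *: X + x *: Dm i X.
by mxext a b;rewrite !mxE derM. Qed.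
Lemma Dm1 i m: Dm i (1%:M: 'M[A]_m) = 0.
by mxext a b;rewrite !mxE;case: eqP;rewrite ?der1 ?der0. Qed.
Lemma Dm0 i m n: Dm i (0: 'M[A]_(m, n)) = 0.
by mxext a b;rewrite !mxE der0. Qed.
Lemma DmC i j m n (X: 'M[A]_(m, n)): Dm i (Dm j X) = Dm j (Dm i X).
by mxext a b;rewrite !mxE derC. Qed.
Lemma Dm_sum i m n (I: Type) (r: seq I) (f: I -> 'M[A]_(m, n)) :
 Dm i (\sum_(j <- r) f j) = \sum_(j <- r) Dm i (f j).
exact: (big_morph _ (@DmD i m n) (Dm0 i m n)). Qed.

Lemma der_prod i (I: finType) (f: I -> A) :
 D i (\prod_j f j) = \sum_j D i (f j) * \prod_(l | l != j) f l.
have H (s: seq I): uniq s -> D i (\prod_(j <- s) f j) = \sum_(j <- s) D i (f j) * \prod_(l <- s | l != j) f l.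
 elim: s=> [|a s IH];first by rewrite !big_nil der1.
 rewrite /= => /andP[as_ us];rewrite !big_cons eqxx derM IH //=;congr (_ * _ + _).
 rewrite big_seq_cond [in RHS]big_seq_cond;apply: eq_bigl=> j.
 by case: (boolP (j \in s))=> //= js;apply/esym;apply: contraNneq as_=> <-.
 rewrite mulr_sumr;rewrite big_seq [in RHS]big_seq;apply: eq_bigr=> j js.
 rewrite big_cons ifT;first by ring.
 by apply: contraNneq as_=> ->.
by have := H _ (enum_uniq I);rewrite !big_enum /= => ->;
 sumext j;rewrite big_enum_cond.
Qed.

(** Jacobi's formula: differentiate one row at a time and expand along that row. *)
Lemma der_det i n (X: 'M[A]_n): D i (\det X) = \tr (Dm i X *m \adj X).
via (\sum_j \det (\matrix_(a, b) (if a == j then D i (X a b) else X a b))).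
 rewrite /determinant der_sum exchange_big /=;sumext s.
 rewrite derM -big_distrr /=.
 have -> : D i ((-1) ^+ perm.odd_perm s) = 0.
 by case: (perm.odd_perm s);rewrite ?expr1 ?expr0 ?derN der1 ?oppr0.
 rewrite mul0r add0r der_prod;congr (_ * _);sumext j.
 rewrite [RHS](bigD1 j) //= mxE eqxx;congr (_ * _).
 by apply: eq_bigr=> l lj;rewrite mxE (negbTE lj).
sumext j;rewrite mxE (expand_det_row _ j);sumext l.
rewrite !mxE eqxx;congr (_ * _);rewrite /cofactor;congr (_ * \det _).
mxext a b;rewrite !mxE ifF //;apply/negbTE.
by rewrite eq_sym neq_lift.
Qed.

Section LeviCivita.
Variables (g gi: 'M[A]_N) (half: A).
Context (gs: g^T = g)
 (ggi: g *m gi = 1%:M)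
 (half2: half * 2%:R = 1).

(** A copy of [christoffel] in the ring, where [gi] stands for the inverse metric and [half] for
    1/2; [ric] copies [ricci] likewise. *)
Definition chr k i j: A := half * \sum_l gi k l * (D i (g j l) + D j (g i l) - D l (g i j)).

Definition ric j k: A := \sum_i (D i (chr i j k) - D k (chr i j i)
 + \sum_p (chr i i p * chr p j k - chr i k p * chr p j i)).

Variable Gam: 'I_N -> 'M[A]_N.
Context (Gsym: forall i j k, Gam i j k = Gam j i k)
 (Gmet: forall i, Dm i g = Gam i *m g + g *m (Gam i)^T).

(** Uniqueness of the Levi-Civita connection. [Gam i j k] has k as its upper index; symmetry in i
    and j collapses the three-term Koszul sum to twice a single term. *)
Lemma chr_unique k i j: chr k i j = Gam i j k.
have E i' j' l: D i' (g j' l) = (Gam i' *m g) j' l + (Gam i' *m g) l j'.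
 have := congr1 (fun X: 'M[A]_N => X j' l) (Gmet i');rewrite [LHS]mxE=> ->.
 by rewrite mxE;congr (_ + _);rewrite -{1}gs -trmx_mul mxE.
have S a b c: (Gam a *m g) b c = (Gam b *m g) a c.
 by rewrite !mxE;sumext l;rewrite Gsym.
rewrite /chr;under eq_bigr => l _.
 rewrite (_: _ + _ - _ = 2%:R * (Gam i *m g) j l);last first.
 rewrite !E (S j i l) (S l i j) (S l j i);ring.
 rewrite mulrCA;over.
rewrite -mulr_sumr mulrA half2 mul1r.
have -> : Gam i j k = (Gam i *m (g *m gi)) j k by rewrite ggi mulmx1.
rewrite mulmxA [RHS]mxE;sumext l;rewrite mulrC;congr (_ * _).
have: gi^T = gi;last by move=> E2;rewrite -{1}E2 mxE.
have gig:= mulmx1C ggi.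
by rewrite -[LHS]mul1mx -gig -mulmxA -{1}gs -trmx_mul gig trmx1 mulmx1.
Qed.

(** The commutator of covariant derivatives on a column frame e with D_i e = Gam_i e, which fixes
    the order of the products. *)
Definition curv i k: 'M[A]_N := Dm i (Gam k) - Dm k (Gam i) + Gam k *m Gam i - Gam i *m Gam k.

Lemma ric_curv j k: ric j k = \sum_i curv i k j i.
sumext i;rewrite !chr_unique /curv !mxE [in Gam j k i]Gsym [in Gam j i i]Gsym.
rewrite -!addrA;congr (_ + (_ + _));rewrite -sumrN -big_split /=.
sumext p;rewrite !chr_unique [Gam j k p]Gsym [Gam j i p]Gsym;ring.
Qed.
End LeviCivita.

Section Frame.
Context {M: nat} (zeta: 'I_M -> A) (F: 'M[A]_(M, N)).
Let E := \matrix_(i, a) D i (zeta a).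
Context (FE: F *m E = 1%:M)
 (EF: E *m F = 1%:M).

Definition pd a x: A := \sum_i F a i * D i x.

Lemma pdE i x: D i x = \sum_a D i (zeta a) * pd a x.
have: (E *m F *m \col_j D j x) i 0 = D i x by rewrite EF mul1mx mxE.
move=> <-;rewrite -mulmxA mxE;sumext a;rewrite mxE;congr (_ * _).
by rewrite mxE;sumext j;rewrite mxE.
Qed.

Lemma pd_derivations a x y: pd a (x + y) = pd a x + pd a y /\
 pd a (x * y) = pd a x * y + x * pd a y.
rewrite /pd mulr_suml mulr_sumr -!big_split /=.
split;sumext i;rewrite ?derD ?derM;ring.
Qed.

(** Differentiating F E = 1 turns derivatives of [F] into second derivatives of [zeta]; both orders
    of differentiation then show the same sums, which are symmetric because the D i commute. *)
Lemma pdC a b x: pd a (pd b x) = pd b (pd a x).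
have DF j: Dm j F = - (F *m Dm j E *m F).
 have := Dm1 j M;rewrite -FE DmM=> /eqP;rewrite addr_eq0=> /eqP E1.
 by rewrite -[Dm j F]mulmx1 -EF mulmxA E1 mulNmx.
have H a' b': pd a' (pd b' x) = \sum_i \sum_j F a' i * F b' j * D i (D j x)
 - \sum_c (\sum_i \sum_j F a' i * F b' j * D i (D j (zeta c))) * pd c x.
 have -> : \sum_c (\sum_i \sum_j F a' i * F b' j * D i (D j (zeta c))) * pd c x =
 - \sum_i \sum_j F a' i * Dm i F b' j * D j x.
 via (\sum_i F a' i * \sum_j (F *m Dm i E *m F) b' j * D j x);last first.
 rewrite -sumrN;sumext i;rewrite mulr_sumr -sumrN;sumext j.
 by rewrite DF [in RHS]mxE;ring.
 via (\sum_i F a' i * \sum_c (F *m Dm i E) b' c * pd c x).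
 under eq_bigr => c _ do rewrite mulr_suml.
 rewrite exchange_big;sumext i;rewrite mulr_sumr;sumext c.
 rewrite mxE !mulr_suml mulr_sumr;sumext j;rewrite !mxE;ring.
 sumext i;congr (_ * _).
 rewrite /pd;under eq_bigr => c _ do rewrite mulr_sumr.
 rewrite exchange_big;sumext j;rewrite [in RHS]mxE mulr_suml.
 by sumext c;rewrite mulrA.
 rewrite opprK -big_split /=;sumext i.
 rewrite /pd der_sum mulr_sumr -big_split /=;sumext j.
 by rewrite derM !mxE;ring.
rewrite !H;congr (_ - _).
 by rewrite exchange_big;sumext i;sumext j;rewrite derC [F a j * _]mulrC.
sumext c;congr (_ * _);rewrite exchange_big.
by sumext i;sumext j;rewrite derC [F a j * _]mulrC.
Qed.
End Frame.

(** * Kähler metrics in Wirtinger derivatives, and their Ricci curvature *)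

Section Kaehler.
Context {m: nat} (bar: {rmorphism A -> A}) (z: 'I_m -> A) (F: 'M[A]_(m, N)).
Context (barK: involutive bar)
 (barD: forall i x, bar (D i x) = D i (bar x)).
Let E := \matrix_(i, a) D i (z a).
Notation bm X := (map_mx bar X).
Context (FE: F *m E = 1%:M)
 (FEb: F *m bm E = 0)
 (EF: E *m F + bm E *m bm F = 1%:M).
Variables (phi half: A).
Context (half2: half * 2%:R = 1)
 (phib: bar phi = phi).
(** The Wirtinger derivatives along the coordinates [z]: [F] and its conjugate are the two halves of
    the inverse of the Jacobian of [z] and of its conjugate. *)
Let dz a x: A := \sum_i F a i * D i x.
Let db a x: A := \sum_i bar (F a i) * D i x.
Let zz (a: 'I_(m + m)): A := match fintype.split a with inl a => z a | inr a => bar (z a) end.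
Let FF := col_mx F (bm F).
Let EEE: \matrix_(i, a) D i (zz a) = row_mx E (bm E).
mxext i a;rewrite !mxE /zz.
by case: (fintype.split a)=> b;rewrite !mxE ?barD.
Qed.
Let FbE: bm F *m E = 0.
have: bm (F *m bm E) = 0 by rewrite FEb map_mx0.
rewrite map_mxM /= -map_mx_comp;rewrite (_: map_mx _ E = E) //.
by mxext i j;rewrite !mxE /= barK.
Qed.
Let FbEb: bm F *m bm E = 1%:M.
by rewrite -map_mxM FE map_mx1. Qed.
Let FFE: FF *m (\matrix_(i, a) D i (zz a)) = 1%:M.
by rewrite EEE mul_col_row FE FEb FbE FbEb -scalar_mx_block. Qed.
Let EFF: (\matrix_(i, a) D i (zz a)) *m FF = 1%:M.
by rewrite EEE mul_row_col EF. Qed.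

Lemma dz_pd a x: dz a x = pd FF (lshift m a) x.
by sumext i;rewrite col_mxEu. Qed.
Lemma db_pd a x: db a x = pd FF (rshift m a) x.
by sumext i;rewrite col_mxEd mxE. Qed.

Lemma dzM a x y: dz a (x * y) = dz a x * y + x * dz a y.
by rewrite !dz_pd (pd_derivations _ _ _ _).2. Qed.
Lemma dbM a x y: db a (x * y) = db a x * y + x * db a y.
by rewrite !db_pd (pd_derivations _ _ _ _).2. Qed.
Lemma dzD a x y: dz a (x + y) = dz a x + dz a y.
by rewrite !dz_pd (pd_derivations _ _ _ _).1. Qed.
Lemma dbD a x y: db a (x + y) = db a x + db a y.
by rewrite !db_pd (pd_derivations _ _ _ _).1. Qed.
Lemma dzC a b x: dz a (dz b x) = dz b (dz a x).
by rewrite !dz_pd (pdC FFE EFF). Qed.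

Lemma dzbC a b x: dz a (db b x) = db b (dz a x).
by rewrite !dz_pd !db_pd (pdC FFE EFF). Qed.
Lemma bar_dz a x: bar (dz a x) = db a (bar x).
by rewrite rmorph_sum;sumext i;rewrite rmorphM barD. Qed.
Lemma bar_db a x: bar (db a x) = dz a (bar x).
by rewrite -[x in LHS]barK -bar_dz barK. Qed.
Lemma der_dzdb i x: D i x = \sum_a (E i a * dz a x + bar (E i a) * db a x).
rewrite (pdE EFF) big_split_ord /= big_split /=;congr (_ + _);sumext a.
 by rewrite dz_pd /zz -[lshift m a]/(unsplit (inl a)) unsplitK mxE.
by rewrite db_pd /zz -[rshift m a]/(unsplit (inr a)) unsplitK mxE barD.
Qed.
Let h := \matrix_(a, b) (half * dz a (db b phi)).
Variable hi: 'M[A]_m.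
Hypothesis hhi: h *m hi = 1%:M.
(** The Chern connection matrix of the Hermitian matrix h, the complex Hessian of [phi] times
    [half]. *)
Definition kgamma (a: 'I_m): 'M[A]_m := map_mx (dz a) h *m hi.

(** Twice the real part of h in the real frame; the entries are ring elements fixed by [bar]. *)
Definition kmetric: 'M[A]_N := E *m h *m (bm E)^T + bm E *m bm h *m E^T.
Let hih: hi *m h = 1%:M. exact: mulmx1C. Qed.
Let half_der: (forall i, D i half = 0) /\ bar half = half.
have h1: half = half * half * 2%:R by rewrite -mulrA half2 mulr1.
split.
 move=> i;have /(congr1 (D i)) := half2;rewrite derM der1 -[2%:R]/(1 + 1) derD der1 addr0 mulr0 addr0.
 move=> /(congr1 (fun x => x * half));rewrite mul0r -mulrA [(1 + 1) * half]mulrC.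
 by rewrite half2 mulr1.
have /(congr1 bar) := half2;rewrite rmorphM rmorph1 rmorph_nat=> /(congr1 (fun x => x * half)).
by rewrite mul1r -mulrA [2%:R * half]mulrC half2 mulr1.
Qed.
Let dz_half a x: dz a (half * x) = half * dz a x.
have [H _] := half_der;rewrite dzM (_: dz a half = 0) ?mul0r ?add0r //.
by apply: big1=> i _;rewrite H mulr0.
Qed.
Let db_half a x: db a (half * x) = half * db a x.
have [H _] := half_der;rewrite dbM (_: db a half = 0) ?mul0r ?add0r //.
by apply: big1=> i _;rewrite H mulr0.
Qed.
Let hsym c a b: dz c (h a b) = dz a (h c b).
by rewrite !mxE !dz_half dzC. Qed.
Let hbar: bm h = h^T.
mxext a b;rewrite !mxE rmorphM half_der.2 bar_dz bar_db phib.
by rewrite dzbC.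
Qed.
(** [theta] is the Chern connection along the real direction i, and [Gam] below its transfer to the
    real frame. [Gam] is symmetric, through [hsym], and metric, so by [chr_unique] it is the
    Levi-Civita connection: this is the Kähler condition at work. *)
Let theta i := \sum_b E i b *: kgamma b.
Let Pm i := map_mx (D i) E + E *m theta i.
Let Gam i := Pm i *m F + bm (Pm i) *m bm F.
Let kgammaE b c a: kgamma b c a = \sum_d dz b (h c d) * hi d a.
by rewrite mxE;sumext d;rewrite [in LHS]mxE. Qed.
Let kgamma_sym b c a: kgamma b c a = kgamma c b a.
by rewrite !kgammaE;sumext d;rewrite hsym. Qed.
Let sE (x: A) (X: 'M[A]_m) c a: (x *: X) c a = x * X c a.
by rewrite mxE. Qed.
Let Psym i j a: Pm i j a = Pm j i a.
rewrite !mxE derC;congr (_ + _);rewrite /theta.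
under eq_bigr => c _ do rewrite summxE mulr_sumr.
under [RHS]eq_bigr => c _ do rewrite summxE mulr_sumr.
rewrite exchange_big;sumext b;sumext c.
by rewrite !sE kgamma_sym;ring.
Qed.
Let Gsym i j k: Gam i j k = Gam j i k.
rewrite /Gam !mxE;congr (_ + _);sumext a;first by rewrite Psym.
by rewrite [bm (Pm i) j a]mxE [bm (Pm j) i a]mxE Psym.
Qed.
Let bmK p r (X: 'M[A]_(p, r)): bm (bm X) = X.
by mxext i j;rewrite !mxE barK. Qed.
Let barGam i: bm (Gam i) = Gam i.
by rewrite /Gam map_mxD !map_mxM !bmK addrC. Qed.
Let GamE i: Gam i *m E = Pm i.
by rewrite mulmxDl -!mulmxA FE FbE mulmx0 addr0 mulmx1. Qed.
Let GamEb i: Gam i *m bm E = bm (Pm i).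
by rewrite mulmxDl -!mulmxA FEb FbEb mulmx0 add0r mulmx1. Qed.
Let Dbm i p r (X: 'M[A]_(p, r)): map_mx (D i) (bm X) = bm (map_mx (D i) X).
by mxext a b;rewrite !mxE barD. Qed.

Lemma kmetric_sym: kmetric^T = kmetric.
by rewrite /kmetric linearD /= !trmx_mul !trmxK hbar trmxK addrC !mulmxA.
Qed.
Let Dh i: map_mx (D i) h = theta i *m h + h *m (bm (theta i))^T.
have E1: theta i *m h = \sum_b E i b *: map_mx (dz b) h.
 rewrite mulmx_suml;sumext b.
 by rewrite -scalemxAl /kgamma -mulmxA hih mulmx1.
have E2: h *m (bm (theta i))^T = \sum_b bar (E i b) *: map_mx (db b) h.
 have: (bm (theta i *m h))^T = h *m (bm (theta i))^T.
 by rewrite map_mxM trmx_mul hbar trmxK.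
 move=> <-;rewrite E1 map_mx_sum linear_sum;sumext b.
 rewrite map_mxZ linearZ /=;congr (_ *: _);mxext a c;rewrite !mxE.
 by rewrite -/(dz _ _) bar_dz;congr (db _ _);have := congr1 (fun X: 'M[A]_m => X c a) hbar;rewrite !mxE.
rewrite E1 E2 -big_split /=;mxext a c.
rewrite [LHS]mxE der_dzdb summxE;sumext b.
by rewrite !mxE.
Qed.
Let Gmet i: map_mx (D i) kmetric = Gam i *m kmetric + kmetric *m (Gam i)^T.
have H1: Gam i *m (E *m h *m (bm E)^T) + E *m h *m (bm E)^T *m (Gam i)^T =
 map_mx (D i) (E *m h *m (bm E)^T).
 rewrite !mulmxA GamE -[_ *m (Gam i)^T]mulmxA -trmx_mul GamEb /Pm !DmM Dh -map_trmx Dbm.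
 rewrite !map_mxD map_mxM linearD /= trmx_mul !mulmxDl !mulmxDr !mulmxDl !mulmxA.
 rewrite -!addrA;congr (_ + (_ + _)).
 by rewrite addrC.
have H2: Gam i *m (bm E *m bm h *m E^T) + bm E *m bm h *m E^T *m (Gam i)^T =
 map_mx (D i) (bm E *m bm h *m E^T).
 have := congr1 (map_mx bar) H1.
 by rewrite map_mxD !map_mxM -!map_trmx barGam !bmK -Dbm !map_mxM -!map_trmx bmK.
by rewrite /kmetric DmD -H1 -H2 mulmxDr mulmxDl addrACA.
Qed.

Hypothesis htr: forall a b, db b (\tr (kgamma a)) = 0.
(** The (2,0) part of the Chern curvature vanishes because the connection has the form (dh) h^-1 and
    holomorphic derivatives commute. *)
Let flat a b: map_mx (dz a) (kgamma b) - map_mx (dz b) (kgamma a)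
 + kgamma b *m kgamma a - kgamma a *m kgamma b = 0.
have dzm c p r s (X: 'M[A]_(p, r)) (Y: 'M[A]_(r, s)) :
 map_mx (dz c) (X *m Y) = map_mx (dz c) X *m Y + X *m map_mx (dz c) Y.
 mxext i j;rewrite !mxE (big_morph (dz c) (dzD c) (_: dz c 0 = 0));last first.
 by apply: big1=> k _;rewrite der0 mulr0.
 by rewrite -big_split /=;sumext k;rewrite dzM !mxE.
have dhi c: map_mx (dz c) hi = - (hi *m map_mx (dz c) h *m hi).
 have: map_mx (dz c) (h *m hi) = 0.
 rewrite hhi;mxext i j;rewrite !mxE;apply: big1=> k _.
 by case: eqP;rewrite ?der1 ?der0 mulr0.
 rewrite dzm addrC=> /eqP;rewrite addr_eq0=> /eqP H.
 via (hi *m (h *m map_mx (dz c) hi));first by rewrite mulmxA hih mul1mx.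
 by rewrite H mulmxN mulmxA.
have H c d: map_mx (dz c) (kgamma d) = map_mx (dz c) (map_mx (dz d) h) *m hi - kgamma d *m kgamma c.
 by rewrite /kgamma dzm dhi mulmxN !mulmxA.
rewrite !H (_: map_mx (dz a) (map_mx (dz b) h) = map_mx (dz b) (map_mx (dz a) h));last first.
 by mxext i j;rewrite !mxE dzC.
move: (kgamma b *m _) (kgamma a *m _) (map_mx _ _ *m hi)=> p q X'.
by mxext i j;rewrite !mxE;ring.
Qed.
Let Om i k := map_mx (D i) (theta k) - map_mx (D k) (theta i) + theta k *m theta i - theta i *m theta k.
Let curvE i k: curv Gam i k *m E = E *m Om i k.
have H i' k': map_mx (D i') (Gam k') *m E = map_mx (D i') (Pm k') - Gam k' *m map_mx (D i') E.
 by rewrite -GamE DmM addrK.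
have H2 i' k': Gam k' *m Gam i' *m E = Gam k' *m map_mx (D i') E + Pm k' *m theta i'.
 by rewrite -mulmxA GamE mulmxDr mulmxA GamE.
have m4l (X Y Z W: 'M[A]_N): (X - Y + Z - W) *m E = X *m E - Y *m E + Z *m E - W *m E.
 by rewrite !(mulmxDl, mulNmx).
have m4r (X Y Z W: 'M[A]_m): E *m (X - Y + Z - W) = E *m X - E *m Y + E *m Z - E *m W.
 by rewrite !(mulmxDr, mulmxN).
rewrite /curv m4l !H !H2 /Om m4r.
move: (Gam i) (Gam k)=> Gi Gk;rewrite /Pm !DmD !DmM DmC !mulmxDl !mulmxA.
have mxDE p r (X Y: 'M[A]_(p, r)) x y: (X + Y) x y = X x y + Y x y by rewrite mxE.
have mxNE p r (X: 'M[A]_(p, r)) x y: (- X) x y = - X x y by rewrite mxE.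
by mxext x y;rewrite !(mxDE, mxNE);ring.
Qed.

(** By [curvF] the curvature is the Chern curvature plus its conjugate. Contraction with [F] leaves
    only the antiholomorphic derivatives of [kgamma], and the symmetry of [kgamma] in its form and
    row indices turns the remaining contraction into the trace handled by [htr]. *)
Lemma kaehler_ricci_flat gi: kmetric *m gi = 1%:M -> forall j k, ric kmetric gi half j k = 0.
move=> ggi j k;rewrite (ric_curv kmetric_sym ggi half2 Gsym Gmet).
have curvF i: curv Gam i k = E *m Om i k *m F + bm (E *m Om i k *m F).
 have cb: bm (curv Gam i k) = curv Gam i k.
 by rewrite /curv map_mxB map_mxD map_mxB !map_mxM -!Dbm !barGam.
 have cEb: curv Gam i k *m bm E = bm (E *m Om i k).
 by rewrite -curvE map_mxM cb.
 rewrite -[LHS]mulmx1 -EF mulmxDr !mulmxA curvE cEb.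
 by rewrite [in RHS]map_mxM.
have Z: \sum_i (E *m Om i k *m F) j i = 0.
 via (\sum_c E j c * \sum_a (\sum_i F a i *: Om i k) c a).
 via (\sum_i \sum_a \sum_c E j c * Om i k c a * F a i).
 sumext i;rewrite mxE;sumext a.
 by rewrite mxE mulr_suml.
 rewrite exchange_big;via (\sum_a \sum_c E j c * (\sum_i F a i *: Om i k) c a).
 sumext a;rewrite exchange_big;sumext c.
 by rewrite summxE mulr_sumr;sumext i;rewrite !mxE;ring.
 by rewrite exchange_big;sumext c;rewrite mulr_sumr.
 (* The holomorphic derivatives of [kgamma] cancel by [flat], and the derivatives of [F] cancel
    those of [E] because F E = 1. *)
 have X a: \sum_i F a i *: Om i k = - \sum_b bar (E k b) *: map_mx (db b) (kgamma a).
 have Fth: \sum_i F a i *: theta i = kgamma a.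
 under eq_bigr => i _ do rewrite /theta scaler_sumr.
 rewrite exchange_big (bigD1 a) //= [X in _ + X]big1=> [|b ba].
 rewrite addr0;under eq_bigr => i _ do rewrite scalerA.
 by rewrite -scaler_suml;have := congr1 (fun X: 'M[A]_m => X a a) FE;
 rewrite !mxE eqxx=> ->;rewrite scale1r.
 under eq_bigr => i _ do rewrite scalerA.
 rewrite -scaler_suml;have := congr1 (fun X: 'M[A]_m => X a b) FE.
 by rewrite !mxE eq_sym (negbTE ba)=> ->;rewrite scale0r.
 have FDk: \sum_i F a i *: map_mx (D k) (theta i) =
 \sum_b dz a (E k b) *: kgamma b + map_mx (D k) (kgamma a).
 rewrite -Fth Dm_sum.
 have -> : \sum_i map_mx (D k) (F a i *: theta i) =
 \sum_i D k (F a i) *: theta i + \sum_i F a i *: map_mx (D k) (theta i).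
 by rewrite -big_split /=;sumext i;rewrite DmZ.
 rewrite addrA (_: _ + \sum_i D k (F a i) *: theta i = 0) ?add0r //.
 under [X in _ + X]eq_bigr => i _ do rewrite /theta scaler_sumr.
 rewrite [X in _ + X]exchange_big -big_split /= big1 // => b _.
 under [X in _ + X]eq_bigr => i _ do rewrite scalerA.
 rewrite -scaler_suml -scalerDl.
 have: D k ((F *m E) a b) = 0 by rewrite FE mxE;case: eqP;rewrite ?der1 ?der0.
 rewrite mxE der_sum=> H;rewrite (_: _ + _ = 0) ?scale0r //.
 via (\sum_j D k (F a j * E j b));last exact: H.
 via (\sum_i F a i * D i (E k b) + \sum_i D k (F a i) * E i b)=> //.
 rewrite -big_split /=;sumext i;rewrite derM addrC;congr (_ + _ * _).
 by rewrite !mxE derC.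
 have Dth: \sum_i F a i *: map_mx (D i) (theta k) =
 \sum_b (dz a (E k b) *: kgamma b + E k b *: map_mx (dz a) (kgamma b)).
 have -> : \sum_i F a i *: map_mx (D i) (theta k) = map_mx (dz a) (theta k).
 by mxext x y;rewrite summxE [RHS]mxE;sumext i;rewrite !mxE.
 mxext x y;rewrite [LHS]mxE summxE.
 rewrite summxE (big_morph (dz a) (dzD a) (_: dz a 0 = 0));last first.
 by apply: big1=> i _;rewrite der0 mulr0.
 by sumext b;rewrite sE dzM [RHS]mxE !sE [map_mx _ _ _ _]mxE.
 have -> : \sum_i F a i *: Om i k = \sum_i F a i *: map_mx (D i) (theta k)
 - \sum_i F a i *: map_mx (D k) (theta i)
 + theta k *m (\sum_i F a i *: theta i) - (\sum_i F a i *: theta i) *m theta k.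
 rewrite mulmx_sumr mulmx_suml -!sumrN -!big_split /=;sumext i.
 by rewrite /Om !scalerBr scalerDr scalerBr -scalemxAr -scalemxAl.
 have G (S T U V X Y: 'M[A]_m): S + T - (S + (U + V)) + X - Y = (T - U + X - Y) - V.
 by mxext x y;rewrite !mxE;ring.
 have Dk: map_mx (D k) (kgamma a) = \sum_b E k b *: map_mx (dz b) (kgamma a)
 + \sum_b bar (E k b) *: map_mx (db b) (kgamma a).
 rewrite -big_split /=;mxext x y;rewrite [LHS]mxE der_dzdb summxE.
 by sumext b;rewrite [RHS]mxE !sE ![map_mx _ _ _ _]mxE.
 rewrite Fth FDk Dth big_split /= Dk G -[RHS]add0r;congr (_ + _).
 rewrite /theta mulmx_suml mulmx_sumr -!sumrN -!big_split /=.
 apply: big1=> b _;rewrite -scalemxAl -scalemxAr -!scalerN -!scalerDr.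
 by rewrite flat scaler0.
 under eq_bigr => c _.
 rewrite (_: \sum_a _ = 0);first (rewrite mulr0;over).
 under eq_bigr => a _ do rewrite X mxE summxE.
 rewrite sumrN exchange_big big1 ?oppr0 // => b _.
 have mapE (f: A -> A) (Y: 'M[A]_m) x y: map_mx f Y x y = f (Y x y) by rewrite mxE.
 under eq_bigr => a _ do rewrite sE mapE.
 rewrite -mulr_sumr;have <- : db b (\tr (kgamma c)) = \sum_a db b (kgamma a c a).
 rewrite /mxtrace (big_morph (db b) (dbD b) (_: db b 0 = 0));last first.
 by apply: big1=> i _;rewrite der0 mulr0.
 by sumext a;rewrite kgamma_sym.
 by rewrite htr mulr0.
 by rewrite big1.
under eq_bigr => i _ do rewrite curvF mxE [(map_mx _ _) _ _]mxE.
by rewrite big_split /= -rmorph_sum Z rmorph0 addr0.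
Qed.

Variables (Psi T Psi' T': A).
Context (PsiV: Psi * Psi' = 1)
 (TV: T * T' = 1)
 (dPsi: forall i, D i Psi = 0)
 (dT: forall a, db a T = 0)
 (hdet: \det h = Psi * (T * bar T)).

(** By Jacobi's formula the trace is the holomorphic logarithmic derivative of det h. In Psi T
    bar(T) the first factor is constant and the last antiholomorphic, so only the logarithmic
    derivative of T remains, and it is holomorphic. *)
Lemma kgamma_tr a b: db b (\tr (kgamma a)) = 0.
have TbV: bar T * bar T' = 1 by rewrite -rmorphM TV rmorph1.
have adjE: \adj h = \det h *: hi.
 by rewrite -[LHS]mulmx1 -hhi mulmxA mul_adj_mx mul_scalar_mx.
have dPsi0: dz a Psi = 0 by apply: big1=> i _;rewrite dPsi mulr0.
have dTb0: dz a (bar T) = 0 by rewrite -bar_db dT rmorph0.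
have E1: \tr (kgamma a) * T = dz a T.
 have dd: dz a (\det h) = \det h * \tr (kgamma a).
 rewrite /dz;under eq_bigr => i _ do rewrite der_det -mxtraceZ.
 rewrite -raddf_sum -mxtraceZ /=;congr (\tr _);rewrite /kgamma scalemxAr -adjE.
 under eq_bigr => i _ do rewrite scalemxAl.
 rewrite -mulmx_suml;congr (_ *m _);mxext x y.
 by rewrite summxE [RHS]mxE;sumext i;rewrite !mxE.
 move: dd;rewrite hdet dzM dPsi0 mul0r add0r dzM dTb0 mulr0 addr0.
 move=> /(congr1 (fun x => x * Psi' * bar T')).
 have c1 x: Psi * (x * bar T) * Psi' * bar T' = x.
 by rewrite -[RHS]mulr1 -PsiV -[RHS]mulr1 -TbV;ring.
 rewrite c1=> ->;rewrite -[LHS]mulr1 -PsiV -[LHS]mulr1 -TbV;ring.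
have E2: db b (\tr (kgamma a)) * T = 0.
 have := congr1 (db b) E1;rewrite dbM dT mulr0 addr0=> ->.
 by rewrite -dzbC dT;apply: big1=> i _;rewrite der0 mulr0.
by rewrite -[LHS]mulr1 -TV mulrA E2 mul0r.
Qed.
End Kaehler.
End DiffAlg.

(** * The ring of smooth complex functions on a nonempty open set *)

Record odom (R: realType) (N: nat) := Odom {
 dset :> set 'rV[R]_N;
 dset_open: open dset;
 dpt: 'rV[R]_N;
 dptP: dset dpt }.

Lemma cReD (R: realType) (a b: (cnum R)) :
 cRe (a + b) = cRe a + cRe b.
by case: a b=> [? ?] []. Qed.
Lemma cImD (R: realType) (a b: (cnum R)) :
 cIm (a + b) = cIm a + cIm b.
by case: a b=> [? ?] []. Qed.

Section DeriveMM.
Context {K: numF} {V: nmod K} (a b c d: V -> K) (x v: V).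
Context (da: derivable a x v) (db: derivable b x v)
 (dc: derivable c x v) (dd: derivable d x v).

Lemma derive_mulr: 'D_v (fun y => a y * b y) x = 'D_v a x * b x + a x * 'D_v b x.
by rewrite deriveM // addrC mulrC. Qed.

Lemma deriveMDM: 'D_v (fun y => a y * b y + c y * d y) x =
 ('D_v a x * b x + a x * 'D_v b x) + ('D_v c x * d x + c x * 'D_v d x).
rewrite (@deriveD _ _ _ (a * b) (c * d));try exact: derivableM.
rewrite !deriveM // /GRing.scale /= [_ * d x]mulrC [_ * b x]mulrC.
by congr (_ + _);rewrite addrC.
Qed.

Lemma deriveMBM: 'D_v (fun y => a y * b y - c y * d y) x =
 ('D_v a x * b x + a x * 'D_v b x) - ('D_v c x * d x + c x * 'D_v d x).
rewrite (@deriveB _ _ _ (a * b) (c * d));try exact: derivableM.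
rewrite !deriveM // /GRing.scale /= [_ * d x]mulrC [_ * b x]mulrC.
by congr (_ - _);rewrite addrC.
Qed.
End DeriveMM.

Section SmoothRing.
Context {R: realType} {N: nat}.
Notation C := (cnum R).

Definition csm (U: set 'rV[R]_N) (F: 'rV[R]_N -> C): Prop :=
 smooth_on U (fun x => cRe (F x): R) /\ smooth_on U (fun x => cIm (F x): R).

Definition rsm (U: set 'rV[R]_N) (f: 'rV[R]_N -> R): Prop := smooth_on U f.

Section Closure.
Variable U: set 'rV[R]_N.
Hypothesis oU: open U.

Lemma rsm_eq f g: (forall x, U x -> f x = g x) -> rsm U f -> rsm U g.
by move=> fg /smooth_onP h;apply/smooth_onP=> n;exact: smn_eq fg (h n). Qed.
Lemma rsmD f g: rsm U f -> rsm U g -> rsm U (fun x => f x + g x).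
by move=> /smooth_onP h /smooth_onP k;apply/smooth_onP=> n;exact: smn_D. Qed.
Lemma rsmM f g: rsm U f -> rsm U g -> rsm U (fun x => f x * g x).
by move=> /smooth_onP h /smooth_onP k;apply/smooth_onP=> n;exact: smn_M. Qed.
Lemma rsmN f: rsm U f -> rsm U (fun x => - f x).
by move=> /smooth_onP h;apply/smooth_onP=> n;exact: smn_N. Qed.
Lemma rsmB f g: rsm U f -> rsm U g -> rsm U (fun x => f x - g x).
by move=> hf hg;apply: rsmD=> //;exact: rsmN. Qed.
Lemma rsmC c: rsm U (fun=> c).
by apply/smooth_onP=> n;exact: smn_cst. Qed.
Lemma rsmV f: (forall x, U x -> f x != 0) -> rsm U f -> rsm U (fun x => (f x)^-1).
by move=> f0 /smooth_onP h;apply/smooth_onP=> n;exact: smn_V. Qed.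
Lemma rsmDer v f: rsm U f -> rsm U ('D_v f).
by move=> /smooth_onP h;apply/smooth_onP=> n;exact: smnD1 (h n.+1). Qed.
Lemma rsm_diff f x: rsm U f -> U x -> dfb f x.
by move=> /smooth_onP h;exact: smn_diff (h 0%N). Qed.

Lemma csm_eq F G: (forall x, U x -> F x = G x) -> csm U F -> csm U G.
by move=> FG [h k];split;[apply: rsm_eq h|apply: rsm_eq k] => x Ux;rewrite FG.
Qed.
Lemma csmD F G: csm U F -> csm U G -> csm U (fun x => F x + G x).
move=> [h k] [h' k'];split.
 by apply: (rsm_eq _ (rsmD h h'))=> x _;rewrite raddfD.
by apply: (rsm_eq _ (rsmD k k'))=> x _;rewrite raddfD.
Qed.
Lemma csmN F: csm U F -> csm U (fun x => - F x).
move=> [h k];split.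
 by apply: (rsm_eq _ (rsmN h))=> x _;rewrite raddfN.
by apply: (rsm_eq _ (rsmN k))=> x _;rewrite raddfN.
Qed.
Lemma csmM F G: csm U F -> csm U G -> csm U (fun x => F x * G x).
move=> [h k] [h' k'];split.
 by apply: (rsm_eq _ (rsmB (rsmM h h') (rsmM k k')))=> x _;rewrite cReM.
by apply: (rsm_eq _ (rsmD (rsmM h k') (rsmM k h')))=> x _;rewrite cImM.
Qed.
Lemma csmC c: csm U (fun=> c).
by split;exact: rsmC. Qed.
Lemma csmJ F: csm U F -> csm U (fun x => (F x)^*).
move=> [h k];split;first by apply: (rsm_eq _ h)=> x _;case: (F x).
by apply: (rsm_eq _ (rsmN k))=> x _;case: (F x).
Qed.
Lemma csmR f: rsm U f -> csm U (fun x => (f x)%:C).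
by move=> h;split;[exact: h|exact: rsmC]. Qed.
Lemma csmV (F: 'rV[R]_N -> C): (forall x, U x -> F x != 0) -> csm U F -> csm U (fun x => (F x)^-1).
move=> F0 sF;have [h k] := sF.
pose n2 x := cRe (F x) * cRe (F x) + cIm (F x) * cIm (F x).
have sn: rsm U n2 by apply: rsmD;apply: rsmM.
have n0 x: U x -> n2 x != 0.
 move=> /F0;apply: contraNneq;rewrite /n2 -!expr2=> /eqP;rewrite paddr_eq0 ?sqr_ge0 //.
 rewrite !sqrf_eq0=> /andP[/eqP r0 /eqP i0];by apply/eqP/cpx_eq;rewrite ?r0 ?i0.
apply: (csm_eq _ (csmM (csmJ sF) (csmR (rsmV n0 sn))))=> x Ux.
have := n0 x Ux;have := F0 x Ux;rewrite /n2;case: (F x)=> a b /= F0' n0'.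
rewrite -[LHS]mul1r -(mulVf F0') -mulrA -[RHS]mulr1;congr (_ * _).
have -> : ((a * a + b * b)^-1)%:C = ((a * a + b * b)%:C: C)^-1 by rewrite fmorphV.
have -> : (a * a + b * b)%:C = (a +i* b) * (a -i* b) :> C by apply: cpx_eq=> /=;ring.
rewrite mulrA mulfV // mulf_neq0 //.
by apply: contraNneq F0'=> /(congr1 conjc);rewrite rmorph0=> <-;rewrite /= opprK.
Qed.
End Closure.

Definition cpd (i: 'I_N) (F: 'rV[R]_N -> C) (x: 'rV[R]_N): C :=
 pderiv i (fun y => cRe (F y): R) x +i* pderiv i (fun y => cIm (F y): R) x.

Lemma csm_cpd (U: set 'rV[R]_N) i F: csm U F -> csm U (cpd i F).
by move=> [h k];split;apply: rsmDer. Qed.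

Section Ring.
Variable O: odom R N.

(** Functions vanish outside the open set, so that equality on the set is equality of elements;
    every operation is cut off accordingly. The point stored in [odom] separates 1 from 0, as the
    ring structure demands. *)
Record smf := Smf {
 sfun :> 'rV[R]_N -> C;
 sfun_sm: csm (dset O) sfun;
 sfun_out: forall x, ~ dset O x -> sfun x = 0 }.

HB.instance Definition _ := gen_eqMixin smf.
HB.instance Definition _ := gen_choiceMixin smf.
Let oO: open (dset O). exact: dset_open. Qed.

Definition cutoff (F: 'rV[R]_N -> C) x: C := if `[< dset O x >] then F x else 0.

Lemma cutoff_in F x: dset O x -> cutoff F x = F x.
by move=> Ox;rewrite /cutoff ifT //;apply/asboolP. Qed.
Lemma cutoff_sm F: csm (dset O) F -> csm (dset O) (cutoff F).
by apply: csm_eq=> // x Ox;rewrite cutoff_in. Qed.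
Lemma cutoff_out F x: ~ dset O x -> cutoff F x = 0.
by move=> Ox;rewrite /cutoff ifF //;apply/asboolPn. Qed.

Definition mksmf F (s: csm (dset O) F): smf := Smf (cutoff_sm s) (@cutoff_out F).

Lemma mksmfE F (s: csm (dset O) F) x: dset O x -> mksmf s x = F x.
exact: cutoff_in. Qed.

Lemma smf_eq (f g: smf): (forall x, dset O x -> f x = g x) -> f = g.
case: f g=> [f fs fo] [g gs go] /= fg.
have E: f = g.
 fext x;have [Ox|nOx] := pselect (dset O x);first exact: fg.
 by rewrite fo // go.
by subst g;congr Smf;exact: Prop_irrelevance.
Qed.

Definition smf_cst c: smf := mksmf (csmC (dset O) c).
Definition smf_add (f g: smf): smf := mksmf (csmD oO (sfun_sm f) (sfun_sm g)).
Definition smf_opp (f: smf): smf := mksmf (csmN oO (sfun_sm f)).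
Definition smf_mul (f g: smf): smf := mksmf (csmM oO (sfun_sm f) (sfun_sm g)).
Definition smf_bar (f: smf): smf := mksmf (csmJ oO (sfun_sm f)).
Definition smf_der i (f: smf): smf := mksmf (csm_cpd i (sfun_sm f)).

Fact smf_addA: associative smf_add. by move=> *;apply: smf_eq=> x Ox;rewrite !(mksmfE _ Ox);rewrite addrA. Qed.
Fact smf_addC: commutative smf_add. by move=> *;apply: smf_eq=> x Ox;rewrite !(mksmfE _ Ox);rewrite addrC. Qed.
Fact smf_add0: left_id (smf_cst 0) smf_add. by move=> *;apply: smf_eq=> x Ox;rewrite !(mksmfE _ Ox);rewrite add0r. Qed.
Fact smf_addN: left_inverse (smf_cst 0) smf_opp smf_add.
by move=> *;apply: smf_eq=> x Ox;rewrite !(mksmfE _ Ox);rewrite addNr. Qed.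
HB.instance Definition _ := GRing.isZmodule.Build smf smf_addA smf_addC smf_add0 smf_addN.

Fact smf_mulA: associative smf_mul. by move=> *;apply: smf_eq=> x Ox;rewrite !(mksmfE _ Ox);rewrite mulrA. Qed.
Fact smf_mulC: commutative smf_mul. by move=> *;apply: smf_eq=> x Ox;rewrite !(mksmfE _ Ox);rewrite mulrC. Qed.
Fact smf_mul1: left_id (smf_cst 1) smf_mul. by move=> *;apply: smf_eq=> x Ox;rewrite !(mksmfE _ Ox);rewrite mul1r. Qed.
Fact smf_mulD: left_distributive smf_mul smf_add.
by move=> *;apply: smf_eq=> x Ox;rewrite !(mksmfE _ Ox) mulrDl.
Qed.
Fact smf_1_neq0: smf_cst 1 != 0.
apply/eqP=> /(congr1 (fun f: smf => f (dpt O))).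
rewrite !(mksmfE _ (@dptP _ _ O))=> /eqP;by rewrite oner_eq0.
Qed.
HB.instance Definition _ := GRing.Zmodule_isComNzRing.Build smf smf_mulA smf_mulC smf_mul1
 smf_mulD smf_1_neq0.

Lemma smfD (f g: smf) x: dset O x -> (f + g) x = f x + g x. exact: mksmfE. Qed.
Lemma smfM (f g: smf) x: dset O x -> (f * g) x = f x * g x. exact: mksmfE. Qed.
Lemma smfN (f: smf) x: dset O x -> (- f) x = - f x. exact: mksmfE. Qed.
Lemma smf0 x: (0: smf) x = 0.
by have [Ox|nOx] := pselect (dset O x);[exact: mksmfE|exact: sfun_out]. Qed.
Lemma smf1 x: dset O x -> (1: smf) x = 1. exact: mksmfE. Qed.
Lemma smfB (f g: smf) x: dset O x -> (f - g) x = f x - g x.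
by move=> Ox;rewrite smfD // smfN. Qed.
Lemma smf_sumE (I: Type) (r: seq I) (P: pred I) (F: I -> smf) x: dset O x ->
 (\sum_(i <- r | P i) F i) x = \sum_(i <- r | P i) F i x.
by move=> Ox;apply: (big_morph (fun f: smf => f x))=> [f g|];[exact: smfD|exact: smf0].
Qed.
Lemma smf_prodE (I: Type) (r: seq I) (P: pred I) (F: I -> smf) x: dset O x ->
 (\prod_(i <- r | P i) F i) x = \prod_(i <- r | P i) F i x.
by move=> Ox;apply: (big_morph (fun f: smf => f x))=> [f g|];[exact: smfM|exact: smf1].
Qed.

Fact smf_bar_additive: additive smf_bar.
by move=> f g;apply: smf_eq=> x Ox;rewrite smfB // ![smf_bar _ _](mksmfE _ Ox) smfB // rmorphB. Qed.
Fact smf_bar_multiplicative: GRing.monoid_morphism smf_bar.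
split;first by apply: smf_eq=> x Ox;rewrite [smf_bar _ _](mksmfE _ Ox) smf1 // conjc1.
by move=> f g;apply: smf_eq=> x Ox;rewrite smfM // ![smf_bar _ _](mksmfE _ Ox) smfM // rmorphM.
Qed.
HB.instance Definition _ := GRing.isZmodMorphism.Build smf smf smf_bar smf_bar_additive.
HB.instance Definition _ := GRing.isMonoidMorphism.Build smf smf smf_bar smf_bar_multiplicative.

Lemma smf_barE (f: smf) x: dset O x -> smf_bar f x = (f x)^*. exact: mksmfE. Qed.
Lemma smf_barK: involutive smf_bar.
by move=> f;apply: smf_eq=> x Ox;rewrite !smf_barE // conjcK. Qed.
Lemma smf_derE i (f: smf) x: dset O x -> smf_der i f x = cpd i f x. exact: mksmfE. Qed.

Lemma cpd_near i (F G: 'rV[R]_N -> C) x: (\forall y \near x, F y = G y) ->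
 cpd i F x = cpd i G x.
move=> h;rewrite /cpd /pderiv;congr (_ +i* _);apply: near_eq_derive;
by apply: filterS h=> y ->.
Qed.

Lemma cpd_in i (F G: 'rV[R]_N -> C) x: dset O x -> (forall y, dset O y -> F y = G y) ->
 cpd i F x = cpd i G x.
by move=> Ox h;apply: cpd_near;exact: open_near Ox h. Qed.
Lemma smf_derderE i j (f: smf) x: dset O x ->
 smf_der i (smf_der j f) x = cpd i (cpd j f) x.
move=> Ox;rewrite smf_derE //;apply: cpd_in=> // y Oy;exact: smf_derE.
Qed.

Lemma cpdC i j (f: smf) x: dset O x -> cpd i (cpd j f) x = cpd j (cpd i f) x.
move=> Ox.
have S (g: 'rV[R]_N -> R): rsm (dset O) g ->
 pderiv i (fun y => pderiv j g y: R) x = pderiv j (fun y => pderiv i g y: R) x.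
 by move=> /smooth_onP sg;exact: (@schwarzR R _ (dset O) g x _ _ oO Ox (sg 1%N)).
by apply: cpx_eq;[exact: (S _ (sfun_sm f).1)|exact: (S _ (sfun_sm f).2)].
Qed.

Lemma smf_derivations: derivations smf_der.
have dR (f: smf) x v: dset O x -> derivable (fun y => cRe (f y): R) x v.
 by move=> Ox;apply: dfd;exact: rsm_diff (sfun_sm f).1 Ox.
have dI (f: smf) x v: dset O x -> derivable (fun y => cIm (f y): R) x v.
 by move=> Ox;apply: dfd;exact: rsm_diff (sfun_sm f).2 Ox.
split=> [i f g|i f g|i j f];apply: smf_eq => x Ox.
- rewrite smfD // !smf_derE // (cpd_in i Ox (fun y (Oy: dset O y) => smfD f g Oy)).
 rewrite /cpd /pderiv;apply: cpx_eq=> /=.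
 under eq_fun do rewrite raddfD.
 by rewrite deriveD //;exact: dR.
 under eq_fun do rewrite raddfD.
 by rewrite deriveD //;exact: dI.
- rewrite smfD // !smfM // !smf_derE // (cpd_in i Ox (fun y (Oy: dset O y) => smfM f g Oy)).
 rewrite /cpd /pderiv;apply: cpx_eq.
 rewrite cReD !cReM /=.
 have -> : (fun y => cRe (f y * g y)) = (fun y: 'rV[R]_N =>
 cRe (f y) * cRe (g y) - cIm (f y) * cIm (g y)).
 by fext y;exact: cReM.
 rewrite (deriveMBM (dR f x _ Ox) (dR g x _ Ox) (dI f x _ Ox) (dI g x _ Ox)).
 by rewrite opprD addrACA.
 rewrite cImD !cImM /=.
 have -> : (fun y => cIm (f y * g y)) = (fun y: 'rV[R]_N =>
 cRe (f y) * cIm (g y) + cIm (f y) * cRe (g y)).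
 by fext y;exact: cImM.
 rewrite (deriveMDM (dR f x _ Ox) (dI g x _ Ox) (dI f x _ Ox) (dR g x _ Ox)).
 by rewrite addrACA.
- exact: etrans (smf_derderE i j f Ox) (etrans (cpdC i j f Ox) (esym (smf_derderE j i f Ox))).
Qed.

Lemma smf_bar_der i f: smf_bar (smf_der i f) = smf_der i (smf_bar f).
apply: smf_eq=> x Ox;rewrite smf_barE // !smf_derE //.
rewrite (cpd_in i Ox (fun y (Oy: dset O y) => smf_barE f Oy)) /cpd /pderiv.
apply: cpx_eq=> /=.
 have -> // : (fun y => cRe (f y)) = (fun y: 'rV[R]_N => cRe (f y)^*).
 by fext y;case: (f y).
rewrite -deriveN;last by apply: dfd;exact: rsm_diff (sfun_sm f).2 Ox.
have -> // : (- (fun y => cIm (f y))) = (fun y: 'rV[R]_N => cIm (f y)^*).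
by apply/funext=> y /=;rewrite fctE;case: (f y).
Qed.

Lemma smf_inv (f: smf): (forall x, dset O x -> f x != 0) -> exists g: smf, f * g = 1.
move=> f0;exists (mksmf (csmV oO f0 (sfun_sm f))).
by apply: smf_eq=> x Ox;rewrite smfM // mksmfE // smf1 // mulfV // f0.
Qed.

Definition evm m n (A: 'M[smf]_(m, n)) x: 'M[C]_(m, n) := \matrix_(i, j) A i j x.

Lemma evmM m n p (A: 'M[smf]_(m, n)) (B: 'M[smf]_(n, p)) x: dset O x ->
 evm (A *m B) x = evm A x *m evm B x.
move=> Ox;mxext i j;rewrite !mxE smf_sumE //.
by sumext k;rewrite smfM // !mxE.
Qed.

Lemma evm1 m x: dset O x -> evm (1%:M: 'M[smf]_m) x = 1%:M.
by move=> Ox;mxext i j;rewrite !mxE;case: eqP=> _;rewrite ?smf1 ?smf0.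
Qed.

Lemma evm_det m (A: 'M[smf]_m) x: dset O x -> (\det A) x = \det (evm A x).
move=> Ox;rewrite /determinant smf_sumE //;sumext s.
rewrite smfM // smf_prodE //;congr (_ * _).
 by case: (perm.odd_perm s);rewrite ?expr1 ?expr0 ?smfN // smf1.
by sumext i;rewrite mxE.
Qed.

Lemma evm_inv m (A: 'M[smf]_m): (forall x, dset O x -> evm A x \in unitmx) ->
 exists B: 'M[smf]_m, A *m B = 1%:M.
move=> h;have [|d dE] := @smf_inv (\det A).
 by move=> x Ox;rewrite evm_det //;have := h x Ox;rewrite unitmxE unitfE.
by exists (d *: \adj A);rewrite -scalemxAr mul_mx_adj scale_scalar_mx mulrC dE.
Qed.
End Ring.
End SmoothRing.

(** * Germs of smooth maps between vector spaces *)

Section Germs.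
Context {K: numF}.
Implicit Types (V W: nmod K).

(** One neighbourhood serves all orders at once, which makes the class stable under differentiation
    and under changes of the function away from [x]. *)
Definition lsm V W (f: V -> W) (x: V): Prop :=
 exists U: set V, [/\ open U, U x & forall n, smn n U f].

Lemma lsd V W (f: V -> W) x: lsm f x -> dfb f x.
by move=> [U [_ Ux h]];exact: smn_diff (h 0%N) Ux. Qed.
Lemma lsm_cont V W (f: V -> W) x: lsm f x -> {for x, continuous f}.
by move=> /lsd; exact: differentiable_continuous. Qed.
Lemma lsm_near V W (f: V -> W) x: lsm f x -> \forall y \near x, lsm f y.
by move=> [U [oU Ux h]];apply: open_near Ux _=> // y Uy;exists U. Qed.

Lemma lsm_of V W (S: set V) (f: V -> W) x: nbhs x S -> smooth_on S f -> lsm f x.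
move=> Sx /smooth_onP h;exists S°;split=> [| |n];first exact: open_interior.
 exact: Sx.
by apply: smn_subset (h n);exact: interior_subset.
Qed.

Lemma lsm_near_eq V W (f g: V -> W) x: (\forall y \near x, f y = g y) -> lsm f x -> lsm g x.
move=> fg [U [oU Ux h]].
have Ux': nbhs x [set y | f y = g y /\ U y] by apply: filterI=> //;exact: onbhs.
exists [set y | f y = g y /\ U y]°;split=> [| |n];first exact: open_interior.
 exact: Ux'.
apply: (@smn_eq _ _ _ n _ f);first exact: open_interior.
 by move=> y /interior_subset[].
by apply: smn_subset (h n)=> y /interior_subset[].
Qed.

Lemma lsm_D V W (f: V -> W) x v: lsm f x -> lsm ('D_v f) x.
by move=> [U [oU Ux h]];exists U;split=> // n;exact: smnD1 (h n.+1). Qed.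
Lemma lsm_cst V W (c: W) (x: V): lsm (fun _: V => c) x.
by exists setT;split=> // [|n];[exact: openT|exact: smn_cst]. Qed.

Lemma lsm2 V W W1 W2 (f: V -> W1) (g: V -> W2) (h: V -> W) x: lsm f x -> lsm g x ->
 (forall U, open U -> forall n, smn n U f -> smn n U g -> smn n U h) -> lsm h x.
move=> [U [oU Ux hf]] [U' [oU' Ux' hg]] H;exists (U `&` U');split=> // [|n].
 exact: openI.
by apply: H;[exact: openI|apply: smn_subset (hf n)|apply: smn_subset (hg n)] => y [].
Qed.

Lemma lsm_add V W (f g: V -> W) x: lsm f x -> lsm g x -> lsm (fun y => f y + g y) x.
by move=> hf hg;apply: (lsm2 hf hg)=> U oU n;exact: smn_D. Qed.
Lemma lsm_mul V (f g: V -> K) x: lsm f x -> lsm g x -> lsm (fun y => f y * g y) x.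
by move=> hf hg;apply: (lsm2 hf hg)=> U oU n;exact: smn_M. Qed.
Lemma lsm_opp V W (f: V -> W) x: lsm f x -> lsm (fun y => - f y) x.
by move=> hf;apply: (lsm2 hf hf)=> U oU n h _;exact: smn_N. Qed.

Lemma lsm_sum V W (I: Type) (r: seq I) (F: I -> V -> W) x: (forall i, lsm (F i) x) ->
 lsm (fun y => \sum_(i <- r) F i y) x.
move=> h;elim: r=> [|i r IH].
 by apply: lsm_near_eq (lsm_cst 0 x);apply: nearW=> y;rewrite big_nil.
by apply: lsm_near_eq (lsm_add (h i) IH);apply: nearW=> y;rewrite big_cons.
Qed.

Lemma lsm_mx V m n (M: V -> 'M[K]_(m, n)) x :
 lsm M x <-> forall i j, lsm (fun y => M y i j: K) x.
split=> [[U [oU Ux h]] i j|h];first by exists U;split=> // p;apply (smn_mx p M oU).1.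
suff: exists U: set V, [/\ open U, U x & forall ij p, smn p U (fun y => M y ij.1 ij.2: K)].
 move=> [U [oU Ux hU]];exists U;split=> // p;apply (smn_mx p M oU).2=> i j.
 exact: (hU (i, j)).
suff H (s: seq ('I_m * 'I_n)): exists U: set V, [/\ open U, U x &
 forall ij p, ij \in s -> smn p U (fun y => M y ij.1 ij.2: K)].
 have [U [oU Ux hU]] := H (enum {: 'I_m * 'I_n});exists U;split=> // ij p.
 by apply: hU;rewrite mem_enum.
elim: s=> [|ij s [U [oU Ux hU]]];first by exists setT;split=> //;exact: openT.
have [U' [oU' Ux' hU']] := h ij.1 ij.2;exists (U `&` U');split=> //;first exact: openI.
move=> ij' p;rewrite inE=> /orP[/eqP ->|s'];first by apply: smn_subset (hU' p) => y [].
by apply: smn_subset (hU _ _ s')=> y [].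
Qed.

Lemma lsm_compK V m (g: V -> 'rV[K]_m) (f: 'rV[K]_m -> K) x: lsm g x -> lsm f (g x) ->
 lsm (fun y => f (g y)) x.
move=> sg [Q [oQ Qgx hf]].
have cg: {for x, continuous g} by exact: lsm_cont.
have [U [oU Ux hg]] := sg.
have Wx: nbhs x [set y | Q (g y) /\ U y].
 apply: filterI;last exact: onbhs.
 by apply: cg;exact: onbhs.
exists [set y | Q (g y) /\ U y]°;split=> [| |n];first exact: open_interior.
 exact: Wx.
apply: (smn_comp _ _ _ (hf n));first exact: open_interior.
 by move=> y /interior_subset[].
by apply: smn_subset (hg n)=> y /interior_subset[].
Qed.

Lemma lsm_comp V m p q (g: V -> 'rV[K]_m) (f: 'rV[K]_m -> 'M[K]_(p, q)) x :
 lsm g x -> lsm f (g x) -> lsm (fun y => f (g y)) x.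
move=> sg /lsm_mx sf;apply/lsm_mx=> i j.
exact: (lsm_compK sg (sf i j)).
Qed.

Lemma smn_linear m n p q (L: 'M[K]_(m, n) -> 'M[K]_(p, q)) (U: set _): linear L ->
 forall N, smn N U L.
move=> lL;pose LL: {linear _ -> _} := HB.pack L (GRing.isLinear.Build K _ _ _ L lL).
have LE: L = fun A => \sum_i \sum_j A i j *: L (delta_mx i j).
 apply/funext=> A;rewrite {1}(matrix_sum_delta A) -[L]/(LL: _ -> _) linear_sum.
 by sumext i;rewrite linear_sum;sumext j;rewrite linearZ.
have dL (x: 'M[K]_(m, n)): dfb L x.
 rewrite LE;apply: (@smn_diff _ _ _ 0 setT)=> //.
 apply: smn_sum;[exact: openT|move=> i];apply: smn_sum;[exact: openT|move=> j].
 by split=> // y _;apply: differentiableZl;exact: differentiable_coord.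
have cL: continuous LL by move=> x;apply: differentiable_continuous;exact: dL.
case=> [|N];first by split=> // x _;exact: dL.
split=> [x _|v];first exact: dL.
have -> : 'D_v L = fun=> L v.
 by fext x;rewrite -[L]/(LL: _ -> _) deriveE // diff_lin.
exact: smn_cst.
Qed.

Lemma lsm_linear m n p q (L: 'M[K]_(m, n) -> 'M[K]_(p, q)) x: linear L -> lsm L x.
by move=> lL;exists setT;split=> // [|N];[exact: openT|exact: smn_linear]. Qed.
Lemma lsm_id m n (x: 'M[K]_(m, n)): lsm (fun y => y) x.
exact: lsm_linear. Qed.

Lemma lsm_row V m n (f: V -> 'rV[K]_m) (g: V -> 'rV[K]_n) x: lsm f x -> lsm g x ->
 lsm (fun y => row_mx (f y) (g y)) x.
move=> /lsm_mx sf /lsm_mx sg;apply/lsm_mx=> i j.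
case: (split_ordP j)=> l ->.
 by apply: lsm_near_eq (sf i l);apply: nearW=> y;rewrite row_mxEl.
by apply: lsm_near_eq (sg i l);apply: nearW=> y;rewrite row_mxEr.
Qed.

Lemma lsm_mulmx V m n p (f: V -> 'M[K]_(m, n)) (g: V -> 'M[K]_(n, p)) x :
 lsm f x -> lsm g x -> lsm (fun y => f y *m g y) x.
move=> /lsm_mx sf /lsm_mx sg;apply/lsm_mx=> i j.
have := lsm_sum (enum 'I_n) (fun k => lsm_mul (sf i k) (sg k j)).
by apply: lsm_near_eq;apply: nearW=> y;rewrite mxE big_enum.
Qed.

Lemma smooth_on_lsm V W (U: set V) (f: V -> W): (forall x, U x -> lsm f x) -> smooth_on U f.
by move=> h;apply/smooth_onP=> n;apply: smn_local=> x /h[U' [_ U'x s]];exists U'.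
Qed.
Lemma smooth_on_lsmE V W (U: set V) (f: V -> W) x: open U -> U x -> smooth_on U f -> lsm f x.
by move=> oU Ux;apply: lsm_of;exact: onbhs. Qed.

Lemma chain_rule m n W (g: 'rV[K]_m -> 'rV[K]_n) (f: 'rV[K]_n -> W) x v :
 dfb g x -> dfb f (g x) ->
 'D_v (fun y => f (g y)) x = 'D_('D_v g x) f (g x).
move=> dg df;rewrite deriveE;last exact: dfb_comp.
by rewrite (@diff_comp _ _ _ _ g f) //= !deriveE.
Qed.

Lemma derive_linear m n (L: {linear 'rV[K]_m -> 'rV[K]_n}) x v: 'D_v L x = L v.
have dL: dfb L x by apply: (@lsd _ _ L);apply: lsm_linear;exact: linearP.
rewrite deriveE // diff_lin // => y.
by apply: differentiable_continuous;apply: (@lsd _ _ L);apply: lsm_linear;exact: linearP.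
Qed.

Lemma lsm_part1 m n p q (G: 'rV[K]_(m + n) -> 'M[K]_(p, q)) x y :
 lsm G (row_mx x y) -> lsm (fun x' => G (row_mx x' y)) x.
by move=> sG;apply: lsm_comp=> //;apply: lsm_row;[exact: lsm_id|exact: lsm_cst]. Qed.
Lemma lsm_part2 m n p q (G: 'rV[K]_(m + n) -> 'M[K]_(p, q)) x y :
 lsm G (row_mx x y) -> lsm (fun y' => G (row_mx x y')) y.
by move=> sG;apply: lsm_comp=> //;apply: lsm_row;[exact: lsm_cst|exact: lsm_id]. Qed.
Lemma derv_eq V W (f g: V -> W) x v: (\forall y \near x, f y = g y) ->
 'D_v f x = 'D_v g x.
exact: near_eq_derive. Qed.

Lemma derive_part1 m n W (G: 'rV[K]_(m + n) -> W) x y v: dfb G (row_mx x y) ->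
 'D_v (fun x' => G (row_mx x' y)) x = 'D_(row_mx v 0) G (row_mx x y).
move=> dG;have sr: lsm (fun x' => row_mx x' y) x by apply: lsm_row;[exact: lsm_id|exact: lsm_cst].
rewrite (@chain_rule _ _ _ (fun x' => row_mx x' y)) //;last exact: lsd.
congr ('D__ _ _);rewrite derive_entry;last exact: lsd.
rowext i;rewrite mxE;case: (split_ordP i)=> l ->.
 rewrite row_mxEl;under eq_fun do rewrite row_mxEl.
 have di: dfb (fun y: 'rV[K]_m => y) x by apply: lsd;exact: lsm_id.
 by rewrite (dfb_ij 0 l di).2 derive_id.
rewrite row_mxEr;under eq_fun do rewrite row_mxEr.
by rewrite derive_cst mxE.
Qed.

Lemma derive_part2 m n W (G: 'rV[K]_(m + n) -> W) x y v: dfb G (row_mx x y) ->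
 'D_v (fun y' => G (row_mx x y')) y = 'D_(row_mx 0 v) G (row_mx x y).
move=> dG;have sr: lsm (fun y' => row_mx x y') y by apply: lsm_row;[exact: lsm_cst|exact: lsm_id].
rewrite (@chain_rule _ _ _ (fun y' => row_mx x y')) //;last exact: lsd.
congr ('D__ _ _);rewrite derive_entry;last exact: lsd.
rowext i;rewrite mxE;case: (split_ordP i)=> l ->.
 rewrite row_mxEl;under eq_fun do rewrite row_mxEl.
 by rewrite derive_cst mxE.
rewrite row_mxEr;under eq_fun do rewrite row_mxEr.
have di: dfb (fun y: 'rV[K]_n => y) y by apply: lsd;exact: lsm_id.
by rewrite (dfb_ij 0 l di).2 derive_id.
Qed.
End Germs.

(** * Germs of smooth maps into manifolds and Lie groups *)

Section Charts.
Context {K: numF} {m: nat} {T: topologicalType} (c: chart K m T).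
Hypothesis okc: chart_ok c.

Lemma coordK p: dom c p -> param c (coord c p) = p.
by case: okc=> _ _ h _ _;exact: h. Qed.
Lemma img_coord p: dom c p -> img c (coord c p).
by move=> h;exists p. Qed.
Lemma imgP x: img c x -> dom c (param c x) /\ coord c (param c x) = x.
by move=> [p dp <-];rewrite coordK. Qed.

Lemma near_param x (O: set T): img c x -> nbhs (param c x) O ->
 \forall y \near x, img c y /\ O (param c y).
move=> ix Op;have [_ oi _ _ cp] := okc;rewrite (continuous_open_subspace _ oi) in cp.
apply: filterI;first exact: onbhs.
by have := cp x;rewrite inE=> /(_ ix);exact.
Qed.

Lemma near_coord p (O: set 'rV[K]_m): dom c p -> nbhs (coord c p) O ->
 \forall q \near p, dom c q /\ O (coord c q).
move=> dp Op;have [od _ _ cc _] := okc;rewrite (continuous_open_subspace _ od) in cc.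
apply: filterI;first exact: onbhs.
by have := cc p;rewrite inE=> /(_ dp);exact.
Qed.
End Charts.

Section MapGerms.
Context {K: numF}.

Lemma atlas_ok m (N: manifold K m) c: @atlas _ _ N c -> chart_ok c.
by move=> /(atlas_maximal c).1[]. Qed.

Lemma atlas_trans m (N: manifold K m) c d p: @atlas _ _ N c -> atlas d ->
 dom c p -> dom d p -> lsm (trans c d) (coord c p).
move=> ac ad cp dp;have [ok h] := (atlas_maximal c).1 ac.
have [st _] := h d ad;apply: lsm_of st.
have dN: nbhs (param c (coord c p)) (dom d).
 by rewrite coordK //;apply: onbhs;split=> //;have [] := atlas_ok ad.
apply: filterS (near_param ok (img_coord cp) dN)=> y [/(imgP ok)[h1 h2] dy].
by exists (param c y).
Qed.

(** Continuity is asked for separately: smoothness of the composite with [coord d] says nothing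
    about a map that leaves the domain of [d]. *)
Definition gsm (V: nmod K) m (N: manifold K m) (f: V -> N) (x: V): Prop :=
 {for x, continuous f} /\
 forall d, atlas d -> dom d (f x) -> lsm (fun y => coord d (f y)) x.

Section Maps.
Context {V: nmod K} {m: nat} {N: manifold K m}.
Implicit Types f: V -> N.

Lemma gsm_near_dom f x d: gsm f x -> atlas d -> dom d (f x) ->
 \forall y \near x, dom d (f y) /\ param d (coord d (f y)) = f y.
move=> [cf _] ad dfx;have okd:= atlas_ok ad.
have nd: nbhs (f x) (dom d) by apply: onbhs;split=> //;have [] := okd.
have nx: \forall y \near x, dom d (f y) := cf _ nd.
by apply: filterS nx=> y dy;split=> //;exact: coordK.
Qed.

Lemma gsm_chart f x d: {for x, continuous f} -> atlas d -> dom d (f x) ->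
 lsm (fun y => coord d (f y)) x -> gsm f x.
move=> cf ad dfx sf;split=> // d' ad' d'fx.
have st: lsm (trans d d') (coord d (f x)) := atlas_trans ad ad' dfx d'fx.
apply: lsm_near_eq (lsm_comp sf st).
have nd: nbhs (f x) (dom d).
 by apply: onbhs;split=> //;have [] := atlas_ok ad.
have nx: \forall y \near x, dom d (f y) := cf _ nd.
by apply: filterS nx=> y dy;rewrite /trans coordK //;exact: atlas_ok.
Qed.

Lemma gsm_cst (p: N) (x: V): gsm (fun _: V => p) x.
by split=> [|d _ _];[exact: cvg_cst|exact: lsm_cst]. Qed.

Lemma gsm_map b (Q: manifold K b) (U: set N) (g: N -> Q) f x: open U -> smooth_map U g ->
 U (f x) -> gsm f x -> gsm (fun y => g (f y)) x.
move=> oU [cg sg] Ufx [cf sf].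
have cgx: {for f x, continuous g}.
 by rewrite (continuous_open_subspace _ oU) in cg;apply: cg;rewrite inE.
split;first exact: (@continuous_comp _ _ _ f g x).
move=> d ad dgf;have [c ac cfx] := @atlas_cover _ _ N (f x).
have okc:= atlas_ok ac.
have sgl: lsm (fun y => coord d (g (param c y))) (coord c (f x)).
 apply: lsm_of (sg c d ac ad).
 have Wn: nbhs (f x) (U `&` g @^-1` (dom d)).
 apply: filterI;first exact: onbhs.
 by apply: cgx;apply: onbhs;split=> //;have [] := atlas_ok ad.
 rewrite -(coordK okc cfx) in Wn.
 apply: filterS (near_param okc (img_coord cfx) Wn)=> y [/(imgP okc)[h1 h2] [Uy dy]].
 by exists (param c y).
apply: lsm_near_eq (lsm_comp (sf c ac cfx) sgl).
have := @gsm_near_dom f x c (conj cf sf) ac cfx.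
by apply: filterS=> y [_ ->].
Qed.
End Maps.

Lemma gsm_param m (N: manifold K m) c x: @atlas _ _ N c -> img c x -> gsm (param c) x.
move=> ac ix;have okc:= atlas_ok ac;have [dx cx] := imgP okc ix.
apply: (gsm_chart _ ac dx).
 move=> A /(near_param okc ix);apply: filterS=> y [];done.
apply: lsm_near_eq (lsm_id x).
have [_ oi _ _ _] := okc;apply: open_near ix _=> // y iy.
by have [_ ->] := imgP okc iy.
Qed.

Lemma gsm_rebase (V: nmod K) n m (N: manifold K m) (g: V -> 'rV[K]_n) (f: 'rV[K]_n -> N) x :
 lsm g x -> gsm f (g x) -> gsm (fun y => f (g y)) x.
move=> sg [cf sf];split.
 apply: (@continuous_comp _ _ _ g f x)=> //.
 by exact: lsm_cont.
by move=> d ad dx;exact: (lsm_comp sg (sf d ad dx)).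
Qed.

Section Group.
Context {k: nat} (G: lie_group K k).

Lemma gsm_mul (V: nmod K) (f g: V -> G) x: gsm f x -> gsm g x ->
 gsm (fun y => gmul (f y) (g y)) x.
move=> sf sg;have [cm sm] := @gmul_smooth _ _ G.
have cfg: {for x, continuous (fun y => (f y, g y))} by apply: cvg_pair;[exact: sf.1|exact: sg.1].
split.
 exact: (@continuous_comp _ _ _ (fun y => (f y, g y)) (fun p: (G * G)%type => gmul p.1 p.2) x cfg (cm _)).
move=> d ad dx.
have [c ac cfx] := @atlas_cover _ _ G (f x);have [c' ac' cgx] := @atlas_cover _ _ G (g x).
have [okc okc'] := (atlas_ok ac, atlas_ok ac').
have sml: lsm (fun z: 'rV[K]_(k + k) => coord d (gmul (param c (lsubmx z)) (param c' (rsubmx z))))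
 (row_mx (coord c (f x)) (coord c' (g x))).
 apply: lsm_of (sm c c' d ac ac' ad).
 have := cm (f x, g x) (dom d) (_: nbhs _ _).
 case=> [|[A B] /= [nA nB] AB].
 by apply: onbhs;split=> //;have [] := atlas_ok ad.
 rewrite -(coordK okc cfx) in nA;rewrite -(coordK okc' cgx) in nB.
 have hl:= near_param okc (img_coord cfx) nA;have hr:= near_param okc' (img_coord cgx) nB.
 set rr := row_mx _ _.
 have {}hl: nbhs (lsubmx rr) [set y | img c y /\ A (param c y)] by rewrite row_mxKl.
 have {}hr: nbhs (rsubmx rr) [set y | img c' y /\ B (param c' y)] by rewrite row_mxKr.
 have cl: continuous (@lsubmx K 1 k k).
 by move=> z;apply: lsm_cont;apply: lsm_linear;exact: linearP.
 have cr: continuous (@rsubmx K 1 k k).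
 by move=> z;apply: lsm_cont;apply: lsm_linear;exact: linearP.
 near=> z.
 have [/(imgP okc)[zc1 zc2] zA]: img c (lsubmx z) /\ A (param c (lsubmx z)).
 by near: z;exact: (cl _ _ hl).
 have [/(imgP okc')[zd1 zd2] zB]: img c' (rsubmx z) /\ B (param c' (rsubmx z)).
 by near: z;exact: (cr _ _ hr).
 exists (param c (lsubmx z)), (param c' (rsubmx z));split=> //.
 exact: (AB (_, _)).
 by rewrite zc2 zd2 hsubmxK.
have srow:= lsm_row (sf.2 c ac cfx) (sg.2 c' ac' cgx).
apply: lsm_near_eq (lsm_comp srow sml).
apply: filterS2 (gsm_near_dom sf ac cfx) (gsm_near_dom sg ac' cgx)=> y [_ E1] [_ E2].
by rewrite row_mxKl row_mxKr E1 E2.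
Unshelve. all: by end_near. Qed.

Lemma gsm_inv (V: nmod K) (f: V -> G) x: gsm f x -> gsm (fun y => ginv (f y)) x.
by apply: (@gsm_map _ _ _ _ _ setT)=> //;[exact: openT|exact: ginv_smooth].
Qed.

Lemma gmulV' (x: G): gmul x (ginv x) = gone G.
by rewrite -[LHS]gmul1 -{1}(gmulV (ginv x)) -gmulA [gmul _ (gmul x _)]gmulA gmulV gmul1 gmulV.
Qed.
Lemma gmul1' (x: G): gmul x (gone G) = x.
by rewrite -(gmulV x) gmulA gmulV' gmul1. Qed.
Lemma gmulKV (x y: G): gmul x (gmul (ginv x) y) = y.
by rewrite gmulA gmulV' gmul1. Qed.
Lemma gmulVK (x y: G): gmul (ginv x) (gmul x y) = y.
by rewrite gmulA gmulV gmul1. Qed.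
Lemma ginv_uniq (x y: G): gmul x y = gone G -> y = ginv x.
by move=> h;rewrite -[y](gmulVK x) h gmul1'. Qed.
Lemma ginvM (x y: G): ginv (gmul x y) = gmul (ginv y) (ginv x).
by apply/esym/ginv_uniq;rewrite -gmulA [gmul y _]gmulA gmulV' gmul1 gmulV'. Qed.
Lemma ginv1: ginv (gone G) = gone G.
by apply/esym/ginv_uniq;rewrite gmul1. Qed.
End Group.
End MapGerms.

Section RowMxContinuity.
Context {K: numF} {k: nat} (x0: 'rV[K]_k).

Lemma row_mx_contl: {for x0, continuous (fun x: 'rV[K]_k => row_mx x x0)}.
by apply: lsm_cont;apply: lsm_row;[exact: lsm_id|exact: lsm_cst]. Qed.

Lemma row_mx_contr: {for x0, continuous (fun x: 'rV[K]_k => row_mx x0 x)}.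
by apply: lsm_cont;apply: lsm_row;[exact: lsm_cst|exact: lsm_id]. Qed.
End RowMxContinuity.
Arguments row_mx_contl {K k} x0.
Arguments row_mx_contr {K k} x0.

(** * Representations, brackets and the adjoint action, over any scalars with symmetric second
    derivatives *)

Section LieDeriv.
Context {K: numF}.
Hypothesis HS: forall (V: nmod K) (U: set V) (F: V -> K) x u v,
 open U -> U x -> smn 1 U F -> 'D_u ('D_v F) x = 'D_v ('D_u F) x.
Context {k: nat} (G: lie_group K k).
Let e := echart G.
Let x0 := coord e (gone G).
Let ae: atlas e := echart_atlas G.
Let e1: dom e (gone G) := echart_one G.
Let oke: chart_ok e := atlas_ok ae.
Let ix0: img e x0 := img_coord e1.
Let pe0: param e x0 = gone G := coordK oke e1.

Lemma lsm_schwarz (V: nmod K) p q (F: V -> 'M[K]_(p, q)) x u v: lsm F x ->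
 'D_u ('D_v F) x = 'D_v ('D_u F) x.
move=> sF;have H w w' i j: 'D_w ('D_w' F) x i j = 'D_w ('D_w' (fun y => F y i j: K)) x.
 have sD:= lsm_D w' sF;rewrite -(dfb_ij i j (lsd sD)).2.
 apply: near_eq_derive;apply: filterS (lsm_near sF)=> y sy.
 by rewrite (dfb_ij i j (lsd sy)).2.
mxext i j;have /lsm_mx/(_ i j)[U [oU Ux h]] := sF.
exact: etrans (H u v i j) (etrans (HS u v oU Ux (h 1%N)) (esym (H v u i j))).
Qed.

Lemma derive_lin (V W: nmod K) (F: V -> W) x u v (a: K): dfb F x ->
 'D_(a *: u + v) F x = a *: 'D_u F x + 'D_v F x.
by move=> dF;rewrite !deriveE // linearP. Qed.

Lemma derive_post (V: nmod K) m n p q (L: {linear 'M[K]_(m, n) -> 'M[K]_(p, q)})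
 (f: V -> 'M[K]_(m, n)) x v: dfb f x -> 'D_v (fun y => L (f y)) x = L ('D_v f x).
move=> df;have dL y: dfb L y by apply: (@lsd _ _ _ L);apply: lsm_linear;exact: linearP.
rewrite deriveE;last by apply: (@dfb_comp _ _ _ _ f L).
rewrite (@diff_comp _ _ _ _ f L) //= diff_lin ?deriveE // => y.
by apply: differentiable_continuous;exact: dL.
Qed.

Lemma derive_mulmxl (V: nmod K) m n p (A: 'M[K]_(m, n)) (f: V -> 'M[K]_(n, p)) x v :
 dfb f x -> 'D_v (fun y => A *m f y) x = A *m 'D_v f x.
exact: (derive_post (mulmx A)). Qed.
Lemma derive_mulmxr (V: nmod K) m n p (A: 'M[K]_(n, p)) (f: V -> 'M[K]_(m, n)) x v :
 dfb f x -> 'D_v (fun y => f y *m A) x = 'D_v f x *m A.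
exact: (derive_post (mulmxr A)). Qed.
Lemma lsm_ext (V W: nmod K) (f g: V -> W) x: (forall y, f y = g y) -> lsm f x -> lsm g x.
by move=> /funext ->. Qed.

Lemma derive_comb (V: nmod K) m p q (M: V -> 'rV[K]_m) (N: 'I_m -> V -> 'M[K]_(p, q)) (x: V) u :
 lsm M x -> (forall l, lsm (N l) x) ->
 'D_u (fun y => \sum_l M y 0 l *: N l y) x =
 \sum_l ('D_u M x 0 l *: N l x + M x 0 l *: 'D_u (N l) x).
move=> sM sN.
have sMl l: lsm (fun x => M x 0 l: K) x by move/lsm_mx: sM;exact.
have sNij l i j: lsm (fun x => N l x i j: K) x by have /lsm_mx := sN l;exact.
have sprod l: lsm (fun x => M x 0 l *: N l x) x.
 apply/lsm_mx=> i' j'.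
 by apply: lsm_ext (lsm_mul (sMl l) (sNij l i' j'))=> y;rewrite mxE.
have ssum: lsm (fun x => \sum_l M x 0 l *: N l x) x.
 by apply: lsm_ext (lsm_sum (enum 'I_m) sprod)=> y;rewrite big_enum.
mxext i j;rewrite -(dfb_ij i j (lsd ssum)).2 summxE.
have -> : (fun x => (\sum_l M x 0 l *: N l x) i j: K) = \sum_l (fun x => M x 0 l * N l x i j).
 by fext y;rewrite summxE fct_sumE;sumext l;rewrite mxE.
rewrite derive_sum;last by move=> l;apply: derivableM;apply: dfd;exact: lsd.
sumext l;rewrite derive_mulr;try by apply: dfd;exact: lsd.
by rewrite (dfb_ij 0 l (lsd sM)).2 (dfb_ij i j (lsd (sN l))).2 !mxE addrC.
Qed.

Lemma lsm_D2 n m p q (F: 'rV[K]_(n + m) -> 'M[K]_(p, q)) x y v: lsm F (row_mx x y) ->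
 lsm (fun x' => 'D_v (fun y' => F (row_mx x' y')) y) x.
move=> sF;have := lsm_part1 (lsm_D (row_mx 0 v) sF);apply: lsm_near_eq.
have cp: {for x, continuous (fun x': 'rV[K]_n => row_mx x' y)}.
 by apply: lsm_cont;apply: lsm_row;[exact: lsm_id|exact: lsm_cst].
have: \forall x' \near x, lsm F (row_mx x' y) := cp _ (lsm_near sF).
by apply: filterS=> x' sx';rewrite -derive_part2 //;exact: lsd.
Qed.

Definition mu (x y: 'rV[K]_k) := coord e (gmul (param e x) (param e y)).

Lemma gsm_one: gsm (param e) x0. exact: gsm_param. Qed.

Lemma mu_lsm: lsm (fun z: 'rV[K]_(k + k) => mu (lsubmx z) (rsubmx z)) (row_mx x0 x0).
have H: gsm (fun z: 'rV[K]_(k + k) => gmul (param e (lsubmx z)) (param e (rsubmx z))) (row_mx x0 x0).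
 apply: gsm_mul;apply: gsm_rebase;try by apply: lsm_linear;exact: linearP.
 by rewrite row_mxKl;exact: gsm_one.
 by rewrite row_mxKr;exact: gsm_one.
by apply: H.2=> //;rewrite row_mxKl row_mxKr pe0 gmul1.
Qed.

Lemma mu1: \forall x \near x0, mu x x0 = x /\ mu x0 x = x.
have [_ oi _ _ _] := oke;apply: open_near ix0 _=> // x ix.
by rewrite /mu pe0 gmul1 gmul1';have [_ ->] := imgP oke ix.
Qed.

(** Smoothness is tested on germs of maps into the group, the form in which it combines with
    [gsm]. *)
Definition smooth_rep r (tau: G -> 'M[K]_r): Prop :=
 (forall a b, tau (gmul a b) = tau a *m tau b) /\ tau (gone G) = 1%:M /\
 forall n (f: 'rV[K]_n -> G) x, gsm f x -> lsm (fun y => tau (f y)) x.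

Definition dtau r (tau: G -> 'M[K]_r) (v: 'rV[K]_k): 'M[K]_r :=
 'D_v (fun y => tau (param e y)) x0.

(** The left logarithmic derivative f^-1 df, an element of the Lie algebra read in [echart]. *)
Definition vel n (f: 'rV[K]_n -> G) x w: 'rV[K]_k :=
 'D_w (fun y => coord e (gmul (ginv (f x)) (f y))) x.

Section Rep.
Context {r: nat} (tau: G -> 'M[K]_r).
Hypothesis Ht: smooth_rep tau.
Let tM := Ht.1. Let t1 := Ht.2.1.

Lemma rep_lsm0: lsm (fun y => tau (param e y)) x0.
by apply: Ht.2.2;exact: gsm_one. Qed.
Lemma dtau_lin a u v: dtau tau (a *: u + v) = a *: dtau tau u + dtau tau v.
by apply: derive_lin;exact: lsd rep_lsm0. Qed.

Lemma dtau_vel n (f: 'rV[K]_n -> G) x w: gsm f x ->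
 'D_w (fun y => tau (f y)) x = tau (f x) *m dtau tau (vel f x w).
move=> sf;pose g y := gmul (ginv (f x)) (f y).
have sg: gsm g x by apply: gsm_mul=> //;exact: gsm_cst.
have gx: g x = gone G by rewrite /g gmulV.
have E1: (fun y => tau (f y)) = (fun y => tau (f x) *m tau (g y)).
 by fext y;rewrite -tM /g gmulKV.
have st: lsm (fun y => tau (g y)) x by apply: Ht.2.2.
have dt:= lsd st.
rewrite E1 derive_mulmxl //;congr (_ *m _).
have E3: \forall y \near x, tau (g y) = tau (param e (coord e (g y))).
 by apply: filterS (gsm_near_dom sg ae _);rewrite ?gx // => y [_ ->].
rewrite (derv_eq _ E3).
have sc: lsm (fun y => coord e (g y)) x by apply: sg.2;rewrite // gx.
rewrite (@chain_rule _ _ _ _ (fun y => coord e (g y)) (fun y => tau (param e y))) //.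
- by rewrite gx.
- exact: lsd.
- by rewrite gx;exact: lsd rep_lsm0.
Qed.

(** Second-order expansion of tau(xy), with f the map tau in the chart: [key] expresses dtau(a)
    dtau(b) by the mixed derivative of the multiplication and the Hessian of f. Antisymmetrization
    removes the Hessian and leaves the bracket. *)
Lemma dtau_bracket u v :
 dtau tau (lie_bracket G u v) = dtau tau u *m dtau tau v - dtau tau v *m dtau tau u.
pose f y := tau (param e y).
pose Mv v x := 'D_v (fun y => mu x y) x0.
have sf: lsm f x0 := rep_lsm0.
have smu:= mu_lsm.
have sMv w: lsm (Mv w) x0.
 have := lsm_part1 (lsm_D (row_mx 0 w) smu);apply: lsm_near_eq.
 have cp:= row_mx_contl x0.
 have: \forall x' \near x0, lsm (fun z: 'rV[K]_(k + k) => mu (lsubmx z) (rsubmx z)) (row_mx x' x0).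
 exact: cp _ (lsm_near smu).
 apply: filterS=> x' sx';rewrite /Mv -derive_part2;last exact: lsd.
 have -> // : (fun y': 'rV[K]_k => mu (lsubmx (row_mx x' y')) (rsubmx (row_mx x' y'))) = mu x'.
 by fext y;rewrite row_mxKl row_mxKr.
have Mx0 w: Mv w x0 = w.
 rewrite /Mv;have h: \forall y \near x0, mu x0 y = y by apply: filterS mu1=> y [].
 rewrite (derv_eq _ h);exact: derive_id.
have key a b: dtau tau a *m dtau tau b = dtau tau ('D_a (Mv b) x0) + 'D_a ('D_b f) x0.
 have step: \forall x \near x0, tau (param e x) *m dtau tau b = 'D_(Mv b x) f x.
 have cp:= row_mx_contl x0.
 have h1: \forall x' \near x0, lsm (fun z: 'rV[K]_(k + k) => mu (lsubmx z) (rsubmx z)) (row_mx x' x0).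
 exact: cp _ (lsm_near smu).
 have h2: \forall x' \near x0, lsm f x' := lsm_near sf.
 have h3: \forall x' \near x0, dom e (param e x').
 by have [_ oi _ _ _] := oke;apply: open_near ix0 _=> // y /(imgP oke)[].
 apply: filterS2 (filterI h1 h2) (filterI h3 mu1)=> x [sx fx] [dx [mx _]].
 have gx: gsm (fun y => gmul (param e x) (param e y)) x0.
 by apply: gsm_mul;[exact: gsm_cst|exact: gsm_one].
 have dgx: dom e (gmul (param e x) (param e x0)) by rewrite pe0 gmul1'.
 have <- : 'D_b (fun y => tau (gmul (param e x) (param e y))) x0 = tau (param e x) *m dtau tau b.
 rewrite (dtau_vel _ gx) pe0 gmul1';congr (_ *m dtau _ _).
 rewrite /vel;via ('D_b (fun y: 'rV[K]_k => y) x0);last exact: derive_id.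
 apply: derv_eq;have [_ oi _ _ _] := oke;apply: open_near ix0 _=> // y iy.
 by rewrite pe0 gmul1' gmulVK;have [_ ->] := imgP oke iy.
 have E: \forall y \near x0, tau (gmul (param e x) (param e y)) = f (mu x y).
 by apply: filterS (gsm_near_dom gx ae dgx)=> y [_ E];rewrite /f /mu E.
 have smx: lsm (fun y => mu x y) x0 by exact: gx.2.
 rewrite (derv_eq _ E) (@chain_rule _ _ _ _ (fun y => mu x y)) //.
 - by rewrite mx.
 - exact: lsd.
 - by rewrite mx;exact: lsd.
 have <- : 'D_a (fun x => tau (param e x) *m dtau tau b) x0 = dtau tau a *m dtau tau b.
 by rewrite derive_mulmxr //;exact: lsd.
 rewrite (derv_eq _ step).
 have step2: \forall x \near x0, 'D_(Mv b x) f x = \sum_l Mv b x 0 l *: 'D_(dlt l) f x.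
 by apply: filterS (lsm_near sf)=> x sx;rewrite deriveE ?diff_rV_sum //;exact: lsd.
 rewrite (derv_eq _ step2).
 rewrite (@derive_comb _ _ _ _ (Mv b) (fun l => 'D_(dlt l) f)) // => [|l];last exact: lsm_D.
 rewrite big_split /= Mx0;congr (_ + _).
 by rewrite /dtau -/f [RHS]deriveE ?[in RHS]diff_rV_sum //;exact: lsd.
 rewrite lsm_schwarz // deriveE ?diff_rV_sum;try (by apply: lsd;exact: lsm_D).
 by sumext l;rewrite lsm_schwarz.
have sw: 'D_u ('D_v f) x0 = 'D_v ('D_u f) x0 by exact: lsm_schwarz.
have E (A B S: 'M[K]_r): A + S - (B + S) = A - B by rewrite opprD addrACA subrr addr0.
rewrite (key u v) (key v u) sw E.
have -> : lie_bracket G u v = -1 *: 'D_v (Mv u) x0 + 'D_u (Mv v) x0.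
 by rewrite scaleN1r addrC.
by rewrite dtau_lin scaleN1r addrC.
Qed.
End Rep.

Definition gconj (g a: G) := gmul (gmul g a) (ginv g).

Lemma gconjM g a b: gconj g (gmul a b) = gmul (gconj g a) (gconj g b).
by rewrite /gconj -!gmulA gmulVK. Qed.
Lemma gconj1 g: gconj g (gone G) = gone G.
by rewrite /gconj gmul1' gmulV'. Qed.
Lemma gconjJ g h a: gconj (gmul g h) a = gconj g (gconj h a).
by rewrite /gconj ginvM -!gmulA. Qed.
Lemma conj1g a: gconj (gone G) a = a.
by rewrite /gconj ginv1 gmul1 gmul1'. Qed.
Lemma gsm_conj (V: nmod K) (f g: V -> G) x: gsm f x -> gsm g x ->
 gsm (fun y => gconj (f y) (g y)) x.
by move=> sf sg;apply: gsm_mul;[exact: gsm_mul|exact: gsm_inv]. Qed.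

Definition adf g (y: 'rV[K]_k) := coord e (gconj g (param e y)).

Definition admap g v: 'rV[K]_k := 'D_v (adf g) x0.

Lemma adf0 g: adf g x0 = x0.
by rewrite /adf pe0 gconj1. Qed.
Lemma adf_lsm g: lsm (adf g) x0.
have s: gsm (fun y => gconj g (param e y)) x0 by apply: gsm_conj;[exact: gsm_cst|exact: gsm_one].
by apply: s.2=> //;rewrite pe0 gconj1.
Qed.
Lemma near_adf g: \forall y \near x0, param e (adf g y) = gconj g (param e y).
have s: gsm (fun y => gconj g (param e y)) x0 by apply: gsm_conj;[exact: gsm_cst|exact: gsm_one].
by apply: filterS (gsm_near_dom s ae _)=> [y []//|];rewrite pe0 gconj1.
Qed.

Lemma admapM g h v: admap (gmul g h) v = admap g (admap h v).
rewrite /admap;via ('D_v (fun y => adf g (adf h y)) x0).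
 by apply: derv_eq;apply: filterS (near_adf h)=> y E;rewrite {2}/adf E -gconjJ.
by rewrite chain_rule ?adf0 //;apply: lsd;rewrite ?adf0;exact: adf_lsm.
Qed.

Lemma admap1 v: admap (gone G) v = v.
via ('D_v (fun y: 'rV[K]_k => y) x0);last exact: derive_id.
apply: derv_eq;have [_ oi _ _ _] := oke;apply: open_near ix0 _=> // y iy.
by rewrite /adf conj1g;have [_ ->] := imgP oke iy.
Qed.

Lemma admap_lin g a u v: admap g (a *: u + v) = a *: admap g u + admap g v.
by apply: derive_lin;apply: lsd;exact: adf_lsm. Qed.

(** Lie algebra vectors are rows while representations act on columns, hence the transposes in
    [AdmE] and wherever the bracket is written with adjoint matrices. *)
Definition Adm (g: G): 'M[K]_k := \matrix_(i, j) admap g (dlt j) 0 i.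

Lemma AdmE g v: admap g v = v *m (Adm g)^T.
rewrite {1}(row_sum_delta v).
pose L: {linear 'rV[K]_k -> 'rV[K]_k} :=
 HB.pack (admap g) (GRing.isLinear.Build K _ _ _ (admap g) (admap_lin g)).
have -> : admap g (\sum_j v 0 j *: dlt j) = \sum_j v 0 j *: admap g (dlt j).
 by rewrite -[admap g]/(L: _ -> _) linear_sum;sumext j;rewrite linearZ.
rowext i;rewrite summxE mxE;sumext j;rewrite !mxE.
by [].
Qed.

Lemma Adm_rep: smooth_rep Adm.
split=> [a b|];last split.
- apply/trmx_inj/row_matrixP=> i;rewrite !rowE -AdmE admapM 2!AdmE -mulmxA -trmx_mul.
 by [].
- by apply/trmx_inj/row_matrixP=> i;rewrite !rowE -AdmE admap1 trmx1 mulmx1.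
move=> n f x sf;apply/lsm_mx=> i j.
pose F (z: 'rV[K]_(n + k)) := coord e (gconj (f (lsubmx z)) (param e (rsubmx z))).
have sF: lsm F (row_mx x x0).
 have s: gsm (fun z: 'rV[K]_(n + k) => gconj (f (lsubmx z)) (param e (rsubmx z))) (row_mx x x0).
 apply: gsm_conj;apply: gsm_rebase;try by apply: lsm_linear;exact: linearP.
 by rewrite row_mxKl.
 by rewrite row_mxKr;exact: gsm_one.
 by apply: s.2=> //;rewrite row_mxKl row_mxKr pe0 gconj1.
have := lsm_D2 (dlt j) sF=> /lsm_mx /(_ 0 i);apply: lsm_ext=> y.
rewrite /Adm mxE /admap;suff -> : (fun y' => F (row_mx y y')) = adf (f y) by [].
fext z;by rewrite /F row_mxKl row_mxKr.
Qed.

Lemma rep_conj r (tau: G -> 'M[K]_r) g u: smooth_rep tau ->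
 tau g *m dtau tau u *m tau (ginv g) = dtau tau (admap g u).
move=> Ht;have [tM [t1 ts]] := Ht.
have s: gsm (fun y => gconj g (param e y)) x0 by apply: gsm_conj;[exact: gsm_cst|exact: gsm_one].
have := dtau_vel Ht u s;rewrite pe0 gconj1 t1 mul1mx.
have -> : vel (fun y => gconj g (param e y)) x0 u = admap g u.
 rewrite /vel pe0 gconj1 ginv1 /admap.
 by apply: (congr1 (fun F => 'D_u F x0));fext y;rewrite gmul1.
move=> <-;have -> : (fun y => tau (gconj g (param e y))) = (fun y => tau g *m tau (param e y) *m tau (ginv g)).
 by fext y;rewrite /gconj !tM.
have df: dfb (fun y => tau (param e y)) x0 by apply: lsd;exact: rep_lsm0.
rewrite (derive_mulmxr _ (f := fun y => tau g *m tau (param e y))) ?derive_mulmxl //.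
by apply: lsd;apply: lsm_mulmx;[exact: lsm_cst|exact: rep_lsm0].
Qed.

(** Write xy as (x y x^-1) x and differentiate in y, then in x: one term is the derivative of Ad,
    the other is the mixed derivative of the multiplication in the opposite order, which the bracket
    subtracts. *)
Lemma dAdm u v: lie_bracket G u v = v *m (dtau Adm u)^T.
have dA: dfb (fun y => Adm (param e y)) x0 by apply: lsd;exact: rep_lsm0 Adm_rep.
have sA: lsm (fun x => admap (param e x) v) x0.
 apply: (@lsm_ext _ _ (fun x => v *m (Adm (param e x))^T))=> [x|];first by rewrite AdmE.
 apply: lsm_mulmx;first exact: lsm_cst.
 have /lsm_mx h := rep_lsm0 Adm_rep;apply/lsm_mx=> i j;by apply: (lsm_ext _ (h j i))=> x;rewrite [RHS]mxE.
have -> : v *m (dtau Adm u)^T = 'D_u (fun x => admap (param e x) v) x0.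
 rowext i;rewrite -(dfb_ij 0 i (lsd sA)).2 mxE.
 have -> : (fun x => admap (param e x) v 0 i: K) =
 \sum_j (fun x => v 0 j * Adm (param e x) i j).
 by fext x;rewrite AdmE mxE fct_sumE;sumext j;rewrite mxE.
 rewrite derive_sum;last first.
 by move=> j;apply: derivableM;apply: dfd=> //;exact: (dfb_ij i j dA).1.
 sumext j;have dij:= (dfb_ij i j dA).1.
 rewrite derive_mulr ?derive_cst;try exact: dfd.
 by rewrite mul0r add0r mxE (dfb_ij i j dA).2.
pose F (z: 'rV[K]_(k + k)) := mu (lsubmx z) (rsubmx z).
have sF: lsm F (row_mx x0 x0) := mu_lsm.
pose F' (z: 'rV[K]_(k + k)) := mu (rsubmx z) (lsubmx z).
have sF': lsm F' (row_mx x0 x0).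
 have -> : F' = (fun z => F (row_mx (rsubmx z) (lsubmx z))).
 by fext z;rewrite /F row_mxKl row_mxKr.
 apply: lsm_comp;last by rewrite row_mxKl row_mxKr.
 by apply: lsm_row;apply: lsm_linear;exact: linearP.
pose Mv w x := 'D_w (fun y => mu x y) x0.
pose Nv w x := 'D_w (fun y => mu y x) x0.
have FE x: (fun y => F (row_mx x y)) = mu x by fext y;rewrite /F row_mxKl row_mxKr.
have FE' x: (fun y => F' (row_mx x y)) = mu^~ x by fext y;rewrite /F' row_mxKl row_mxKr.
have sM w: lsm (Mv w) x0.
 by apply: lsm_ext (lsm_D2 w sF)=> x;rewrite FE.
have sN w: lsm (Nv w) x0.
 by apply: lsm_ext (lsm_D2 w sF')=> x;rewrite FE'.
have step: \forall x \near x0, Mv v x = \sum_l admap (param e x) v 0 l *: Nv (dlt l) x.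
 have cp:= row_mx_contl x0.
 have h1: \forall x' \near x0, lsm F' (row_mx x' x0) := cp _ (lsm_near sF').
 apply: filterS h1=> x sx.
 have sNx: lsm (mu^~ x) x0 by rewrite -FE';exact: lsm_part2.
 via ('D_v (fun y => mu (adf (param e x) y) x) x0).
 apply: derv_eq;apply: filterS (near_adf (param e x))=> y E.
 by rewrite /mu E /gconj -!gmulA gmulV gmul1'.
 rewrite (@chain_rule _ _ _ _ (adf (param e x)) (mu^~ x)) ?adf0 //;try by apply: lsd;rewrite ?adf0 //;exact: adf_lsm.
 by rewrite -/(admap _ _) deriveE ?diff_rV_sum //;exact: lsd.
rewrite /lie_bracket -/e -/x0 -/(Mv v) -/(Mv u) (derv_eq _ step) derive_comb //.
rewrite big_split /= pe0 admap1.
have Nx0 w: Nv w x0 = w.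
 rewrite /Nv;have h: \forall y \near x0, mu y x0 = y by apply: filterS mu1=> y [].
 rewrite (derv_eq _ h);exact: derive_id.
have -> : \sum_l 'D_u (fun x => admap (param e x) v) x0 0 l *: Nv (dlt l) x0 = 'D_u (fun x => admap (param e x) v) x0.
 by rewrite [RHS]row_sum_delta;sumext l;rewrite Nx0.
have MN a b: 'D_a (Mv b) x0 = 'D_b (Nv a) x0.
 have h1: \forall x \near x0, Mv b x = 'D_(row_mx 0 b) F (row_mx x x0).
 have cp:= row_mx_contl x0.
 have h1: \forall x' \near x0, lsm F (row_mx x' x0) := cp _ (lsm_near sF).
 by apply: filterS h1=> x sx;rewrite -derive_part2 ?FE //;exact: lsd.
 have h2: \forall x \near x0, Nv a x = 'D_(row_mx a 0) F (row_mx x0 x).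
 have cp:= row_mx_contr x0.
 have h2: \forall x' \near x0, lsm F (row_mx x0 x') := cp _ (lsm_near sF).
 apply: filterS h2=> x sx;rewrite -derive_part1;last exact: lsd.
 suff -> : (fun x' => F (row_mx x' x)) = mu^~ x by [].
 by fext y;rewrite /F row_mxKl row_mxKr.
 rewrite (derv_eq _ h1) (derv_eq _ h2).
 rewrite (@derive_part1 _ _ _ _ ('D_(row_mx 0 b) F));last by apply: lsd;exact: lsm_D.
 rewrite (@derive_part2 _ _ _ _ ('D_(row_mx a 0) F));last by apply: lsd;exact: lsm_D.
 exact: lsm_schwarz.
rewrite (MN v u).
have -> : 'D_u (Nv v) x0 = \sum_l v 0 l *: 'D_u (Nv (dlt l)) x0.
 rewrite -(MN v u) deriveE ?diff_rV_sum;try by apply: lsd;exact: sM.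
 by sumext l;rewrite -MN.
by rewrite addrK.
Qed.

Lemma derive_translate (W: nmod K) (F H: K -> W) t: (forall h, F (h + t) = H h) ->
 derivable H 0 1 -> derivable F t 1 /\ 'D_1 F t = 'D_1 H 0.
move=> FH;rewrite /derivable /derive.
have -> : (fun h: K => h^-1 *: ((F \o shift t) (h *: (1: K)) - F t)) =
 (fun h: K => h^-1 *: ((H \o shift 0) (h *: (1: K)) - H 0)).
 by fext h;rewrite /= /shift /= FH addr0 -[X in F X]add0r FH.
by [].
Qed.

Lemma one_param0 (gam: K -> G) w: one_param gam w -> gam 0 = gone G.
move=> [_ h _];have := h 0 0;rewrite addr0=> E.
have := congr1 (gmul (ginv (gam 0))) E;rewrite gmulV gmulVK. by move=> <-.
Qed.

(** [one_param] provides a derivative at 0 only; the homomorphism property carries it to every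
    time. *)
Lemma one_param_rep r (tau: G -> 'M[K]_r) gam w t: smooth_rep tau -> one_param gam w ->
 derivable (fun s => tau (gam s)) t 1 /\
 'D_1 (fun s => tau (gam s)) t = tau (gam t) *m dtau tau w.
move=> Ht op;have g0:= one_param0 op;have [cg gD dg] := op;have [tM [t1 ts]] := Ht.
have d0: dfb (fun s => coord e (gam s)) 0 by apply/dfdP;case: dg.
have n0: \forall s \near (0: K), tau (gam s) = tau (param e (coord e (gam s))).
 have: nbhs (gam 0) (dom e) by rewrite g0;apply: onbhs;split=> //;have [] := oke.
 move=> nd;have h: \forall s \near (0: K), dom e (gam s) := cg 0 _ nd.
 by apply: filterS h=> s ds;rewrite coordK.
have df: dfb (fun y => tau (param e y)) (coord e (gam 0)).
 by rewrite g0;apply: lsd;exact: rep_lsm0.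
have dc:= dfb_comp d0 df.
have D0: dfb (fun s => tau (gam s)) 0.
 by apply: (near_dfb _ dc);apply: filterS n0=> s ->.
have E0: 'D_1 (fun s => tau (gam s)) 0 = dtau tau w.
 rewrite (derv_eq _ n0) (@derive_comp _ _ _ _ (fun s => coord e (gam s)) (fun y => tau (param e y))) //.
 rewrite g0 in df *.
 rewrite /dtau deriveE // diff_rV_sum //;sumext i;rewrite (dfb_ij 0 i d0).2.
 by have [_ ->] := dg.
pose H s := tau (gam t) *m tau (gam s).
have dH: derivable H 0 1.
 apply: dfd.
 pose L: {linear 'M[K]_r -> 'M[K]_r} := mulmx (tau (gam t)).
 have dL y: dfb L y by apply: (@lsd _ _ _ L);apply: lsm_linear;exact: linearP.
 exact: (@dfb_comp _ _ _ _ (fun s => tau (gam s)) L).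
have FH s: tau (gam (s + t)) = H s by rewrite addrC gD tM.
have [h1 h2] := @derive_translate _ (fun s: K => tau (gam s)) H t FH dH.
by split;[exact: h1|rewrite h2 /H derive_mulmxl // E0].
Qed.

Lemma one_param_comm r (tau: G -> 'M[K]_r) gam w t: smooth_rep tau -> one_param gam w ->
 tau (gam t) *m dtau tau w = dtau tau w *m tau (gam t).
move=> Ht op;have g0:= one_param0 op;have [cg gD dg] := op;have [tM [t1 ts]] := Ht.
have [d0 E0] := one_param_rep 0 Ht op;rewrite g0 t1 mul1mx in E0.
have df: dfb (fun s => tau (gam s)) (0: K) by apply/dfdP.
rewrite -E0 -(derive_mulmxl _ _ df) -(derive_mulmxr _ _ df).
suff -> : (fun y => tau (gam t) *m tau (gam y)) = (fun y => tau (gam y) *m tau (gam t)) by [].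
by fext s;rewrite -!tM -!gD addrC.
Qed.
End LieDeriv.

(** * The complex exponential and first-order linear equations *)

Section Lines.
Context {R: realType}.
Notation C := (cnum R).

Lemma line_Re (V: nmod C) (F: V -> C) p u (t0: R): dfb F (t0%:C *: u + p) ->
 is_derive t0 (1:R) (fun t: R => cRe (F (t%:C *: u + p)))
 (cRe ('D_u F (t0%:C *: u + p))).
move=> dF;apply: (@line_derive R C (@real_complex R) (@cRe R))=> //.
- exact: normCR.
- exact: leCR.
- by move=> e /Cpos[d d0 ->];exists d.
- exact: Re_real.
- exact: Re_norm.
Qed.

Lemma line_Im (V: nmod C) (F: V -> C) p u (t0: R): dfb F (t0%:C *: u + p) ->
 is_derive t0 (1:R) (fun t: R => cIm (F (t%:C *: u + p)))
 (cIm ('D_u F (t0%:C *: u + p))).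
move=> dF;have [dG DG] := @derive_Zl C V (- 'i) F _ u dF.
have h:= @line_Re V (fun z => - 'i * F z) p u t0 dG.
have -> : (fun t: R => cIm (F (t%:C *: u + p))) =
 (fun t: R => cRe (- 'i * F (t%:C *: u + p))).
 by fext t;exact: Im_Re.
by rewrite Im_Re -DG.
Qed.

Lemma cexp0: cexp (0: C) = 1.
by rewrite /cexp /= expR0 cos0 sin0 mul1r. Qed.
Lemma Re_cexp (z: C): cRe (cexp z) = expR (cRe z) * cos (cIm z).
by rewrite /cexp cReM /=;ring. Qed.
Lemma Im_cexp (z: C): cIm (cexp z) = expR (cRe z) * sin (cIm z).
by rewrite /cexp cImM /=;ring. Qed.

Lemma cexpD (z w: C): cexp (z + w) = cexp z * cexp w.
apply: cpx_eq.
 by rewrite [LHS]Re_cexp [RHS]cReM !Re_cexp !Im_cexp !raddfD /= expRD cosD;ring.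
by rewrite [LHS]Im_cexp [RHS]cImM !Re_cexp !Im_cexp !raddfD /= expRD sinD;ring.
Qed.

Lemma cexp_neq0 (z: C): cexp z != 0.
apply/eqP=> h;have := cexpD z (- z);rewrite subrr h mul0r cexp0.
by move/eqP;rewrite oner_eq0.
Qed.

(** With z = t mu, [Z1] and [Z2] are the real and imaginary parts of cexp(- s z) y(s t) as functions
    of a real s; their derivatives vanish, and s = 0, 1 are compared. *)
Lemma ode (mu: C) (y: C -> C): (forall t, derivable y t 1 /\ 'D_1 y t = mu * y t) ->
 forall t, y t = cexp (t * mu) * y 0.
move=> H t.
have dy z: dfb y z by apply/dfdP;exact: (H z).1.
pose z: C := t * mu;pose a := cRe z;pose b := cIm z.
pose Y1 (s: R) := cRe (y (s%:C *: t + 0)).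
pose Y2 (s: R) := cIm (y (s%:C *: t + 0)).
have D s: 'D_t y (s%:C *: t + 0) = z * y (s%:C *: t + 0).
 by rewrite (derive_K1 _ (dy _)) (H _).2 mulrA.
have d1 (s: R): is_derive s (1:R) Y1 (a * Y1 s - b * Y2 s).
 by have := @line_Re _ y 0 t s (dy _);rewrite D cReM.
have d2 (s: R): is_derive s (1:R) Y2 (a * Y2 s + b * Y1 s).
 by have := @line_Im _ y 0 t s (dy _);rewrite D cImM.
have dl (c s: R): is_derive s (1:R) (fun s => c * s) c.
 by have := @is_deriveZ R R R id c s 1 1 (is_derive_id s 1);rewrite [c *: 1]mulr1.
have de (s: R): is_derive s (1:R) (fun s => expR (- a * s)) (- a * expR (- a * s)).
 by have h:= dl (- a) s;apply: is_derive_eq;rewrite [LHS]mulrC.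
have dc (s: R): is_derive s (1:R) (fun s => cos (b * s)) (- b * sin (b * s)).
 by have h:= dl b s;apply: is_derive_eq;rewrite [LHS]mulrC mulrN mulNr.
have ds (s: R): is_derive s (1:R) (fun s => sin (b * s)) (b * cos (b * s)).
 by have h:= dl b s;apply: is_derive_eq;rewrite [LHS]mulrC.
pose Z1 (s: R) := expR (- a * s) * (cos (b * s) * Y1 s + sin (b * s) * Y2 s).
pose Z2 (s: R) := expR (- a * s) * (cos (b * s) * Y2 s - sin (b * s) * Y1 s).
have z1: Z1 1 = Z1 0.
 apply: is_derive_0_is_cst=> s.
 have h1:= de s;have h2:= dc s;have h3:= ds s;have h4:= d1 s;have h5:= d2 s.
 by apply: is_derive_eq;rewrite /GRing.scale /=;ring.
have z2: Z2 1 = Z2 0.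
 apply: is_derive_0_is_cst=> s.
 have h1:= de s;have h2:= dc s;have h3:= ds s;have h4:= d1 s;have h5:= d2 s.
 by apply: is_derive_eq;rewrite /GRing.scale /=;ring.
have y00: y (0%:C *: t + 0) = y 0 by rewrite scale0r addr0.
have y11: y (1%:C *: t + 0) = y t by rewrite scale1r addr0.
rewrite /Z1 /Z2 /Y1 /Y2 y00 y11 !mulr0 !mulr1 expR0 cos0 sin0 !mul0r !mul1r addr0 subr0 in z1 z2.
have ea: expR a * expR (- a) = 1 by rewrite -expRD subrr expR0.
have cs: cos b ^+ 2 + sin b ^+ 2 = 1 := cos2Dsin2 b.
apply: cpx_eq.
 rewrite [RHS]cReM Re_cexp Im_cexp -/z -/a -/b -z1 -z2.
 via (expR a * expR (- a) * (cos b ^+ 2 + sin b ^+ 2) * cRe (y t));last by ring.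
 by rewrite ea cs !mul1r.
rewrite [RHS]cImM Re_cexp Im_cexp -/z -/a -/b -z1 -z2.
via (expR a * expR (- a) * (cos b ^+ 2 + sin b ^+ 2) * cIm (y t));last by ring.
by rewrite ea cs !mul1r.
Qed.

Lemma Re_norm_continuous: continuous (fun z: C => cRe `|z| : R).
move=> z U /nbhs_ballP[e /= e0 h];apply/nbhs_ballP;exists (e%:C: C)=> /=;first by rewrite ltcR.
move=> w /= zw;apply: h;rewrite -ball_normE /=.
have -> : Normc.normc z - Normc.normc w = cRe (`|z| - `|w| : C) by [].
rewrite -ltcR;apply: le_lt_trans (Re_norm _) _;apply: le_lt_trans zw.
exact: ler_dist_dist.
Qed.

Lemma norm_cexp (z: C): `|cexp z| = (expR (cRe z))%:C.
have h (b: R): `|(cos b +i* sin b: C)| = 1 by rewrite normc_def /= cos2Dsin2 sqrtr1.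
by rewrite /cexp normrM h mulr1 normCR ger0_norm ?expR_ge0.
Qed.
End Lines.

(** * Triangular and nilpotent matrices *)

Section Trig.
Context {F: numClosedFieldType}.

Lemma trig_exists n (A: 'M[F]_n): exists P T: 'M[F]_n,
 [/\ P \in unitmx, is_trig_mx T & A = invmx P *m T *m P].
case: n A=> [|n] A.
 by exists 1%:M, 1%:M;split;rewrite ?unitmx1 //;first [apply/is_trig_mxP=> -[]|apply/matrixP => -[]].
have [P Pu PA] := @Schur F n.+1 A isT.
exists P, (P *m A *m invmx P);have Pu':= unitarymx_unit Pu;split=> //.
 by move: PA;rewrite /similar_to -conjumx.
by rewrite !mulmxA mulVmx // mul1mx mulmxKV.
Qed.

Lemma trig_eigen n (P T A: 'M[F]_n) i: P \in unitmx -> is_trig_mx T -> A = invmx P *m T *m P ->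
 exists2 u: 'rV[F]_n, u != 0 & u *m A = T i i *: u.
move=> Pu Tt ->.
have: root (char_poly T) (T i i).
 by rewrite char_poly_trig // rootE horner_prod (bigD1 i) //= hornerXsubC subrr mul0r.
rewrite -eigenvalue_root_char=> /eigenvalueP[v vT v0];exists (v *m P).
 by apply: contraNneq v0=> h;rewrite -(mulmxK Pu v) h mul0mx.
by rewrite !mulmxA mulmxK // vT scalemxAl.
Qed.

Lemma trig_mul n (S T: 'M[F]_n): is_trig_mx S -> is_trig_mx T ->
 forall i, (S *m T) i i = S i i * T i i.
move=> /is_trig_mxP hS /is_trig_mxP hT i;rewrite mxE (bigD1 i) //= big1 ?addr0 // => j ji.
have [ij|ij|/val_inj ij] := ltngtP i j;[by rewrite hS ?mul0r|by rewrite hT ?mulr0|].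
by rewrite ij eqxx in ji.
Qed.

Lemma tr_sqr n (P T A: 'M[F]_n): P \in unitmx -> is_trig_mx T -> A = invmx P *m T *m P ->
 \tr (A *m A) = \sum_i T i i ^+ 2.
move=> Pu Tt ->;rewrite -!mulmxA mxtrace_mulC -!mulmxA mulmxV // mulmx1.
by rewrite mulKVmx //;sumext i;rewrite trig_mul.
Qed.

Lemma trig_nil n (T: 'M[F]_n): is_trig_mx T -> (forall i, T i i = 0) ->
 forall u: 'rV[F]_n, u *m T ^+ n = 0.
move=> /is_trig_mxP hT T0 u.
suff H m (w: 'rV[F]_n): (forall i: 'I_n, (n - m <= i)%N -> (w *m T ^+ m) 0 i = 0).
 by rowext i;rewrite H ?mxE // subnn.
elim: m=> [|m IH] i ni;first by move: (ltn_ord i);rewrite ltnNge -[n in (n <= _)%N]subn0 ni.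
rewrite exprSr mulmxA mxE big1 // => j _.
have [ij|ij|/val_inj ij] := ltngtP i j;last by rewrite ij T0 mulr0.
 by rewrite IH ?mul0r //;lia.
by rewrite hT ?mulr0.
Qed.

(** The witness lies one step before the last power of [A] that does not vanish identically. *)
Lemma nil_step n (A: 'M[F]_n) m: A != 0 -> (forall u: 'rV[F]_n, u *m A ^+ m = 0) ->
 exists2 u: 'rV[F]_n, u *m A != 0 & u *m A *m A = 0.
move=> A0;elim: m=> [|m IH] H.
 have e0: A ^+ 0 = 1%:M by [].
 have: A = 0 by apply/row_matrixP=> i;rewrite row0 -[row i A]mulmx1 -e0 H.
 by move/eqP;rewrite (negPf A0).
have [h|/existsNP[u /eqP hu]] := pselect (forall u: 'rV[F]_n, u *m A ^+ m = 0);first exact: IH.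
have eS q: A ^+ q.+1 = A ^+ q *m A by exact: exprSr.
have hS: u *m A ^+ m *m A = 0 by rewrite -mulmxA -eS H.
case: m IH H hu hS=> [|m] IH H hu hS.
 have E (w: 'rV[F]_n): w *m A = 0 by have := H w;rewrite eS mul1mx.
 have: A = 0 by apply/row_matrixP=> i;rewrite row0 rowE E.
 by move/eqP;rewrite (negPf A0).
have E: u *m A ^+ m *m A = u *m A ^+ m.+1 by rewrite -mulmxA -eS.
by exists (u *m A ^+ m);rewrite E.
Qed.
End Trig.

(** * Lie algebras given by adjoint matrices, and their Killing form *)

Section LieAlg.
Context {K: numF} {k: nat} (ad: 'rV[K]_k -> 'M[K]_k).
Definition lbr x y: 'rV[K]_k := y *m (ad x)^T.
(** The third clause is the Jacobi identity. *)
Definition lie_ad: Prop :=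
 [/\ forall a x y, ad (a *: x + y) = a *: ad x + ad y, forall x y, lbr x y = - lbr y x &
 forall x y, ad (lbr x y) = ad x *m ad y - ad y *m ad x].
Hypothesis L: lie_ad.
Let ad_lin: forall a x y, ad (a *: x + y) = a *: ad x + ad y. by case: L. Qed.
Lemma lbrC x y: lbr x y = - lbr y x. by case: L. Qed.
Lemma ad_lbr x y: ad (lbr x y) = ad x *m ad y - ad y *m ad x. by case: L. Qed.

Lemma adD x y: ad (x + y) = ad x + ad y.
by rewrite -[x]scale1r ad_lin !scale1r. Qed.
Lemma ad0: ad 0 = 0.
by have := adD 0 0;rewrite addr0=> /esym/eqP;rewrite -subr_eq0 addrK=> /eqP. Qed.
Lemma adZ a x: ad (a *: x) = a *: ad x.
by rewrite -[a *: x]addr0 ad_lin ad0 addr0. Qed.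
Lemma ad_sum (I: Type) (r: seq I) (P: pred I) (F: I -> 'rV[K]_k) :
 ad (\sum_(i <- r | P i) F i) = \sum_(i <- r | P i) ad (F i).
exact: (big_morph ad adD ad0). Qed.
Lemma lbr_linl x a y z: lbr (a *: y + z) x = a *: lbr y x + lbr z x.
by rewrite /lbr ad_lin linearD linearZ mulmxDr scalemxAr. Qed.
Lemma jacobi x y z: lbr x (lbr y z) = lbr (lbr x y) z + lbr y (lbr x z).
have E (X Y: 'M[K]_k): (X - Y)^T = X^T - Y^T by exact: linearB.
by rewrite /lbr ad_lbr E !trmx_mul mulmxBr !mulmxA subrK.
Qed.

Definition kil x y: K := \tr (ad x *m ad y).

Lemma kilC x y: kil x y = kil y x.
exact: mxtrace_mulC. Qed.
Lemma kil_linr x a y z: kil x (a *: y + z) = a * kil x y + kil x z.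
by rewrite /kil ad_lin mulmxDr mxtraceD -scalemxAr mxtraceZ. Qed.
Lemma kil_linl x a y z: kil (a *: y + z) x = a * kil y x + kil z x.
by rewrite !(kilC _ x) kil_linr. Qed.
Lemma kil_sumr x (I: Type) (r: seq I) (P: pred I) (F: I -> 'rV[K]_k) :
 kil x (\sum_(i <- r | P i) F i) = \sum_(i <- r | P i) kil x (F i).
by rewrite /kil ad_sum mulmx_sumr raddf_sum. Qed.
Lemma kilZr x a y: kil x (a *: y) = a * kil x y.
by rewrite /kil adZ -scalemxAr mxtraceZ. Qed.
Lemma kil_comb x a y z: kil (x + a *: y) z = kil x z + a * kil y z.
by rewrite addrC kil_linl addrC. Qed.
Lemma kilDD x y: kil (x + y) (x + y) = kil x x + 2 * kil x y + kil y y.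
have E z: kil (x + y) z = kil x z + kil y z by rewrite -[y in LHS]scale1r kil_comb mul1r.
by rewrite E !(kilC _ (x + y)) !E (kilC y x);ring.
Qed.

Lemma kil_inv x y z: kil (lbr x y) z = kil x (lbr y z).
rewrite /kil !ad_lbr mulmxBl mulmxBr !raddfB /= -!mulmxA;congr (_ - _).
by rewrite mxtrace_mulC -!mulmxA.
Qed.
End LieAlg.

Section LieGroupAd.
Context {K: numF}.
Hypothesis HS: forall (V: nmod K) (U: set V) (F: V -> K) x u v,
 open U -> U x -> smn 1 U F -> 'D_u ('D_v F) x = 'D_v ('D_u F) x.
Context {k: nat} (G: lie_group K k).

Definition adm (x: 'rV[K]_k): 'M[K]_k := dtau (@Adm K k G) x.

Lemma lbE x y: lie_bracket G x y = lbr adm x y.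
exact: (dAdm HS). Qed.

Lemma adm_lie: lie_ad adm.
have H:= Adm_rep G;split=> [a x y|x y|x y];first exact: dtau_lin H _ _ _.
 by rewrite -!lbE /lie_bracket opprB.
by rewrite -lbE;exact: (dtau_bracket HS H).
Qed.

Lemma kil_Ad g x y: kil adm (@admap K k G g x) (admap g y) = kil adm x y.
have H:= Adm_rep G;rewrite /kil /adm -!(rep_conj _ _ H) -!mulmxA mxtrace_mulC -!mulmxA.
have h: Adm (ginv g) *m Adm g = 1%:M :> 'M[K]_k by rewrite -H.1 gmulV H.2.1.
set X := dtau _ x;set Y := dtau _ y;clearbody X Y.
by rewrite h mulmx1 (mulmxA _ _ Y) h mul1mx.
Qed.

Lemma derive_rowrep r (tau: G -> 'M[K]_r) gam w t (x: 'rV[K]_r) j: smooth_rep tau -> one_param gam w ->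
 derivable (fun t => (x *m tau (gam t)) 0 j: K) t 1 /\
 'D_1 (fun t => (x *m tau (gam t)) 0 j: K) t = (x *m dtau tau w *m tau (gam t)) 0 j.
move=> H op;have [d1 d2] := one_param_rep t H op.
have df: dfb (fun s => tau (gam s)) t by apply/dfdP.
have dx: dfb (fun s => x *m tau (gam s)) t.
 apply: differentiable_mx=> i l.
 have -> : (fun y => (x *m tau (gam y)) i l: K) = \sum_m (fun y => x i m * tau (gam y) m l).
 by fext s;rewrite mxE fct_sumE.
 apply: differentiable_sum=> m.
 by apply: differentiableM;[exact: differentiable_cst|exact: (dfb_ij m l df).1].
split;first by apply: dfd;exact: (dfb_ij 0 j dx).1.
by rewrite (dfb_ij 0 j dx).2 derive_mulmxl // d2 (one_param_comm _ H op) mulmxA.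
Qed.

Lemma derive_colrep r (tau: G -> 'M[K]_r) gam w t (x: 'cV[K]_r) j: smooth_rep tau -> one_param gam w ->
 derivable (fun t => (tau (gam t) *m x) j 0: K) t 1 /\
 'D_1 (fun t => (tau (gam t) *m x) j 0: K) t = (tau (gam t) *m dtau tau w *m x) j 0.
move=> H op;have [d1 d2] := one_param_rep t H op.
have df: dfb (fun s => tau (gam s)) t by apply/dfdP.
have dx: dfb (fun s => tau (gam s) *m x) t.
 apply: differentiable_mx=> i l.
 have -> : (fun y => (tau (gam y) *m x) i l: K) = \sum_m (fun y => tau (gam y) i m * x m l).
 by fext s;rewrite mxE fct_sumE.
 apply: differentiable_sum=> m.
 by apply: differentiableM;[exact: (dfb_ij i m df).1|exact: differentiable_cst].
split;first by apply: dfd;exact: (dfb_ij j 0 dx).1.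
by rewrite (dfb_ij j 0 dx).2 derive_mulmxr // d2.
Qed.
End LieGroupAd.

(** * Definiteness of the Killing form on the compact real form *)

Section Killing.
Context {R: realType}.
Notation C := (cnum R).
Context {k: nat} (GC: lie_group C k).
Notation Ad := (@Adm C k GC).
Notation ad := (@adm C k GC).

Lemma ode_row r (tau: GC -> 'M[C]_r) gam w (x: 'rV[C]_r) mu t: smooth_rep tau -> one_param gam w ->
 x *m dtau tau w = mu *: x -> x *m tau (gam t) = cexp (t * mu) *: x.
move=> H op xE;rowext j;rewrite [RHS]mxE.
have Hy t': derivable (fun t => (x *m tau (gam t)) 0 j: C) t' 1 /\
 'D_1 (fun t => (x *m tau (gam t)) 0 j: C) t' = mu * (x *m tau (gam t')) 0 j.
 have [d1 d2] := derive_rowrep t' x j H op;split;first exact: d1.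
 by rewrite d2 xE -scalemxAl mxE.
by rewrite (ode Hy) (one_param0 op) H.2.1 mulmx1.
Qed.

Lemma ode_col r (tau: GC -> 'M[C]_r) gam w (x: 'cV[C]_r) mu t: smooth_rep tau -> one_param gam w ->
 dtau tau w *m x = mu *: x -> tau (gam t) *m x = cexp (t * mu) *: x.
move=> H op xE;apply/colP=> j;rewrite [RHS]mxE.
have Hy t': derivable (fun t => (tau (gam t) *m x) j 0: C) t' 1 /\
 'D_1 (fun t => (tau (gam t) *m x) j 0: C) t' = mu * (tau (gam t') *m x) j 0.
 have [d1 d2] := derive_colrep t' x j H op;split;first exact: d1.
 by rewrite d2 -mulmxA xE -scalemxAr mxE.
by rewrite (ode Hy) (one_param0 op) H.2.1 mul1mx.
Qed.

Lemma Ad_rep: smooth_rep Ad. exact: (Adm_rep GC). Qed.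

Lemma rep_continuous r (tau: GC -> 'M[C]_r) i j: smooth_rep tau -> continuous (fun g => tau g i j: C).
move=> Ht p U nU;have [c ac dp] := atlas_cover p;have okc:= atlas_ok ac.
have s:= Ht.2.2 _ _ _ (gsm_param ac (img_coord dp)).
have cs: {for coord c p, continuous (fun y => tau (param c y) i j: C)}.
 by apply: differentiable_continuous;exact: (dfb_ij i j (lsd s)).1.
have n1: nbhs (coord c p) [set y | U (tau (param c y) i j)].
 by apply: cs;rewrite coordK.
by apply: filterS (near_coord okc dp n1)=> q [dq];rewrite /= coordK.
Qed.

Lemma rep_compact_bound r (tau: GC -> 'M[C]_r) i j (S: set GC): smooth_rep tau -> compact S ->
 exists b: R, forall g, S g -> `|tau g i j| <= b%:C.
move=> Ht cS;have [->|/set0P S0] := eqVneq S set0;first by exists 0.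
have [|c _ h] := @compact_EVT_max _ R (fun g => cRe `|tau g i j|) S S0 cS.
 apply: continuous_subspaceT=> g;apply: continuous_comp (@Re_norm_continuous R _).
 exact: rep_continuous.
exists (cRe `|tau c i j|) => g Sg.
have -> : `|tau g i j| = (cRe `|tau g i j|)%:C by [].
by rewrite lecR;apply: h;rewrite inE.
Qed.

Context {G: lie_group R k} (B: 'M[C]_k) (Gu: set GC).
Context (ssG: semisimple G)
 (cG: complexification G GC B)
 (cu: compact_real_form B Gu).

Definition iotaC (u: 'rV[R]_k): 'rV[C]_k := map_mx (fun t => t%:C) u *m B.

Lemma iotaCD u w: iotaC (u + w) = iotaC u + iotaC w.
by rewrite /iotaC -mulmxDl;congr (_ *m _);rowext i;rewrite !mxE rmorphD. Qed.
Lemma iotaCZ a u: iotaC (a *: u) = a%:C *: iotaC u.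
by rewrite /iotaC scalemxAl;congr (_ *m _);rowext i;rewrite !mxE rmorphM. Qed.

Lemma iotaC_inj u: iotaC u = 0 -> u = 0.
have [Bu _] := cG;move=> h;have: map_mx (fun t => t%:C) u = 0 :> 'rV[C]_k.
 by rewrite -(mulmxK Bu (map_mx _ _)) -/(iotaC u) h mul0mx.
by move=> /rowP E;rowext i;have := E i;rewrite !mxE=> -[].
Qed.

Definition cre (x: 'rV[C]_k): 'rV[R]_k := map_mx (@cRe R) (x *m invmx B).
Definition cim (x: 'rV[C]_k): 'rV[R]_k := map_mx (@cIm R) (x *m invmx B).

Lemma decu x: x = iotaC (cre x) + 'i *: iotaC (cim x).
have [Bu _] := cG;rewrite -[LHS](mulmxKV Bu) /iotaC scalemxAl -mulmxDl;congr (_ *m _).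
by rowext i;rewrite !mxE -complexE.
Qed.
Lemma u_gam u: exists2 gam: C -> GC, one_param gam (iotaC u) & forall t: R, Gu (gam t%:C).
by have [_ [_ _ _ h]] := cu;apply/h;exists u. Qed.

Lemma gam_bound (u: 'rV[R]_k) (x: 'rV[C]_k) j gam: (forall t: R, Gu (gam t%:C)) ->
 exists b: R, forall t: R, `|(x *m Ad (gam t%:C)) 0 j| <= b%:C.
move=> hg;have /all_sig[b hb] i: {b: R | forall g, Gu g -> `|Ad g i j| <= b%:C}.
 by apply: cid;apply: rep_compact_bound Ad_rep cu.1.
exists (\sum_i cRe `|x 0 i| * b i) => t;rewrite mxE.
apply: le_trans (ler_norm_sum _ _ _) _;rewrite rmorph_sum /=;apply: ler_sum=> i _.
by rewrite normrM rmorphM /=;apply: ler_wpM2l=> //;exact: hb.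
Qed.

(** On an eigenvector Ad(gam t) is multiplication by exp(t mu). The real times stay in the compact
    group, where Ad is bounded, so exp(t Re mu) is bounded for t of both signs. *)
Lemma eigen_im u mu (x: 'rV[C]_k): x != 0 -> x *m ad (iotaC u) = mu *: x -> cRe mu = 0.
have [gam op hg] := u_gam u;move=> x0 xE.
have [j xj]: exists j, x 0 j != 0.
 exact/rV0Pn.
have [b hb] := gam_bound u x j hg.
have E t: (x *m Ad (gam t)) 0 j = cexp (t * mu) * x 0 j.
 by rewrite (ode_row _ Ad_rep op xE) mxE.
pose c := cRe `|x 0 j|;have cE: `|x 0 j| = c%:C by [].
have c0: 0 < c by rewrite -ltcR -cE normr_gt0.
apply/eqP;apply: contraT=> m0.
(* At this time the exponential is expR(b / c), at least 1 + b / c, while the bound allows only b /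
   c. *)
pose a := cRe mu;have := hb (a^-1 * (b / c)).
rewrite E normrM norm_cexp cE -rmorphM lecR Re_real -/a.
rewrite mulrAC mulVf // mul1r=> h.
have := expR_ge1Dx (b / c);rewrite -(ler_pM2r c0) mulrDl divfK ?gt_eqF // mul1r=> h'.
by have := le_trans h' h;rewrite gerDr leNgt c0.
Qed.

(** Otherwise [nil_step] gives x whose second image under ad vanishes but not the first, and x
    Ad(gam t) grows linearly in t, against compactness. *)
Lemma iotaC_nilp u m: (forall x: 'rV[C]_k, x *m ad (iotaC u) ^+ m = 0) -> ad (iotaC u) = 0.
move=> H;apply/eqP;apply: contraT=> A0.
have [x x1 x2] := nil_step (F := R[i]) A0 H.
have [gam op hg] := u_gam u.
have [j xj]: exists j, (x *m ad (iotaC u)) 0 j != 0.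
 exact/rV0Pn.
set c := (x *m ad (iotaC u)) 0 j in xj.
have [b hb] := gam_bound u x j hg.
have cst t: x *m ad (iotaC u) *m Ad (gam t) = x *m ad (iotaC u).
 have h0: x *m ad (iotaC u) *m dtau Ad (iotaC u) = 0 *: (x *m ad (iotaC u)) by rewrite scale0r -x2.
 by rewrite (ode_row t Ad_rep op h0) mulr0 cexp0 scale1r.
pose y (t: C) := (x *m Ad (gam t)) 0 j - t * c.
have Hy t: derivable y t 1 /\ 'D_1 y t = 0 * y t.
 have [d1 d2] := derive_rowrep t x j Ad_rep op.
 have i1: is_derive t (1: C) (fun t => (x *m Ad (gam t)) 0 j: C) c.
 by apply: DeriveDef=> //;rewrite d2 cst.
 have i2: is_derive t (1: C) (fun t: C => t * c) c.
 have d0: dfb (fun t: C => t) t by case: (is_diff_id t).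
 have [e1 e2] := @derive_Zl C C c (fun t => t) t 1 d0.
 have -> : (fun t: C => t * c) = (fun t => c * t) by fext s;rewrite mulrC.
 apply: DeriveDef;first exact: dfd.
 by rewrite e2 derive_id mulr1.
 by have [? ->] := is_deriveB i1 i2;rewrite subrr mul0r.
have E t: (x *m Ad (gam t)) 0 j = t * c + x 0 j.
 have y0: y 0 = x 0 j by rewrite /y mul0r subr0 (one_param0 op) Ad_rep.2.1 mulmx1.
 have c1: cexp (t * 0) = 1 :> C by rewrite mulr0 cexp0.
 have yt: y t = x 0 j by rewrite (ode Hy t) c1 y0 mul1r.
 by rewrite -yt addrC subrK.
pose d := cRe `|c|;have dE: `|c| = d%:C by [].
have d0: 0 < d by rewrite -ltcR -dE normr_gt0.
pose e := cRe `|x 0 j|;have eE: `|x 0 j| = e%:C by [].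
have := hb (d^-1 * (b + e + 1));rewrite E=> h.
have := le_trans (ler_normB _ _) (lerD h (lexx `|x 0 j|));rewrite addrK normrM normCR dE eE -rmorphM -rmorphD lecR.
have b0: 0 <= b by have := le_trans (normr_ge0 _) (hb 0);rewrite -[0]/(0%:C) lecR.
have e0: 0 <= e by have := normr_ge0 (x 0 j);rewrite eE -[0]/(0%:C) lecR.
rewrite ger0_norm;last by rewrite mulr_ge0 ?invr_ge0 ?ltW //;lra.
by rewrite mulrAC mulVf ?gt_eqF // mul1r;lra.
Qed.

(** The eigenvalues of ad are purely imaginary, so the trace of its square is minus a sum of
    squares. If that vanishes, ad is nilpotent, hence 0, and [u] spans an abelian ideal, which
    semisimplicity excludes. *)
Lemma kil_neg u: exists r: R, kil ad (iotaC u) (iotaC u) = (- r)%:C /\ (0 <= r) /\ (r = 0 -> u = 0).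
have [P [T [Pu Tt AE]]] := trig_exists (F := R[i]) (ad (iotaC u)).
have Ti i: exists s: R, T i i = 'i * s%:C.
 have [x x0 xE] := trig_eigen i Pu Tt AE;exists (cIm (T i i)).
 have := eigen_im x0 xE;rewrite {2}[T i i]complexE=> ->.
 by rewrite add0r.
have /all_sig[s sE]: forall i, {s: R | T i i = 'i * s%:C} by move=> i;exact: cid.
exists (\sum_i s i ^+ 2);split;last split.
- rewrite /kil (tr_sqr Pu Tt AE) rmorphN rmorph_sum /= -sumrN;sumext i.
 by rewrite sE exprMn sqrCi mulN1r rmorphXn.
- by apply: sumr_ge0=> i _;exact: sqr_ge0.
move/eqP;rewrite psumr_eq0;last by move=> i _;exact: sqr_ge0.
move/allP=> h;have T0 i: T i i = 0.
 have := h i (mem_index_enum _);rewrite sqrf_eq0=> /eqP s0.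
 by rewrite sE s0 mulr0.
have a0: ad (iotaC u) = 0.
 apply: (@iotaC_nilp _ k)=> x.
 have AE' m: ad (iotaC u) ^+ m = invmx P *m T ^+ m *m P.
 elim: m=> [|m IH];first by rewrite mulmx1 mulVmx.
 by rewrite !exprSr IH {1}AE -!mulmxE !mulmxA mulmxK.
 by rewrite AE' mulmxA mulmxA (trig_nil Tt T0) mul0mx.
have hlb u' w': iotaC (lie_bracket G u' w') = lie_bracket GC (iotaC u') (iotaC w') := cG.2 u' w'.
have cen w c: lie_bracket G w (c *: u) = 0.
 apply: iotaC_inj;rewrite hlb (lbE (@schwarzC R)) iotaCZ (lbrC (adm_lie (@schwarzC R) GC)) /lbr.
 by rewrite (adZ (adm_lie (@schwarzC R) GC)) a0 scaler0 trmx0 mulmx0 oppr0.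
have E: <[u]>%VS = 0%VS.
 apply: ssG.
 by move=> w y /vlineP[c ->];rewrite cen mem0v.
 by move=> w y _ /vlineP[c ->];exact: cen.
by apply/eqP;rewrite -memv0 -E memv_line.
Qed.

(** Polarization of the real values on the diagonal. *)
Lemma kil_real u w: exists r: R, kil ad (iotaC u) (iotaC w) = r%:C.
have L:= adm_lie (@schwarzC R) GC.
have [r1 [E1 _]] := kil_neg u;have [r2 [E2 _]] := kil_neg w;have [r3 [E3 _]] := kil_neg (u + w).
exists (2^-1 * (- r3 + r1 + r2)).
have E: 2 * kil ad (iotaC u) (iotaC w) = (- r3 + r1 + r2)%:C.
 have := E3;rewrite iotaCD (kilDD L) E1 E2=> E.
 rewrite [in RHS]rmorphD [in RHS]rmorphD /= -E !rmorphN /=;ring.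
rewrite rmorphM /= -E mulrA.
by rewrite fmorphV rmorph_nat mulVf ?mul1r // pnatr_eq0.
Qed.

Lemma reim0 (a b: R): a%:C + 'i * b%:C = 0 :> C -> a = 0 /\ b = 0.
have -> : a%:C + 'i * b%:C = a +i* b :> C by rewrite [RHS]complexE.
by case.
Qed.

(** Write x = u + i w with u, w in the real form. Pairing with u and with w isolates kil(u, u) as a
    real part and kil(w, w) as an imaginary part. *)
Lemma kil_nondeg x: (forall y, kil ad x y = 0) -> x = 0.
have L:= adm_lie (@schwarzC R) GC.
move=> H;rewrite [x]decu in H *.
set u := cre x in H *;set w := cim x in H *.
have [r1 [E1 [_ h1]]] := kil_neg u;have [r2 [E2 [_ h2]]] := kil_neg w;have [r E] := kil_real w u.
have a1:= H (iotaC u);have a2:= H (iotaC w).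
rewrite (kil_comb L) E E1 in a1;rewrite (kil_comb L) E2 kilC E in a2.
have u0: u = 0.
 by apply: h1;have [/eqP + _] := reim0 a1;rewrite oppr_eq0=> /eqP.
have w0: w = 0.
 by apply: h2;have [_ /eqP] := reim0 a2;rewrite oppr_eq0=> /eqP.
have i0: iotaC 0 = 0 by rewrite -[0](scale0r (0: 'rV[R]_k)) iotaCZ scale0r.
by rewrite u0 w0 i0 scaler0 addr0.
Qed.
End Killing.

(** * Highest weights of sl2-triples *)

Section Sl2.
Context {K: numF} {N: nat} (X Y H: 'M[K]_N) (s: K).
Context (XY: X *m Y - Y *m X = H)
 (HY: H *m Y - Y *m H = - s *: Y)
 (s0: s != 0).
Variables (u: 'cV[K]_N) (mu: K).
Context (u0: u != 0)
 (Xu: X *m u = 0)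
 (Hu: H *m u = mu *: u).
Let U n := iter n (mulmx Y) u.
Let HU n: H *m U n = (mu - n%:R * s) *: U n.
elim: n=> [|n IH];first by rewrite mul0r subr0.
have E: H *m Y = Y *m H - s *: Y by rewrite -[H *m Y](subrK (Y *m H)) HY scaleNr addrC.
rewrite /U iterS -/(U n) mulmxA E mulmxBl -mulmxA IH -scalemxAr -scalemxAl -scalerBl.
by congr (_ *: _);rewrite -[n.+1]addn1 natrD;ring.
Qed.
Let XU n: X *m U n.+1 = (n.+1%:R * (mu - n%:R * s / 2)) *: U n.
have E: X *m Y = Y *m X + H by rewrite -XY addrC subrK.
elim: n=> [|n IH].
 rewrite /U iterS /= mulmxA E mulmxDl -mulmxA Xu mulmx0 add0r Hu;congr (_ *: _).
 by rewrite !mul0r subr0 mul1r.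
rewrite /U iterS -/(U n.+1) mulmxA E mulmxDl -mulmxA IH -scalemxAr HU.
have -> : Y *m U n = U n.+1 by [].
rewrite -scalerDl;congr (_ *: _);rewrite -[n.+2]addn1 -[n.+1]addn1 !natrD.
by field.
Qed.

(** The vectors Y^m u have the distinct H-eigenvalues mu - m s, so some of them vanish. At the first
    one, X Y^(m+1) u = (m+1) (mu - m s / 2) Y^m u forces mu = m s / 2. The triple is not normalized:
    [H, Y] = - s Y for any nonzero s. *)
Lemma sl2: exists j: nat, mu = s * j%:R / 2.
have [n n0]: exists n, U n = 0.
 apply: contrapT=> /forallNP h.
 pose rs := [seq mu - n%:R * s | n <- iota 0 N.+1].
 have rt: all (root (char_poly H^T)) rs.
 apply/allP=> _ /mapP[n _ ->];rewrite -eigenvalue_root_char;apply/eigenvalueP.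
 exists (U n)^T;first by rewrite -trmx_mul HU linearZ.
 by apply/eqP=> /(congr1 trmx);rewrite trmxK trmx0;exact: h.
 have ur: uniq rs.
 rewrite map_inj_uniq ?iota_uniq // => m n /eqP.
 rewrite (inj_eq (addrI _)) eqr_opp=> /eqP /(mulIf s0) /eqP;rewrite eqr_nat=> /eqP //.
 have := max_poly_roots (monic_neq0 (char_poly_monic _)) rt ur.
 by rewrite size_char_poly size_map size_iota ltnn.
have [m um un]: exists2 m, U m.+1 = 0 & U m != 0.
 elim: n n0=> [|n IH] n0;first by move: u0;rewrite -[u]/(U 0) n0 eqxx.
 by have [/IH|?] := eqVneq (U n) 0;last exists n.
exists m;have := XU m;rewrite um mulmx0=> /esym/eqP;rewrite scaler_eq0 (negPf un) orbF.
rewrite mulf_eq0 pnatr_eq0 /= subr_eq0=> /eqP ->;rewrite [s * _]mulrC.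
by [].
Qed.
End Sl2.

(** * Root decomposition in a basis of weight vectors *)

Section Roots.
Context {K: numF} {k: nat} (ad: 'rV[K]_k -> 'M[K]_k).
Context (L: lie_ad ad)
 (nd: forall x, (forall y, kil ad x y = 0) -> x = 0).
Notation lb := (lbr ad).
Notation kl := (kil ad).
Variable h: {vspace 'rV[K]_k}.
Context (habel: forall x y, x \in h -> y \in h -> lb x y = 0)
 (hmax: forall x, (forall y, y \in h -> lb x y = 0) -> x \in h).
Notation wt := ('Hom(subvs_of h, K^o)).
Variables (Bm: 'M[K]_k) (a: 'I_k -> wt).
Hypothesis Bu: Bm \in unitmx.
Notation b i := (row i Bm).
Hypothesis ab: forall (t: subvs_of h) i, lb (vsval t) (b i) = (a i t: K) *: b i.
Let kilZl c x y: kl (c *: x) y = c * kl x y.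
by rewrite kilC kilZr // kilC. Qed.

(** Coordinates in the basis of weight vectors. The weight 0 belongs to the list [a] too, on the
    indices whose [b i] lie in h. *)
Definition co (x: 'rV[K]_k) i: K := (x *m invmx Bm) 0 i.

Lemma coE x: x = \sum_i co x i *: b i.
by rewrite -[LHS](mulmxKV Bu) mulmx_sum_row. Qed.
Lemma co_b i j: co (b i) j = (i == j)%:R.
by rewrite /co -row_mul mulmxV // mxE mxE. Qed.
Lemma co_lin c x y i: co (c *: x + y) i = c * co x i + co y i.
by rewrite /co mulmxDl -scalemxAl !mxE. Qed.
Lemma coZ c x i: co (c *: x) i = c * co x i.
by rewrite /co -scalemxAl mxE. Qed.
Lemma co_sum (I: Type) (r: seq I) (P: pred I) (F: I -> 'rV[K]_k) i :
 co (\sum_(j <- r | P j) F j) i = \sum_(j <- r | P j) co (F j) i.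
by rewrite /co mulmx_suml summxE. Qed.

Definition rsp (al: wt) x := forall t: subvs_of h, lb (vsval t) x = (al t: K) *: x.

Lemma rsp_b i: rsp (a i) (b i). by move=> t;exact: ab. Qed.

Lemma lb_co (t: subvs_of h) x i: co (lb (vsval t) x) i = (a i t: K) * co x i.
rewrite [x in LHS]coE {1}/lbr mulmx_suml co_sum (bigD1 i) //= big1=> [|j ji].
 by rewrite addr0 -scalemxAl -/(lbr ad _ _) ab !coZ co_b eqxx mulr1 mulrC.
by rewrite -scalemxAl -/(lbr ad _ _) ab !coZ co_b (negPf ji) !mulr0.
Qed.

Lemma rsp_co al x i: rsp al x -> co x i != 0 -> a i = al.
move=> hx x0;apply/lfunP=> t;have := lb_co t x i;rewrite hx coZ=> /esym/(mulIf x0).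
by [].
Qed.

Lemma rsp_lb al be x y: rsp al x -> rsp be y -> rsp (al + be) (lb x y).
move=> hx hy t;rewrite (jacobi L) hx hy add_lfunE scalerDl;congr (_ + _).
 by rewrite -[al t *: x]addr0 (lbr_linl L) {2}/lbr (ad0 L) trmx0 mulmx0 addr0.
by rewrite /lbr scalemxAl.
Qed.

Lemma rspZ al c x: rsp al x -> rsp al (c *: x).
by move=> hx t;rewrite /lbr -scalemxAl -/(lbr ad _ _) hx !scalerA mulrC. Qed.

Lemma kil_rsp al be x y: rsp al x -> rsp be y -> al + be != 0 -> kl x y = 0.
move=> hx hy;apply: contraNeq=> xy;apply/eqP/lfunP=> t;rewrite add_lfunE zero_lfunE.
have := kil_inv L x (vsval t) y.
rewrite (lbrC L) hx hy -scaleNr kilZl kilZr // => /(mulIf xy) <-.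
by rewrite subrr.
Qed.

Lemma rsp0_h x: rsp 0 x -> x \in h.
move=> hx;apply: hmax=> y yh;rewrite (lbrC L) -[y](vsprojK yh).
by rewrite hx zero_lfunE scale0r oppr0.
Qed.
Lemma h_rsp x: x \in h -> rsp 0 x.
by move=> xh t;rewrite habel ?subvsP // zero_lfunE scale0r. Qed.

(** Nondegeneracy pairs [b j] with some basis vector, and the Killing form pairs opposite weights
    only. *)
Lemma dual j: exists2 i, kl (b i) (b j) != 0 & a i = - a j.
have [i hi]: exists i, kl (b i) (b j) != 0.
 apply: contrapT=> /forallNP H.
 have b0: b j = 0.
 apply: nd=> y;rewrite [y]coE kil_sumr // big1 // => i _;rewrite kilZr // kilC.
 by have /negP := H i;rewrite negbK=> /eqP ->;rewrite mulr0.
 by have := co_b j j;rewrite b0 eqxx /co mul0mx mxE=> /eqP;rewrite eq_sym oner_eq0.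
exists i=> //;apply/eqP;rewrite -addr_eq0;apply: contraNT hi=> hi.
by rewrite (kil_rsp (rsp_b i) (rsp_b j) hi).
Qed.

Lemma dualx j: exists x i c, [/\ x = c *: b i, a i = - a j & kl x (b j) = 1].
have [i i0 ai] := dual j;exists ((kl (b i) (b j))^-1 *: b i), i, (kl (b i) (b j))^-1;split=> //.
by rewrite kilZl mulVf.
Qed.

Lemma h_nd s: s \in h -> (forall t: subvs_of h, kl s (vsval t) = 0) -> s = 0.
move=> sh H;apply: nd=> y;rewrite [y]coE kil_sumr // big1 // => i _;rewrite kilZr //.
have [a0|a0] := eqVneq (a i) 0;last by rewrite (kil_rsp (h_rsp sh) (rsp_b i)) ?mulr0 ?add0r.
have bh: b i \in h by apply: rsp0_h;rewrite -a0;exact: rsp_b.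
by rewrite -[b i](vsprojK bh) H mulr0.
Qed.

Lemma kilH al x y (t: subvs_of h): rsp al y -> rsp (- al) x -> kl (lb x y) (vsval t) = - (al t: K) * kl x y.
move=> hy hx;rewrite (kil_inv L) (lbrC L) hy -scaleNr kilZr //.
Qed.
Lemma lb_h al x y: rsp al y -> rsp (- al) x -> lb x y \in h.
by move=> hy hx;apply: rsp0_h;rewrite -(addNr al);exact: rsp_lb. Qed.

Definition Mx x: 'M[K]_k := Bm *m (ad x)^T *m invmx Bm.

Lemma MxE x i j: Mx x i j = co (lb x (b i)) j.
by rewrite /co /lbr -!row_mul [RHS]mxE. Qed.

Lemma Mx_lb x y: Mx (lb x y) = Mx y *m Mx x - Mx x *m Mx y.
rewrite /Mx !mulmxA !mulmxKV // (ad_lbr L).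
have -> : (ad x *m ad y - ad y *m ad x)^T = (ad y)^T *m (ad x)^T - (ad x)^T *m (ad y)^T.
 by rewrite -!trmx_mul;exact: linearB.
by rewrite mulmxBr mulmxBl !mulmxA.
Qed.

Lemma Mx_tr x y: kl x y = \tr (Mx x *m Mx y).
rewrite /Mx !mulmxA mulmxKV // -!mulmxA mxtrace_mulC -!mulmxA mulVmx // mulmx1.
by rewrite -trmx_mul mxtrace_tr kilC.
Qed.
Lemma Mx_h (t: subvs_of h) i j: Mx (vsval t) i j = (a i t: K) * (i == j)%:R.
by rewrite MxE ab coZ co_b. Qed.

(** The trace of a commutator over a block of indices vanishes as soon as entries leading out of the
    block never meet entries leading back. This identity serves three times: for root strings, for
    the character of p on commutators, and in [Psi0]. *)
Lemma sub_trace (I: pred 'I_k) x y :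
 (forall i j, I i -> ~~ I j -> Mx x i j * Mx y j i = 0 /\ Mx y i j * Mx x j i = 0) ->
 \sum_(i | I i) Mx (lb x y) i i = 0.
move=> H;rewrite Mx_lb;under eq_bigr do rewrite !mxE;rewrite sumrB.
have E z w: (forall i j, I i -> ~~ I j -> Mx z i j * Mx w j i = 0) ->
 \sum_(i | I i) \sum_j Mx z i j * Mx w j i = \sum_(i | I i) \sum_(j | I j) Mx z i j * Mx w j i.
 move=> H';apply: eq_bigr=> i Ii;rewrite (bigID I) /= [X in _ + X]big1 ?addr0 // => j nj.
 exact: H'.
rewrite !E;try by move=> i j Ii nj;have [] := H i j Ii nj.
rewrite exchange_big /= [X in _ - X](_: _ = \sum_(j | I j) \sum_(i | I i) Mx y i j * Mx x j i) ?subrr //.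
by sumext i;sumext j;rewrite mulrC.
Qed.

Lemma Mx_rsp al x i j: rsp al x -> Mx x i j != 0 -> a j = al + a i.
by move=> hx;rewrite MxE=> /rsp_co;apply;apply: rsp_lb=> //;exact: rsp_b. Qed.

Section OneRoot.
Variables (x y: 'rV[K]_k) (al: wt).
Hypothesis (hx: rsp al x) (hy: rsp (- al) y) (xy1: kl x y = 1) (al0: al != 0).
Let hx': rsp (- - al) x. by rewrite opprK. Qed.
(** The element of h dual to [al] under the Killing form, as [kil_hv] shows; a multiple of the
    coroot. *)
Definition hv: subvs_of h := vsproj h (lb x y).

Lemma hvE: vsval hv = lb x y.
by rewrite vsprojK // (lb_h hy). Qed.
Lemma kil_hv (t: subvs_of h): kl (lb x y) (vsval t) = al t.
by rewrite (kilH _ hy hx') xy1 mulr1 opp_lfunE opprK. Qed.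

(** The trace of [x, y] over all weights a i + n al vanishes, which gives a linear relation with
    integer coefficients between the values of a i and of al. *)
Lemma hv_rat i: exists2 r: K, r \is Num.real & (a i hv: K) = r * (al hv: K).
pose I: pred 'I_k := fun l => `[< exists n: int, a l = a i + al *~ n >].
have Ii: I i by apply/asboolP;exists 0;rewrite mulr0z addr0.
have /all_sig[n hn] l: {n: int | I l -> a l = a i + al *~ n}.
 have [/asboolP/cid[n hn]|_] := boolP (I l);last by exists 0.
 by exists n.
have H: \sum_(l | I l) Mx (lb x y) l l = 0.
 apply: sub_trace=> l j Il nj.
 have hal be z: (exists m: int, be = al *~ m) -> rsp be z -> Mx z l j = 0.
 move=> [m bem] hz;apply: contraNeq nj=> /(Mx_rsp hz) aj;apply/asboolP;exists (n l + m).
 by rewrite aj (hn _ Il) bem addrCA -mulrzDr [m + _]addrC.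
 rewrite (hal al x) ?(hal (- al) y) ?mul0r //;first by exists (-1);rewrite mulrN1z.
 by exists 1;rewrite mulr1z.
have c0: (\sum_(l | I l) 1: K) != 0.
 by rewrite sumr_const pnatr_eq0 -lt0n;apply/card_gt0P;exists i.
exists (- (\sum_(l | I l) (n l)%:~R) / (\sum_(l | I l) 1)).
 rewrite rpredM ?rpredN ?rpredV //;apply: rpred_sum=> l _;[exact: realz|exact: rpred1].
apply: (mulfI c0);rewrite mulrA mulrCA mulfV // mulr1 mulNr;apply/eqP;rewrite -addr_eq0.
rewrite !mulr_suml -big_split /=;apply/eqP;rewrite -[RHS]H;apply: eq_bigr=> l Il.
rewrite -hvE Mx_h eqxx mulr1 (hn _ Il) add_lfunE mul1r;congr (_ + _).
have -> : al *~ n l = (n l)%:~R *: al by rewrite scaler_int.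
by rewrite scale_lfunE.
Qed.

Lemma hv_sqr: (al hv: K) = \sum_i (a i hv: K) ^+ 2.
rewrite -kil_hv hvE Mx_tr;sumext i;rewrite mxE (bigD1 i) //= big1=> [|j ji].
 by rewrite addr0 -hvE Mx_h eqxx mulr1.
by rewrite -hvE Mx_h eq_sym (negPf ji) mulr0 mul0r.
Qed.

(** If al vanishes on [hv], so does every weight by [hv_rat]; then [hv] is Killing-orthogonal to h,
    and al = 0. *)
Lemma hv_neq0: (al hv: K) != 0.
apply: contraNneq al0=> E;apply/eqP/lfunP=> t;rewrite zero_lfunE -kil_hv Mx_tr -hvE.
have -> : Mx (vsval hv) = 0.
 mxext i j;have [r _ ai] := hv_rat i.
 by rewrite Mx_h ai E mulr0 mul0r mxE.
by rewrite mul0mx mxtrace0.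
Qed.

(** By [hv_sqr] the value al(hv) is the sum of the squares of real multiples r_i of itself, so its
    inverse is the real number sum r_i^2. *)
Lemma hv_real i: (a i hv: K) \is Num.real.
have /all_sig2[r rr ar] i': {r: K | r \is Num.real & (a i' hv: K) = r * (al hv: K)}.
 exact/cid2/hv_rat.
have E: 1 = (al hv: K) * \sum_i r i ^+ 2.
 apply: (mulfI hv_neq0);rewrite mulr1 {1}hv_sqr mulrA -expr2 mulr_sumr;sumext i'.
 by rewrite ar exprMn mulrC.
have S0: \sum_i r i ^+ 2 != 0 by apply: contraTneq (oner_neq0 K)=> S0;rewrite E S0 mulr0 eqxx.
have -> : (a i hv: K) = r i * (\sum_i r i ^+ 2)^-1.
 by rewrite ar;congr (_ * _);apply: (mulIf S0);rewrite -E mulVf.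
rewrite rpredM // rpredV;apply: rpred_sum=> i' _;exact: rpredX.
Qed.
End OneRoot.

Lemma lb_hv al x y c z: rsp al x -> rsp (- al) y -> rsp c z -> lb (lb x y) z = (c (hv x y): K) *: z.
by move=> hx hy hz;rewrite -(hvE hx hy) hz. Qed.
Let adZ' c x: ad (c *: x) = c *: ad x := adZ L c x.
Let trE (A: 'M[K]_k) (z: 'rV[K]_k): A *m z^T = (z *m A^T)^T.
by rewrite trmx_mul trmxK. Qed.
Let sl2_ad X Y H s (z: 'rV[K]_k) mu': lb X Y = H -> lb H Y = - s *: Y -> s != 0 -> z != 0 ->
 lb X z = 0 -> lb H z = mu' *: z -> exists j: nat, mu' = s * j%:R / 2.
move=> XY HY s0 z0 Xz Hz.
apply: (@sl2 _ _ (ad X) (ad Y) (ad H) s _ _ s0 z^T).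
- by rewrite -(ad_lbr L) XY.
- by rewrite -(ad_lbr L) HY adZ'.
- by apply: contraNneq z0=> E;rewrite -[z]trmxK E trmx0.
- by rewrite trE -/(lbr ad _ _) Xz trmx0.
- by rewrite trE -/(lbr ad _ _) Hz linearZ.
Qed.

(** A second vector of weight a i yields a z in the same root space, orthogonal to y, hence with
    [y, z] = 0. In the triple with raising operator y it would be a highest vector of weight - s,
    which [sl2] forbids. *)
Lemma mult_one i j: a i = a j -> a i != 0 -> i = j.
move=> aij a0;apply: contrapT=> /eqP ij.
have [y [j' [c [yE aj' yb]]]] := dualx i.
have hy: rsp (- a i) y by rewrite yE;apply: rspZ;rewrite -aj';exact: rsp_b.
have hx:= rsp_b i;have xy1: kl (b i) y = 1 by rewrite kilC.
pose s: K := a i (hv (b i) y).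
have s0: s != 0 by exact: hv_neq0 hx hy xy1 a0.
(* [b j] corrected along [b i] so that its Killing product with y vanishes. *)
pose z := - kl (b j) y *: b i + b j.
have hz: rsp (a i) z.
 move=> t;rewrite /z /lbr mulmxDl -scalemxAl -!/(lbr ad _ _) !ab -aij scalerDr !scalerA.
 by rewrite [_ * a i t]mulrC.
have z0: z != 0.
 apply/eqP=> /(congr1 (co^~ j));rewrite /z co_lin !co_b (negPf ij) eqxx mulr0 add0r.
 by rewrite /co mul0mx mxE=> /eqP;rewrite oner_eq0.
have kz: kl z y = 0 by rewrite /z kil_linl // xy1 mulr1 addNr.
have zy: lb z y = 0.
 apply: h_nd=> [|t];first by apply: (lb_h hy);rewrite opprK.
 by rewrite (kilH (al := - a i)) // ?opprK // kz mulr0.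
have [n]: exists n: nat, - s = s * n%:R / 2.
 apply: (@sl2_ad y (b i) (- lb (b i) y) s z)=> //.
 - by rewrite (lbrC L).
 - rewrite /lbr (_: ad (- _) = - ad (lb (b i) y));last by rewrite -scaleN1r adZ' scaleN1r.
 by rewrite linearN mulmxN -/(lbr ad _ _) (lb_hv hx hy hx) scaleNr.
 - by rewrite (lbrC L) zy oppr0.
 - rewrite /lbr (_: ad (- _) = - ad (lb (b i) y));last by rewrite -scaleN1r adZ' scaleN1r.
 by rewrite linearN mulmxN -/(lbr ad _ _) (lb_hv hx hy hz) scaleNr.
rewrite -mulrA -{1}[s]mulr1 -mulrN=> /(mulfI s0) /eqP;rewrite eq_sym -addr_eq0.
have: 0 < n%:R / 2 + 1 :> K by rewrite ltr_wpDl // divr_ge0 // ler0n.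
by rewrite lt0r=> /andP[/negPf ->].
Qed.

(** * The parabolic subalgebra as the stabilizer of the highest weight line *)

Section Parabolic.
Context {N: nat} (D: 'rV[K]_k -> 'M[K]_N) (v: 'cV[K]_N) (dl: wt).
Variables (ht: wt -> K) (S: pred 'I_k).
Context (D_lin: forall c x y, D (c *: x + y) = c *: D x + D y)
 (D_lb: forall x y, D (lb x y) = D x *m D y - D y *m D x)
 (ht_add: forall x y, ht (x + y) = ht x + ht y)
 (ht_root: forall i, a i != 0 -> (0 < ht (a i)) || (ht (a i) < 0))
 (S_neg: forall i, S i -> ht (a i) < 0)
 (S_closed: forall i j l, ~~ S i -> ~~ S j -> S l -> Mx (b i) j l = 0)
 (v0: v != 0)
 (v_h: forall t: subvs_of h, D (vsval t) *m v = (dl t: K) *: v)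
 (v_pos: forall i, 0 < ht (a i) -> D (b i) *m v = 0)
 (dlE: forall t: subvs_of h, (dl t: K) = - \sum_(i | S i) (a i t: K)).
Let ht0: ht 0 = 0.
by apply: (addrI (ht 0));rewrite -ht_add !addr0. Qed.
Let htN x: ht (- x) = - ht x.
by apply/eqP;rewrite -addr_eq0 -ht_add addNr ht0. Qed.
Let nSpos i: 0 < ht (a i) -> ~~ S i.
by move=> h0;apply/negP=> /S_neg /(lt_trans h0);rewrite ltxx. Qed.

(** Minus the trace of ad x on g/p, whose weights are the a i with i in [S]: the character of p that
    extends delta_P. *)
Definition lam x: K := - \sum_(i | S i) Mx x i i.

Lemma Mx_lin c x y: Mx (c *: x + y) = c *: Mx x + Mx y.
by case: L=> H _ _;rewrite /Mx H linearD linearZ mulmxDr mulmxDl -!scalemxAr -!scalemxAl.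
Qed.

Lemma lam_lin c x y: lam (c *: x + y) = c * lam x + lam y.
have E (X Y: 'M[K]_k) i: (c *: X + Y) i i = c * X i i + Y i i by rewrite !mxE.
rewrite /lam;under eq_bigr do rewrite Mx_lin E.
by rewrite big_split /= -mulr_sumr opprD mulrN.
Qed.

Lemma lamD x y: lam (x + y) = lam x + lam y.
by rewrite -[x]scale1r lam_lin scale1r mul1r. Qed.
Lemma lam0: lam 0 = 0.
by apply: (addrI (lam 0));rewrite -lamD !addr0. Qed.

Lemma lamZ c x: lam (c *: x) = c * lam x.
by rewrite -[c *: x]addr0 lam_lin lam0 addr0. Qed.
Let D0: D 0 = 0.
by have := D_lin 1 0 0;rewrite !scale1r addr0=> /esym/eqP;rewrite -subr_eq0 addrK=> /eqP. Qed.
Let DZ c x: D (c *: x) = c *: D x.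
by rewrite -[c *: x]addr0 D_lin D0 addr0. Qed.
Let D_sum (r: seq 'I_k) (P: pred 'I_k) F: D (\sum_(i <- r | P i) F i) = \sum_(i <- r | P i) D (F i).
by apply: (big_morph D)=> // x y;rewrite -[x]scale1r D_lin !scale1r. Qed.

Lemma lam_h (t: subvs_of h): lam (vsval t) = dl t.
by rewrite dlE;congr (- _);sumext i;rewrite Mx_h eqxx mulr1. Qed.

(** The delicate case is a negative root in p. With x in the opposite root space, x kills b i v,
    since [x, b i] acts on v through [lam], which vanishes on commutators of p. A nonzero b i v
    would then be a highest vector of negative weight. *)
Lemma D_v i: ~~ S i -> D (b i) *m v = lam (b i) *: v.
move=> nS;have [a0|a0] := eqVneq (a i) 0.
 have bh: b i \in h by apply: rsp0_h;rewrite -a0;exact: rsp_b.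
 by rewrite -[b i](vsprojK bh) v_h lam_h.
have lami: lam (b i) = 0.
 rewrite /lam big1 ?oppr0 // => j _;apply/eqP;apply: contraNT a0=> /(Mx_rsp (rsp_b i)) /eqP.
 by rewrite -subr_eq subrr eq_sym.
rewrite lami scale0r;have /orP[hp|hn] := ht_root a0;first exact: v_pos.
have [x [i' [c [xE ai' xy1]]]] := dualx i.
have hx: rsp (- a i) x by rewrite xE;apply: rspZ;rewrite -ai';exact: rsp_b.
have hi': 0 < ht (a i') by rewrite ai' htN oppr_gt0.
have hy: rsp (- - a i) (b i) by rewrite opprK;exact: rsp_b.
have xv: D x *m v = 0 by rewrite xE DZ -scalemxAl v_pos // scaler0.
have nal0: - a i != 0 by rewrite oppr_eq0.
pose s: K := - a i (hv x (b i)).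
have s0: s != 0 by have := hv_neq0 hx hy xy1 nal0;rewrite opp_lfunE.
have Hv: D (lb x (b i)) *m v = 0.
 rewrite -(hvE hx hy) v_h -lam_h (hvE hx hy) /lam sub_trace ?oppr0 ?scale0r // => l j Sl Sj.
 have MZ m n: Mx x m n = c * Mx (b i') m n by rewrite !MxE xE /lbr adZ' linearZ -scalemxAr coZ.
 by rewrite MZ (S_closed nS Sj Sl) MZ (S_closed (nSpos hi') Sj Sl) !mulr0.
apply/eqP;apply: contraT=> w0.
have [n]: exists n: nat, - s = s * n%:R / 2.
 apply: (@sl2 _ _ (D x) (D (b i)) (D (lb x (b i))) s _ _ s0 (D (b i) *m v))=> //.
 - by rewrite -D_lb (lb_hv hx hy (rsp_b i)) /s opprK DZ.
 - have -> : D x *m (D (b i) *m v) = D (lb x (b i)) *m v + D (b i) *m (D x *m v).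
 by rewrite D_lb mulmxBl !mulmxA subrK.
 by rewrite Hv xv mulmx0 addr0.
 - have -> : D (lb x (b i)) *m (D (b i) *m v) = D (lb (lb x (b i)) (b i)) *m v + D (b i) *m (D (lb x (b i)) *m v).
 by rewrite [D (lb (lb _ _) _)]D_lb mulmxBl !mulmxA subrK.
 by rewrite Hv mulmx0 addr0 (lb_hv hx hy (rsp_b i)) DZ -scalemxAl /s opprK.
rewrite -mulrA -{1}[s]mulr1 -mulrN=> /(mulfI s0) /eqP;rewrite eq_sym -addr_eq0.
have: 0 < n%:R / 2 + 1 :> K by rewrite ltr_wpDl // divr_ge0 // ler0n.
by rewrite lt0r=> /andP[/negPf ->].
Qed.

Lemma D_lam x: (forall i, S i -> co x i = 0) -> D x *m v = lam x *: v.
move=> hx;have lamE: lam x = \sum_i co x i * lam (b i).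
 rewrite {1}[x]coE (big_morph lam lamD lam0);sumext i;exact: lamZ.
rewrite lamE {1}[x]coE D_sum mulmx_suml scaler_suml;sumext i.
rewrite DZ -scalemxAl -scalerA;have [Si|nS] := boolP (S i);first by rewrite hx // !scale0r.
by rewrite D_v.
Qed.

(** The Killing orthogonal of p lies in p: the dual of a root in [S] is positive, hence outside [S],
    and as root spaces are lines its pairing isolates one coordinate. *)
Lemma perpS x: (forall i, ~~ S i -> kl x (b i) = 0) -> forall i, S i -> co x i = 0.
move=> hx i Si;have [j ij aj] := dual i.
have ai0: a i != 0 by apply: contraTneq (S_neg Si)=> E;rewrite E ht0 ltxx.
have nS: ~~ S j by apply: nSpos;rewrite aj htN oppr_gt0 S_neg.
have := hx j nS;rewrite [x in kl x _]coE kilC kil_sumr // (bigD1 i) //= big1=> [|l li].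
 by rewrite addr0 kilZr // => /eqP;rewrite mulf_eq0 (negPf ij) orbF=> /eqP.
rewrite kilZr // (kil_rsp (rsp_b j) (rsp_b l)) ?mulr0 // aj addrC subr_eq0.
by apply: contraNneq li=> /esym/mult_one -> .
Qed.

(** The roots of [S] whose vectors kill v, a set to be shown empty; unrelated to the density Psi of
    the cone. With it, [Jq] indexes vectors that preserve the line of v, and [Jq_closed] shows that
    they span a subalgebra. *)
Definition Psi: pred 'I_k := fun i => S i && (D (b i) *m v == 0).
Definition Jq: pred 'I_k := fun i => ~~ S i || Psi i.
Let Jq_v i: Jq i -> exists c, D (b i) *m v = c *: v.
move=> /orP[nS|/andP[_ /eqP ->]];first by exists (lam (b i));exact: D_v.
by exists 0;rewrite scale0r.
Qed.
Let Jq_closed j l i: Jq j -> Jq l -> ~~ Jq i -> Mx (b j) l i = 0.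
move=> Jj Jl nJ;apply/eqP;apply: contraT=> M0.
have /andP[Si ni]: S i && ~~ Psi i by move: nJ;rewrite /Jq negb_or negbK.
have ai:= Mx_rsp (rsp_b j) M0.
have E: lb (b j) (b l) = Mx (b j) l i *: b i.
 rewrite [LHS]coE (bigD1 i) //= big1 ?addr0 ?MxE // => m mi.
 apply/eqP;rewrite scaler_eq0;apply/orP;left;apply: contraNT mi=> m0.
 have am:= rsp_co (rsp_lb (rsp_b j) (rsp_b l)) m0.
 apply/eqP/mult_one;first by rewrite am ai.
 by rewrite am -ai;apply: contraTneq (S_neg Si)=> E;rewrite E ht0 ltxx.
have [c cE] := Jq_v Jj;have [d dE] := Jq_v Jl.
have: D (lb (b j) (b l)) *m v = 0.
 by rewrite D_lb mulmxBl -!mulmxA dE cE -!scalemxAr cE dE !scalerA mulrC subrr.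
rewrite E DZ -scalemxAl=> /eqP;rewrite scaler_eq0 (negPf M0) /= => bv.
by move: ni;rewrite /Psi Si bv.
Qed.

Lemma kil_hh (t: subvs_of h): kl (vsval t) (vsval t) = \sum_i (a i t: K) ^+ 2.
rewrite Mx_tr;sumext i;rewrite mxE (bigD1 i) //= big1=> [|j ji].
 by rewrite addr0 Mx_h eqxx mulr1.
by rewrite Mx_h eq_sym (negPf ji) mulr0 mul0r.
Qed.
Let S_neq0 i: S i -> a i != 0.
by move/S_neg;apply: contraTneq=> E;rewrite E ht0 ltxx. Qed.

(** Let T_j be the Killing dual of a root a j of [Psi]. Both the sum of the roots in [S] and the sum
    over the complement of [Jq] vanish on T_j, so the sum over [Psi] does. Then the sum [hS] of the
    T_j has Killing norm 0; all weights are real on it, so all vanish there, and the roots of [Psi]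
    add up to 0, against their negative heights. *)
Lemma Psi0 i: S i -> D (b i) *m v != 0.
move=> Si;apply/negP=> Pi.
have Psi_i: Psi i by rewrite /Psi Si.
have /all_sig[f hf] j: {t: 'rV[K]_k * 'I_k * K |
 [/\ t.1.1 = t.2 *: b t.1.2, a t.1.2 = - a j & kl t.1.1 (b j) = 1]}.
 by apply: cid;have [x [i' [c H]]] := dualx j;exists (x, i', c).
pose xx j := (f j).1.1.
have hxx j: rsp (- a j) (xx j).
 by have [E <- _] := hf j;rewrite /xx E;apply: rspZ;exact: rsp_b.
have k1 j: kl (b j) (xx j) = 1 by rewrite kilC;have [_ _ ->] := hf j.
pose T j: subvs_of h := hv (b j) (xx j).
have TE j: vsval (T j) = lb (b j) (xx j) := hvE (rsp_b j) (hxx j).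
have kT j t: kl (vsval (T j)) (vsval t) = a j t by rewrite TE (kil_hv (rsp_b j) (hxx j)).
have nSx j: S j -> ~~ S (f j).1.2.
 by move=> Sj;have [_ E _] := hf j;apply: nSpos;rewrite E htN oppr_gt0 S_neg.
have dT j: Psi j -> \sum_(l | Psi l) (a l (T j): K) = 0.
 move=> /andP[Sj /eqP vj].
 (* [b j, xx j] kills v, because b j does and xx j, which lies in p, only scales v. *)
 have e1: \sum_(l | S l) (a l (T j): K) = 0.
 have: D (vsval (T j)) *m v = 0.
 rewrite TE D_lb mulmxBl -!mulmxA vj mulmx0 subr0.
 have [E _ _] := hf j;rewrite /xx E DZ -!scalemxAl D_v ?nSx // -!scalemxAr vj !scaler0.
 by [].
 rewrite v_h=> /eqP;rewrite scaler_eq0 (negPf v0) orbF dlE oppr_eq0=> /eqP.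
 by [].
 (* The trace, modulo the stabilizer, of a commutator of two of its elements. *)
 have e2: \sum_(l | ~~ Jq l) Mx (lb (b j) (xx j)) l l = 0.
 apply: sub_trace=> m l nm;rewrite negbK=> Jl.
 have Jj: Jq j by rewrite /Jq /Psi Sj vj eqxx orbT.
 have Jf: Jq (f j).1.2 by rewrite /Jq nSx.
 rewrite (Jq_closed Jj Jl nm) mulr0;split=> //.
 have -> : Mx (xx j) l m = 0;last by rewrite mulr0.
 have [E _ _] := hf j;rewrite /xx E -[_ *: _]addr0 Mx_lin mxE mxE (Jq_closed Jf Jl nm) mulr0 add0r.
 by rewrite /Mx (ad0 L) trmx0 mulmx0 mul0mx mxE.
 move: e1;rewrite (bigID Psi) /= => e1;rewrite -[RHS]e1 -[LHS]addr0;congr (_ + _).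
 by apply: eq_bigl=> l;rewrite /Psi;case: (S l).
 rewrite -[LHS]e2;apply: eq_big=> [l|l _];last by rewrite -TE Mx_h eqxx mulr1.
 by rewrite /Jq negb_or negbK.
pose hS: subvs_of h := \sum_(j | Psi j) T j.
have aS l: (a l hS: K) = \sum_(j | Psi j) (a l (T j): K) by rewrite /hS linear_sum.
have kS t: kl (vsval hS) (vsval t) = \sum_(j | Psi j) (a j t: K).
 rewrite kilC /hS linear_sum kil_sumr //;sumext j;rewrite kilC;exact: kT.
have z: \sum_l (a l hS: K) ^+ 2 = 0.
 rewrite -kil_hh kS;under eq_bigr do rewrite aS.
 by rewrite exchange_big /= big1 // => j Pj;exact: dT.
have re l: (a l hS: K) \is Num.real.
 by rewrite aS;apply: rpred_sum=> j /andP[Sj _];exact: (hv_real (rsp_b j) (hxx j) (k1 j) (S_neq0 Sj)).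
have al0 l: (a l hS: K) = 0.
 have /psumr_eq0P := z;move=> /(_ _ l isT) H;apply/eqP;rewrite -sqrf_eq0;apply/eqP;apply: H.
 by move=> m _;rewrite real_exprn_even_ge0.
have w0: \sum_(j | Psi j) a j = 0.
 apply/lfunP=> t;rewrite sum_lfunE zero_lfunE -kS Mx_tr.
 have -> : Mx (vsval hS) = 0;last by rewrite mul0mx mxtrace0.
 by mxext l m;rewrite Mx_h al0 mul0r mxE.
have := ht0;rewrite -w0 (big_morph ht ht_add ht0)=> E.
have: \sum_(j | Psi j) ht (a j) < 0.
 rewrite (bigD1 i) //=;apply: ltr_wnDr;last exact: S_neg.
 by apply: sumr_le0=> j /andP[/andP[Sj _] _];exact/ltW/S_neg.
by rewrite E ltxx.
Qed.
Let u i := D (b i) *m v.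
Let Dt_u (t: subvs_of h) i: D (vsval t) *m u i = (a i t + dl t: K) *: u i.
have -> : D (vsval t) *m u i = D (lb (vsval t) (b i)) *m v + D (b i) *m (D (vsval t) *m v).
 by rewrite D_lb mulmxBl /u !mulmxA subrK.
by rewrite ab DZ v_h -scalemxAl -scalemxAr -scalerDl.
Qed.
(** Induction on the number of nonzero coefficients: applying D t minus the eigenvalue of one term
    removes that term, and the weights a i are distinct by [mult_one]. *)
Let u_indep (n: nat) (c: 'I_k -> K): (#|[pred i | S i & c i != 0%R]| <= n)%N ->
 \sum_(i | S i) c i *: u i = 0 -> forall i, S i -> c i = 0.
elim: n c=> [|n IH] c hn hc i Si.
 by apply/eqP;move: hn;rewrite leqn0=> /eqP/card0_eq/(_ i);rewrite inE Si=> /negbFE.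
apply: contrapT=> /eqP ci.
have [[j /andP[/andP[Sj cj] ji]]|/forallNP H] := pselect (exists j, (S j && (c j != 0)) && (j != i)).
 have /lfunPn[t aij]: a i != a j by apply: contra_neq ji=> /mult_one -> //;exact: S_neq0.
 pose c' l: K := c l * ((a l t: K) - (a j t: K)).
 have: c' i = 0.
 apply: (IH c')=> //;last first.
 have := congr1 (mulmx (D (vsval t))) hc;rewrite mulmx0 mulmx_sumr=> E.
 have := congr1 ( *:%R (a j t + dl t: K)) hc;rewrite scaler0 scaler_sumr=> E'.
 have -> : \sum_(l | S l) c' l *: u l = \sum_(l | S l) D (vsval t) *m (c l *: u l)
 - \sum_(l | S l) (a j t + dl t: K) *: (c l *: u l).
 rewrite -sumrB;sumext l.
 rewrite -scalemxAr Dt_u !scalerA -scalerBl;congr (_ *: _);rewrite /c';ring.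
 by rewrite E E' subr0.
 rewrite -ltnS;apply: leq_trans hn;apply: proper_card;apply/properP;split.
 apply/fintype.subsetP=> l;rewrite !inE=> /andP[-> /=];apply: contra_neq=> cl.
 by rewrite /c' cl mul0r.
 by exists j;rewrite !inE Sj ?cj // /c' subrr mulr0 eqxx.
 by move/eqP;rewrite mulf_eq0 (negPf ci) subr_eq0 (negPf aij).
move: hc;rewrite (bigD1 i) //= big1 ?addr0=> [/eqP|j /andP[Sj ji]].
 by rewrite scaler_eq0 (negPf ci) (negPf (Psi0 Si)).
have [->|cj] := eqVneq (c j) 0;first by rewrite scale0r.
by case: (H j);rewrite Sj cj.
Qed.

(** D t minus dl t kills the multiples of v and multiplies D (b i) v by a i t, which reduces the
    relation to [u_indep]. *)
Lemma stab_L x c: D x *m v = c *: v -> forall i, S i -> co x i = 0.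
move=> xv i Si;have [t at0]: exists t, a i t != 0.
 by have /lfunPn[t] := S_neq0 Si;rewrite zero_lfunE;exists t.
have E: \sum_(l | S l) co x l *: u l = (c - \sum_(l | ~~ S l) co x l * lam (b l)) *: v.
 have Ex: D x *m v = \sum_(l | S l) co x l *: u l + (\sum_(l | ~~ S l) co x l * lam (b l)) *: v.
 rewrite {1}[x]coE D_sum mulmx_suml (bigID S) /= scaler_suml;congr (_ + _).
 by sumext l;rewrite DZ -scalemxAl.
 by apply: eq_bigr=> l nS;rewrite DZ -scalemxAl D_v // scalerA.
 by rewrite scalerBl -xv Ex addrK.
have: co x i * (a i t: K) = 0.
 apply: (u_indep (c := fun l => co x l * (a l t: K)) (leqnn _))=> //.
 have := congr1 (fun w => D (vsval t) *m w - (dl t: K) *: w) E.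
 rewrite -scalemxAr v_h !scalerA [_ * dl t]mulrC subrr mulmx_sumr scaler_sumr -sumrB=> E'.
 rewrite -[RHS]E';sumext l;rewrite -scalemxAr Dt_u !scalerA -scalerBl.
 by congr (_ *: _);ring.
by move/eqP;rewrite mulf_eq0 (negPf at0) orbF=> /eqP.
Qed.

(** A linear relation says that a combination of the b i with i in [S] preserves the line of v, so
    [stab_L] annihilates its coefficients. *)
Lemma yv_indep c (d: 'I_k -> K): c *: v + \sum_(i | S i) d i *: (D (b i) *m v) = 0 ->
 c = 0 /\ forall i, S i -> d i = 0.
move=> E;pose x := \sum_(i | S i) d i *: b i.
have Ex: D x *m v = \sum_(i | S i) d i *: (D (b i) *m v).
 by rewrite /x D_sum mulmx_suml;sumext i;rewrite DZ -scalemxAl.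
have cx i: S i -> co x i = d i.
 move=> Si;rewrite /x co_sum (bigD1 i) //= big1=> [|j /andP[_ ji]].
 by rewrite coZ co_b eqxx mulr1 addr0.
 by rewrite coZ co_b (negPf ji) mulr0.
have d0 i: S i -> d i = 0.
 move=> Si;rewrite -cx //;apply: (@stab_L x (- c))=> //;rewrite Ex scaleNr.
 by apply/eqP;rewrite -addr_eq0 addrC E.
split=> //;move: E;rewrite big1 ?addr0=> [/eqP|i Si];last by rewrite d0 // scale0r.
by rewrite scaler_eq0 (negPf v0) orbF=> /eqP.
Qed.

(** The span of v and the D (b i) v is a p-module: ad on g/p twisted by [lam], extended by multiples
    of v. Its trace is what makes the metric Ricci-flat. *)
Lemma D_y x i: (forall i, S i -> co x i = 0) ->
 D x *m (D (b i) *m v) = \sum_(j | S j) Mx x i j *: (D (b j) *m v) + lam x *: (D (b i) *m v)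
 + (\sum_(j | ~~ S j) Mx x i j * lam (b j)) *: v.
move=> hx.
have -> : D x *m (D (b i) *m v) = D (lb x (b i)) *m v + D (b i) *m (D x *m v).
 by rewrite D_lb mulmxBl !mulmxA subrK.
rewrite (D_lam hx) -scalemxAr addrAC;congr (_ + _).
rewrite [lb x (b i)]coE D_sum mulmx_suml (bigID S) /= scaler_suml;congr (_ + _).
 by sumext j;rewrite MxE DZ -scalemxAl.
by apply: eq_bigr=> j nS;rewrite MxE DZ -scalemxAl D_v // scalerA.
Qed.
End Parabolic.
End Roots.

(** * Simultaneous diagonalization of the Cartan subalgebra *)

Section WeightBasis.
Context {K: numF} {k: nat} (ad: 'rV[K]_k -> 'M[K]_k).
Hypothesis L: lie_ad ad.
Notation lb := (lbr ad).
Variable h: {vspace 'rV[K]_k}.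
Context (habel: forall x y, x \in h -> y \in h -> lb x y = 0)
 (hdiag: forall x, x \in h -> exists2 B: 'M[K]_k, B \in unitmx &
 forall i, exists c: K, lb x (row i B) = c *: row i B).

(** The adjoint matrices of a basis of h commute and are diagonalizable, so one matrix diagonalizes
    all of them; the diagonal entries depend linearly on the element of h. *)
Lemma weight_basis: exists (Bm: 'M[K]_k) (a: 'I_k -> 'Hom(subvs_of h, K^o)),
 Bm \in unitmx /\ forall (t: subvs_of h) i, lb (vsval t) (row i Bm) = (a i t: K) *: row i Bm.
pose As := [seq (ad x)^T | x <- vbasis h].
have cd: codiagonalizable As.
 apply/codiagonalizableP;split=> [A A' /mapP[x xh ->] /mapP[y yh ->]|A /mapP[x xh ->]].
 have := habel (vbasis_mem xh) (vbasis_mem yh)=> xy.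
 have := ad_lbr L x y;rewrite xy (ad0 L)=> /esym/eqP;rewrite subr_eq0=> /eqP E.
 by rewrite /comm_mx -!trmx_mul E.
 have [B Bu hB] := hdiag (vbasis_mem xh);exists B=> //.
 rewrite /similar_to conjumx //;apply/is_diag_mxP=> i j ij.
 have [c E] := hB i;rewrite /lbr -row_mul in E.
 have -> : (B *m (ad x)^T *m invmx B) i j = (row i (B *m (ad x)^T) *m invmx B) 0 j by rewrite -row_mul [RHS]mxE.
 rewrite E -scalemxAl -row_mul mulmxV // row1 2!mxE.
 have -> : (j == i) = false by rewrite -val_eqE eq_sym (negPf ij).
 by rewrite andbF mulr0.
have [P Pu /allP PA] := cd.
have Pd x i j: x \in h -> i != j -> (P *m (ad x)^T *m invmx P) i j = 0.
 move=> xh ij;rewrite {1}(coord_vbasis xh).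
 have tS m (F: 'I_m -> 'M[K]_k): (\sum_l F l)^T = \sum_l (F l)^T by exact: linear_sum.
 have tZ c (A: 'M[K]_k): (c *: A)^T = c *: A^T by exact: linearZ.
 rewrite (ad_sum L) tS mulmx_sumr mulmx_suml summxE big1 // => l _.
 rewrite (adZ L) tZ -scalemxAr -scalemxAl mxE.
 have: (ad (vbasis h)`_l)^T \in As by apply/map_f/mem_nth;rewrite size_tuple.
 move=> hm;have: is_diag_mx (conjmx P (ad (vbasis h)`_l)^T) := PA _ hm.
 by rewrite (conjumx _ Pu)=> /is_diag_mxP /(_ i j ij) ->;rewrite mulr0.
pose f i (t: subvs_of h): K^o := (P *m (ad (vsval t))^T *m invmx P) i i.
have fl i: linear (f i).
 move=> c x y;rewrite /f linearP /=;have [-> _ _] := L.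
 by rewrite linearD linearZ mulmxDr mulmxDl -scalemxAr -scalemxAl mxE mxE.
pose F i: {linear subvs_of h -> K^o} := HB.pack (f i) (GRing.isLinear.Build K _ _ _ (f i) (fl i)).
exists P, (fun i => linfun (F i));split=> // t i.
rewrite lfunE /= /f /lbr;set M := P *m _ *m _.
have E: row i M = M i i *: dlt i.
 rowext j;rewrite !mxE eqxx /=;have [->|ij] := eqVneq j i;first by rewrite mulr1.
 by rewrite mulr0;have := Pd _ _ _ (subvsP t) (negbT (etrans (eq_sym i j) (negPf ij)));rewrite /M mxE.
by rewrite -row_mul -[P *m _](mulmxKV Pu) -/M row_mul E -scalemxAl -rowE.
Qed.
End WeightBasis.

(** * Heights of roots, the algebra of P and the weight delta_P *)

Section Flag.
Context {R: realType}.
Notation C := (cnum R).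
Context {k N n: nat} (GC: lie_group C k).
Notation ad := (@adm C k GC).
Notation lb := (lbr ad).
Let L: lie_ad ad := adm_lie (@schwarzC R) GC.

Lemma hol_rep (rho: GC -> 'M[C]_N): holomorphic_rep rho -> smooth_rep rho.
move=> [r1 rM rs];split=> //;split=> // m f x sf.
have [c ac dc] := atlas_cover (f x);have okc:= atlas_ok ac.
have [_ oi _ _ _] := okc.
have s2:= smooth_on_lsmE oi (img_coord dc) (rs c ac).
apply: lsm_near_eq (lsm_comp (sf.2 c ac dc) s2).
by apply: filterS (gsm_near_dom sf ac dc)=> y [_ ->].
Qed.

Variables (h: {vspace 'rV[C]_k}) (Sig Theta: seq (weight h)).
Context (hc: cartan_subalgebra GC h)
 (hS: simple_roots GC Sig)
 (nd: forall x, (forall y, kil ad x y = 0) -> x = 0).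
Variables (Bm: 'M[C]_k) (a: 'I_k -> weight h).
Hypothesis Bu: Bm \in unitmx.
Notation b i := (row i Bm).
Hypothesis ab: forall (t: subvs_of h) i, lb (vsval t) (b i) = (a i t: C) *: b i.
Let habel x y: x \in h -> y \in h -> lb x y = 0.
by have [H _ _] := hc=> xh yh;rewrite -(lbE (@schwarzC R)) H. Qed.
Let hmax x: (forall y, y \in h -> lb x y = 0) -> x \in h.
by have [_ H _] := hc=> hx;apply: H=> y yh;rewrite (lbE (@schwarzC R)) hx. Qed.
Let Dual := @dual C k ad L nd h Bm a Bu ab.
Let Mult := @mult_one C k ad L nd h habel hmax Bm a Bu ab.
Let Rsp_co := @rsp_co C k ad h Bm a Bu ab.

Lemma rsp_root (al: weight h) x: rsp ad al x <-> root_space GC al x.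
by split=> H t;have := H t;rewrite (lbE (@schwarzC R)). Qed.
Lemma b_neq0 i: b i != 0.
apply/eqP=> E;have := co_b Bu i i;rewrite E /co mul0mx mxE eqxx=> /eqP.
by rewrite eq_sym oner_eq0.
Qed.
Lemma root_a i: a i != 0 -> is_root GC (a i).
by move=> a0;split=> //;exists (b i);[exact: b_neq0|apply/rsp_root => t;exact: ab]. Qed.

Lemma root_ex al: is_root GC al -> exists i, a i = al.
move=> [al0 [x x0 /rsp_root hx]].
have [i hi]: exists i, co Bm x i != 0.
 apply: contrapT=> /forallNP H;move: x0;rewrite [x](coE Bu) big1 ?eqxx // => i _.
 by have /negP := H i;rewrite negbK=> /eqP ->;rewrite scale0r.
by exists i;exact: Rsp_co hx hi.
Qed.

(** The height with respect to the simple roots, extended linearly to all weights. On roots it is a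
    nonzero integer, so the partial order of C detects its sign. *)
Definition ht (x: weight h): C := \sum_(i < size Sig) vector.coord (in_tuple Sig) i x.

Lemma ht_add x y: ht (x + y) = ht x + ht y.
by rewrite /ht -big_split;sumext i;rewrite linearD. Qed.
Let ht0: ht 0 = 0.
by apply: (addrI (ht 0));rewrite -ht_add !addr0. Qed.
Let htN x: ht (- x) = - ht x.
by apply/eqP;rewrite -addr_eq0 -ht_add addNr ht0. Qed.

Lemma ht_comb x: nat_comb Sig x -> x != 0 -> 0 < ht x.
have [fS _ _] := hS;move=> [f E] x0.
have htS c: c \in Sig -> ht c = 1.
 move=> cS;have iS:= cS;rewrite -index_mem in iS.
 rewrite /ht (bigD1 (Ordinal iS)) //= big1=> [|i ii].
 by have := @coord_free _ _ _ (in_tuple Sig) (Ordinal iS) (Ordinal iS) fS;rewrite /= nth_index // eqxx addr0.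
 have := @coord_free _ _ _ (in_tuple Sig) (Ordinal iS) i fS;rewrite /= nth_index // => ->.
 by rewrite eq_sym (negPf ii).
have htM c m: ht (c *+ m) = ht c *+ m.
 by elim: m=> [|m IH];rewrite ?mulr0n ?ht0 // !mulrS ht_add IH.
have hE: ht x = (\sum_(c <- Sig) f c)%:R.
 rewrite E (big_morph ht ht_add ht0) natr_sum big_seq [RHS]big_seq;apply: eq_bigr=> c cS.
 by rewrite htM htS.
rewrite hE ltr0n lt0n;apply: contraNneq x0=> /eqP;rewrite sum_nat_seq_eq0=> /allP H.
by rewrite E big_seq big1 // => c cS;have /eqP -> := H c cS.
Qed.

Lemma ht_root i: a i != 0 -> (0 < ht (a i)) || (ht (a i) < 0).
have [_ _ H] := hS;move=> a0;have [/ht_comb ->//|/ht_comb] := H _ (root_a a0).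
by rewrite oppr_eq0 htN oppr_gt0=> -> //;rewrite orbT.
Qed.

Lemma ht_pos i: 0 < ht (a i) -> pos_root GC Sig (a i).
have [_ _ H] := hS;move=> h0;have a0: a i != 0 by apply: contraTneq h0=> ->;rewrite ht0 ltxx.
split;first exact: root_a.
have [//|/ht_comb] := H _ (root_a a0);rewrite oppr_eq0 htN oppr_gt0=> /(_ a0) /(lt_trans h0).
by rewrite ltxx.
Qed.

(** The roots that do not occur in p; the [b i] with these indices are a basis of g modulo p. *)
Definition Sp: pred 'I_k := fun i =>
 `[< [/\ a i != 0, ~ pos_root GC Sig (a i) & ~ neg_root GC Theta (a i)] >].

Lemma Sp_neg i: Sp i -> ht (a i) < 0.
move=> /asboolP[a0 np _];have /orP[/ht_pos //|//] := ht_root a0.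
Qed.

(** [span_of] is an intersection of subspaces: one direction tests it on the kernel of the i-th
    coordinate, which contains the generators, the other expands [x] in the weight basis. *)
Lemma par_iff x: parabolic_algebra GC Sig Theta x <-> forall i, Sp i -> co Bm x i = 0.
split=> [H i Si|H W hW].
 (* Multiplication by [A] keeps the i-th coordinate alone, so the kernel of [mulmxr A] is the
    hyperplane to test. *)
 pose A: 'M[C]_k := invmx Bm *m \matrix_(l, j) ((l == j) && (l == i))%:R.
 have AE y: (y *m A == 0) = (co Bm y i == 0).
 have E j: (y *m A) 0 j = co Bm y i * (j == i)%:R.
 rewrite /A mulmxA mxE (bigD1 i) //= big1=> [|l li];last by rewrite mxE (negPf li) andbF mulr0.
 by rewrite mxE eqxx andbT addr0 eq_sym.
 apply/eqP/eqP=> [E0|E0];first by have := E i;rewrite E0 mxE eqxx mulr1.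
 by rowext j;rewrite E E0 mul0r mxE.
 apply/eqP;rewrite -AE.
 have := H (lker (linfun (mulmxr A)));rewrite memv_ker lfunE /=;apply=> y Hy.
 rewrite memv_ker lfunE /= AE;apply: contraT=> c0;move/asboolP: Si=> [a0 np nn].
 case: Hy=> [yh|[al hal /rsp_root hy]].
 by move: a0;rewrite (Rsp_co (h_rsp habel yh) c0) eqxx.
 by case: hal;rewrite -(Rsp_co hy c0).
rewrite [x](coE Bu);apply: memv_suml=> i _.
have [Si|nS] := boolP (Sp i);first by rewrite H // scale0r mem0v.
apply/memvZ/hW;have [a0|a0] := eqVneq (a i) 0.
 by left;apply: (rsp0_h L hmax);rewrite -a0=> t;exact: ab.
right;exists (a i);last by apply/rsp_root=> t;exact: ab.
apply: contrapT=> /not_orP[np nn];move/negP: nS;apply;exact/asboolP.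
Qed.

(** i |-> - a i maps [Sp] onto the roots summed in [delta], and injectively because root spaces are
    lines. *)
Lemma delta_sum (t: subvs_of h): (delta GC Sig Theta t: C) = - \sum_(i | Sp i) (a i t: C).
have -> : delta GC Sig Theta = \sum_(i | Sp i) - a i.
 rewrite /delta;set A := [set al | _].
 have -> : A = (fun i => - a i) @` [set i | Sp i].
 apply/seteqP;split=> [al [[ral cal] nal]|_ [i Si <-]].
 have [i ai] := root_ex ral;have [j _ aj] := Dual i;exists j;last by rewrite aj ai opprK.
 have a0: a j != 0 by rewrite aj oppr_eq0 ai;case: ral.
 apply/asboolP;split=> //.
 move=> [_ cj];have := ht_comb cj a0;rewrite aj ai htN oppr_gt0=> /(lt_trans (ht_comb cal _)).
 by case: ral=> al0 _;rewrite ltxx=> /(_ al0).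
 by move=> [_];rewrite aj ai opprK=> cT;apply: nal.
 have si:= Si;move/asboolP: Si=> [a0 np nn].
 have [j _ aj] := Dual i;have rj: is_root GC (- a i) by rewrite -aj;apply: root_a;rewrite aj oppr_eq0.
 split.
 by rewrite -aj;apply: ht_pos;rewrite aj htN oppr_gt0 Sp_neg.
 by move=> [_ cT];apply: nn;split=> //;exact: root_a.
 rewrite fsbig_image;last first.
 by move=> i j;rewrite !inE=> /asboolP[a0 _ _] _ /oppr_inj /Mult ->.
 rewrite (fsbigE (enum Sp)) ?enum_uniq //;last 2 first.
 - by move=> i;rewrite /= mem_enum.
 - by move=> i Si;rewrite mem_enum=> /negP;case.
 rewrite big_enum_cond;apply: eq_bigl=> i.
 have -> : (i \in Sp) = Sp i by [].
 by case Si: (Sp i)=> //=;apply/mem_set.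
by rewrite sumrN opp_lfunE sum_lfunE.
Qed.
End Flag.

(** * Isolated solutions and the inverse function theorem *)

Section LocalInj.
Context {K: numF}.

Lemma mulmx_norm m n p (A: 'M[K]_(m, n)) (B: 'M[K]_(n, p)): `|A *m B| <= n%:R * (`|A| * `|B|).
apply: mxnorm_le=> [|i j];first by rewrite mulr_ge0 // mulr_ge0.
rewrite mxE;apply: le_trans (ler_norm_sum _ _ _) _.
have -> : n%:R * (`|A| * `|B|) = \sum_(l < n) (`|A| * `|B|) by rewrite sumr_const card_ord mulr_natl.
apply: ler_sum=> l _;rewrite normrM;apply: ler_pM=> //;exact: coord_norm.
Qed.

Lemma derive_mulJ m n (F: 'rV[K]_m -> 'rV[K]_n) z v: dfb F z -> 'D_v F z = v *m 'J F z.
by move=> dF;rewrite deriveE // /jacobian mul_rV_lin1. Qed.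

(** Differentiability at the single point z0 does not make F injective around z0, but it does
    isolate z0 in its own fibre. *)
Lemma local_inj m (F: 'rV[K]_m -> 'rV[K]_m) z0: dfb F z0 ->
 (forall v, 'D_v F z0 = 0 -> v = 0) -> 'J F z0 \in unitmx /\ \forall z \near z0, F z = F z0 -> z = z0.
move=> dF inj;have Ju: 'J F z0 \in unitmx.
 rewrite -row_free_unit;apply/inj_row_free=> v;rewrite -derive_mulJ //;exact: inj.
(* With a remainder of at most |w| / (2 M), and M larger than m |J^-1|, a solution at distance |w|
   from z0 satisfies |w| <= |w| / 2. *)
split=> //;set J := 'J F z0 in Ju;pose M: K := m%:R * `|invmx J| + 1.
have M0: 0 < M by rewrite ltr_wpDl // mulr_ge0.
have e0: 0 < (2 * M)^-1 by rewrite invr_gt0 mulr_gt0.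
have H:= diff_epsE dF e0.
have H2: \forall z \near z0, `|F z - F z0 - 'd F z0 (z - z0)| <= (2 * M)^-1 * `|z - z0|.
 have ct: {for z0, continuous (fun z: 'rV[K]_m => z - z0)}.
 apply: lsm_cont.
 exact: (lsm_add (lsm_id z0) (lsm_cst (- z0) z0)).
 have H': nbhs (z0 - z0) [set h | `|F (h + z0) - F z0 - 'd F z0 h| <= (2 * M)^-1 * `|h|].
 by rewrite subrr.
 have H3: \forall z \near z0, `|F (z - z0 + z0) - F z0 - 'd F z0 (z - z0)| <= (2 * M)^-1 * `|z - z0| := ct _ H'.
 by apply: filterS H3=> z;rewrite subrK.
apply: filterS H2=> z hz E;apply/eqP;rewrite -subr_eq0 -normr_eq0;set w := z - z0 in hz *.
rewrite E subrr sub0r normrN -deriveE // derive_mulJ // -/J in hz.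
have: `|w| <= 2^-1 * `|w|.
 rewrite -{1}(mulmxK Ju w);apply: le_trans (mulmx_norm _ _) _.
 apply: (@le_trans _ _ (m%:R * (((2 * M)^-1 * `|w|) * `|invmx J|))).
 by apply: ler_wpM2l=> //;apply: ler_wpM2r.
 have -> : m%:R * ((2 * M)^-1 * `|w| * `|invmx J|) = (m%:R * `|invmx J|) * M^-1 * (2^-1 * `|w|).
 by rewrite invfM;ring.
 rewrite -[leRHS]mul1r;apply: ler_wpM2r;first by rewrite mulr_ge0 ?invr_ge0.
 by rewrite ler_pdivrMr // mul1r /M lerDl.
rewrite -subr_ge0=> h;rewrite eq_le normr_ge0 andbT.
have: 0 <= - (2^-1 * `|w|) by apply: le_trans h _;rewrite le_eqVlt;apply/orP;left;apply/eqP;field.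
by rewrite oppr_ge0 pmulr_rle0 // invr_gt0.
Qed.

Lemma lsm_prod (V: nmod K) (I: Type) (r: seq I) (F: I -> V -> K) x :
 (forall i, lsm (F i) x) -> lsm (fun y => \prod_(i <- r) F i y) x.
move=> h;elim: r=> [|i r IH].
 have -> : (fun y => \prod_(i <- [::]) F i y) = (fun=> 1) by fext y;rewrite big_nil.
 exact: lsm_cst.
by apply: (lsm_ext _ (lsm_mul (h i) IH))=> y;rewrite big_cons.
Qed.

Lemma lsm_det (V: nmod K) n (A: V -> 'M[K]_n) x: lsm A x -> lsm (fun y => \det (A y)) x.
move=> /lsm_mx sA;apply: (lsm_sum (index_enum _))=> s.
by apply: lsm_mul;[exact: lsm_cst|apply: lsm_prod => i;exact: sA].
Qed.

Lemma lsm_J m (F: 'rV[K]_m -> 'rV[K]_m) z0: lsm F z0 -> 'J F z0 \in unitmx ->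
 \forall z \near z0, 'J F z \in unitmx.
move=> sF J0.
have sJ: lsm (fun z => \matrix_(i, j) ('D_(dlt i) F z 0 j: K)) z0.
 apply/lsm_mx=> i j;have /lsm_mx h := lsm_D (dlt i) sF.
 by apply: lsm_ext (h 0 j)=> z;rewrite mxE.
have EJ z: lsm F z -> 'J F z = \matrix_(i, j) ('D_(dlt i) F z 0 j: K).
 by move=> sz;mxext i j;rewrite [RHS]mxE (derive_mulJ _ (lsd sz)) -rowE [RHS]mxE.
have c:= differentiable_continuous (lsd (lsm_det sJ)).
have: nbhs (\det (\matrix_(i, j) ('D_(dlt i) F z0 0 j: K))) [set d: K | d != 0].
 have d0: \det (\matrix_(i, j) ('D_(dlt i) F z0 0 j: K)) != 0 by move: J0;rewrite EJ // unitmxE unitfE.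
 apply/nbhs_ballP;exists `|\det (\matrix_(i, j) ('D_(dlt i) F z0 0 j: K))|;rewrite /= ?normr_gt0 //.
 by move=> d;rewrite -ball_normE /= => hd;apply/eqP=> E;move: hd;rewrite E subr0 ltxx.
by move=> /c;apply: filterS2 (lsm_near sF)=> z sz;rewrite /= EJ // unitmxE unitfE.
Qed.
End LocalInj.

Section InverseFunction.
Context {R: realType}.
Notation C := (cnum R).

Lemma realifyK n (z: 'rV[C]_n): cplx (realify z) = z.
by rowext i;rewrite mxE /realify row_mxEl row_mxEr !mxE;apply: cpx_eq. Qed.
Lemma cplxK n (x: 'rV[R]_(n + n)): realify (cplx x) = x.
rewrite -[RHS]hsubmxK /realify;congr row_mx;rowext i;by rewrite !mxE.
Qed.

(** Minimize the square distance [phi y] from F to y over a closed ball, compact in real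
    coordinates. For y near F z0 the minimum is interior; the gradient vanishes there, and as the
    Jacobian is invertible so does F - y. *)
Lemma inverse_fun m (F: 'rV[C]_m -> 'rV[C]_m) z0 (U: set 'rV[C]_m): lsm F z0 ->
 (forall v, 'D_v F z0 = 0 -> v = 0) -> nbhs z0 U -> nbhs (F z0) (F @` U).
move=> sF inj nU;have [Ju li] := local_inj (lsd sF) inj.
pose x0 := realify z0.
pose p j (x: 'rV[R]_(m + m)): R := cRe (F (cplx x) 0 j).
pose q j (x: 'rV[R]_(m + m)): R := cIm (F (cplx x) 0 j).
have: \forall x \near x0, [/\ lsm F (cplx x), 'J F (cplx x) \in unitmx, F (cplx x) = F z0 -> cplx x = z0 & U (cplx x)].
 have nz: nbhs (cplx x0) [set z | [/\ lsm F z, 'J F z \in unitmx, F z = F z0 -> z = z0 & U z]].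
 rewrite realifyK;apply: filterS2 (filterI (lsm_near sF) (lsm_J sF Ju)) (filterI li nU).
 by move=> z [? ?] [? ?].
 exact: cplx_near nz.
move=> /nbhs_ballP[d0 /= d00 hd].
pose d := d0 / 2;have d_gt0: 0 < d by rewrite divr_gt0.
have {}hd x: `|x - x0| <= d -> [/\ lsm F (cplx x), 'J F (cplx x) \in unitmx, F (cplx x) = F z0 -> cplx x = z0 & U (cplx x)].
 move=> xd;apply: hd;rewrite -ball_normE /= distrC;apply: le_lt_trans xd _.
 by rewrite /d ltr_pdivrMr // mulr2n mulrDr mulr1 ltrDl.
have dp x j w: `|x - x0| <= d -> [/\ dfb (p j) x, dfb (q j) x,
 'D_w (p j) x = cRe ('D_(cplx w) F (cplx x) 0 j) & 'D_w (q j) x = cIm ('D_(cplx w) F (cplx x) 0 j)].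
 move=> /hd[sx _ _ _];have [e1 e2] := dfb_ij 0 j (lsd sx).
 have [p1 p2] := holo_Re e1;have [q1 q2] := holo_Im e1.
 by split;[exact: p1|exact: q1|rewrite p2 e2|rewrite q2 e2].
pose phi (y: 'rV[C]_m) (x: 'rV[R]_(m + m)): R :=
 \sum_j ((p j x - cRe (y 0 j)) ^+ 2 + (q j x - cIm (y 0 j)) ^+ 2).
have phi_ge0 y x: 0 <= phi y x by apply: sumr_ge0=> j _;rewrite addr_ge0 ?sqr_ge0.
have phi0 y x: phi y x = 0 -> F (cplx x) = y.
 move/eqP;rewrite psumr_eq0=> [/allP H|j _];last by rewrite addr_ge0 ?sqr_ge0.
 rowext j;have := H j (mem_index_enum _);rewrite /= paddr_eq0 ?sqr_ge0 // !sqrf_eq0 !subr_eq0.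
 by move=> /andP[/eqP h1 /eqP h2];apply: cpx_eq.
have dphi y x w: `|x - x0| <= d -> dfb (phi y) x /\
 'D_w (phi y) x = \sum_j 2 * ((p j x - cRe (y 0 j)) * 'D_w (p j) x + (q j x - cIm (y 0 j)) * 'D_w (q j) x).
 move=> xd.
 have h j: is_derive x w (fun x => (p j x - cRe (y 0 j)) ^+ 2 + (q j x - cIm (y 0 j)) ^+ 2)
 (2 * ((p j x - cRe (y 0 j)) * 'D_w (p j) x + (q j x - cIm (y 0 j)) * 'D_w (q j) x)).
 have [d1 d2 _ _] := dp x j w xd.
 have i1: is_derive x w (p j) ('D_w (p j) x) by apply: DeriveDef=> //;exact: dfd.
 have i2: is_derive x w (q j) ('D_w (q j) x) by apply: DeriveDef=> //;exact: dfd.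
 by apply: is_derive_eq;rewrite /GRing.scale /=;ring.
 have hd' j: dfb (fun x => (p j x - cRe (y 0 j)) ^+ 2 + (q j x - cIm (y 0 j)) ^+ 2) x.
 have [d1 d2 _ _] := dp x j w xd.
 pose g1 x := p j x - cRe (y 0 j);pose g2 x := q j x - cIm (y 0 j).
 have e1: dfb g1 x by apply: differentiableB=> //;exact: differentiable_cst.
 have e2: dfb g2 x by apply: differentiableB=> //;exact: differentiable_cst.
 exact: (differentiableD (differentiableM e1 e1) (differentiableM e2 e2)).
 have E: phi y = \sum_j (fun x => (p j x - cRe (y 0 j)) ^+ 2 + (q j x - cIm (y 0 j)) ^+ 2).
 by fext x';rewrite fct_sumE.
 split;first by rewrite E;exact: differentiable_sum.
 rewrite E derive_sum=> [|j];last by have [] := h j.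
 by sumext j;have [_ ->] := h j.
pose Bl: set 'rV[R]_(m + m) := [set x | `|x - x0| <= d].
have cpt (A: set 'rV[R]_(m + m)): closed A -> A `<=` Bl -> compact A.
 move=> clA AB;apply: bounded_closed_compact=> //;exists (`|x0| + d);split=> [|r hr x /AB xd];first exact: num_real.
 rewrite -(subrK x0 x);apply: le_trans (ler_normD _ _) _;apply: le_trans (ltW hr).
 by rewrite addrC lerD2l.
have cd: continuous (fun x: 'rV[R]_(m + m) => `|x - x0|).
 move=> x;have ct: {for x, continuous (fun x: 'rV[R]_(m + m) => x - x0)}.
 by apply: lsm_cont;apply: (lsm_add (lsm_id x) (lsm_cst (- x0) x)).
 exact: (continuous_comp ct (@norm_continuous _ _ _)).
have cB: compact Bl.
 have c1: closed ((fun x: 'rV[R]_(m + m) => `|x - x0|) @^-1` [set r: R | r <= d]).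
 by apply: preimage_closed=> [x _|];[exact: cd|exact: closed_le].
 exact: (cpt Bl c1 (fun x h => h)).
pose Sp: set 'rV[R]_(m + m) := [set x | `|x - x0| = d].
have cS: compact Sp.
 have c1: closed ((fun x: 'rV[R]_(m + m) => `|x - x0|) @^-1` [set r: R | r = d]).
 by apply: preimage_closed=> [x _|];[exact: cd|exact: closed_eq].
 by apply: (cpt Sp c1)=> x xS;rewrite /Bl /= (xS: `|x - x0| = d).
have cphi y (A: set 'rV[R]_(m + m)): A `<=` Bl -> {within A, continuous (phi y)}.
 move=> AB;apply: continuous_in_subspaceT=> x;rewrite inE=> /AB xB.
 by apply: differentiable_continuous;exact: (dphi y x 0 xB).1.
have [m0 [m00 hm]]: exists m0: R, 0 < m0 /\ forall x, Sp x -> m0 <= phi (F z0) x.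
 have [S0|S0] := eqVneq Sp set0;first by exists 1;split=> // x;rewrite S0.
 have /set0P S0' := S0.
 have [c cS' hc] := EVT_min_rV S0' cS (cphi (F z0) Sp (fun x (h: Sp x) => ltac:(by rewrite /Bl /= h))).
 exists (phi (F z0) c);split=> [|x Sx];last by apply: hc;rewrite inE.
 rewrite lt_def phi_ge0 andbT;apply/eqP=> /phi0 E;rewrite inE /Sp /= in cS'.
 have [_ _ h _] := hd c (eq_ind_r (fun t => t <= d) (lexx d) cS').
 by move: cS';rewrite -[c]cplxK (h E) subrr normr0=> d0';move: d_gt0;rewrite -d0' ltxx.
(* Since (a - b)^2 <= 2 a^2 + 2 b^2, a minimum on the sphere would give m0 <= 4 phi y x0; hence the
   bound m0 / 4. *)
have near_y: \forall y \near F z0, phi y x0 < m0 / 4.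
 pose ep: R := Num.min 1 (m0 / (8 * m.+1%:R)).
 have m1: 0 < 8 * m.+1%:R :> R by rewrite mulr_gt0 // ltr0n.
 have ep0: 0 < ep by rewrite lt_min ltr01 divr_gt0.
 have ep0': 0 < (ep%:C: C) by rewrite ltcR.
 apply/nbhs_ballP;exists (ep%:C: C)=> // y;rewrite -ball_normE /= => hy.
 have hj j: (p j x0 - cRe (y 0 j)) ^+ 2 + (q j x0 - cIm (y 0 j)) ^+ 2 <= 2 * ep.
 have nj: `|(F z0 - y) 0 j| <= ep%:C by apply: le_trans (coord_norm _ _ _) (ltW hy).
 have a1: `|p j x0 - cRe (y 0 j)| <= ep.
 by rewrite /p realifyK -raddfB -lecR;apply: le_trans (Re_norm _) _;move: nj;rewrite !mxE.
 have a2: `|q j x0 - cIm (y 0 j)| <= ep.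
 by rewrite /q realifyK -raddfB -lecR;apply: le_trans (Im_norm _) _;move: nj;rewrite !mxE.
 have ep1: ep <= 1 by rewrite ge_min lexx.
 have sq (t: R): `|t| <= ep -> t ^+ 2 <= ep.
 move=> ht;rewrite -real_normK ?num_real // expr2;apply: le_trans (ler_pM _ _ ht ht) _=> //.
 by rewrite -[leRHS]mulr1;apply: ler_wpM2l=> //;exact: ltW.
 by rewrite mulr2n mulrDl mul1r;apply: lerD;exact: sq.
 apply: le_lt_trans (ler_sum _ (fun j _ => hj j)) _.
 rewrite sumr_const card_ord -mulr_natl.
 have: ep <= m0 / (8 * m.+1%:R) by rewrite ge_min lexx orbT.
 rewrite ler_pdivlMr // -natr1=> h.
 have mg: 0 <= m%:R :> R by [].
 by nra.
apply: filterS near_y=> y hy.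
have Bx0: Bl x0 by rewrite /Bl /= subrr normr0 ltW.
have B0: Bl !=set0 by exists x0.
have [c cB' hc] := EVT_min_rV B0 cB (cphi y Bl (fun x h => h)).
rewrite inE in cB';have hc0:= hc x0 (mem_set Bx0).
have cd': `|c - x0| < d.
 rewrite lt_neqAle cB' andbT;apply/eqP=> cS';have h1:= hm c cS'.
 have: phi (F z0) c <= 2 * phi y c + 2 * phi y x0.
 rewrite !mulr_sumr -big_split /=;apply: ler_sum=> j _.
 have -> : p j x0 = cRe (F z0 0 j) by rewrite /p realifyK.
 have -> : q j x0 = cIm (F z0 0 j) by rewrite /q realifyK.
 set A := p j c;set B := q j c;set A0 := cRe (F z0 0 j);set B0' := cIm (F z0 0 j).
 set y1 := cRe (y 0 j);set y2 := cIm (y 0 j).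
 rewrite -subr_ge0 (_: _ - _ = (A + A0 - 2 * y1) ^+ 2 + (B + B0' - 2 * y2) ^+ 2);first by rewrite addr_ge0 ?sqr_ge0.
 by ring.
 move: hy hc0 h1;lra.
have [sc Jc _ Uc] := hd c (ltW cd').
exists (cplx c)=> //;apply: phi0.
have Dz w: 'D_w (phi y) c = 0.
 pose rho := (d - `|c - x0|) / (`|w| + 1).
 have w1: 0 < `|w| + 1 by rewrite ltr_wpDl.
 have rho0: 0 < rho by rewrite divr_gt0 // subr_gt0.
 have inB (t: R): `|t| < rho -> `|t *: w + c - x0| <= d.
 rewrite /rho ltr_pdivlMr // => ht;rewrite -addrA;apply: le_trans (ler_normD _ _) _.
 rewrite normrZ;have t0:= normr_ge0 t;move: ht;rewrite mulrDr mulr1;move: (`|t| * `|w|) (`|c - x0|) => A1 A2;lra.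
 pose g (t: R) := phi y (t *: w + c).
 have ld (t: R): `|t| < rho -> is_derive t (1:R) g ('D_w (phi y) (t *: w + c)).
 move=> ht;apply: (@line_derive R R idfun idfun)=> //=;try by move=> e e0';exists e.
 exact: (dphi y _ w (inB t ht)).1.
 have g0: is_derive (0:R) (1:R) g 0.
 apply: (@derive1_at_min R g (- rho) rho 0).
 - by rewrite ge0_cp // ltW.
 - by move=> t;rewrite in_itv /= => /andP[h1 h2];have [] := ld t (_: `|t| < rho);rewrite ?ltr_norml ?h1.
 - by rewrite in_itv /= oppr_lt0 rho0.
 - move=> t;rewrite in_itv /= => /andP[h1 h2];rewrite /g scale0r add0r;apply: hc.
 by rewrite inE;apply: inB;rewrite ltr_norml h1.
 have r0: `|0: R| < rho by rewrite normr0.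
 have [_ e1] := g0;have [_ e2] := ld 0 r0.
 by move: e2;rewrite e1 scale0r add0r.
(* The direction along which F moves by F(c) - y; the derivative of [phi y] along it is twice
   [phi y]. *)
pose v := (F (cplx c) - y) *m invmx ('J F (cplx c)).
have vE: 'D_v F (cplx c) = F (cplx c) - y by rewrite derive_mulJ ?mulmxKV //;exact: lsd.
have := Dz (realify v);rewrite (dphi y c _ (ltW cd')).2 -mulr_sumr=> /eqP.
rewrite mulf_eq0 pnatr_eq0 /= => /eqP E;rewrite -[RHS]E;sumext j.
have [_ _ -> ->] := dp c j (realify v) (ltW cd').
by rewrite realifyK vE /p /q !mxE !raddfB /= !expr2.
Qed.
End InverseFunction.

(** * Smoothness and coordinates of one-parameter subgroups *)

Section OneParam.
Context {K: numF} {k: nat} (G: lie_group K k).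
Notation e := (echart G).
Notation x0 := (coord (echart G) (gone G)).
Let ae: atlas e := echart_atlas G.
Let e1: dom e (gone G) := echart_one G.
Let oke: chart_ok e := atlas_ok ae.
Let ix0: img e x0 := img_coord e1.
Let pe0: param e x0 = gone G := coordK oke e1.

Lemma gmul_cont (T: topologicalType) (f g: T -> G) (t: T): {for t, continuous f} -> {for t, continuous g} ->
 {for t, continuous (fun s => gmul (f s) (g s))}.
move=> cf cg;have cfg: {for t, continuous (fun y => (f y, g y))} by exact: cvg_pair.
have [cm _] := @gmul_smooth _ _ G.
exact: (@continuous_comp _ _ _ (fun y => (f y, g y)) (fun p: (G * G)%type => gmul p.1 p.2) t cfg (cm _)).
Qed.

Lemma gam_derive p q (gam: K -> G) w (f: G -> 'M[K]_(p, q)): one_param gam w ->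
 lsm (fun y => f (param e y)) x0 ->
 derivable (fun s => f (gam s)) 0 1 /\ 'D_1 (fun s => f (gam s)) 0 = 'D_w (fun y => f (param e y)) x0.
move=> op sf;have g0:= one_param0 op;have [cg gD dg] := op.
have d0: dfb (fun s => coord e (gam s)) 0 by apply/dfdP;case: dg.
have n0: \forall s \near (0: K), f (gam s) = f (param e (coord e (gam s))).
 have nd: nbhs (gam 0) (dom e) by rewrite g0;apply: onbhs;split=> //;have [] := oke.
 have h: \forall s \near (0: K), dom e (gam s) := cg 0 _ nd.
 by apply: filterS h=> s ds;rewrite coordK.
have df: dfb (fun y => f (param e y)) (coord e (gam 0)) by rewrite g0;exact: lsd.
have dc:= dfb_comp d0 df.
have n0': \forall s \near (0: K), f (param e (coord e (gam s))) = f (gam s) by apply: filterS n0=> s ->.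
split;first by apply: dfd;exact: near_dfb n0' dc.
rewrite (derv_eq _ n0) (@derive_comp _ _ _ _ (fun s => coord e (gam s)) (fun y => f (param e y))) //.
rewrite g0 in df *.
rewrite deriveE // diff_rV_sum //;sumext i;rewrite (dfb_ij 0 i d0).2.
by have [_ ->] := dg.
Qed.

Lemma gam_derive_at p q (gam: K -> G) w (f: G -> 'M[K]_(p, q)) t: one_param gam w ->
 lsm (fun y => f (gmul (gam t) (param e y))) x0 ->
 dfb (fun s => f (gam s)) t /\
 'D_1 (fun s => f (gam s)) t = 'D_w (fun y => f (gmul (gam t) (param e y))) x0.
move=> op sf;have [_ gD _] := op.
have [d1 d2] := @gam_derive _ _ gam w (fun a => f (gmul (gam t) a)) op sf.
have FH s: f (gam (s + t)) = f (gmul (gam t) (gam s)) by rewrite addrC gD.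
have [h1 h2] := @derive_translate _ _ (fun s => f (gam s)) _ t FH d1.
by split;[apply/dfdP|rewrite h2 d2].
Qed.

Lemma one_param_conj (gam: K -> G) w g: one_param gam w ->
 one_param (fun s => gconj g (gam s)) (admap g w).
move=> op;have [cg gD dg] := op;split.
- move=> s;have cc (a: G): {for s, continuous (fun _: K => a)} by exact: cst_continuous.
 have c1: {for s, continuous (fun s => gmul g (gam s))} by exact: (@gmul_cont K (fun=> g) gam s (cc g) (cg s)).
 exact: (@gmul_cont K (fun s => gmul g (gam s)) (fun=> ginv g) s c1 (cc _)).
- by move=> s t;rewrite gD gconjM.
have := @gam_derive _ _ gam w (fun a => coord e (gconj g a)) op (adf_lsm g).
by case=> d1 d2;apply: DeriveDef.
Qed.

(** At the identity the multiplication restricts to the identity on each factor, so its differential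
    is addition. *)
Lemma derive_gmul (V: nmod K) (f g: V -> G) x v: gsm f x -> gsm g x ->
 f x = gone G -> g x = gone G ->
 'D_v (fun y => coord e (gmul (f y) (g y))) x =
 'D_v (fun y => coord e (f y)) x + 'D_v (fun y => coord e (g y)) x.
move=> sf sg f1 g1.
have df: dom e (f x) by rewrite f1. have dg: dom e (g x) by rewrite g1.
have lf:= sf.2 e ae df;have lg:= sg.2 e ae dg.
pose F (z: 'rV[K]_(k + k)) := mu G (lsubmx z) (rsubmx z).
have sF: lsm F (row_mx x0 x0) := mu_lsm G.
have E: \forall y \near x, coord e (gmul (f y) (g y)) = F (row_mx (coord e (f y)) (coord e (g y))).
 apply: filterS2 (gsm_near_dom sf ae df) (gsm_near_dom sg ae dg)=> y [_ E1] [_ E2].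
 by rewrite /F /mu row_mxKl row_mxKr E1 E2.
rewrite (derv_eq _ E).
have lrow:= lsm_row lf lg.
rewrite (@derive_comp _ _ _ _ (fun y => row_mx (coord e (f y)) (coord e (g y))) F);first last.
- by rewrite f1 g1;exact: lsd.
- exact: lsd.
have rE i: 'D_v (fun y => row_mx (coord e (f y)) (coord e (g y)) 0 i: K) x =
 row_mx ('D_v (fun y => coord e (f y)) x) ('D_v (fun y => coord e (g y)) x) 0 i.
 case: (split_ordP i)=> i' ->.
 rewrite row_mxEl -(dfb_ij 0 i' (lsd lf)).2;congr ('D_ _ _ _).
 by fext y;rewrite row_mxEl.
 rewrite row_mxEr -(dfb_ij 0 i' (lsd lg)).2;congr ('D_ _ _ _).
 by fext y;rewrite row_mxEr.
under eq_bigr do rewrite rE.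
rewrite f1 g1 -diff_rV_sum;last exact: lsd.
rewrite -deriveE;last exact: lsd.
set a := 'D_v _ x;set b := 'D_v _ x.
have -> : row_mx a b = 1 *: row_mx a 0 + row_mx 0 b by rewrite scale1r add_row_mx addr0 add0r.
rewrite derive_lin;last exact: lsd.
rewrite scale1r -derive_part1 -?derive_part2;try exact: lsd.
congr (_ + _).
 via ('D_a (fun y: 'rV[K]_k => y) x0);last exact: derive_id.
 by apply: derv_eq;apply: filterS (mu1 G)=> y [h _];rewrite /F row_mxKl row_mxKr.
via ('D_b (fun y: 'rV[K]_k => y) x0);last exact: derive_id.
by apply: derv_eq;apply: filterS (mu1 G)=> y [_ h];rewrite /F row_mxKl row_mxKr.
Qed.

(** Translation turns the derivative at 0 into the equation y' = V(y) in the chart, with V the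
    left-invariant field of [w]. As V is smooth, the equation raises the order of differentiability
    of y step by step. *)
Lemma one_param_gsm (gam: K -> G) w: one_param gam w -> gsm gam 0.
move=> op;have g0:= one_param0 op;have [cg gD dg] := op.
pose y (t: K) := coord e (gam t).
pose F (z: 'rV[K]_(k + k)) := mu G (lsubmx z) (rsubmx z).
have sF: lsm F (row_mx x0 x0) := mu_lsm G.
pose V x := 'D_w (fun y' => F (row_mx x y')) x0.
have sV: lsm V x0 by exact: lsm_D2.
have nd: nbhs (gam 0) (dom e) by rewrite g0;apply: onbhs;split=> //;have [] := oke.
have cy: {for (0: K), continuous y}.
 by apply: differentiable_continuous;apply/dfdP;case: dg.
have near_dom: \forall t \near (0: K), dom e (gam t) := cg 0 _ nd.
have y0: y 0 = x0 by rewrite /y g0.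
have [U [oU Ux sU]] := sV.
have nU: \forall t \near (0: K), U (y t).
 by apply: (cy U);rewrite y0;apply: onbhs.
have nL: \forall t \near (0: K), lsm F (row_mx (y t) x0).
 have cp:= row_mx_contl x0.
 have h1: \forall x' \near x0, lsm F (row_mx x' x0) := cp _ (lsm_near sF).
 by apply: (cy [set x | lsm F (row_mx x x0)]);rewrite y0.
have nE: \forall s \near (0: K), param e (y s) = gam s by apply: filterS near_dom=> s ds;rewrite /y coordK.
have ode1 t: dom e (gam t) -> lsm F (row_mx (y t) x0) -> dfb y t /\ 'D_1 y t = V (y t).
 move=> dt sFt;pose H s := coord e (gmul (gam t) (gam s)).
 have gs: gsm (fun z => gmul (gam t) (param e z)) x0.
 by apply: gsm_mul;[exact: gsm_cst|exact: gsm_param].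
 have l: lsm (fun z => coord e (gmul (gam t) (param e z))) x0.
 by apply: gs.2=> //;rewrite pe0 gmul1'.
 have [d1 d2] := @gam_derive _ _ gam w (fun a => coord e (gmul (gam t) a)) op l.
 have FH s: y (s + t) = H s by rewrite /y /H addrC gD.
 have [h1 h2] := @derive_translate _ _ y H t FH d1.
 split;first by apply/dfdP.
 rewrite h2 d2 /V;suff -> : (fun y' => F (row_mx (y t) y')) = (fun z => coord e (gmul (gam t) (param e z))) by [].
 by fext z;rewrite /F /mu row_mxKl row_mxKr /y coordK.
have [Q [oO O0 hO]]: exists O: set K, [/\ open O, O 0 & forall t, O t ->
 [/\ dom e (gam t), lsm F (row_mx (y t) x0) & U (y t)]].
 pose A: set K := [set t | [/\ dom e (gam t), lsm F (row_mx (y t) x0) & U (y t)]].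
 have nA: nbhs (0: K) A by apply: filterS2 near_dom (filterI nL nU)=> t ? [].
 exists (A°)%classic;split=> [| |t /interior_subset //];[exact: open_interior|exact: nA].
have sy m: smn m Q y.
 elim: m=> [|m IH].
 by split=> // t Ot;have [dt lt _] := hO t Ot;exact: (ode1 t dt lt).1.
 split=> [t Ot|v];first by have [dt lt _] := hO t Ot;exact: (ode1 t dt lt).1.
 have sVy: smn m Q (fun t => v *: V (y t)).
 have sVt: smn m Q (fun t => V (y t)).
 apply/(smn_mx _ _ oO)=> i j;apply: (@smn_comp _ _ _ m Q U y (fun z => V z i j))=> //.
 by move=> t /hO[].
 by have /(smn_mx _ _ oU) := sU m;exact.
 apply/(smn_mx _ _ oO)=> i j;have /(smn_mx _ _ oO) /(_ i j) h := sVt.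
 have -> : (fun t => (v *: V (y t)) i j) = (fun t => v * V (y t) i j) by fext t;rewrite mxE.
 by apply: smn_M=> //;exact: smn_cst.
 apply: smn_eq oO _ sVy=> t Ot;have [dt lt _] := hO t Ot;have [dy E] := ode1 t dt lt.
 rewrite -E !deriveE // -[v in RHS]mulr1.
 exact: esym (@linearZ_LR _ _ _ _ ('d y t) v 1).
have ly: lsm y 0 by exists Q;split.
apply: (@gsm_chart _ _ _ _ gam 0 e)=> //;first exact: cg.
by rewrite g0.
Qed.

Lemma lsm_comp1 (V: nmod K) p q (g: V -> K) (f: K -> 'M[K]_(p, q)) x :
 lsm g x -> lsm f (g x) -> lsm (fun y => f (g y)) x.
move=> sg /lsm_mx sf;apply/lsm_mx=> i j;have [Q [oQ Qgx hf]] := sf i j.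
have cg: {for x, continuous g} by exact: lsm_cont.
have [U [oU Ux hg]] := sg.
have Wx: nbhs x [set y | Q (g y) /\ U y].
 apply: filterI;last exact: onbhs.
 by apply: cg;exact: onbhs.
exists [set y | Q (g y) /\ U y]°;split=> [| |m];first exact: open_interior.
 exact: Wx.
apply: (@smn_comp1 _ _ m _ Q g (fun t => f t i j))=> //;first exact: open_interior.
 by move=> y /interior_subset[].
by apply: smn_subset (hg m)=> y /interior_subset[].
Qed.

Lemma derive_affine m p (c: 'rV[K]_p) (L: 'rV[K]_m -> 'rV[K]_p) x v: linear L ->
 'D_v (fun z => c + L z) x = L v.
move=> lL;pose LL: {linear 'rV[K]_m -> 'rV[K]_p} := HB.pack L (GRing.isLinear.Build K _ _ _ L lL).
have dL: dfb L x by apply: lsd;exact: lsm_linear.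
rewrite (@deriveD _ _ _ (cst c) L);[|exact: derivable_cst|exact: dfd].
by rewrite derive_cst add0r;exact: (derive_linear LL).
Qed.

Lemma one_param_coord m (gam: K -> G) w (i: 'I_m) (z: 'rV[K]_m): one_param gam w -> z 0 i = 0 ->
 gsm (fun z: 'rV[K]_m => gam (z 0 i)) z /\
 forall v, 'D_v (fun z: 'rV[K]_m => coord e (gam (z 0 i))) z = v 0 i *: w.
move=> op z0;have gg:= one_param_gsm op;have g0:= one_param0 op;have [cg gD dg] := op.
have sc: lsm (fun z: 'rV[K]_m => z 0 i: K) z by have /lsm_mx := lsm_id z;exact.
have cz:= lsm_cont sc.
have d0: dom e (gam 0) by rewrite g0.
have ly: lsm (fun t => coord e (gam t)) (z 0 i) by rewrite z0;exact: gg.2 e ae d0.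
split.
 apply: (@gsm_chart _ _ _ _ _ z e)=> //;last exact: (lsm_comp1 sc ly);last by rewrite z0.
 exact: (@continuous_comp _ _ _ (fun z: 'rV[K]_m => z 0 i) gam z cz (cg _)).
move=> v;rowext j;have dl:= lsd (lsm_comp1 sc ly).
rewrite -(dfb_ij 0 j dl).2 mxE;have [dy Dy] := dfb_ij 0 j (lsd ly).
rewrite (@derive_comp1 _ _ (fun z: 'rV[K]_m => z 0 i) (fun t => coord e (gam t) 0 j)) //;last exact: lsd.
rewrite Dy (dfb_ij 0 i (lsd (lsm_id z))).2 derive_id z0.
by have [_ ->] := dg.
Qed.
End OneParam.

(** * The quotient by P: tangent map, dimension, and the local form of P *)

Section PGeom.
Context {R: realType}.
Notation C := (cnum R).

Lemma const_ball (F: C -> C) (rho: R): (forall t: C, `|t| < rho%:C -> dfb F t /\ 'D_1 F t = 0) ->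
 forall t: C, `|t| < rho%:C -> F t = F 0.
move=> H t ht.
have inb (s: R): s \in `[0, 1]%R -> `|s%:C *: t + 0| < rho%:C :> C.
 rewrite in_itv /= => /andP[s0 s1];rewrite addr0 normrZ normCR;apply: le_lt_trans ht.
 by rewrite -[leRHS]mul1r;apply: ler_wpM2r=> //;rewrite -[1]/(1%:C) lecR ger0_norm.
have D0 (s: R): s \in `[0, 1]%R -> 'D_t F (s%:C *: t + 0) = 0.
 by move=> /inb /H [d1 d2];rewrite (derive_K1 _ d1) d2 mulr0.
have main (f: R -> R): (forall s: R, s \in `[0, 1]%R -> is_derive s (1:R) f 0) -> f 1 = f 0.
 move=> hf.
 have h1 (s: R): s \in `](0:R), (1:R)[%R -> is_derive s (1:R) f ((fun=> 0) s).
 by rewrite in_itv /= => /andP[h1 h2];apply: hf;rewrite in_itv /= !ltW.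
 have h2: {within `[(0:R), (1:R)], continuous f}.
 by apply: derivable_within_continuous=> s /hf[].
 have [c _] := MVT_segment (ler01: (0:R) <= 1) h1 h2.
 by rewrite mul0r=> /eqP;rewrite subr_eq0=> /eqP.
have E1: F (1%:C *: t + 0) = F t by rewrite scale1r addr0.
have E0: F (0%:C *: t + 0) = F 0 by rewrite scale0r addr0.
rewrite -E1 -E0;apply: cpx_eq.
 apply: (main (fun s: R => cRe (F (s%:C *: t + 0))))=> s hs.
 by have := @line_Re R _ F 0 t s (H _ (inb s hs)).1;rewrite D0.
apply: (main (fun s: R => cIm (F (s%:C *: t + 0))))=> s hs.
by have := @line_Im R _ F 0 t s (H _ (inb s hs)).1;rewrite D0.
Qed.

(** A complex derivative can be computed along the real line. This links [closed_subgroup_of], which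
    controls real times only, to holomorphic maps. *)
Lemma real_const (F: C -> C) (c: C): derivable F 0 1 -> (forall t: R, F t%:C = c) -> 'D_1 F 0 = 0.
move=> dF Fc;have df: dfb F 0 by apply/dfdP.
have z0: (0:R)%:C *: (1: C) + 0 = 0 :> C by rewrite scale0r addr0.
have df0: dfb F ((0:R)%:C *: (1: C) + 0) by rewrite z0.
have E (s: R): s%:C *: (1: C) + 0 = s%:C by rewrite addr0 [_ *: _]mulr1.
have := line_Re df0;have := line_Im df0;rewrite z0.
have -> : (fun t: R => cIm (F (t%:C *: (1: C) + 0))) = (fun=> cIm c) by fext s;rewrite E Fc.
have -> : (fun t: R => cRe (F (t%:C *: (1: C) + 0))) = (fun=> cRe c) by fext s;rewrite E Fc.
by case=> _;rewrite derive_cst=> i0 [_];rewrite derive_cst=> r0;apply: cpx_eq.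
Qed.

Context {k n: nat} (GC: lie_group C k) (X: manifold C n) (P: set GC) (pr: GC -> X).
Variable Lset: set 'rV[C]_k.
Context (HP: closed_subgroup_of Lset P)
 (Hq: quotient_manifold P pr).
Notation e := (echart GC).
Notation x0 := (coord (echart GC) (gone GC)).
Let ae: atlas e := echart_atlas GC.
Let e1: dom e (gone GC) := echart_one GC.
Let oke: chart_ok e := atlas_ok ae.
Let ix0: img e x0 := img_coord e1.
Let pe0: param e x0 = gone GC := coordK oke e1.
Let P1: P (gone GC). by have [[]] := HP. Qed.
Let PM x y: P x -> P y -> P (gmul x y). by have [[]] := HP=> _ h _ _ _ _;exact: h. Qed.
Let PV x: P x -> P (ginv x). by have [[]] := HP=> _ _ h _ _ _;exact: h. Qed.
Let prE a b: pr a = pr b <-> P (gmul (ginv a) b). by have [_ h _] := Hq. Qed.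

Lemma pr_mulP g p: P p -> pr (gmul g p) = pr g.
by move=> Pp;apply/esym/prE;rewrite gmulVK. Qed.
Lemma pr_left g a b: pr a = pr b -> pr (gmul g a) = pr (gmul g b).
by move=> /prE h;apply/prE;rewrite ginvM -gmulA gmulVK. Qed.
Lemma pr_gsm (V: nmod C) (f: V -> GC) x: gsm f x -> gsm (fun y => pr (f y)) x.
by move=> sf;have [sp _ _] := Hq;apply: (@gsm_map _ _ _ _ _ _ setT)=> //;exact: openT. Qed.
Lemma lgsm g: gsm (fun y => gmul g (param e y)) x0.
by apply: gsm_mul;[exact: gsm_cst|exact: gsm_param]. Qed.
Lemma pr_lsm g d: atlas d -> dom d (pr g) -> lsm (fun y => coord d (pr (gmul g (param e y)))) x0.
by move=> ad dg;apply: (pr_gsm (lgsm g)).2=> //;rewrite pe0 gmul1'. Qed.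

(** The tangent map of the projection at g, in the left trivialization. *)
Definition dpr g (d: chart C n X) w := 'D_w (fun y => coord d (pr (gmul g (param e y)))) x0.

Lemma dpr_lin g d a u w: atlas d -> dom d (pr g) -> dpr g d (a *: u + w) = a *: dpr g d u + dpr g d w.
by move=> ad dg;apply: derive_lin;apply: lsd;exact: pr_lsm. Qed.

(** Left translation by g' g^-1 descends to the quotient. Read through a local section it is the
    smooth map [H] between charts, so a vector killed at g is killed at g'. *)
Lemma dpr_transfer g d g' d' w: atlas d -> dom d (pr g) -> atlas d' -> dom d' (pr g') ->
 dpr g d w = 0 -> dpr g' d' w = 0.
move=> ad dg ad' dg' Hw;have okd:= atlas_ok ad.
have [_ _ hs] := Hq;have [U [s [[oU sU hU] Ug]]] := hs (pr g).
pose z0 := coord d (pr g).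
pose H z := coord d' (pr (gmul (gmul g' (ginv g)) (s (param d z)))).
have pz0: param d z0 = pr g by rewrite /z0 coordK.
have prs: pr (gmul (gmul g' (ginv g)) (s (pr g))) = pr g'.
 by rewrite (pr_left (gmul g' (ginv g)) (hU _ Ug: pr (s (pr g)) = pr g)) -gmulA gmulV gmul1'.
have sH: lsm H z0.
 have g1: gsm (fun z => s (param d z)) z0.
 apply: (@gsm_map _ _ _ _ _ _ U)=> //;first by rewrite pz0.
 by apply: gsm_param=> //;exact: img_coord.
 have g2: gsm (fun z => gmul (gmul g' (ginv g)) (s (param d z))) z0 by apply: gsm_mul=> //;exact: gsm_cst.
 by apply: (pr_gsm g2).2=> //;rewrite pz0 prs.
have sp:= pr_gsm (lgsm g).
have nd: nbhs (pr (gmul g (param e x0))) (dom d `&` U).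
 rewrite pe0 gmul1';apply: filterI;apply: onbhs;split=> //;by have [] := okd.
have nE: \forall y \near x0, coord d' (pr (gmul g' (param e y))) = H (coord d (pr (gmul g (param e y)))).
 have h: \forall y \near x0, (dom d `&` U) (pr (gmul g (param e y))) := sp.1 _ nd.
 apply: filterS h=> y [dy Uy];rewrite /H coordK //;congr (coord d' _).
 have -> : gmul g' (param e y) = gmul (gmul g' (ginv g)) (gmul g (param e y)).
 by rewrite -gmulA gmulVK.
 by apply: pr_left;rewrite hU.
have E0: coord d (pr (gmul g (param e x0))) = z0 by rewrite pe0 gmul1'.
rewrite /dpr (derv_eq _ nE).
rewrite (@chain_rule _ _ _ _ (fun y => coord d (pr (gmul g (param e y)))) H);first last.
- by rewrite E0;exact: lsd.
- by apply: lsd;exact: pr_lsm.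
by rewrite -/(dpr g d w) Hw E0 deriveE ?linear0 //;exact: lsd.
Qed.

Lemma gam_pr gam w t d: one_param gam w -> atlas d -> dom d (pr (gam t)) ->
 dfb (fun s => coord d (pr (gam s))) t /\ 'D_1 (fun s => coord d (pr (gam s))) t = dpr (gam t) d w.
move=> op ad dt;exact: (@gam_derive_at _ _ _ _ _ gam w (fun a => coord d (pr a)) t op (pr_lsm ad dt)).
Qed.

Lemma L_ker w d: Lset w -> atlas d -> dom d (pr (gone GC)) -> dpr (gone GC) d w = 0.
move=> Lw ad d1;have [_ _ _ HL] := HP;have [gam op hg] := (HL w).1 Lw.
have g0:= one_param0 op;have [|dF DF] := gam_pr (t := 0) op ad;first by rewrite g0.
rewrite -g0 -DF;rowext i;rewrite mxE -(dfb_ij 0 i dF).2.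
apply: (@real_const _ (coord d (pr (gone GC)) 0 i))=> [|t].
 by apply: dfd;exact: (dfb_ij 0 i dF).1.
by rewrite -[gam _]gmul1 pr_mulP.
Qed.

(** gam t is a power of gam(t / m), and t / m is small for large m. *)
Lemma P_gen gam: (forall s t, gam (s + t) = gmul (gam s) (gam t)) -> forall (rho: R), 0 < rho ->
 (forall t: C, `|t| < rho%:C -> P (gam t)) -> forall t: C, P (gam t).
move=> gD rho r0 H t.
pose b := cRe `|t| / rho;have tE: `|t| = (cRe `|t|)%:C by [].
have t0: 0 <= cRe `|t| by have := normr_ge0 t;rewrite tE -[0]/(0%:C) lecR.
have b0: 0 <= b by rewrite divr_ge0 // ltW.
pose m := Num.bound b;have hm: b < m.+1%:R by apply: lt_trans (archi_boundP b0) _;rewrite ltr_nat.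
have ht: `|t / m.+1%:R| < rho%:C :> C.
 rewrite normf_div tE normr_nat -(rmorph_nat (@real_complex R)) -fmorphV -rmorphM ltcR.
 by rewrite ltr_pdivrMr ?ltr0n // mulrC -ltr_pdivrMr.
have g0: P (gam 0).
 by apply: H;rewrite normr0 ltcR.
have PS j: P (gam ((t / m.+1%:R) *+ j)).
 by elim: j=> [|j IH];rewrite ?mulr0n // mulrS gD;apply: PM => //;exact: H.
by have := PS m.+1;rewrite -mulr_natr divfK // pnatr_eq0.
Qed.

(** By [dpr_transfer] the projected curve has zero derivative as long as it stays in the chart, so
    it is constant on a disc around 0, and gam lies in P there; [P_gen] does the rest. *)
Lemma ker_P gam w d: one_param gam w -> atlas d -> dom d (pr (gone GC)) -> dpr (gone GC) d w = 0 ->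
 forall t: C, P (gam t).
move=> op ad d1 Hw;have g0:= one_param0 op;have [cg gD _] := op.
have okd:= atlas_ok ad.
have nd: nbhs (pr (gam 0)) (dom d) by rewrite g0;apply: onbhs;split=> //;have [] := okd.
have cp: {for (0: C), continuous (fun t => pr (gam t))} by exact: (pr_gsm (one_param_gsm op)).1.
have h: \forall t \near (0: C), dom d (pr (gam t)) := cp _ nd.
move: h=> /nbhs_ballP[r /= /Cpos[rho rho0 ->] hr].
apply: (P_gen gD rho0)=> t ht.
have dt (s: C): `|s| < rho%:C -> dom d (pr (gam s)).
 by move=> hs;apply: hr;rewrite -ball_normE /= sub0r normrN.
have E: coord d (pr (gam t)) = coord d (pr (gam 0)).
 rowext i;apply: (@const_ball (fun s => coord d (pr (gam s)) 0 i) rho)=> // s hs.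
 have [dF DF] := gam_pr op ad (dt s hs).
 split;first exact: (dfb_ij 0 i dF).1.
 by rewrite (dfb_ij 0 i dF).2 DF (dpr_transfer ad d1 ad (dt s hs) Hw) mxE.
have Ep: pr (gam 0) = pr (gam t).
 by rewrite -(coordK okd (dt t ht)) E coordK // g0.
by have := (prE _ _).1 Ep;rewrite g0 ginv1 gmul1.
Qed.

Lemma L_Ad g w: P g -> Lset w -> Lset (admap g w).
move=> Pg;have [_ _ _ HL] := HP=> /HL[gam op hg];apply/HL.
exists (fun s => gconj g (gam s));first exact: one_param_conj.
by move=> t;apply: (PM (PM Pg (hg t)) (PV Pg)).
Qed.

(** Closure under the bracket, tested on linear forms [c] that vanish on L: c(Ad(gam t) w2) is 0 for
    all real t, hence so is its complex derivative at 0. *)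
Lemma L_lb (c: 'cV[C]_k) w1 w2: (forall w, Lset w -> w *m c = 0) -> Lset w1 -> Lset w2 ->
 lbr (@adm C k GC) w1 w2 *m c = 0.
move=> c0 L1 L2;have [_ _ _ HL] := HP;have [gam op hg] := (HL w1).1 L1.
have H:= Adm_rep GC;have sA:= rep_lsm0 H.
pose f (a: GC): 'M[C]_1 := c^T *m Adm a *m w2^T.
have sf1: lsm (fun y => c^T *m Adm (param e y)) x0 by apply: lsm_mulmx=> //;exact: lsm_cst.
have sf: lsm (fun y => f (param e y)) x0 by apply: lsm_mulmx=> //;exact: lsm_cst.
have [d1 d2] := gam_derive op sf.
have df: dfb (fun s => f (gam s)) 0 by apply/dfdP.
have E: 'D_w1 (fun y => f (param e y)) x0 = c^T *m @adm C k GC w1 *m w2^T.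
 by rewrite (derive_mulmxr _ _ (lsd sf1)) (derive_mulmxl _ _ (lsd sA)).
have z: (c^T *m @adm C k GC w1 *m w2^T) 0 0 = 0.
 rewrite -E -d2 -(dfb_ij 0 0 df).2;apply: (@real_const _ 0)=> [|t].
 by apply: dfd;exact: (dfb_ij 0 0 df).1.
 have := c0 _ (L_Ad (hg t) L2);rewrite AdmE=> /(congr1 trmx);rewrite !trmx_mul trmxK trmx0.
 by rewrite mulmxA /f=> ->;rewrite mxE.
apply/trmx_inj;rewrite /lbr !trmx_mul trmxK trmx0 mulmxA.
by mxext i j;rewrite !ord1 z mxE.
Qed.

Lemma ker_L0 w d (gam: C -> GC): one_param gam w -> atlas d -> dom d (pr (gone GC)) -> dpr (gone GC) d w = 0 -> Lset w.
move=> op ad d1 Hw;have [_ _ _ HL] := HP;apply/HL;exists gam=> // t.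
exact: ker_P op ad d1 Hw _.
Qed.

Context (L_add: forall x y, Lset x -> Lset y -> Lset (x + y))
 (uL: forall xi, exists a l, [/\ xi = a + l, exists gam: C -> GC, one_param gam a & Lset l]).

(** [ker_P] asks for a one-parameter subgroup; [uL] provides one for w modulo L, and L itself lies
    in the kernel. *)
Lemma ker_L g w d: atlas d -> dom d (pr g) -> dpr g d w = 0 -> Lset w.
move=> ad dg H0;have [d1 ad1 dd1] := atlas_cover (pr (gone GC)).
have H:= dpr_transfer ad dg ad1 dd1 H0.
have [a [l [E [gam op] Ll]]] := uL w;rewrite E;apply: (L_add _ Ll).
apply: (ker_L0 op ad1 dd1);have := L_ker Ll ad1 dd1;move: H.
have h:= dpr_lin 1 a l ad1 dd1;rewrite [1 *: a]scale1r -E in h.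
move=> H' hl;rewrite H' hl addr0 in h.
by rewrite -[LHS]scale1r.
Qed.

Lemma L_ker_all g w d: Lset w -> atlas d -> dom d (pr g) -> dpr g d w = 0.
move=> Lw ad dg;have [d1 ad1 dd1] := atlas_cover (pr (gone GC)).
exact: dpr_transfer ad1 dd1 ad dg (L_ker Lw ad1 dd1).
Qed.

(** Differentiate the identity y = coord c (pr (s (param c y))). *)
Lemma section_dpr U s c x w: local_section pr U s -> atlas c -> img c x -> U (param c x) ->
 gsm (fun y => s (param c y)) x /\ dpr (s (param c x)) c (vel (fun y => s (param c y)) x w) = w.
move=> [oU sU hU] ac ix Ux;have okc:= atlas_ok ac;have [dx cx] := imgP okc ix.
have sf: gsm (fun y => s (param c y)) x.
 by apply: (@gsm_map _ _ _ _ _ _ U)=> //;exact: gsm_param.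
split=> //;set g := s (param c x).
pose f y := s (param c y);pose h y := gmul (ginv g) (f y).
have sh: gsm h x by apply: gsm_mul=> //;exact: gsm_cst.
have hx: h x = gone GC by rewrite /h gmulV.
have lh: lsm (fun y => coord e (h y)) x by apply: sh.2=> //;rewrite hx.
have dcg: dom c (pr g) by rewrite hU.
have nE: \forall y \near x, y = coord c (pr (gmul g (param e (coord e (h y))))).
 have h1: \forall y \near x, dom e (h y) /\ param e (coord e (h y)) = h y.
 by apply: (gsm_near_dom sh ae);rewrite hx.
 have h2: \forall y \near x, img c y /\ U (param c y).
 by apply: (near_param okc ix);exact: onbhs.
 apply: filterS2 h1 h2=> y [_ ->] [iy Uy].
 by rewrite /h gmulKV hU //;have [_ ->] := imgP okc iy.
via ('D_w (fun y: 'rV[C]_n => y) x);last exact: derive_id.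
rewrite (derv_eq _ nE).
pose A y := coord e (h y);pose B y := coord c (pr (gmul g (param e y))).
have Ax: A x = x0 by rewrite /A hx.
have dB: dfb B (A x) by rewrite Ax;apply: lsd;exact: pr_lsm.
have E:= @chain_rule _ _ _ _ A B x w (lsd lh) dB.
by rewrite Ax in E;exact: esym E.
Qed.

Variables (Bm: 'M[C]_k) (S: pred 'I_k).
Context (Bu: Bm \in unitmx)
 (LS: forall x, Lset x <-> forall i, S i -> co Bm x i = 0).
Notation b i := (row i Bm).
Let bL i: ~~ S i -> Lset (b i).
by move=> nS;apply/LS=> j Sj;rewrite co_b //;case: eqVneq=> // E;move: nS;rewrite E Sj.
Qed.

Lemma dpr_S g d xi: atlas d -> dom d (pr g) ->
 dpr g d xi = \sum_(i | S i) co Bm xi i *: dpr g d (b i).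
move=> ad dg;have dl:= fun a u w => dpr_lin a u w ad dg.
have d0: dpr g d 0 = 0 by rewrite /dpr deriveE ?linear0 //;apply: lsd;exact: pr_lsm.
have dD u w: dpr g d (u + w) = dpr g d u + dpr g d w by rewrite -[u]scale1r dl !scale1r.
have dZ a u: dpr g d (a *: u) = a *: dpr g d u by rewrite -[a *: u]addr0 dl d0 addr0.
rewrite {1}[xi](coE Bu) (big_morph (dpr g d) dD d0) (bigID S) /= [X in _ + X]big1 ?addr0.
 by sumext i;rewrite dZ.
by move=> i nS;rewrite dZ L_ker_all ?scaler0 //;exact: bL.
Qed.

(** The tangent map is injective on the span of the b i with i in [S] by [ker_L], and onto because
    of the local section; so [S] has n elements. *)
Lemma dim_S: exists2 es: 'I_n -> 'I_k, injective es & forall i, S i <-> exists j, i = es j.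
have [_ _ hs] := Hq;have [U [s [ls Up]]] := hs (pr (gone GC)).
have [c ac dc] := atlas_cover (pr (gone GC));have okc:= atlas_ok ac.
set x := coord c (pr (gone GC));have ix: img c x by exact: img_coord.
have Ux: U (param c x) by rewrite /x coordK.
set g := s (param c x);have [_ _ hU] := ls.
have dg: dom c (pr g) by rewrite /g hU // /x coordK.
pose m := #|S|;pose ev (j: 'I_m): 'I_k := enum_val j.
have evS j: S (ev j) by have := enum_valP j.
pose D: 'M[C]_(m, n) := \matrix_(j, l) dpr g c (b (ev j)) 0 l.
have sumS (f: 'I_k -> 'rV[C]_n): \sum_(i | S i) f i = \sum_(j < m) f (ev j).
 by rewrite (big_enum_val f).
have DE (r: 'rV[C]_m): r *m D = dpr g c (\sum_j r 0 j *: b (ev j)).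
 rewrite dpr_S // sumS;rowext l;rewrite mxE summxE;sumext j.
 rewrite !mxE co_sum (bigD1 j) //= big1=> [|j' jj].
 by rewrite coZ co_b // eqxx mulr1 addr0.
 by rewrite coZ co_b // (inj_eq enum_val_inj) (negPf jj) mulr0.
have fD: row_free D.
 apply/inj_row_free=> r;rewrite DE=> /(ker_L ac dg) /LS h.
 rowext j;rewrite mxE -(h (ev j) (evS j)) co_sum (bigD1 j) //= big1=> [|j' jj].
 by rewrite coZ co_b // eqxx mulr1 addr0.
 by rewrite coZ co_b // (inj_eq enum_val_inj) (negPf jj) mulr0.
(* Row l holds the coordinates of the velocity of the section in direction l; projecting it back
   gives [T *m D = 1%:M], hence n <= m. *)
pose T: 'M[C]_(n, m) := \matrix_(l, j) co Bm (vel (fun y => s (param c y)) x (dlt l)) (ev j).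
have TD: T *m D = 1%:M.
 apply/row_matrixP=> l;rewrite row_mul row1;have [_ h] := section_dpr (dlt l) ls ac ix Ux.
 rewrite -[RHS]h -/g dpr_S // sumS;rowext l';rewrite mxE summxE;sumext j.
 by rewrite !mxE.
have mn: m = n.
 apply/eqP;rewrite eqn_leq;apply/andP;split.
 by move: fD;rewrite /row_free=> /eqP <-;exact: rank_leq_col.
 have: (\rank (T *m D) <= m)%N by apply: leq_trans (mulmx_max_rank _ _) _.
 by rewrite TD mxrank1.
exists (fun j => ev (cast_ord (esym mn) j)).
 by move=> j j' /enum_val_inj /cast_ord_inj.
move=> i;split=> [Si|[j ->]];last exact: evS.
have iS: i \in S by [].
by exists (cast_ord mn (enum_rank_in iS i));rewrite cast_ordK /ev enum_rankK_in.
Qed.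

(** Connectedness: the part of P where [Q] holds and the part where it fails are both relatively
    open, each being a union of traces of translated neighbourhoods of the identity. *)
Lemma P_generated (Q: set GC): Q (gone GC) -> (forall x y, Q x -> Q y -> Q (gmul x y)) ->
 (forall x, Q x -> Q (ginv x)) -> nbhs (gone GC) [set p | P p -> Q p] -> forall p, P p -> Q p.
move=> Q1 QM QV nQ;have [_ _ cP _] := HP.
pose W p: set GC := [set y | P (gmul (ginv p) y) -> Q (gmul (ginv p) y)].
have nW p: nbhs p (W p).
 have c: {for p, continuous (fun y: GC => gmul (ginv p) y)}.
 by apply: gmul_cont;[exact: cst_continuous|exact: cvg_id].
 by apply: (c [set p | P p -> Q p]);rewrite gmulV.
pose I p: set GC := (W p)°%classic.
have oI p: open (I p) by exact: open_interior.
have Ip p: I p p by exact: nW.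
have IW p y: I p y -> P p -> P y -> Q (gmul (ginv p) y).
 by move=> /interior_subset h Pp Py;apply: h;apply: PM=> //;exact: PV.
suff <- : P `&` Q = P by move=> p [].
apply: cP.
- by exists (gone GC).
- exists (\bigcup_(p in P `&` Q) I p);first by apply: bigcup_open=> p _;exact: oI.
 apply/seteqP;split=> [p [Pp Qp]|y [Py [p [Pp Qp] Iy]]].
 by split=> //;exists p.
 by split=> //;rewrite -(gmulKV p y);apply: QM=> //;exact: IW Iy Pp Py.
exists (~` (\bigcup_(p in P `&` ~` Q) I p)).
 by apply: open_closedC;apply: bigcup_open=> p _;exact: oI.
apply/seteqP;split=> [y [Py Qy]|y [Py nI]].
 split=> // -[p [Pp nQp] Iy];apply: nQp.
 have h:= IW _ _ Iy Pp Py.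
 have -> : p = gmul y (ginv (gmul (ginv p) y)).
 by rewrite ginvM gmulA gmulV' gmul1;apply: ginv_uniq;rewrite gmulV.
 by apply: QM=> //;exact: QV.
split=> //;apply: contrapT=> nQy;apply: nI;exists y=> //.
Qed.

Variables (gam: 'I_k -> C -> GC).
Hypothesis gam_op: forall i, ~~ S i -> one_param (gam i) (b i).

(** Coordinates of the second kind on P: the ordered product of the one-parameter subgroups of the b
    i, the indices in [S] contributing the identity. *)
Definition gprod (z: 'rV[C]_k) (r: seq 'I_k): GC :=
 foldr (fun i g => gmul (if S i then gone GC else gam i (z 0 i)) g) (gone GC) r.
Let zS (z: 'rV[C]_k): 'rV[C]_k := \sum_(i | S i) z 0 i *: b i.

Lemma gprod0 r: gprod 0 r = gone GC.
elim: r=> //= i r ->;case: ifPn=> nS;rewrite ?gmul1 // mxE (one_param0 (gam_op nS)) gmul1.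
by [].
Qed.

Lemma gprod_gsm r v: uniq r -> gsm (fun z => gprod z r) 0 /\
 'D_v (fun z => coord e (gprod z r)) 0 = \sum_(i <- r | ~~ S i) v 0 i *: b i.
elim: r=> [|i r IH] /=.
 by move=> _;split;[exact: gsm_cst|rewrite big_nil derive_cst].
move=> /andP[_ /IH [gr Dr]].
pose f (z: 'rV[C]_k) := if S i then gone GC else gam i (z 0 i).
have f0: f 0 = gone GC by rewrite /f;case: ifPn=> // nS;rewrite mxE (one_param0 (gam_op nS)).
have [gf Df]: gsm f 0 /\ 'D_v (fun z => coord e (f z)) 0 = if S i then 0 else v 0 i *: b i.
 rewrite /f;case: ifPn=> nS.
 by split;[exact: gsm_cst|rewrite derive_cst].
 have z0: (0: 'rV[C]_k) 0 i = 0 by rewrite mxE.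
 have [g1 g2] := one_param_coord (gam_op nS) z0.
 by split;[exact: g1|exact: g2].
have [E1 E2]: gsm (fun z => gmul (f z) (gprod z r)) 0 /\ True by split=> //;exact: gsm_mul.
split=> //;rewrite (derive_gmul v gf gr f0 (gprod0 r)) Df Dr big_cons.
by case: ifPn=> nS;rewrite ?add0r.
Qed.

Lemma sum_es (V: zmodType) (es: 'I_n -> 'I_k) (f: 'I_k -> V): injective es ->
 (forall i, S i <-> exists j, i = es j) -> \sum_(i | S i) f i = \sum_j f (es j).
move=> es_inj esS;rewrite -big_filter -(big_map es xpredT f);apply: perm_big;apply: uniq_perm.
- by rewrite filter_uniq // index_enum_uniq.
- by rewrite map_inj_uniq // index_enum_uniq.
move=> i;rewrite mem_filter mem_index_enum andbT;apply/idP/mapP=> [/esS[j ->]|[j _ ->]].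
 by exists j=> //;rewrite mem_index_enum.
by apply/esS;exists j.
Qed.

(** With [A] a slice transversal to P, z |-> A z times [gprod z] is open at 0 by [inverse_fun]. If
    the product lies in P, then A z projects to the base point, and [local_inj] for the projected
    slice forces A z = 1. *)
Lemma P_local (U0: set 'rV[C]_k): nbhs (0: 'rV[C]_k) U0 -> (forall i t, ~~ S i -> P (gam i t)) ->
 nbhs (gone GC) [set p | P p -> exists2 z, U0 z & p = gprod z (enum 'I_k)].
move=> nU Pg.
have [es es_inj esS] := dim_S;have sE (V: zmodType) (f: 'I_k -> V) := sum_es f es_inj esS.
have [d ad dd] := atlas_cover (pr (gone GC));have okd:= atlas_ok ad.
pose A (z: 'rV[C]_k) := param e (x0 + zS z).
have lz: linear zS.
 move=> a u w;rewrite /zS scaler_sumr -big_split;sumext i.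
 by rewrite !mxE scalerDl scalerA.
have z00: zS 0 = 0 by rewrite /zS big1 // => i _;rewrite mxE scale0r.
have lx: lsm (fun z => x0 + zS z) (0: 'rV[C]_k).
 by apply: lsm_add;[exact: lsm_cst|apply: lsm_linear].
have gA: gsm A 0.
 by apply: (gsm_rebase lx);rewrite z00 addr0;exact: gsm_param.
have A0: A 0 = gone GC by rewrite /A z00 addr0.
have DA v: 'D_v (fun z => coord e (A z)) 0 = zS v.
 rewrite -[RHS](derive_affine x0 0 v lz);apply: derv_eq.
 have cA:= lsm_cont lx.
 have ni: nbhs (x0 + zS 0) (img e) by rewrite z00 addr0;apply: onbhs;split=> //;have [] := oke.
 have h: \forall z \near (0: 'rV[C]_k), img e (x0 + zS z) := cA _ ni.
 by apply: filterS h=> z /(imgP oke)[].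
have [gP _] := gprod_gsm 0 (enum_uniq 'I_k).
pose Phi z := gmul (A z) (gprod z (enum 'I_k)).
have gPhi: gsm Phi 0 by exact: gsm_mul.
have Phi0: Phi 0 = gone GC by rewrite /Phi A0 gprod0 gmul1.
have dPhi: dom e (Phi 0) by rewrite Phi0.
pose F z := coord e (Phi z).
have sF: lsm F 0 := gPhi.2 e ae dPhi.
have DF v: 'D_v F 0 = v *m Bm.
 have [gP' DP] := gprod_gsm v (enum_uniq 'I_k).
 rewrite /F (derive_gmul v gA gP A0 (gprod0 _)) DA DP /zS big_enum_cond mulmx_sum_row [RHS](bigID S) /=.
 by [].
have inj v: 'D_v F 0 = 0 -> v = 0.
 by rewrite DF=> h;rewrite -(mulmxK Bu v) h mul0mx.
pose H (zt: 'rV[C]_n) := coord d (pr (param e (x0 + \sum_j zt 0 j *: b (es j)))).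
have lH: linear (fun zt: 'rV[C]_n => \sum_j zt 0 j *: b (es j)).
 by move=> a u w;rewrite scaler_sumr -big_split;sumext i;rewrite !mxE scalerDl scalerA.
pose lin (zt: 'rV[C]_n) := \sum_j zt 0 j *: b (es j).
have lin0: lin 0 = 0 by rewrite /lin big1 // => j _;rewrite mxE scale0r.
have sl: lsm (fun zt => x0 + lin zt) (0: 'rV[C]_n) by apply: lsm_add;[exact: lsm_cst|apply: lsm_linear].
have sB: lsm (fun y => coord d (pr (param e y))) x0.
 by apply: (pr_gsm (gsm_param ae ix0)).2=> //;rewrite pe0.
have HE0: x0 + lin 0 = x0 by rewrite lin0 addr0.
have sB': lsm (fun y => coord d (pr (param e y))) (x0 + lin 0) by rewrite HE0.
have sH: lsm H 0 := lsm_comp sl sB'.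
have dprE w: dpr (gone GC) d w = 'D_w (fun y => coord d (pr (param e y))) x0.
 by rewrite /dpr;suff -> : (fun y => coord d (pr (gmul (gone GC) (param e y)))) = (fun y => coord d (pr (param e y))) by [];fext y;rewrite gmul1.
have li: \forall zt \near (0: 'rV[C]_n), H zt = H 0 -> zt = 0.
 apply: (local_inj (lsd sH) _).2=> v Hv.
 have E:= @chain_rule _ _ _ _ (fun zt => x0 + lin zt) (fun y => coord d (pr (param e y))) 0 v (lsd sl) (lsd sB').
 rewrite (derive_affine x0 0 v lH) HE0 -dprE -/H Hv in E.
 have /LS h := ker_L ad dd (esym E).
 rowext j;rewrite mxE -(h (es j) (_: S (es j)));last by apply/esS;exists j.
 rewrite co_sum (bigD1 j) //= big1=> [|j' jj].
 by rewrite coZ co_b // eqxx mulr1 addr0.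
 by rewrite coZ co_b // (inj_eq es_inj) (negPf jj) mulr0.
pose sel (z: 'rV[C]_k): 'rV[C]_n := \row_j z 0 (es j).
have nU1: nbhs (0: 'rV[C]_k) [set z | [/\ U0 z, dom e (Phi z) /\ param e (F z) = Phi z,
 dom d (pr (A z)) & H (sel z) = H 0 -> sel z = 0]].
 have lsel: linear sel by move=> a u w;rowext j;rewrite !mxE.
 have csel:= differentiable_continuous (lsd (lsm_linear 0 lsel)).
 have sel0: sel 0 = 0 by rowext j;rewrite !mxE.
 have li': nbhs (sel 0) [set zt | H zt = H 0 -> zt = 0] by rewrite sel0.
 have n1: \forall z \near (0: 'rV[C]_k), H (sel z) = H 0 -> sel z = 0 := csel _ li'.
 have nd: nbhs (pr (A 0)) (dom d) by rewrite A0;apply: onbhs;split=> //;have [] := okd.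
 have n2: \forall z \near (0: 'rV[C]_k), dom d (pr (A z)) := (pr_gsm gA).1 _ nd.
 by apply: filterS2 (filterI nU (gsm_near_dom gPhi ae dPhi)) (filterI n1 n2)=> z [? ?] [? ?].
have := inverse_fun sF inj nU1;rewrite /F Phi0=> nF.
apply: filterS (near_coord oke e1 nF)=> p [dp [z [Uz [dz1 dz2] dAz inz] Fz]] Pp.
exists z=> //;have pE: p = Phi z.
 by rewrite -(coordK oke dp) -Fz -/(F z) dz2.
have PG: P (gprod z (enum 'I_k)).
 elim: (enum 'I_k)=> //= i r IH;apply: PM=> //;case: ifPn=> // nS;exact: Pg.
have prA: pr (A z) = pr (gone GC).
 have <- : pr p = pr (gone GC) by rewrite -[p]gmul1 pr_mulP.
 by rewrite pE /Phi pr_mulP.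
have sz: \sum_j sel z 0 j *: b (es j) = zS z.
 by rewrite /zS sE;sumext j;rewrite mxE.
have s0: sel z = 0.
 apply: inz;rewrite /H sz -/(A z) prA big1 ?addr0 ?pe0 // => j _;by rewrite mxE scale0r.
have zS0: zS z = 0 by rewrite -sz s0 big1 // => j _;rewrite mxE scale0r.
by rewrite pE /Phi /A zS0 addr0 pe0 gmul1.
Qed.
End PGeom.

(** * A real form together with p spans the complex Lie algebra *)

Section RealFormComplement.
Context {R: realType}.
Notation C := (cnum R).
Context {k: nat}.
Variables (kl: 'rV[C]_k -> 'rV[C]_k -> C) (Bg: 'M[C]_k) (S: pred 'I_k) (Bm: 'M[C]_k).
Context (klr: forall x a y z, kl x (a *: y + z) = a * kl x y + kl x z)
 (kll: forall x a y z, kl (a *: y + z) x = a * kl y x + kl z x)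
 (nd: forall x, (forall y, kl x y = 0) -> x = 0)
 (Bgu: Bg \in unitmx)
 (Bu: Bm \in unitmx).
Notation b i := (row i Bm).
Let io (u: 'rV[R]_k): 'rV[C]_k := map_mx (fun t => t%:C) u *m Bg.
Context (neg: forall u w, kl (io u) (io u) + kl (io w) (io w) = 0 -> u = 0 /\ w = 0)
 (klC: forall u w, kl (io u) (io w) = kl (io w) (io u))
 (perp: forall x, (forall i, ~~ S i -> kl x (b i) = 0) -> forall i, S i -> co Bm x i = 0).
Let sg (x: 'rV[C]_k): 'rV[C]_k := map_mx (fun z: C => z^*) (x *m invmx Bg) *m Bg.
Let re (x: 'rV[C]_k): 'rV[R]_k := map_mx (@cRe R) (x *m invmx Bg).
Let im (x: 'rV[C]_k): 'rV[R]_k := map_mx (@cIm R) (x *m invmx Bg).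
Let decx x: x = io (re x) + 'i *: io (im x).
rewrite -[LHS](mulmxKV Bgu) /io scalemxAl -mulmxDl;congr (_ *m _).
by rowext i;rewrite !mxE -complexE.
Qed.
Let sgE x: sg x = io (re x) - 'i *: io (im x).
rewrite /sg /io scalemxAl -mulmxBl;congr (_ *m _).
rowext i;rewrite !mxE;set z := \sum_j _;clearbody z.
by apply: cpx_eq;case: z=> a b /=;ring.
Qed.
Let sgK x: sg (sg x) = x.
rewrite /sg mulmxK // -[RHS](mulmxKV Bgu);congr (_ *m _).
by rowext i;rewrite !mxE conjcK.
Qed.

(** [Lm] spans p and [Pm] is its orthogonal, contained in p. The conjugate [sP] of [Pm] meets p only
    in 0, and its dimension is the codimension of p, so p and [sP] span everything. *)
Lemma real_form_complement x: exists u l, x = io u + l /\ forall i, S i -> co Bm l i = 0.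
pose Q: 'M[C]_k := \matrix_(i, j) kl (dlt i) (dlt j).
have kl0r y: kl y 0 = 0.
 by have := klr y 1 0 0;rewrite scale1r addr0 mul1r=> /esym/eqP;rewrite -subr_eq0 addrK=> /eqP.
have kl0l y: kl 0 y = 0.
 by have := kll y 1 0 0;rewrite scale1r addr0 mul1r=> /esym/eqP;rewrite -subr_eq0 addrK=> /eqP.
have klZr y a z: kl y (a *: z) = a * kl y z by rewrite -[a *: z]addr0 klr kl0r addr0.
have klZl y a z: kl (a *: z) y = a * kl z y by rewrite -[a *: z]addr0 kll kl0l addr0.
have klDr y z z': kl y (z + z') = kl y z + kl y z' by rewrite -[z]scale1r klr scale1r mul1r.
have klDl y z z': kl (z + z') y = kl z y + kl z' y by rewrite -[z]scale1r kll scale1r mul1r.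
have QE y z: kl y z = (y *m Q *m z^T) 0 0.
 have E1 j: kl y (dlt j) = (y *m Q) 0 j.
 rewrite {1}(row_sum_delta y) (big_morph (kl^~ (dlt j)) (klDl _) (kl0l _)) mxE.
 by sumext i;rewrite klZl !mxE.
 rewrite {1}(row_sum_delta z) (big_morph (kl y) (klDr y) (kl0r y)) mxE.
 by sumext j;rewrite klZr E1 !mxE mulrC.
have Qu: Q \in unitmx.
 rewrite -row_free_unit;apply/inj_row_free=> y yQ;apply: nd=> z.
 by rewrite QE yQ mul0mx mxE.
pose Lm: 'M[C]_k := \matrix_(i, j) (if S i then 0 else Bm i j).
have rowL i: row i Lm = if S i then 0 else b i.
 by rowext j;rewrite !mxE;case: (S i);rewrite !mxE.
have inL y: (y <= Lm)%MS -> forall i, S i -> co Bm y i = 0.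
 move=> /submxP[D ->] i Si;rewrite mulmx_sum_row co_sum big1 // => j _.
 rewrite coZ rowL;case: ifPn=> Sj;first by rewrite /co mul0mx mxE mulr0.
 by rewrite co_b //;case: eqVneq=> E;rewrite ?mulr0 //;move: Sj;rewrite E Si.
pose Pm := kermx (Q *m Lm^T).
have inP y: (y <= Pm)%MS -> forall i, ~~ S i -> kl y (b i) = 0.
 move=> /sub_kermxP h i nS;rewrite QE;have := congr1 (fun M: 'rV_k => M 0 i) h.
 rewrite mulmxA mxE=> h';rewrite [LHS]mxE.
 rewrite [RHS](_: 0 = (0: 'rV[C]_k) 0 i);last by rewrite mxE.
 by rewrite -h' /=;sumext j;rewrite !mxE (negPf nS).
have PL y: (y <= Pm)%MS -> forall i, S i -> co Bm y i = 0 by move=> /inP;exact: perp.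
pose sP: 'M[C]_k := map_mx (fun z: C => z^*) (Pm *m invmx Bg) *m Bg.
have conj_conj m (A: 'M[C]_(m, k)): map_mx (fun z: C => z^*) (map_mx (fun z: C => z^*) A) = A.
 by mxext i j;rewrite !mxE conjcK.
have insP y: (y <= sP)%MS -> (sg y <= Pm)%MS.
 move=> /submxP[D ->];rewrite /sP /sg mulmxA mulmxK //.
 have -> : map_mx (fun z: C => z^*) (D *m map_mx (fun z: C => z^*) (Pm *m invmx Bg)) =
 map_mx (fun z: C => z^*) D *m (Pm *m invmx Bg) by rewrite map_mxM conj_conj.
 by rewrite -!mulmxA mulVmx // mulmx1 submxMl.
have rP: \rank sP = \rank Pm.
 by rewrite /sP mxrankMfree ?row_free_unit // mxrank_map mxrankMfree // row_free_unit unitmx_inv.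
(* For y in p with conjugate orthogonal to p, kl(conj y, y) = 0; this number is kl(re y, re y) +
   kl(im y, im y), and [neg] applies. *)
have cap0: (Lm :&: sP)%MS = 0.
 apply/eqP/rowV0P=> y;rewrite sub_capmx=> /andP[yL /insP yP].
 have ky: kl (sg y) y = 0.
 have /submxP[D yE] := yL;rewrite {2}yE mulmx_sum_row.
 rewrite (big_morph (kl (sg y)) (klDr _) (kl0r _)) big1 // => j _.
 rewrite klZr rowL;case: ifPn=> Sj;first by rewrite kl0r mulr0.
 by rewrite inP // mulr0.
 have [u0 w0]: re y = 0 /\ im y = 0.
 apply: neg;rewrite -ky {6}[y]decx sgE.
 have iN z: - ('i *: z) = (- 'i) *: z :> 'rV[C]_k by rewrite scaleNr.
 rewrite iN klDl !klDr !klZl !klZr (klC (im y)).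
 have i2: 'i * 'i = -1 :> C by rewrite -expr2 sqrCi.
 have -> : - 'i * ('i * kl (io (im y)) (io (im y))) = kl (io (im y)) (io (im y)).
 by rewrite mulrA mulNr i2 opprK mul1r.
 set A := kl _ _;set A' := kl _ _;set A'' := kl _ _;ring.
 have io0: io 0 = 0 by rewrite /io (_: map_mx _ _ = 0) ?mul0mx //;rowext i;rewrite !mxE.
 by rewrite [y]decx u0 w0 io0 scaler0 addr0.
have full: row_full (Lm + sP)%MS.
 rewrite /row_full;have := mxrank_sum_cap Lm sP;rewrite cap0 mxrank0 addn0=> ->.
 rewrite rP /Pm mxrank_ker (_: \rank (Q *m Lm^T) = \rank Lm);first by rewrite subnKC // rank_leq_row.
 rewrite -mxrank_tr trmx_mul trmxK mxrankMfree // row_free_unit unitmx_tr //.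
have /sub_addsmxP[[D1 D2] /= xE] := submx_full x full.
have mP: (sg (D2 *m sP) <= Pm)%MS by apply: insP;exact: submxMl.
set m := sg (D2 *m sP) in mP;have mE: D2 *m sP = sg m by rewrite sgK.
(* The conjugate of m is twice its real part minus m, and m lies in p by [PL]. *)
exists (2%:R *: re m), (D1 *m Lm - m);split.
 rewrite xE mE sgE {4}[m]decx.
 have -> : io (2%:R *: re m) = io (re m) + io (re m).
 by rewrite /io -mulmxDl;congr (_ *m _);rowext i;rewrite !mxE mulr_natl mulr2n rmorphD.
 set a := io _;set b := 'i *: _;set c := D1 *m _.
 by clearbody a b c;rowext i;rewrite !mxE;ring.
move=> i Si;rewrite -[- m]scaleN1r addrC co_lin (PL _ mP _ Si) mulr0 add0r.
by apply: inL=> //;exact: submxMl.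
Qed.
End RealFormComplement.

(** * Invariant inner products and skewness of the compact form *)

Section DiffMul.
Context {K: numF} {V: nmod K}.

Lemma diff_post m n p q (L: {linear 'M[K]_(m, n) -> 'M[K]_(p, q)}) (f: V -> 'M[K]_(m, n)) x :
 dfb f x -> dfb (fun y => L (f y)) x.
have dL y: dfb L y by apply: (@lsd _ _ _ L);apply: lsm_linear;exact: linearP.
by move=> df;apply: (@dfb_comp _ _ _ _ f L).
Qed.

Lemma diff_mulmxl m n p (A: 'M[K]_(m, n)) (f: V -> 'M[K]_(n, p)) x :
 dfb f x -> dfb (fun y => A *m f y) x.
exact: (diff_post (mulmx A)). Qed.
Lemma diff_mulmxr m n p (A: 'M[K]_(n, p)) (f: V -> 'M[K]_(m, n)) x :
 dfb f x -> dfb (fun y => f y *m A) x.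
exact: (diff_post (mulmxr A)). Qed.
Lemma derive_Nex (W: nmod K) (F: V -> W) x v: dfb F x ->
 exists2 p, p = - v & 'D_p F x = - 'D_v F x.
by move=> dF;exists (- v)=> //;rewrite !deriveE // linearN. Qed.
End DiffMul.

Section RealSkew.
Context {R: realType}.
Notation C := (cnum R).

Lemma real_skew (F H: C -> C): dfb F 0 -> dfb H 0 ->
 (forall t: R, F t%:C = (H (- t)%:C)^*) -> 'D_1 F 0 = - ('D_1 H 0)^*.
move=> dF dG FH.
have EF (t: R): t%:C *: (1: C) + 0 = t%:C by rewrite addr0;exact: mulr1.
have [p pE Dp] := derive_Nex (1: C) dG.
have EH (t: R): t%:C *: p + 0 = (- t)%:C by rewrite addr0 pE [LHS](mulrN1 t%:C) rmorphN.
have h0: (0: R)%:C *: (1: C) + 0 = 0 by exact: EF.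
have h0': (0: R)%:C *: p + 0 = 0 by rewrite EH oppr0.
have dF0: dfb F ((0: R)%:C *: (1: C) + 0) by exact: (eq_ind_r (fun x => dfb F x) dF h0).
have dH0: dfb H ((0: R)%:C *: p + 0) by exact: (eq_ind_r (fun x => dfb H x) dG h0').
have := line_Re dF0;have := line_Re dH0;have := line_Im dF0;have := line_Im dH0.
rewrite h0 h0' Dp.
move=> [_ i2] [_ i1] [_ r2] [_ r1].
have Er: (fun t: R => cRe (F (t%:C *: (1: C) + 0))) = (fun t: R => cRe (H (t%:C *: p + 0))).
 by fext t;rewrite EF EH FH;case: (H _).
have Ei: (fun t: R => cIm (F (t%:C *: (1: C) + 0))) = - (fun t: R => cIm (H (t%:C *: p + 0))).
 by fext t;rewrite fctE EF EH FH;case: (H _).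
rewrite Er r2 in r1.
have dI: derivable (fun t: R => cIm (H (t%:C *: p + 0))) 0 1 by case: (line_Im dH0).
rewrite Ei deriveN // i2 in i1.
apply: cpx_eq;first by rewrite -r1;case: ('D_1 H 0)=> a b.
by rewrite -i1;case: ('D_1 H 0).
Qed.
End RealSkew.

Section SkewRep.
Context {R: realType} {k N: nat}.
Notation C := (cnum R).
Variables (GC: lie_group C k) (rho: GC -> 'M[C]_N) (Gu: set GC).
Variable (ip: 'cV[C]_N -> 'cV[C]_N -> C).
Context (Hr: smooth_rep rho)
 (Hi: invariant_inner_product rho Gu ip).

Lemma ip_linl a u w z: ip (a *: u + w) z = a * ip u z + ip w z. by case: Hi. Qed.
Lemma ip_conj u w: ip u w = (ip w u)^*. by case: Hi. Qed.
Lemma ip0l z: ip 0 z = 0.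
by have := ip_linl (-1) 0 0 z;rewrite scaler0 addr0 mulN1r addNr. Qed.
Lemma ip0r z: ip z 0 = 0. by rewrite ip_conj ip0l rmorph0. Qed.
Lemma ipZl a u z: ip (a *: u) z = a * ip u z.
by rewrite -[a *: u]addr0 ip_linl ip0l addr0. Qed.
Lemma ipDl u w z: ip (u + w) z = ip u z + ip w z.
by rewrite -[u]scale1r ip_linl scale1r mul1r. Qed.
Lemma ipZr a u z: ip u (a *: z) = a^* * ip u z.
by rewrite [LHS]ip_conj ipZl rmorphM [X in _ = _ * X]ip_conj. Qed.
Lemma ipDr u w z: ip u (w + z) = ip u w + ip u z.
by rewrite [LHS]ip_conj ipDl rmorphD [ip u w]ip_conj [ip u z]ip_conj. Qed.
Lemma ip_suml (I: Type) (r: seq I) (P: pred I) f z :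
 ip (\sum_(i <- r | P i) f i) z = \sum_(i <- r | P i) ip (f i) z.
exact: (big_morph (ip^~ z) (fun u w => ipDl u w z) (ip0l z)). Qed.
Lemma ip_sumr (I: Type) (r: seq I) (P: pred I) f z :
 ip z (\sum_(i <- r | P i) f i) = \sum_(i <- r | P i) ip z (f i).
exact: (big_morph (ip z) (ipDr z) (ip0r z)). Qed.

Lemma ipE u z: ip u z = \sum_i u i 0 * ip (delta_mx i 0) z.
have {1}-> : u = \sum_i u i 0 *: delta_mx i 0.
 apply/colP=> i;rewrite summxE (bigD1 i) //= !mxE !eqxx mulr1 big1 ?addr0 // => j ji.
 by rewrite !mxE eq_sym (negPf ji) mulr0.
by rewrite ip_suml;sumext i;rewrite ipZl.
Qed.

Lemma ip_diff gam w u z: one_param gam w ->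
 dfb (fun t: C => ip (rho (gam t) *m u) z) 0 /\
 'D_1 (fun t: C => ip (rho (gam t) *m u) z) 0 = ip (dtau rho w *m u) z.
move=> op;pose rw: 'rV[C]_N := \row_i ip (delta_mx i 0) z.
have E A: ip (A *m u) z = (rw *m (A *m u)) 0 0.
 by rewrite ipE [RHS]mxE;sumext i;rewrite [rw 0 i]mxE mulrC.
have [d1 d2] := one_param_rep 0 Hr op.
have d1': dfb (fun s => rho (gam s)) 0 by apply/dfdP.
have EF: (fun t: C => ip (rho (gam t) *m u) z) = (fun t => (rw *m (rho (gam t) *m u)) 0 0).
 by fext t;exact: E.
have d3: dfb (fun s => rho (gam s) *m u) 0 by exact: diff_mulmxr.
have [d4 D4] := dfb_ij 0 0 (diff_mulmxl rw d3).
rewrite EF;split;first exact: d4.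
by rewrite D4 derive_mulmxl // derive_mulmxr // d2 (one_param0 op) Hr.2.1 mul1mx -E.
Qed.

(** For real t invariance moves rho(gam t) to the other slot as rho(gam(- t)). Each slot gives a
    complex-differentiable function up to conjugation, so [real_skew] can differentiate along the
    real axis. *)
Lemma rep_skew gam w u z: one_param gam w -> (forall t: R, Gu (gam t%:C)) ->
 ip (dtau rho w *m u) z + ip u (dtau rho w *m z) = 0.
move=> op Gg;have [dF DF] := ip_diff u z op;have [dG DG] := ip_diff z u op.
have [_ gD _] := op.
have := real_skew dF dG;rewrite DF DG [ip u _]ip_conj=> -> //;first by rewrite addNr.
move=> t;rewrite -ip_conj;have [_ _ _ Hinv] := Hi.
rewrite -[RHS](Hinv (gam t%:C)) // mulmxA -Hr.1 -gD -rmorphD addrN.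
by rewrite (one_param0 op) Hr.2.1 mul1mx.
Qed.
End SkewRep.

(** * The two laws that the cone computation takes from the flag manifold *)

Section Laws.
Context {R: realType} {k n N: nat}.
Notation C := (cnum R).
Variables (GC: lie_group C k) (X: manifold C n) (pr: GC -> X) (rho: GC -> 'M[C]_N) (v: 'cV[C]_N)
 (ip: 'cV[C]_N -> 'cV[C]_N -> C) (Ym: 'M[C]_(N, 1 + n)).

(** The derivative of the Gram matrix of the columns of rho(g) Ym in the direction xi. The ratio n
    between the trace of [m] and its corner entry [lm] is what makes the Gram determinant divided by
    the n-th power of <W, W> constant. *)
Definition gram_law: Prop :=
 forall g xi, exists (m: 'M[C]_(1 + n)) (lm: C),
 [/\ \tr m = n%:R * lm, forall c, m (lshift n 0) c = lm * (c == lshift n 0)%:R &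
 forall i j, ip (rho g *m dtau rho xi *m col i Ym) (rho g *m col j Ym)
 + ip (rho g *m col i Ym) (rho g *m dtau rho xi *m col j Ym) =
 \sum_c (m i c * ip (rho g *m col c Ym) (rho g *m col j Ym)
 + (m j c)^* * ip (rho g *m col i Ym) (rho g *m col c Ym))].

(** The derivative of W = rho(s) v in the moving frame rho(s) Ym: [cc] is the component along W
    itself, and [Th] is invertible because the section is transversal to P. *)
Definition section_law: Prop :=
 forall U s c x, local_section pr U s -> atlas c -> img c x -> U (param c x) ->
 gsm (fun y => s (param c y)) x /\
 exists (Th: 'M[C]_n) (cc: 'cV[C]_n), Th \in unitmx /\
 forall w, 'D_w (fun y => rho (s (param c y)) *m v) x =
 rho (s (param c x)) *m Ym *m (row_mx (w *m cc) (w *m Th))^T.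
End Laws.

Lemma linear_sum_continuous (K: numF) m (r: seq 'I_m) (P: pred 'I_m) (c: 'I_m -> K) (x: 'rV[K]_m) :
 {for x, continuous (fun z: 'rV[K]_m => \sum_(i <- r | P i) z 0 i * c i)}.
elim: r=> [|i r IH].
 rewrite (_: (fun z: 'rV[K]_m => _) = fun=> 0);first exact: cst_continuous.
 by fext z;rewrite big_nil.
rewrite (_: (fun z: 'rV[K]_m => _) =
 fun z: 'rV[K]_m => (if P i then z 0 i * c i else 0) + \sum_(i <- r | P i) z 0 i * c i);last first.
 by fext z;rewrite big_cons;case: (P i);rewrite ?add0r.
apply: continuousD=> //;case: (P i);last exact: cst_continuous.
by apply: continuousM;[exact: coord_continuous|exact: cst_continuous].
Qed.

Lemma linear_sum_near0 (K: numF) m (r: seq 'I_m) (P: pred 'I_m) (c: 'I_m -> K) (e: K): 0 < e ->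
 nbhs (0: 'rV[K]_m) [set z: 'rV[K]_m | `|\sum_(i <- r | P i) z 0 i * c i| < e].
move=> e0;have zc:= @linear_sum_continuous K m r P c 0.
have H: nbhs (0: 'rV[K]_m) [set z: 'rV[K]_m | ball (\sum_(i <- r | P i) (0: 'rV[K]_m) 0 i * c i) e
 (\sum_(i <- r | P i) z 0 i * c i)] := zc _ (nbhsx_ballx _ e e0).
apply: filterS H=> z.
by rewrite /= /ball /= big1 ?sub0r ?normrN // => i _;rewrite mxE mul0r.
Qed.

Lemma matrix_colP (T: Type) p r (A1 A2: 'M[T]_(p, r)): (forall j, col j A1 = col j A2) -> A1 = A2.
by move=> H;mxext i j;have := congr1 (fun c: 'cV_p => c i 0) (H j);rewrite !mxE.
Qed.
Lemma col_mulmx (K: pzSemiRingType) p q' r (A1: 'M[K]_(p, q')) (A2: 'M[K]_(q', r)) j :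
 col j (A1 *m A2) = A1 *m col j A2.
by rewrite !colE mulmxA. Qed.

Lemma col_aux (K: comNzRingType) p r (w: 'cV[K]_p) (cs: 'cV[K]_r) (Y: 'M[K]_(p, r)) M x j :
 col j (w *m cs^T + Y *m (M + x%:M)^T) = cs j 0 *: w + (Y *m col j M^T + x *: col j Y).
rewrite [(_ + _)^T]linearD /= tr_scalar_mx mulmxDr mul_mx_scalar -col_mulmx.
by apply/colP=> i;rewrite !mxE big_ord1 !mxE [_ * cs _ _]mulrC.
Qed.

Lemma col_split (K: comNzRingType) p r (rg Dx Du Dl A: 'M[K]_p) (Y: 'M[K]_(p, r)) (M: 'M[K]_r) :
 Dx = Du + Dl -> rg *m Du = A *m rg -> Dl *m Y = Y *m M^T -> forall i,
 rg *m Dx *m col i Y = A *m (rg *m col i Y) + \sum_c M i c *: (rg *m col c Y).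
move=> -> E1 E2 i;rewrite mulmxDr mulmxDl E1 -!mulmxA -[Dl *m _]col_mulmx E2;congr (_ + _).
under eq_bigr do rewrite scalemxAr.
rewrite -mulmx_sumr;congr (_ *m _);apply/colP=> t;rewrite !mxE summxE.
by sumext c;rewrite !mxE mulrC.
Qed.

Lemma rep_vec_derive (K: numF) k (G: lie_group K k) r (tau: G -> 'M[K]_r) m (f: 'rV[K]_m -> G) x
 (u: 'cV[K]_r) w: smooth_rep tau -> gsm f x ->
 'D_w (fun y => tau (f y) *m u) x = tau (f x) *m (dtau tau (vel f x w) *m u).
move=> H sf;rewrite derive_mulmxr;last by apply: lsd;exact: H.2.2.
by rewrite (dtau_vel H w sf) -mulmxA.
Qed.

Lemma scale_as_mul (K: comNzRingType) p (A: 'M[K]_1) (u: 'cV[K]_p): A 0 0 *: u = u *m A^T.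
by apply/colP=> i;rewrite !mxE big_ord1 !mxE mulrC. Qed.

Lemma double_sum (K: comNzRingType) p r (Q: pred 'I_r) (w: 'rV[K]_p) (cc: 'cV[K]_p) (A: 'I_p -> 'I_r -> K)
 (c l: 'I_r -> K): (forall i, cc i 0 = \sum_(j | Q j) A i j * l j) ->
 (forall j, c j = \sum_i w 0 i * A i j) -> \sum_(j | Q j) c j * l j = (w *m cc) 0 0.
move=> E1 E2;rewrite mxE;under [RHS]eq_bigr do rewrite E1 mulr_sumr.
rewrite exchange_big /=;sumext j;rewrite E2 mulr_suml.
by sumext i;rewrite mulrA.
Qed.

(** * The laws for the quotient of G^C by P *)

Section Package.
Context {R: realType} {k n N: nat}.
Notation C := (cnum R).
Variables (G: lie_group R k) (GC: lie_group C k) (B: 'M[C]_k)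
 (h: {vspace 'rV[C]_k}) (Sig Theta: seq (weight h)) (P: set GC)
 (X: manifold C n) (pr: GC -> X) (rho: GC -> 'M[C]_N) (v: 'cV[C]_N)
 (Gu: set GC) (ip: 'cV[C]_N -> 'cV[C]_N -> C) (q: R) (chi: GC -> C).
Context (ssG: semisimple G)
 (cG: complexification G GC B)
 (hc: cartan_subalgebra GC h)
 (hS: simple_roots GC Sig)
 (hP: closed_subgroup_of (parabolic_algebra GC Sig Theta) P)
 (hq: quotient_manifold P pr)
 (hw: highest_weight_module rho Sig (delta GC Sig Theta) v)
 (cu: compact_real_form B Gu)
 (hi: invariant_inner_product rho Gu ip)
 (hchi: character_of P (q%:C *: delta GC Sig Theta) chi).

Notation ad := (@adm C k GC).
Let L: lie_ad ad := adm_lie (@schwarzC R) GC.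
Let nd := @kil_nondeg R k GC G B Gu ssG cG cu.
Let HR: smooth_rep rho. by apply: hol_rep;case: hw. Qed.
Let D x := dtau rho x.
Let habel x y: x \in h -> y \in h -> lbr ad x y = 0.
by move=> hx hy;rewrite -(lbE (@schwarzC R));case: hc=> h1 _ _;exact: h1. Qed.
Let hmax x: (forall y, y \in h -> lbr ad x y = 0) -> x \in h.
by move=> H;case: hc=> _ h2 _;apply: h2=> y hy;rewrite (lbE (@schwarzC R)) H. Qed.

Variables (Bm: 'M[C]_k) (a: 'I_k -> weight h).
Context (Bu: Bm \in unitmx)
 (ab: forall (t: subvs_of h) i, lbr ad (vsval t) (row i Bm) = (a i t: C) *: row i Bm).
Notation b i := (row i Bm).
Notation S := (Sp GC Sig Theta a).
Notation Lset := (parabolic_algebra GC Sig Theta).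
Let LS := @par_iff R k GC h Sig Theta hc Bm a Bu ab.
Let S_closed i j l: ~~ S i -> ~~ S j -> S l -> Mx ad Bm (b i) j l = 0.
move=> nSi nSj Sl;rewrite MxE /co.
have E x: (x *m invmx Bm) 0 l = (x *m col l (invmx Bm)) 0 0.
 by rewrite !mxE;sumext m;rewrite !mxE.
have bL m: ~~ S m -> Lset (b m).
 move=> nS;apply/LS=> m' S';rewrite co_b //;case: eqVneq=> // E'.
 by move: nS;rewrite E' S'.
rewrite E (L_lb hP (c := col l (invmx Bm)) _ (bL _ nSi) (bL _ nSj)) ?mxE // => w /LS /(_ l Sl) Hw.
by mxext i' j';rewrite !ord1 -E [RHS]mxE.
Qed.
Let D_lin c x y: D (c *: x + y) = c *: D x + D y. exact: dtau_lin. Qed.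
Let D_lb x y: D (lbr ad x y) = D x *m D y - D y *m D x.
by rewrite -(lbE (@schwarzC R));exact: (dtau_bracket (@schwarzC R) HR). Qed.
Let v0: v != 0. by case: hw. Qed.
Let v_h (t: subvs_of h): D (vsval t) *m v = (delta GC Sig Theta t: C) *: v.
by case: hw=> _ _ _ H _;exact: H. Qed.
Let v_pos i: 0 < ht Sig (a i) -> D (b i) *m v = 0.
move=> /(ht_pos hS Bu ab) pa;case: hw=> _ _ _ _ H;apply: (H (a i))=> //.
by apply/(@rsp_root R k GC h (a i) (b i))=> t;exact: ab.
Qed.
Let dlE (t: subvs_of h): (delta GC Sig Theta t: C) = - \sum_(i | S i) (a i t: C).
exact: (@delta_sum R k GC h Sig Theta hc hS nd Bm a Bu ab t). Qed.
Let hta := @ht_add R k h Sig.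
Let htr := @ht_root R k GC h Sig hS Bm a Bu ab.
Let sneg := @Sp_neg R k GC h Sig Theta hS Bm a Bu ab.
Notation la := (lam ad Bm S).
Let Dv: forall i, ~~ S i -> D (b i) *m v = la (b i) *: v :=
 D_v L nd hmax Bu ab D_lin D_lb hta htr sneg S_closed v_h v_pos dlE.
Let Dy := D_y L nd hmax Bu ab D_lin D_lb hta htr sneg S_closed v_h v_pos dlE.
Let Dl := D_lam L nd hmax Bu ab D_lin D_lb hta htr sneg S_closed v_h v_pos dlE.
Let perp := perpS L nd habel hmax Bu ab hta sneg.
Let indep := yv_indep L nd habel hmax Bu ab D_lin D_lb hta htr sneg S_closed v0 v_h v_pos dlE.
Let Ladd x y: Lset x -> Lset y -> Lset (x + y).
move=> /LS hx /LS hy;apply/LS=> i Si.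
by have := co_lin Bm 1 x y i;rewrite scale1r mul1r (hx _ Si) (hy _ Si) addr0.
Qed.
(** The splitting at an arbitrary g: the real form moved by Ad(g^-1) has the same Killing products
    as the original one, so [real_form_complement] applies to it. *)
Let real_dec g x: exists u l, x = admap (ginv g: GC) (iotaC B u) + l /\ forall i, S i -> co Bm l i = 0.
pose Bg := B *m (Adm (ginv g))^T.
have Eg u: map_mx (fun t => t%:C) u *m Bg = admap (ginv g: GC) (iotaC B u).
 by rewrite AdmE mulmxA.
have kE u w: kil ad (map_mx (fun t => t%:C) u *m Bg) (map_mx (fun t => t%:C) w *m Bg) =
 kil ad (iotaC B u) (iotaC B w) by rewrite Eg Eg;exact: kil_Ad.
have Bgu: Bg \in unitmx.
 have AV: Adm (ginv g) *m Adm g = 1%:M :> 'M[C]_k by rewrite -(Ad_rep GC).1 gmulV (Ad_rep GC).2.1.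
 rewrite unitmx_mul unitmx_tr;apply/andP;split;first by case: cG.
 exact: (mulmx1_unit AV).1.
have kr:= @kil_linr C k ad L;have kL:= @kil_linl C k ad L.
have [||u [l [E Hl]]] := @real_form_complement R k (kil ad) Bg S Bm kr kL nd Bgu Bu _ _ perp x.
- move=> u w;rewrite !kE.
 have [r [-> [r0 ru]]] := kil_neg ssG cG cu u;have [r' [-> [r0' rw']]] := kil_neg ssG cG cu w.
 rewrite -rmorphD -opprD rmorphN=> /eqP;rewrite oppr_eq0=> /eqP/(congr1 (@cRe R)) /= rr.
 have /eqP := rr;rewrite paddr_eq0 // => /andP[/eqP/ru -> /eqP/rw' ->];split=> //.
- by move=> u w;rewrite !kE;exact: kilC.
by exists u, l;split=> //;rewrite E Eg.
Qed.
Let uL xi: exists a l, [/\ xi = a + l, exists gam: C -> GC, one_param gam a & Lset l].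
have [u [l [-> hl]]] := real_dec (gone GC) xi.
have g1: ginv (gone GC) = gone GC by rewrite -[LHS]gmul1' gmulV.
rewrite g1 admap1;exists (iotaC B u), l;split=> //;last by apply/LS.
by have [gam op _] := u_gam cu u;exists gam.
Qed.
Let dimS := dim_S hP hq Ladd uL Bu LS.
Let pr1: exists2 d, @atlas C n X d & dom d (pr (gone GC)). by exact: atlas_cover. Qed.
Let gam_ex i: exists gam: C -> GC, ~~ S i -> one_param gam (b i) /\ forall t, P (gam t).
have [nS|Si] := boolP (S i);first by exists (fun=> gone GC).
have bL: Lset (b i).
 by apply/LS=> j Sj;rewrite co_b //;case: eqVneq=> // E;move: Si;rewrite E Sj.
have [_ _ _ /(_ (b i)) [/(_ bL)[gam op _] _]] := hP.
have [d ad dd] := pr1;exists gam=> _;split=> //.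
by apply: (ker_P hP hq op ad dd);exact: (L_ker hP hq bL).
Qed.
Let la_root i: a i != 0 -> la (b i) = 0.
move=> ai;rewrite /lam big1 ?oppr0 // => j _;apply/eqP;apply: contraNT ai=> m0.
have /eqP := @Mx_rsp C k ad L h Bm a Bu ab (a i) (b i) j j (fun t => ab t i) m0;rewrite -subr_eq0 opprD addrCA subrr addr0 oppr_eq0.
by [].
Qed.
Let la_cartan i (ai: a i = 0): exists2 t: subvs_of h, b i = vsval t & la (b i) = (delta GC Sig Theta t: C).
have bh: b i \in h.
 apply: hmax=> y yh;rewrite (lbrC L) -(vsprojK yh) ab ai zero_lfunE scale0r oppr0.
 by [].
exists (vsproj h (b i));first by rewrite vsprojK.
rewrite -{1}(vsprojK bh).
exact: (lam_h Bu ab dlE).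
Qed.
(** A basis vector of p lies either in h, where [lam] is delta, or in a root space, where both [lam]
    and the differential of chi vanish; [character_of] covers both cases. *)
Let chi_gam i gam: ~~ S i -> one_param gam (b i) -> (forall t, P (gam t)) ->
 forall t, chi (gam t) = cexp (q%:C * (t * la (b i))).
move=> nS op Pg t;have [_ _ H] := hchi;have [ai|ai] := eqVneq (a i) 0.
 have [s bE ->] := la_cartan ai.
 rewrite (H gam s 0) //.
 - by rewrite mulrCA scale_lfunE.
 - by move=> W _;rewrite mem0v.
 - by rewrite addr0 -bE.
rewrite (H gam 0 (b i)) //.
- by rewrite la_root // linear0 !mulr0.
- move=> W HW;apply: HW;exists (a i);first exact: (root_a Bu ab).
 by apply/(@rsp_root R k GC h (a i) (b i))=> t';exact: ab.
- by rewrite linear0 add0r.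
Qed.

(** Near 1 an element of P is a product of exponentials of basis vectors; each scales v by an
    exponential, and chi takes its q-th power. The smallness of [zeta] selects a branch, without
    which the q-th power would not be determined. *)
Lemma P_char (eps: R): 0 < eps -> nbhs (gone GC) [set p | P p ->
 exists zeta: C, [/\ `|zeta| < eps%:C, rho p *m v = cexp zeta *: v & chi p = cexp (q%:C * zeta)]].
move=> e0;pose gam i := projT1 (cid (gam_ex i)).
have gamP i (nS: ~~ S i): one_param (gam i) (b i) /\ forall t, P (gam i t).
 exact: (projT2 (cid (gam_ex i)) nS).
pose zt (z: 'rV[C]_k) (r: seq 'I_k): C := \sum_(i <- r | ~~ S i) z 0 i * la (b i).
have nU: nbhs (0: 'rV[C]_k) [set z | `|zt z (enum 'I_k)| < eps%:C].
 by apply: linear_sum_near0;rewrite ltcR.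
have := P_local hP hq Ladd uL Bu LS (fun i nS => (gamP i nS).1) nU (fun i t nS => (gamP i nS).2 t).
apply: filterS=> p H Pp;have [z /= zU ->] := H Pp;exists (zt z (enum 'I_k)).
suff E r: [/\ P (gprod S gam z r), rho (gprod S gam z r) *m v = cexp (zt z r) *: v
 & chi (gprod S gam z r) = cexp (q%:C * zt z r)].
 by have [_ E1 E2] := E (enum 'I_k);split.
have [[P1 PM _] _ _ _] := hP;have [ch0 chM _] := hchi.
have c1: chi (gone GC) = 1.
 have := chM _ _ P1 P1;rewrite gmul1=> /eqP;rewrite -[X in X == _]mulr1 (inj_eq (mulfI (ch0 _ P1))).
 by move=> /eqP.
elim: r=> [|i r [IH1 IH2 IH3]] /=.
 by rewrite /zt big_nil mulr0 cexp0 scale1r HR.2.1 mul1mx.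
rewrite /zt big_cons;case: ifPn=> nS /=;first by rewrite gmul1.
have [op Pg] := gamP i nS;rewrite -/(zt z r) mulrDr !cexpD;split.
- exact: PM.
- rewrite HR.1 -mulmxA IH2 -scalemxAr (ode_col (z 0 i) HR op (Dv nS)) scalerA mulrC.
 by [].
- by rewrite chM // IH3 (chi_gam nS op Pg).
Qed.

Lemma P_eigen p: P p -> exists2 kap: C, kap != 0 & rho p *m v = kap *: v.
apply: (P_generated hP (Q := fun p => exists2 kap: C, kap != 0 & rho p *m v = kap *: v)).
- by exists 1;rewrite ?oner_eq0 // HR.2.1 mul1mx scale1r.
- move=> x y [kx kx0 Ex] [ky ky0 Ey];exists (ky * kx);first by rewrite mulf_neq0.
 by rewrite HR.1 -mulmxA Ey -scalemxAr Ex scalerA.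
- move=> x [kx kx0 Ex];exists kx^-1;first by rewrite invr_eq0.
 apply: (scalerI kx0);rewrite scalerA mulfV // scale1r scalemxAr -Ex mulmxA -HR.1 gmulV HR.2.1.
 by rewrite mul1mx.
have := P_char ltr01;apply: filterS=> p' H Pp';have [z [_ E _]] := H Pp'.
by exists (cexp z)=> //;exact: cexp_neq0.
Qed.
(** [Ym] collects v and the vectors D (b i) v for i in [S]. In xi = Ad(g^-1) u + l the first part is
    skew and drops out of the derivative of the Gram matrix, so [m] is the matrix of l on this
    span. *)
Lemma lie_geometry: exists (Ym: 'M[C]_(N, 1 + n)) (Z: 'M[C]_(1 + n, N)),
 [/\ col (lshift n 0) Ym = v, Z *m Ym = 1%:M,
 gram_law rho ip Ym & section_law pr rho v Ym].
have [es es_inj esS] := dimS.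
have sE (V: zmodType) (f: 'I_k -> V) := sum_es f es_inj esS.
pose Yb: 'M[C]_(N, n) := \matrix_(i, j) (D (b (es j)) *m v) i 0.
have Ybc j: col j Yb = D (b (es j)) *m v by apply/colP=> i;rewrite !mxE.
pose Ym: 'M[C]_(N, 1 + n) := row_mx v Yb.
have YbE (d: 'cV[C]_n): Yb *m d = \sum_j d j 0 *: (D (b (es j)) *m v).
 apply/colP=> i;rewrite mxE summxE;sumext j.
 by rewrite [RHS]mxE [Yb i j]mxE mulrC.
have inj (d: 'cV[C]_(1 + n)): Ym *m d = 0 -> d = 0.
 rewrite -[d]vsubmxK mul_row_col YbE=> H.
 (* The coefficients carried from ['I_n] to ['I_k] along [es], with 0 off its image. *)
 pose d' i: C := if [pick j | es j == i] is Some j then dsubmx d j 0 else 0.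
 have d'E j: d' (es j) = dsubmx d j 0.
 rewrite /d';case: pickP=> [j' /eqP/es_inj -> //|/(_ j)];by rewrite eqxx.
 have [|c0 dS] := indep (c := usubmx d 0 0) (d := d').
 rewrite -[RHS]H sE;congr (_ + _).
 by apply/colP=> i;rewrite !mxE big_ord1 !mxE mulrC.
 by sumext j;rewrite d'E.
 rewrite (_: usubmx d = 0);last by apply/colP=> i;rewrite ord1 c0 mxE.
 rewrite (_: dsubmx d = 0) ?col_mx0 //;apply/colP=> j;rewrite -d'E dS ?mxE //.
 by apply/esS;exists j.
have rf: row_free Ym^T.
 apply/inj_row_free=> w wY;have /inj /(congr1 trmx): Ym *m w^T = 0.
 by rewrite -[Ym]trmxK -trmx_mul wY trmx0.
 by rewrite trmxK trmx0.
exists Ym, (pinvmx Ym^T)^T;split.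
- by apply/colP=> i;rewrite mxE row_mxEl.
- by rewrite -[X in _ *m X]trmxK -trmx_mul mulmxVp // trmx1.
- move=> g xi;have [u [l [xiE hl]]] := real_dec g xi.
 pose M: 'M[C]_n := \matrix_(i, j) Mx ad Bm l (es i) (es j).
 pose cs: 'cV[C]_n := \col_i (\sum_(j | ~~ S j) Mx ad Bm l (es i) j * la (b j)).
 (* The trace is (1 + n) la l + \tr M, and \tr M = - la l by the definition of [lam]: n times la l
    in all. *)
 pose m: 'M[C]_(1 + n) := block_mx (la l)%:M 0 cs (M + (la l)%:M).
 have mE: D l *m Ym = Ym *m m^T.
 rewrite /Ym mul_mx_row Dl // tr_block_mx trmx0 tr_scalar_mx mul_row_block mulmx0 addr0.
 congr row_mx;first by rewrite mul_mx_scalar.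
 apply: (@matrix_colP _ _ _)=> j;rewrite col_mulmx Ybc (Dy (es j) hl) sE.
 rewrite col_aux Ybc YbE addrC mxE;congr (_ + (_ + _)).
 by sumext t;rewrite !mxE.
 exists m, (la l);split.
 + rewrite mxtrace_block mxtrace_scalar mulr1n linearD /= mxtrace_scalar.
 rewrite (_: \tr M = - la l);first by rewrite addrA subrr add0r mulr_natl.
 by rewrite /lam opprK sE;sumext i;rewrite mxE.
 + move=> c;rewrite -[c](splitK c);case: (fintype.split c)=> [i|i] /=.
 by rewrite block_mxEul !ord1 !mxE eqxx mulr1.
 by rewrite /m block_mxEur mxE mulr0.
 + pose K := D (iotaC B u).
 have KE: rho g *m D (admap (ginv g) (iotaC B u)) = K *m rho g.
 have := rep_conj (ginv g) (iotaC B u) HR;rewrite -/(D _) -/(D _) -/K=> <-.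
 by rewrite !mulmxA -HR.1 gmulV' HR.2.1 mul1mx -(ginv_uniq (gmulV g)).
 have Dx: D xi = D (admap (ginv g) (iotaC B u)) + D l.
 by rewrite xiE;have := D_lin 1 (admap (ginv g) (iotaC B u)) l;rewrite !scale1r.
 have E i: rho g *m dtau rho xi *m col i Ym = K *m (rho g *m col i Ym)
 + \sum_c m i c *: (rho g *m col c Ym) := col_split Dx KE mE i.
 have [gam op Gg] := u_gam cu u.
 move=> i j;rewrite !E !(ipDl hi) !(ipDr hi) addrACA (rep_skew HR hi _ _ op Gg) add0r.
 rewrite (ip_suml hi) (ip_sumr hi) -big_split;apply: eq_bigr=> c _ /=.
 by rewrite (ipZl hi) (ipZr hi).
- move=> U s c x ls ac ix Ux.
 have H w:= section_dpr hq w ls ac ix Ux.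
 have sg: gsm (fun y => s (param c y)) x by have [] := H 0.
 split=> //;pose g := s (param c x);pose vl w := vel (fun y => s (param c y)) x w.
 have dg: dom c (pr g).
 by have [_ _ ->] := ls=> //;have [] := imgP (atlas_ok ac) ix.
 have vlin t u w: vl (t *: u + w) = t *: vl u + vl w.
 apply: derive_lin;apply: lsd.
 have sg': gsm (fun y => gmul (ginv g) (s (param c y))) x by apply: gsm_mul=> //;exact: gsm_cst.
 by apply: sg'.2;[exact: echart_atlas|rewrite gmulV;exact: echart_one].
 have vlE w: vl w = \sum_i w 0 i *: vl (dlt i).
 have vl0: vl 0 = 0.
 by have := vlin (-1) 0 0;rewrite scaler0 addr0=> ->;rewrite scaleN1r addNr.
 have vlD u t: vl (u + t) = vl u + vl t by rewrite -[u]scale1r vlin !scale1r.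
 rewrite {1}(row_sum_delta w) (big_morph vl vlD vl0);sumext i.
 by rewrite -[X in vl X]addr0 vlin vl0 addr0.
 have coV w j: co Bm (vl w) j = \sum_i w 0 i * co Bm (vl (dlt i)) j.
 by rewrite vlE co_sum;sumext i;rewrite coZ.
 pose Th: 'M[C]_n := \matrix_(i, j) co Bm (vl (dlt i)) (es j).
 pose cc: 'cV[C]_n := \col_i \sum_(j | ~~ S j) co Bm (vl (dlt i)) j * la (b j).
 exists Th, cc;split.
 pose Dm: 'M[C]_n := \matrix_(j, t) dpr pr g c (b (es j)) 0 t.
 suff TD: Th *m Dm = 1%:M by exact: (mulmx1_unit TD).1.
 mxext i t;rewrite mxE.
 have [_ /(congr1 (fun r: 'rV[C]_n => r 0 t))] := H (dlt i).
 rewrite -/(vl _) -/g (@dpr_S R k n GC X P pr Lset hP hq Bm S Bu LS g c (vl (dlt i)) ac dg) sE.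
 rewrite summxE mxE eqxx [in X in _ -> X]mxE eq_sym /= => <-.
 by sumext j;rewrite !mxE.
 have DE x': D x' *m v = \sum_i co Bm x' i *: (D (b i) *m v).
 have D0: D 0 = 0 by have := D_lin (-1) 0 0;rewrite scaler0 addr0=> ->;rewrite scaleN1r addNr.
 have DD u t: D (u + t) = D u + D t by rewrite -[u]scale1r D_lin !scale1r.
 rewrite {1}[x'](coE Bu) (big_morph D DD D0) mulmx_suml;sumext i.
 by rewrite -[X in D X]addr0 D_lin D0 addr0 scalemxAl.
 move=> w;have dW: 'D_w (fun y => rho (s (param c y)) *m v) x = rho g *m (D (vl w) *m v).
 exact: (rep_vec_derive v w HR sg).
 rewrite dW -mulmxA;congr (_ *m _).
 have E1: \sum_(i | ~~ S i) co Bm (vl w) i *: (D (b i) *m v) = v *m (w *m cc)^T.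
 via ((w *m cc) 0 0 *: v).
 have T j: ~~ S j -> co Bm (vl w) j *: (D (b j) *m v) = (co Bm (vl w) j * la (b j)) *: v.
 by move=> nS;rewrite (Dv nS) scalerA.
 rewrite (eq_bigr _ T) -scaler_suml;apply: (f_equal2 (fun (c: C) (u: 'cV[C]_N) => c *: u))=> //.
 have ccE i: cc i 0 = \sum_(j | ~~ S j) co Bm (vl (dlt i)) j * la (b j) by rewrite mxE.
 clearbody cc;move: (fun j => la (b j)) ccE=> lb ccE.
 exact: (double_sum ccE (coV w)).
 exact: scale_as_mul.
 have E2: \sum_(i | S i) co Bm (vl w) i *: (D (b i) *m v) = Yb *m (w *m Th)^T.
 rewrite YbE sE;sumext j;apply: f_equal2=> //;rewrite coV 2!mxE.
 by sumext i;rewrite mxE.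
 have YE (p1: 'cV[C]_1) (p2: 'cV[C]_n): Ym *m col_mx p1 p2 = v *m p1 + Yb *m p2 by exact: mul_row_col.
 rewrite tr_row_mx YE -E1 -E2;apply: etrans (DE _) _.
 move: (fun i => co Bm (vl w) i *: (D (b i) *m v))=> F;rewrite (bigID S) /=;exact: addrC.
Qed.
End Package.

Section Leibniz.
Context {A: comNzRingType} (d: A -> A).
Context (dD: forall x y, d (x + y) = d x + d y)
 (dM: forall x y, d (x * y) = d x * y + x * d y).

Lemma leib0: d 0 = 0.
by have := dD 0 0;rewrite addr0=> /esym/eqP;rewrite -subr_eq0 addrK=> /eqP. Qed.
Lemma leib1: d 1 = 0.
by have := dM 1 1;rewrite !mul1r mulr1=> /esym/eqP;rewrite -subr_eq0 addrK=> /eqP. Qed.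
Lemma leib_sum (I: Type) (r: seq I) (P: pred I) (f: I -> A) :
 d (\sum_(i <- r | P i) f i) = \sum_(i <- r | P i) d (f i).
exact: (big_morph d dD leib0). Qed.
Lemma leib_exp x k: d (x ^+ k.+1) = k.+1%:R * x ^+ k * d x.
elim: k=> [|k IH];first by rewrite expr1 expr0 !mul1r.
by rewrite exprS dM IH -[in RHS]natr1 !exprS;ring.
Qed.
Lemma leib_mx p q r (X: 'M[A]_(p, q)) (Y: 'M[A]_(q, r)) :
 map_mx d (X *m Y) = map_mx d X *m Y + X *m map_mx d Y.
mxext i j;rewrite !mxE leib_sum -big_split;sumext l.
by rewrite !mxE dM.
Qed.
Lemma leib_inv x y: x * y = 1 -> d y = - (y * y * d x).
move=> xy;have := dM x y;rewrite xy leib1=> /esym/eqP;rewrite addrC addr_eq0=> /eqP h.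
by rewrite -[LHS]mul1r -xy mulrAC h;ring.
Qed.
Lemma leib_natZ k x: d (k%:R * x) = k%:R * d x.
rewrite dM (_: d k%:R = 0) ?mul0r ?add0r //.
by elim: k=> [|k IH];rewrite ?leib0 // -natr1 dD IH leib1 addr0.
Qed.
Lemma leib_prod0 (I: Type) (r: seq I) (P: pred I) (f: I -> A): (forall i, P i -> d (f i) = 0) ->
 d (\prod_(i <- r | P i) f i) = 0.
move=> H;elim/big_rec: _=> [|i x Pi IH];first exact: leib1.
by rewrite dM H // IH mul0r mulr0 addr0.
Qed.
Lemma leib_det0 p (X: 'M[A]_p): (forall i j, d (X i j) = 0) -> d (\det X) = 0.
move=> H;rewrite leib_sum big1 // => s _;rewrite dM leib_prod0 // mulr0 addr0.
rewrite (_: d _ = 0) ?mul0r //;case: (perm.odd_perm s);rewrite ?expr0 ?expr1 ?leib1 //.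
by have := dD 1 (-1);rewrite subrr leib0 leib1 add0r.
Qed.
End Leibniz.

(** * The complex Hessian of the cone potential and its determinant *)

Section ConeAlg.
Context {A: comNzRingType} {N n Nr: nat} (D: 'I_N -> A -> A).
Hypothesis HD: derivations D.
Context (bar: {rmorphism A -> A}) (z: 'I_(1 + n) -> A) (F: 'M[A]_(1 + n, N)).
Context (barK: involutive bar)
 (barD: forall i x, bar (D i x) = D i (bar x)).
Let E := \matrix_(i, a) D i (z a).
Notation bm X := (map_mx bar X).
Notation Dm i := (map_mx (D i)).
Context (FE: F *m E = 1%:M)
 (FEb: F *m bm E = 0)
 (EF: E *m F + bm E *m bm F = 1%:M).
Variables (phi half: A).
Context (half2: half * 2%:R = 1)
 (phib: bar phi = phi).
Let dz a x: A := \sum_i F a i * D i x.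
Let db a x: A := \sum_i bar (F a i) * D i x.
Notation o := (lshift n 0: 'I_(1 + n)).

Variables (RY: 'M[A]_(Nr, 1 + n)) (H: 'M[A]_Nr) (cc: 'cV[A]_n) (Tm: 'M[A]_n) (eps q qi ni: A).
Let G := RY^T *m H *m bm RY.
Let E2: 'M[A]_(N, n) := rsubmx (E: 'M[A]_(N, 1 + n)).
Context (DH: forall i, Dm i H = 0)
 (DW: forall i, Dm i (col o RY) = RY *m (row i E2 *m row_mx cc Tm)^T)
 (hT: forall a i j, db a (Tm i j) = 0)
 (De: forall i, D i eps = eps * qi * D i (z o))
 (Dq: forall i, D i qi = 0)
 (Dni: forall i, D i ni = 0)
 (DG: forall i, exists mu, D i (\det G) = n%:R * mu * \det G /\ D i (G o o) = mu * G o o)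
 (phiE: phi ^+ n.+1 = eps * bar eps * G o o).
Variables (phi' eps' G' t' dG': A).
Context (phiV: phi * phi' = 1) (epsV: eps * eps' = 1) (GV: G o o * G' = 1)
 (tV: \det Tm * t' = 1) (dGV: \det G * dG' = 1) (qV: q * qi = 1) (nV: n.+1%:R * ni = 1)
 (barq: bar q = q).
Let Rs: 'M[A]_(1 + n, n) := rsubmx (1%:M: 'M[A]_(1 + n, 1 + n)).
(** The rows express the holomorphic derivatives of [Wd] = eps W in the columns of [RY]. The row of
    the fibre coordinate is eps / q times W, as eps = exp(z_0 / q); the other rows come from the
    derivative of W, with components [cc] and [Tm]. *)
Definition cone_frame: 'M[A]_(1 + n) := eps *: (qi *: delta_mx o o + Rs *m row_mx cc Tm).
Notation TT := cone_frame.
(** The Gram matrix of the derivatives of [Wd]. Since [Wd] is holomorphic and the inner product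
    constant, it is also the complex Hessian of the square norm of [Wd], that is of phi^(n+1); this
    is [Pab]. *)
Definition cone_gram: 'M[A]_(1 + n) := TT *m G *m (bm TT)^T.
Notation NN := cone_gram.
Let dzD a x y: dz a (x + y) = dz a x + dz a y.
exact: (dzD HD bar F). Qed.
Let dzM a x y: dz a (x * y) = dz a x * y + x * dz a y.
exact: (dzM HD bar F). Qed.
Let dbD a x y: db a (x + y) = db a x + db a y.
exact: (dbD HD bar F). Qed.
Let dbM a x y: db a (x * y) = db a x * y + x * db a y.
exact: (dbM HD bar F). Qed.
Let FbE: bm F *m E = 0.
have: bm (F *m bm E) = 0 by rewrite FEb map_mx0.
rewrite map_mxM=> <-;congr (_ *m _);mxext i j;by rewrite !mxE barK.
Qed.
Let dz_z a b: dz a (z b) = (a == b)%:R.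
by have := congr1 (fun M: 'M[A]_(1 + n) => M a b) FE;rewrite !mxE=> <-;sumext i;rewrite mxE. Qed.
Let db_z a b: db a (z b) = 0.
have := congr1 (fun M: 'M[A]_(1 + n) => M a b) FbE;rewrite !mxE=> <-.
by sumext i;rewrite !mxE.
Qed.
Let const_dz x a: (forall i, D i x = 0) -> dz a x = 0 /\ db a x = 0.
by move=> h;split;rewrite /dz /db big1 // => i _;rewrite h mulr0. Qed.
Let dz_eps a: dz a eps = eps * qi * (a == o)%:R.
by rewrite -dz_z /dz mulr_sumr;sumext i;rewrite De;ring. Qed.
Let db_eps a: db a eps = 0.
via (eps * qi * db a (z o));last by rewrite db_z mulr0.
by rewrite /db mulr_sumr;sumext i;rewrite De;ring.
Qed.
Let FE2 (X: 'M[A]_(1 + n, N)): X *m E2 = rsubmx (X *m E: 'M[A]_(1 + n, 1 + n)).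
by rewrite /E2 -[in RHS](hsubmxK (E: 'M[A]_(N, 1 + n))) mul_mx_row row_mxKr. Qed.
Let sum_row (X: 'M[A]_(1 + n, N)) (a: 'I_(1 + n)) p (B: 'M[A]_(n, p)) :
 \sum_i X a i *: (row i E2 *m B) = row a (rsubmx (X *m E: 'M[A]_(1 + n, 1 + n))) *m B.
rewrite -FE2 -[RHS]row_mul -[X *m _ *m _]mulmxA;rowext j;rewrite summxE !mxE.
by sumext i;rewrite !mxE;congr (_ * _);sumext l;rewrite mxE.
Qed.
Let dW (X: 'M[A]_(1 + n, N)) a: map_mx (fun x => \sum_i X a i * D i x) (col o RY) =
 RY *m (row a (rsubmx (X *m E: 'M[A]_(1 + n, 1 + n))) *m row_mx cc Tm)^T.
rewrite -sum_row.
via (\sum_i X a i *: Dm i (col o RY)).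
 by apply/colP=> j;rewrite summxE !mxE;sumext i;rewrite !mxE.
under eq_bigr do rewrite DW scalemxAr.
rewrite -mulmx_sumr;congr (_ *m _);apply/colP=> j;rewrite summxE [RHS]mxE summxE.
by sumext i;rewrite mxE [LHS]mulrC mxE [RHS]mxE mulrC.
Qed.
Let Wd: 'cV[A]_Nr := eps *: col o RY.
Let dzWd a: map_mx (dz a) Wd = RY *m (row a TT)^T.
have -> : map_mx (dz a) Wd = dz a eps *: col o RY + eps *: map_mx (dz a) (col o RY).
 by apply/colP=> i;rewrite !mxE dzM.
rewrite [map_mx (dz a) _](dW F a) FE dz_eps colE !scalemxAr -mulmxDr;congr (_ *m _).
rewrite -row_mul;apply/colP=> i;rewrite !mxE.
by case: (a == o);case: (i == o);rewrite /= ?mulr1 ?mulr0;ring.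
Qed.
Let dbWd a: map_mx (db a) Wd = 0.
have -> : map_mx (db a) Wd = db a eps *: col o RY + eps *: map_mx (db a) (col o RY).
 by apply/colP=> i;rewrite !mxE dbM.
have -> : map_mx (db a) (col o RY) = map_mx (fun x => \sum_i (bm F) a i * D i x) (col o RY).
 by apply/colP=> i;rewrite !mxE;sumext l;rewrite !mxE.
rewrite dW FbE db_eps scale0r add0r (_: rsubmx 0 = 0);last by mxext i l;rewrite !mxE.
by rewrite row0 mul0mx trmx0 mulmx0 scaler0.
Qed.
Let H0 a: map_mx (dz a) H = 0 /\ map_mx (db a) H = 0.
have h i x y: D i (H x y) = 0 by have := congr1 (fun M: 'M[A]_Nr => M x y) (DH i);rewrite !mxE.
by split;mxext x y;rewrite !mxE;have [] := const_dz a (fun i => h i x y).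
Qed.
Let pair (u w: 'rV[A]_(1 + n)): (RY *m u^T)^T *m H *m bm (RY *m w^T) = u *m G *m (bm w)^T.
by rewrite /G trmx_mul trmxK map_mxM map_trmx !mulmxA. Qed.
Let row_o: row o TT = (eps * qi) *: dlt o.
rewrite /TT linearZ /= linearD /= linearZ /= row_mul (_: row o Rs = 0) ?mul0mx ?addr0.
 by rewrite scalerA;congr (_ *: _);rowext i;rewrite !mxE eqxx.
rowext i;rewrite !mxE -val_eqE /=;by [].
Qed.
Let WdE: Wd = RY *m (q *: row o TT)^T.
rewrite row_o scalerA (_: q * (eps * qi) = eps);last by rewrite mulrCA qV mulr1.
by rewrite linearZ /= trmx_delta -scalemxAr -colE.
Qed.
Let NNE a b: NN a b = (row a TT *m G *m (bm (row b TT))^T) 0 0.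
rewrite -row_mul mxE [RHS]mxE;sumext k;rewrite !mxE.
by [].
Qed.
Let qo: q *: row o TT = eps *: dlt o.
by rewrite row_o scalerA mulrCA qV mulr1. Qed.
Let pairZ (c d: A) (u w: 'rV[A]_(1 + n)) :
 ((c *: u) *m G *m (bm (d *: w))^T) 0 0 = c * bar d * (u *m G *m (bm w)^T) 0 0.
have -> : (bm (d *: w))^T = bar d *: (bm w)^T by apply/matrixP=> ? ?;rewrite !mxE rmorphM.
by rewrite -!scalemxAl -scalemxAr scalerA mxE.
Qed.
Let phiW: phi ^+ n.+1 = (Wd^T *m H *m bm Wd) 0 0.
rewrite WdE pair qo map_mxZ map_delta_mx -!scalemxAl linearZ /= -scalemxAr trmx_delta -rowE -colE phiE.
by rewrite !mxE;ring.
Qed.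
Let NN_phi: phi ^+ n.+1 = q ^+ 2 * NN o o.
by rewrite phiW WdE pair NNE pairZ barq expr2.
Qed.
Let cst_mul a x y: db a x = 0 -> db a y = 0 -> db a (x * y) = 0.
by move=> hx hy;rewrite dbM hx hy mul0r mulr0 addr0. Qed.
Let bardz a x: bar (dz a x) = db a (bar x). exact: (bar_dz F barD). Qed.
Let bardb a x: bar (db a x) = dz a (bar x). exact: (bar_db F barK barD). Qed.
Let dzbC' a b x: dz a (db b x) = db b (dz a x). exact: (dzbC HD barK barD FE FEb EF). Qed.
Let dbWb b: map_mx (db b) (bm Wd) = bm (map_mx (dz b) Wd).
by apply/colP=> i;rewrite !mxE bardz. Qed.
Let dzWb a: map_mx (dz a) (bm Wd) = 0.
have: map_mx bar (map_mx (db a) Wd) = 0 by rewrite dbWd map_mx0.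
by move=> <-;apply/colP=> i;rewrite !mxE bardb.
Qed.
Let dzdbWb a b: map_mx (dz a) (bm (map_mx (dz b) Wd)) = 0.
have dbz i: db a (dz b (Wd i 0)) = 0.
 rewrite -dzbC' (_: db a (Wd i 0) = 0) ?(leib0 (dzD b)) //.
 by have := congr1 (fun M: 'cV[A]_Nr => M i 0) (dbWd a);rewrite !mxE.
apply/colP=> i;rewrite !mxE -[RHS](rmorph0 bar) -(dbz i) bardb.
by rewrite !mxE.
Qed.
Let mxdz a p q' r (X: 'M[A]_(p, q')) (Y: 'M[A]_(q', r)) :
 map_mx (dz a) (X *m Y) = map_mx (dz a) X *m Y + X *m map_mx (dz a) Y.
exact: (leib_mx (dzD a) (dzM a)). Qed.
Let mxdb a p q' r (X: 'M[A]_(p, q')) (Y: 'M[A]_(q', r)) :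
 map_mx (db a) (X *m Y) = map_mx (db a) X *m Y + X *m map_mx (db a) Y.
exact: (leib_mx (dbD a) (dbM a)). Qed.
Let Pb b: db b (phi ^+ n.+1) = q * NN o b.
rewrite phiW;have -> : db b ((Wd^T *m H *m bm Wd) 0 0) = map_mx (db b) (Wd^T *m H *m bm Wd) 0 0 by rewrite [RHS]mxE.
rewrite !mxdb (H0 b).2 -map_trmx dbWd trmx0 mulmx0 mul0mx addr0 mul0mx add0r dbWb dzWd WdE pair.
by rewrite NNE -!scalemxAl mxE.
Qed.
Let Pa a: dz a (phi ^+ n.+1) = q * NN a o.
rewrite phiW;have -> : dz a ((Wd^T *m H *m bm Wd) 0 0) = map_mx (dz a) (Wd^T *m H *m bm Wd) 0 0 by rewrite [RHS]mxE.
rewrite !mxdz (H0 a).1 -map_trmx dzWb mulmx0 !addr0 dzWd mulmx0 addr0 WdE pair.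
by rewrite NNE -[row a TT]scale1r pairZ barq mul1r scale1r.
Qed.
Let Pab a b: dz a (db b (phi ^+ n.+1)) = NN a b.
rewrite phiW;have -> : db b ((Wd^T *m H *m bm Wd) 0 0) = map_mx (db b) (Wd^T *m H *m bm Wd) 0 0 by rewrite [RHS]mxE.
rewrite !mxdb (H0 b).2 -map_trmx dbWd trmx0 mulmx0 mul0mx addr0 mul0mx add0r dbWb.
rewrite (_: dz a _ = map_mx (dz a) (Wd^T *m H *m bm (map_mx (dz b) Wd)) 0 0);last by rewrite [RHS]mxE.
by rewrite !mxdz (H0 a).1 -map_trmx dzdbWb mulmx0 !addr0 !dzWd mulmx0 addr0 pair -NNE.
Qed.

Definition cone_gram_inv: A := q ^+ 2 * (eps' * bar eps' * G').
Notation N' := cone_gram_inv.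

Lemma cone_gram_invP: NN o o * N' = 1.
have -> : NN o o = qi ^+ 2 * (eps * bar eps * G o o).
 rewrite -phiE NN_phi mulrA -exprMn [qi * q]mulrC qV expr1n mul1r.
 by [].
have be: bar eps * bar eps' = 1 by rewrite -rmorphM epsV rmorph1.
via ((q * qi) ^+ 2 * (eps * eps') * (bar eps * bar eps') * (G o o * G')).
 by rewrite /N';ring.
by rewrite qV epsV be GV expr1n !mulr1.
Qed.

(** Differentiate phi^(n+1) twice and solve for the Hessian of phi. The product of first derivatives
    gives the rank-one term, normalized by phi^(n+1) = q^2 NN_oo. *)
Lemma cone_hessian: \matrix_(a, b) (half * dz a (db b phi)) =
 (half * ni * phi' ^+ n) *: (NN - (n%:R * ni * N') *: (col o NN *m row o NN)).
mxext a b;rewrite mxE.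
via (half * ni * phi' ^+ n * (NN a b - n%:R * ni * N' * (NN a o * NN o b)));last first.
 by rewrite !mxE big_ord1 !mxE.
have hb: n.+1%:R * phi ^+ n * db b phi = q * NN o b by rewrite -Pb (leib_exp (dbM b)).
have ha: n.+1%:R * phi ^+ n * dz a phi = q * NN a o by rewrite -Pa (leib_exp (dzM a)).
have hab: NN a b = n.+1%:R * (dz a (phi ^+ n) * db b phi + phi ^+ n * dz a (db b phi)).
 rewrite -Pab (leib_exp (dbM b)) -mulrA (leib_natZ (dzD a) (dzM a)) dzM.
 by [].
have hn: dz a (phi ^+ n) * phi = n%:R * phi ^+ n * dz a phi.
 case: (n)=> [|k];first by rewrite expr0 (leib1 (dzM a)) mul0r !mul0r.
 by rewrite (leib_exp (dzM a)) exprS;ring.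
have vn: phi ^+ n * phi' ^+ n = 1 by rewrite -exprMn phiV expr1n.
have vN: phi ^+ n.+1 * (qi ^+ 2 * N') = 1.
 rewrite NN_phi (_: _ * _ = (q * qi) ^+ 2 * (NN o o * N'));last by ring.
 by rewrite qV cone_gram_invP expr1n mulr1.
set x := dz a phi in ha hn *;set y := db b phi in hb hab *;set u := dz a y in hab *.
set w := dz a (phi ^+ n) in hab hn.
(* Inverses are ring elements with product 1, so dividing means inserting [vN] and [nV]. *)
have key: n.+1%:R * (w * y) = n%:R * ni * N' * (NN a o * NN o b).
 via (n.+1%:R * (w * y) * (phi ^+ n.+1 * (qi ^+ 2 * N')) * (n.+1%:R * ni)).
 by rewrite vN nV !mulr1.
 via ((w * phi) * (n.+1%:R * phi ^+ n * y) * (qi ^+ 2 * N') * (n.+1%:R * ni)).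
 by rewrite exprS;ring.
 rewrite hn hb.
 via (n%:R * (n.+1%:R * phi ^+ n * x) * (q * NN o b) * (qi ^+ 2 * N') * ni);first by ring.
 rewrite ha;via (n%:R * ni * N' * (NN a o * NN o b) * (q * qi) ^+ 2);first by ring.
 by rewrite qV expr1n mulr1.
have -> : NN a b - n%:R * ni * N' * (NN a o * NN o b) = n.+1%:R * phi ^+ n * u.
 by rewrite hab -key;ring.
via (half * u * (n.+1%:R * ni) * (phi ^+ n * phi' ^+ n));first by rewrite nV vn !mulr1.
by ring.
Qed.
Let barqi: bar qi = qi.
by rewrite -[LHS]mulr1 -qV mulrA -{1}barq -rmorphM [qi * q]mulrC qV rmorph1 mul1r. Qed.

Lemma cone_frame_det: \det TT = eps ^+ (1 + n) * (qi * \det Tm).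
rewrite detZ (_: qi *: delta_mx o o + Rs *m row_mx cc Tm = block_mx qi%:M 0 cc Tm).
 by rewrite det_lblock det_scalar1.
have -> : Rs = col_mx 0 1%:M.
 mxext i j;rewrite mxE [LHS]mxE;case: (split_ordP i)=> i' ->.
 by rewrite col_mxEu mxE eq_shift.
 by rewrite col_mxEd mxE eq_shift.
rewrite mul_col_mx mul0mx mul1mx;mxext i j;rewrite [LHS]mxE [X in X + _]mxE [delta_mx _ _ _ _]mxE.
case: (split_ordP i)=> i' ->;case: (split_ordP j)=> j' ->;rewrite !eq_shift.
- by rewrite block_mxEul col_mxEu !mxE !ord1 eqxx mulr1 addr0.
- by rewrite block_mxEur col_mxEu !mxE andbF mulr0 addr0.
- by rewrite block_mxEdl col_mxEd row_mxEl mulr0 add0r.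
- by rewrite block_mxEdr col_mxEd row_mxEr mulr0 add0r.
Qed.
Let det_rank1 (c: A) (r: 'rV[A]_(1 + n)): \det (1%:M - c *: (delta_mx o 0 *m r)) = 1 - c * r 0 o.
have -> : 1%:M - c *: (delta_mx o 0 *m r) =
 block_mx (1 - c * r 0 o)%:M (- c *: rsubmx (r: 'M[A]_(1, 1 + n))) 0 1%:M.
 mxext i j;rewrite [LHS]mxE [X in _ + X]mxE [X in - X]mxE.
 have -> : (delta_mx o 0 *m r: 'M[A]_(1 + n)) i j = (i == o)%:R * r 0 j.
 by rewrite mxE big_ord1 !mxE eqxx andbT.
 rewrite [in LHS]mxE;case: (split_ordP i)=> i' ->;case: (split_ordP j)=> j' ->.
 - by rewrite block_mxEul !ord1 !mxE !eqxx mul1r.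
 - by rewrite block_mxEur !ord1 !mxE eqxx mul1r !eq_shift sub0r mulNr.
 - by rewrite block_mxEdl !mxE !eq_shift mul0r mulr0 subr0.
 - by rewrite block_mxEdr !mxE !eq_shift mul0r mulr0 subr0.
by rewrite det_ublock det_scalar1 det1 mulr1.
Qed.
Let det_gram: \det NN = \det TT * \det G * bar (\det TT).
by rewrite !det_mulmx det_tr det_map_mx. Qed.

(** In the determinant of the Gram matrix |eps|^2 occurs with exponent n + 1, and the factor
    phi^(-n(n+1)) removes n of these powers: one factor eps stays in the holomorphic part, and det G
    / (G_oo)^n in [cone_Psi]. *)
Definition cone_T: A := eps * \det Tm.
Definition cone_Psi: A := (half * ni) ^+ (1 + n) * ni * qi ^+ 2 * (\det G * G' ^+ n).
Notation T := cone_T.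
Notation Psi := cone_Psi.
Let be: bar eps * bar eps' = 1. by rewrite -rmorphM epsV rmorph1. Qed.
Let phi'E: phi' ^+ n.+1 = eps' * bar eps' * G'.
have v: phi ^+ n.+1 * phi' ^+ n.+1 = 1 by rewrite -exprMn phiV expr1n.
rewrite -[RHS]mulr1 -v phiE.
via ((eps * eps') * (bar eps * bar eps') * (G o o * G') * phi' ^+ n.+1);last by ring.
by rewrite epsV be GV !mul1r.
Qed.
Let ni1: 1 - n%:R * ni = ni.
by apply/eqP;rewrite subr_eq;apply/eqP;rewrite -[LHS]nV -natr1;ring. Qed.

Lemma cone_det: \det (\matrix_(a, b) (half * dz a (db b phi))) = Psi * (T * bar T).
rewrite cone_hessian detZ.
have -> : NN - (n%:R * ni * N') *: (col o NN *m row o NN) =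
 NN *m (1%:M - (n%:R * ni * N') *: (delta_mx o 0 *m row o NN)).
 by rewrite mulmxBr mulmx1 -scalemxAr mulmxA -colE.
have c1: 1 - n%:R * ni * N' * NN o o = ni.
 by rewrite -[RHS]ni1 -[in RHS](mulr1 (n%:R * ni)) -cone_gram_invP;ring.
rewrite det_mulmx det_rank1 [row o NN 0 o]mxE c1 det_gram cone_frame_det.
rewrite /T /Psi !(rmorphM bar) (rmorphXn bar) barqi [(half * ni * _) ^+ _]exprMn -[(phi' ^+ n) ^+ _]exprM mulnC exprM phi'E.
set t := \det Tm;set g := \det G;set u := half * ni.
via (u ^+ (1 + n) * ni * qi ^+ 2 * g * (t * bar t) * (eps * bar eps) * ((eps * eps') * (bar eps * bar eps')) ^+ n * G' ^+ n);last first.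
 by rewrite epsV be mulr1 expr1n;ring.
by rewrite !exprD !expr1 !exprMn;ring.
Qed.
Let dhalf i: D i half = 0.
have := derM HD i half 2%:R;rewrite half2 (der1 HD).
rewrite (_: D i 2%:R = 0);last by rewrite -[2%:R]natr1 (derD HD) (der1 HD) addr0.
rewrite mulr0 addr0=> h;rewrite -[LHS]mulr1 -half2 mulrCA mulrC -h mul0r.
by [].
Qed.
Let dni i: D i ni = 0. exact: Dni. Qed.

(** The logarithmic derivatives n mu of det G and mu of G_oo cancel in det G / (G_oo)^n. *)
Lemma cone_dPsi i: D i Psi = 0.
have [mu [d1 d2]] := DG i.
have dD:= derD HD i;have dM:= derM HD i.
have d3: D i (G' ^+ n) = - (n%:R * mu) * G' ^+ n.
 have d4: D i G' = - mu * G'.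
 rewrite (leib_inv dM GV) d2.
 via (- mu * G' * (G o o * G'));first by ring.
 by rewrite GV mulr1.
 case: (n)=> [|k];first by rewrite expr0 (leib1 dM);ring.
 by rewrite (leib_exp dM) d4 exprS;ring.
have dX x k: D i x = 0 -> D i (x ^+ k) = 0.
 by move=> h;case: k=> [|k];rewrite ?expr0 ?(leib1 dM) // (leib_exp dM) h mulr0.
have c0: D i ((half * ni) ^+ (1 + n) * ni * qi ^+ 2) = 0.
 rewrite dM (dX _ _ (Dq i)) mulr0 addr0 dM dni mulr0 addr0 dX ?mul0r //.
 by rewrite dM dhalf dni mul0r mulr0 addr0.
by rewrite /Psi dM c0 mul0r add0r dM d1 d3;ring.
Qed.

Lemma cone_ricci (hi: 'M[A]_(1 + n)) (gi: 'M[A]_N) :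
 \matrix_(a, b) (half * dz a (db b phi)) *m hi = 1%:M ->
 kmetric D bar z F phi half *m gi = 1%:M -> forall j k, ric D (kmetric D bar z F phi half) gi half j k = 0.
move=> hh gg;apply: (kaehler_ricci_flat HD barK barD FE FEb EF half2 phib hh _ gg)=> a b.
apply: (@kgamma_tr A N D HD (1 + n) bar z F barK barD FE FEb EF phi half hi hh Psi T
 ((2%:R * n.+1%:R) ^+ (1 + n) * n.+1%:R * q ^+ 2 * (dG' * G o o ^+ n)) (eps' * t')).
- via ((half * 2%:R * (n.+1%:R * ni)) ^+ (1 + n) * (n.+1%:R * ni) * (q * qi) ^+ 2
 * (\det G * dG') * (G o o * G') ^+ n).
 by rewrite /Psi;set u := n.+1%:R;rewrite !exprMn !exprD !expr1;ring.
 by rewrite half2 nV qV dGV GV !mulr1 !expr1n !mulr1.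
- by rewrite /T mulrACA epsV tV mulr1.
- exact: cone_dPsi.
- move=> c;apply: cst_mul;first exact: db_eps.
 by apply: (leib_det0 (dbD c) (dbM c))=> i j;exact: hT.
- exact: cone_det.
Qed.
End ConeAlg.

(** Multiplied by the adjugate, each half of D contributes the trace of m or its conjugate times det
    G; the first row of m is concentrated in its corner, which settles the corner of D. *)
Lemma gram_trace (A: comNzRingType) (bar: {rmorphism A -> A}) n (m G D: 'M[A]_(1 + n)) lm
 (o := lshift n 0: 'I_(1 + n)): \tr m = n%:R * lm -> (forall c, m o c = lm * (c == o)%:R) ->
 D = m *m G + G *m (map_mx bar m)^T ->
 \tr (D *m \adj G) = n%:R * (lm + bar lm) * \det G /\ D o o = (lm + bar lm) * G o o.
move=> trm m0 ->;split.
 rewrite mulmxDl mxtraceD -mulmxA mul_mx_adj mxtrace_mulC mul_scalar_mx mxtraceZ.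
 rewrite [X in _ + X]mxtrace_mulC mulmxA mul_adj_mx mul_scalar_mx mxtraceZ mxtrace_tr trace_map_mx trm.
 by rewrite rmorphM rmorph_nat;ring.
rewrite mxE [X in X + _]mxE [X in _ + X]mxE (bigD1 o) //= m0 eqxx mulr1 big1 ?addr0;last first.
 by move=> j jo;rewrite m0 (negPf jo) mulr0 mul0r.
rewrite (bigD1 o) //= big1 ?addr0;last first.
 by move=> j jo;rewrite !mxE m0 (negPf jo) mulr0 rmorph0 mulr0.
by rewrite !mxE m0 eqxx mulr1;ring.
Qed.

(** * The Kähler form and the metric of a potential *)

Section Potential.
Context {A: comNzRingType} {N m: nat} (D: 'I_N -> A -> A).
Hypothesis HD: derivations D.
Context (bar: {rmorphism A -> A}) (z: 'I_m -> A) (F: 'M[A]_(m, N)).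
Context (barK: involutive bar)
 (barD: forall i x, bar (D i x) = D i (bar x)).
Let E := \matrix_(i, a) D i (z a).
Notation bm X := (map_mx bar X).
Context (FE: F *m E = 1%:M)
 (FEb: F *m bm E = 0)
 (EF: E *m F + bm E *m bm F = 1%:M).
Variables (phi half ii: A) (J: 'M[A]_N).
Context (half2: half * 2%:R = 1)
 (phib: bar phi = phi)
 (ii2: ii * ii = -1)
 (iib: bar ii = - ii)
 (Dii: forall i, D i ii = 0)
 (Dhalf: forall i, D i half = 0)
 (halfb: bar half = half)
 (Jb: bm J = J)
 (JE: J *m E = ii *: E).
Let dz a x: A := \sum_i F a i * D i x.
Let db a x: A := \sum_i bar (F a i) * D i x.

Definition pot_form: 'cV[A]_N := - half *: (J *m \col_l D l phi).
Definition pot_form2: 'M[A]_N := \matrix_(i, j) (half * (D i (pot_form j 0) - D j (pot_form i 0))).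
Notation Phi := pot_form.
Notation Om := pot_form2.
Notation g := (kmetric D bar z F phi half).
Let p a := dz a phi.
Let Xf k := \sum_a E k a * p a.
Let Dphi k: D k phi = Xf k + bar (Xf k).
rewrite (der_dzdb barD EF k phi) big_split /=;congr (_ + _).
rewrite /Xf rmorph_sum;sumext a;rewrite rmorphM;congr (_ * _).
by rewrite /p /dz [RHS](bar_dz F barD) phib.
Qed.
Let PhiE k: Phi k 0 = - (half * ii) * (Xf k - bar (Xf k)).
have JX: J *m \col_l Xf l = ii *: \col_l Xf l.
 have -> : \col_l Xf l = E *m \col_a p a.
 by apply/colP=> l;rewrite !mxE;sumext a;rewrite !mxE.
 by rewrite mulmxA JE scalemxAl.
have JXb: J *m bm (\col_l Xf l) = - ii *: bm (\col_l Xf l).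
 by rewrite -{1}Jb -map_mxM JX map_mxZ iib.
have -> : Phi = - half *: (ii *: \col_l Xf l - ii *: bm (\col_l Xf l)).
 rewrite /Phi;congr (_ *: _);rewrite -JX -[X in _ - X]opprK -scaleNr -JXb opprK -mulmxDr;congr (_ *m _).
 by apply/colP=> l;rewrite !mxE Dphi.
by rewrite !mxE;ring.
Qed.
Let Kq: 'M[A]_N := E *m (\matrix_(a, b) dz a (db b phi)) *m (bm E)^T.
(** The second derivatives of [z] and the (2,0) terms are symmetric in i and k and cancel; only the
    mixed Hessian [Kq] survives. *)
Let DX i k: D i (Xf k) - D k (Xf i) = Kq k i - Kq i k.
have X1 i' k': D i' (Xf k') = \sum_a D i' (D k' (z a)) * p a
 + \sum_a \sum_b E k' a * E i' b * dz b (p a) + Kq k' i'.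
 rewrite /Xf (der_sum HD);under eq_bigr do rewrite (derM HD).
 rewrite big_split /= -addrA;congr (_ + _).
 by sumext a;rewrite mxE.
 have -> : Kq k' i' = \sum_a \sum_b E k' a * bar (E i' b) * db b (p a).
 rewrite /Kq -mulmxA mxE;sumext a;rewrite [X in _ * X]mxE mulr_sumr;sumext b.
 by rewrite !mxE -mulrA;congr (_ * _);rewrite mulrC;congr (_ * _);exact: (dzbC HD barK barD FE FEb EF).
 rewrite -big_split;sumext a;rewrite (der_dzdb barD EF i' (p a)) mulr_sumr -big_split.
 by apply: eq_bigr=> b _ /=;rewrite mulrDr !mulrA.
rewrite !X1 (eq_bigr (fun a => D k (D i (z a)) * p a));last by move=> a _;rewrite (derC HD).
have -> : \sum_a \sum_b E k a * E i b * dz b (p a) = \sum_a \sum_b E i a * E k b * dz b (p a).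
 rewrite exchange_big /=;sumext a;sumext b;rewrite [E k b * _]mulrC;congr (_ * _).
 exact: (dzC HD barK barD FE FEb EF).
by rewrite opprD addrACA opprD [_ + (- _ - _)]addrACA subrr subrr !add0r.
Qed.
Let qb: bm (\matrix_(a, b) dz a (db b phi)) = (\matrix_(a, b) dz a (db b phi))^T.
mxext a b;rewrite !mxE.
rewrite [LHS](bar_dz F barD) (bar_db F barK barD) phib.
exact: (esym (dzbC HD barK barD FE FEb EF b a phi)).
Qed.
Let Kb: bm Kq = Kq^T.
have bE: bm (bm E) = E by mxext a b;rewrite !mxE barK.
by rewrite /Kq !map_mxM qb -map_trmx bE !trmx_mul trmxK mulmxA.
Qed.

Lemma pot_form2E: Om = (half * ii) *: (Kq - Kq^T).
mxext i k;rewrite mxE !PhiE.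
have dc i' x: D i' (- (half * ii) * x) = - (half * ii) * D i' x.
 by rewrite (derM HD) (derN HD) (derM HD) Dhalf Dii mul0r mulr0 addr0 oppr0 mul0r add0r.
have KbE a b: bar (Kq a b) = Kq b a by have := congr1 (fun M: 'M[A]_N => M a b) Kb;rewrite !mxE.
rewrite !dc !(derB HD) -!barD !mxE.
via (half * (- (half * ii)) * ((D i (Xf k) - D k (Xf i)) - bar (D i (Xf k) - D k (Xf i)))).
 by rewrite rmorphB;ring.
rewrite DX rmorphB !KbE;via (half * ii * (half * 2%:R) * (Kq i k - Kq k i));first by ring.
by rewrite half2 mulr1 !mxE.
Qed.
Let JEb: J *m bm E = - ii *: bm E.
by rewrite -{1}Jb -map_mxM JE map_mxZ iib. Qed.
Let gE: g = half *: (Kq + Kq^T).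
rewrite /kmetric;have -> : (\matrix_(a, b) (half * dz a (db b phi))) = half *: \matrix_(a, b) dz a (db b phi).
 by mxext a b;rewrite !mxE.
rewrite map_mxZ halfb -!scalemxAr -!scalemxAl -scalerDr;congr (_ *: (_ + _)).
by rewrite /Kq !trmx_mul trmxK mulmxA qb.
Qed.
Let JK: J *m Kq = ii *: Kq.
by rewrite /Kq !mulmxA JE !scalemxAl. Qed.
Let JKT: J *m Kq^T = - ii *: Kq^T.
by rewrite /Kq !trmx_mul trmxK !mulmxA JEb !scalemxAl. Qed.
Let KJ: Kq *m J^T = - ii *: Kq.
by have := congr1 trmx JKT;rewrite trmx_mul trmxK linearZ /= trmxK. Qed.
Let KTJ: Kq^T *m J^T = ii *: Kq^T.
by have := congr1 trmx JK;rewrite trmx_mul linearZ. Qed.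

Lemma pot_metric: Om *m J^T = g.
rewrite pot_form2E gE -scalemxAl mulmxBl KJ KTJ.
by mxext a b;rewrite !mxE;via (- (ii * ii) * half * (Kq a b + Kq b a));[rewrite !mxE;ring|rewrite ii2 !mxE;ring].
Qed.
Lemma pot_J_metric: J *m g = Om.
rewrite pot_form2E gE -scalemxAr mulmxDr JK JKT.
by mxext a b;rewrite !mxE;ring.
Qed.

Lemma pot_closed i j k: D i (Om j k) + D j (Om k i) + D k (Om i j) = 0.
have dh l x: D l (half * x) = half * D l x by rewrite (derM HD) Dhalf mul0r add0r.
rewrite ![Om _ _]mxE !dh !(derB HD) (derC HD i j) (derC HD j k) (derC HD k i);ring.
Qed.
End Potential.

(** * Positivity of a rank-one perturbation *)

Section Positivity.
Context {R: realType} {n: nat}.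
Notation C := (cnum R).
Variable (M: 'M[C]_(1 + n)) (t: C).
Notation o := (lshift n 0: 'I_(1 + n)).
Notation st u := ((map_mx (fun z: C => z^*) u)^T).
Context (Mh: st M = M)
 (Mpos: forall u: 'rV[C]_(1 + n), u != 0 -> 0 < (u *m M *m st u) 0 0)
 (t0: 0 <= t)
 (t1: t < 1).

(** The value is (1 - t) times the norm of u plus t times the norm of its component orthogonal to
    the o-th vector; the first term is positive because t < 1. *)
Lemma cone_pos (u: 'rV[C]_(1 + n)): u != 0 ->
 0 < (u *m (M - (t * (M o o)^-1) *: (col o M *m row o M)) *m st u) 0 0.
move=> u0;set a := (u *m M *m st u) 0 0;set b := (u *m M) 0 o.
have stD p r (A1 A2: 'M[C]_(p, r)): st (A1 + A2) = st A1 + st A2 by rewrite map_mxD linearD.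
have eM w: (w *m M *m st (dlt o: 'rV[C]_(1 + n))) 0 0 = (w *m M) 0 o.
 by rewrite map_delta_mx trmx_delta -colE mxE.
have Moo: 0 < M o o.
 have := Mpos (u := dlt o);rewrite eM -rowE mxE;apply.
 by apply/eqP=> /rowP/(_ o);rewrite !mxE !eqxx=> /eqP;rewrite oner_eq0.
have be: (M *m st u) o 0 = b^*.
 have <- : st (u *m M) = M *m st u by rewrite map_mxM trmx_mul Mh.
 by rewrite mxE mxE.
have q0: 0 <= a - b * b^* / M o o.
 have Mr: (M o o)^* = M o o by have := congr1 (fun A: 'M[C]_(1 + n) => A o o) Mh;rewrite !mxE.
 pose w := u - (b / M o o) *: dlt o.
 suff <- : (w *m M *m st w) 0 0 = a - b * b^* / M o o.
 by have [->|w0] := eqVneq w 0;[rewrite !mul0mx mxE|exact/ltW/Mpos].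
 have -> : st w = st u - (b^* / M o o) *: st (dlt o: 'rV[C]_(1 + n)).
 by apply/colP=> i;rewrite !mxE rmorphB !rmorphM fmorphV /= Mr.
 have wM: w *m M = u *m M - (b / M o o) *: row o M by rewrite mulmxBl -scalemxAl -rowE.
 rewrite mulmxBr mxE [X in _ + X]mxE -scalemxAr [X in _ - X]mxE eM wM.
 rewrite mulmxBl mxE [X in _ + X - _]mxE -scalemxAl [X in _ - X - _]mxE -/a.
 have -> : (row o M *m st u) 0 0 = b^* by rewrite -be -row_mul mxE.
 rewrite mxE -/b [X in b + X]mxE [X in b - X]mxE [row o M 0 o]mxE divfK ?gt_eqF // subrr mulr0 subr0.
 by rewrite mulrAC.
have -> : (u *m (M - (t * (M o o)^-1) *: (col o M *m row o M)) *m st u) 0 0 =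
 (1 - t) * a + t * (a - b * b^* / M o o).
 rewrite mulmxBr mulmxBl mxE [X in _ + X]mxE -scalemxAr -scalemxAl [X in _ - X]mxE -/a.
 have -> : (u *m (col o M *m row o M) *m st u) 0 0 = b * b^*.
 rewrite mulmxA -mulmxA mxE big_ord1;congr (_ * _).
 by rewrite colE mulmxA -colE mxE.
 by rewrite -row_mul mxE be.
 by ring.
apply: ltr_pwDl;first by rewrite mulr_gt0 ?subr_gt0 // Mpos.
exact: mulr_ge0.
Qed.
End Positivity.

(** * Real smooth germs, gradients and angles *)

Lemma near_neq0 (K: numF) (V: nmod K) (g: V -> K) x: lsm g x -> g x != 0 ->
 \forall y \near x, g y != 0.
move=> sg g0;have cg: {for x, continuous g} by exact: lsm_cont.
have nz: \forall y \near g x, y != 0.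
 have /nbhs_ballP[e e0 be]: nbhs (g x) (ball (g x) `|g x|) by apply: nbhsx_ballx;rewrite normr_gt0.
 apply/nbhs_ballP;exists e=> // y /be;rewrite /ball /=;apply: contraTneq=> ->.
 by rewrite subr0 ltxx.
exact: (cg _ nz).
Qed.

Lemma lsm_inv (K: numF) (V: nmod K) (g: V -> K) x :
 g x != 0 -> lsm g x -> lsm (fun y => (g y)^-1) x.
move=> g0 sg;have [U [oU Ux h]] := sg;have nz:= near_neq0 sg g0.
have Wx: nbhs x [set y | g y != 0 /\ U y].
 by apply: filterI;[exact: nz|exact: onbhs].
exists [set y | g y != 0 /\ U y]°;split=> [| |m];first exact: open_interior.
 exact: Wx.
apply: smn_V;first exact: open_interior.
 by move=> y /interior_subset[].
by apply: smn_subset (h m)=> y /interior_subset[].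
Qed.

Lemma lsm_near_small (R: realType) (V: nmod R) (g: V -> R) x e: 0 < e -> lsm g x ->
 \forall y \near x, `|g y - g x| < e.
move=> e0 sg;have cg: {for x, continuous g} by exact: lsm_cont.
have := cg _ (nbhsx_ballx (g x) e e0)=> h.
have h': \forall y \near x, ball (g x) e (g y) := h.
by apply: filterS h'=> y;rewrite /ball /= distrC.
Qed.

Section RealSmooth.
Context {R: realType}.
Notation C := (cnum R).

Lemma lsm_fun (V: nmod R) (O: set R) (g: V -> R) (f: R -> R) x :
 open O -> O (g x) -> (forall m, smn m O f) -> lsm g x -> lsm (fun y => f (g y)) x.
move=> oO Ogx hf sg;have [U [oU Ux hg]] := sg.
have cg: {for x, continuous g} by exact: lsm_cont.
have Wx: nbhs x [set y | O (g y) /\ U y].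
 apply: filterI;last exact: onbhs.
 by apply: cg;exact: onbhs.
exists [set y | O (g y) /\ U y]°;split=> [| |m];first exact: open_interior.
 exact: Wx.
apply: (@smn_comp1 R V m _ O);[exact: open_interior|by move=> y /interior_subset[]| |exact: hf].
by apply: smn_subset (hg m)=> y /interior_subset[].
Qed.

Lemma lsm_ln (V: nmod R) (g: V -> R) x: 0 < g x -> lsm g x -> lsm (fun y => ln (g y)) x.
have oO: open [set x: R | 0 < x] by exact: open_gt.
by move=> g0;apply: (@lsm_fun V _ _ _ _ oO g0)=> m;exact: smn_ln.
Qed.
Lemma lsm_sin (V: nmod R) (g: V -> R) x: lsm g x -> lsm (fun y => sin (g y)) x.
by apply: (@lsm_fun V setT)=> // [|m];[exact: openT|exact: (smn_sincos m).1]. Qed.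
Lemma lsm_cos (V: nmod R) (g: V -> R) x: lsm g x -> lsm (fun y => cos (g y)) x.
by apply: (@lsm_fun V setT)=> // [|m];[exact: openT|exact: (smn_sincos m).2]. Qed.
Lemma lsm_expR (V: nmod R) (g: V -> R) x: lsm g x -> lsm (fun y => expR (g y)) x.
by apply: (@lsm_fun V setT)=> // [|m];[exact: openT|exact: smn_expR]. Qed.
Lemma derive_fun (V: nmod R) (g: V -> R) (f: R -> R) x v d: is_derive (g x) (1: R) f d ->
 dfb g x -> 'D_v (fun y => f (g y)) x = 'D_v g x * d.
move=> [df <-] dg;rewrite derive_comp1 //.
by apply/dfdP.
Qed.

Lemma lsm_Re n (F: 'rV[C]_n -> C) (x: 'rV[R]_(n + n)): lsm F (cplx x) ->
 lsm (fun y => cRe (F (cplx y)): R) x /\ lsm (fun y => cIm (F (cplx y)): R) x.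
move=> [U [oU Ux h]];split;exists (@cplx R n @^-1` U);split=> //;try exact: cplx_open.
 by move=> m;exact: smn_holo_Re.
by move=> m;exact: smn_holo_Im.
Qed.

Lemma realify_holo n m (G: 'rV[C]_n -> 'rV[C]_m) (x: 'rV[R]_(n + n)): lsm G (cplx x) ->
 lsm (fun z => realify (G (cplx z))) x /\
 forall w, 'D_w (fun z => realify (G (cplx z))) x = realify ('D_(cplx w) G (cplx x)).
move=> sG;have sE i:= (lsm_mx _ _).1 sG 0 i.
have lG: lsm (fun z => realify (G (cplx z))) x.
 apply/lsm_mx=> i j;rewrite ord1;case: (split_ordP j)=> l ->.
 by apply: lsm_ext (lsm_Re (sE l)).1=> y;rewrite /realify row_mxEl mxE.
 by apply: lsm_ext (lsm_Re (sE l)).2=> y;rewrite /realify row_mxEr mxE.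
split=> // w;rewrite derive_entry;last exact: lsd.
have dE i:= dfb_ij 0 i (lsd sG).
rowext j;rewrite [LHS]mxE;case: (split_ordP j)=> l ->.
 rewrite /realify [RHS]row_mxEl mxE -(dE l).2 -(holo_Re (dE l).1).2.
 by congr ('D_w _ x);fext y;rewrite row_mxEl mxE.
rewrite /realify [RHS]row_mxEr mxE -(dE l).2 -(holo_Im (dE l).1).2.
by congr ('D_w _ x);fext y;rewrite row_mxEr mxE.
Qed.

Definition grad m (f: 'rV[R]_m -> R) x: 'cV[R]_m := \col_i 'D_(dlt i) f x.

Lemma gradE m (f: 'rV[R]_m -> R) x w: dfb f x -> 'D_w f x = (w *m grad f x) 0 0.
by move=> df;rewrite deriveE // diff_rV_sum // mxE;sumext i;rewrite mxE. Qed.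
Lemma mulrow_ext m p (A B: 'M[R]_(m, p)): (forall w: 'rV_m, w *m A = w *m B) -> A = B.
by move=> h;apply/row_matrixP=> i;rewrite !rowE. Qed.
Lemma col_ext1 m (A B: 'cV[R]_m): (forall w: 'rV_m, (w *m A) 0 0 = (w *m B) 0 0) -> A = B.
by move=> h;apply: mulrow_ext=> w;mxext i j;rewrite !ord1. Qed.
Lemma mul_stdJ n (a b: 'rV[R]_n): row_mx a b *m stdJ n = row_mx (- b) a.
by rewrite mul_row_block !mulmx0 add0r addr0 mulmxN !mulmx1. Qed.

Lemma cplx_stdJ n (w: 'rV[R]_(n + n)): cplx (w *m stdJ n) = 'i *: cplx w.
have -> : w *m stdJ n = row_mx (- rsubmx w) (lsubmx w) by rewrite -{1}[w]hsubmxK mul_stdJ.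
rowext i;rewrite [LHS]mxE row_mxEl row_mxEr !mxE.
by apply: cpx_eq;rewrite ?cReM ?cImM /=;ring.
Qed.

Lemma realify_i n (z: 'rV[C]_n): realify ('i *: z) = realify z *m stdJ n.
rewrite mul_stdJ;congr row_mx;rowext i;rewrite !mxE ?cReM ?cImM /=;by ring.
Qed.
Lemma stdJ2 n: stdJ n *m stdJ n = - 1%:M :> 'M[R]_(n + n).
by rewrite mulmx_block !mulmx0 !mul0mx !add0r !addr0 mul1mx mulmx1 -[in LHS]oppr0 -opp_block_mx -scalar_mx_block.
Qed.

(** The Cauchy-Riemann equations. *)
Lemma holo_grad n (F: 'rV[C]_n -> C) (x: 'rV[R]_(n + n)): dfb F (cplx x) ->
 stdJ n *m grad (fun y => cIm (F (cplx y)): R) x = grad (fun y => cRe (F (cplx y)): R) x.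
move=> dF;have [dr Dr] := holo_Re dF;have [di Di] := holo_Im dF.
apply: col_ext1=> w;rewrite mulmxA -!gradE // Di Dr cplx_stdJ.
have -> : 'D_('i *: cplx w) F (cplx x) = 'i * 'D_(cplx w) F (cplx x).
 by rewrite !deriveE //;exact: linearZ.
by rewrite cImM /=;ring.
Qed.

Lemma sin0_small (t: R): sin t = 0 -> `|t| < 1 -> t = 0.
move=> st tt;have [t0|t0|//] := ltgtP t 0.
- have: 0 < sin (- t).
 apply: sin_gt0_pi;rewrite oppr_gt0 t0 /=;apply: lt_le_trans (pi_ge2 R).
 by rewrite -ltr0_norm // (lt_trans tt) // ltr1n.
 by rewrite sinN st oppr0 ltxx.
- have: 0 < sin t;last by rewrite st ltxx.
 by apply: sin_gt0_pi;rewrite t0 /=;apply: lt_le_trans (pi_ge2 R);rewrite -(gtr0_norm t0) (lt_trans tt) // ltr1n.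
Qed.

Definition clsm (V: nmod R) (F: V -> C) x: Prop :=
 lsm (fun y => cRe (F y): R) x /\ lsm (fun y => cIm (F y): R) x.

Section Clsm.
Context {V: nmod R}.
Implicit Types (F H: V -> C) (x: V).

Lemma clsm_ext F H x: (forall y, F y = H y) -> clsm F x -> clsm H x.
by move=> E [h1 h2];split;[apply: lsm_ext h1|apply: lsm_ext h2] => y;rewrite E. Qed.

Lemma clsm_cst c x: clsm (fun=> c) x.
by split;exact: lsm_cst. Qed.
Lemma clsm_add F H x: clsm F x -> clsm H x -> clsm (fun y => F y + H y) x.
by move=> [a b] [c d];split;[apply: lsm_ext (lsm_add a c)|apply: lsm_ext (lsm_add b d)] => y;rewrite ?cReD ?cImD.
Qed.
Lemma clsm_mul F H x: clsm F x -> clsm H x -> clsm (fun y => F y * H y) x.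
move=> [a b] [c d];split.
 by apply: lsm_ext (lsm_add (lsm_mul a c) (lsm_opp (lsm_mul b d)))=> y;rewrite cReM.
by apply: lsm_ext (lsm_add (lsm_mul a d) (lsm_mul b c))=> y;rewrite cImM.
Qed.
Lemma clsm_conj F x: clsm F x -> clsm (fun y => (F y)^*) x.
by move=> [a b];split;[apply: lsm_ext a|apply: lsm_ext (lsm_opp b)] => y;case: (F y).
Qed.
Lemma clsm_real (f: V -> R) x: lsm f x -> clsm (fun y => (f y)%:C) x.
by move=> h;split;[exact: h|exact: lsm_cst]. Qed.
Lemma clsm_sum (I: Type) (r: seq I) (F: I -> V -> C) x: (forall i, clsm (F i) x) ->
 clsm (fun y => \sum_(i <- r) F i y) x.
move=> h;elim: r=> [|i r IH].
 by apply: (clsm_ext _ (clsm_cst 0 x))=> y;rewrite big_nil.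
by apply: (clsm_ext _ (clsm_add (h i) IH))=> y;rewrite big_cons.
Qed.
End Clsm.

(** Dividing the two equations shows that the exponential of i times the change of angles minus q
    zeta is real. Only a sine vanishes; that the angle itself does needs the smallness arranged in
    [adapted_trans]. *)
Lemma angle_lemma (t1 t2 t10 t20 h1 h2 h10 h20 q: R) (c0 zeta: C) :
 0 < h1 -> 0 < h2 -> 0 < h10 -> 0 < h20 -> c0 != 0 ->
 cexp ('i * t10%:C) / h10%:C = c0^-1 * (cexp ('i * t20%:C) / h20%:C) ->
 cexp ('i * t1%:C) / h1%:C = (c0 * cexp (q%:C * zeta))^-1 * (cexp ('i * t2%:C) / h2%:C) ->
 sin (t2 - t20 - (t1 - t10) - q * cIm zeta) = 0.
move=> h1p h2p h10p h20p c0n E0 E1.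
have hn (x: R): 0 < x -> x%:C != 0 :> C by move=> x0;apply/eqP=> /(congr1 (@cRe R)) /= E;rewrite E ltxx in x0.
have n1:= hn _ h1p;have n2:= hn _ h2p;have n10:= hn _ h10p;have n20:= hn _ h20p.
have cn:= @cexp_neq0 R.
pose d: C := 'i * (t2 - t20 - (t1 - t10))%:C - q%:C * zeta.
have dE: cexp d * (cexp ('i * t20%:C) * cexp ('i * t1%:C) * cexp (q%:C * zeta)) =
 cexp ('i * t2%:C) * cexp ('i * t10%:C).
 by rewrite -!cexpD;congr cexp;rewrite /d !rmorphB;ring.
have key: cexp d = (h2 * h10 / (h1 * h20))%:C.
 have c0E: c0 = (cexp ('i * t20%:C) / h20%:C) / (cexp ('i * t10%:C) / h10%:C).
 by rewrite E0 invfM invrK mulrCA mulfV ?mulr1 // mulf_neq0 ?invr_eq0.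
 apply: (mulIf (mulf_neq0 (mulf_neq0 (cn ('i * t20%:C)) (cn ('i * t1%:C))) (cn (q%:C * zeta)))).
 rewrite dE !rmorphM fmorphV rmorphM.
 have E2: cexp ('i * t1%:C) = h1%:C * (c0 * cexp (q%:C * zeta))^-1 * (cexp ('i * t2%:C) / h2%:C).
 by rewrite -mulrA -E1 mulrCA mulfV ?mulr1.
 rewrite E2 c0E;field.
 by rewrite n1 n2 n10 n20 !cn.
have := congr1 (@cIm R) key;rewrite Im_cexp /= => /eqP;rewrite mulf_eq0 gt_eqF ?expR_gt0 //= => /eqP.
by rewrite /d cImD cImM /= => <-;congr sin;rewrite raddfN /= cImM /=;ring.
Qed.

(** At a point with a = 1 and b = 0 the derivative of ln(a^2 + b^2) is 2 da. *)
Lemma grad_log_change (m p: nat) (F: 'rV[R]_m -> R) (G: 'rV[R]_m -> 'rV[R]_p) (h: 'rV[R]_p -> R) (a b: 'rV[R]_m -> R) (c0: R) x :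
 lsm F x -> lsm G x -> lsm h (G x) -> lsm a x -> lsm b x -> a x = 1 -> b x = 0 ->
 (\forall z \near x, F z = h (G z) + (ln c0 + ln (a z * a z + b z * b z))) ->
 grad F x = 'J G x *m grad h (G x) + 2%:R *: grad a x.
move=> lF lG lh la lb a1 b0 fE;apply: col_ext1=> w.
rewrite -gradE;last exact: lsd.
rewrite (derv_eq _ fE) mulmxDr [RHS]mxE mulmxA -derive_mulJ;last exact: lsd.
pose g z: R := a z * a z + b z * b z.
have lg: lsm g x by apply: lsm_add;apply: lsm_mul.
have g1: g x = 1 by rewrite /g a1 b0 mul0r addr0 mul1r.
have lg': lsm (fun z => ln (g z)) x by apply: lsm_ln=> //;rewrite g1.
have dG: dfb (fun z => h (G z)) x by apply: dfb_comp;exact: lsd.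
rewrite (@deriveD _ _ _ (fun z => h (G z)) (fun z => ln c0 + ln (g z)));last first.
- by apply: derivableD=> //;apply: dfd;exact: lsd.
- exact: dfd.
rewrite (@chain_rule _ _ _ _ G h);[|exact: lsd|exact: lsd].
rewrite -gradE;last exact: lsd.
congr (_ + _);rewrite (@deriveD _ _ _ (fun=> ln c0) (fun z => ln (g z))) ?derive_cst ?add0r //;last first.
 by apply: dfd;exact: lsd.
have il: is_derive (g x) (1: R) (@ln R) (g x)^-1 by apply: is_derive1_ln;rewrite g1.
rewrite (derive_fun _ il) ?g1 ?invr1 ?mulr1;last exact: lsd.
have da: derivable a x w by apply: dfd;exact: lsd.
have db: derivable b x w by apply: dfd;exact: lsd.
have daa: derivable (fun z => a z * a z: R) x w by apply: dfd;apply: lsd;exact: lsm_mul.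
have dbb: derivable (fun z => b z * b z: R) x w by apply: dfd;apply: lsd;exact: lsm_mul.
rewrite (_: 'D_w g x = 'D_w (fun z => a z * a z: R) x + 'D_w (fun z => b z * b z: R) x);last exact: (deriveD daa dbb).
rewrite (derive_mulr da da) (derive_mulr db db) a1 b0 -scalemxAr [RHS]mxE -gradE;last exact: lsd.
by ring.
Qed.
End RealSmooth.

(** * Tensor fields: from a covering family of charts to the maximal atlas *)

Section Transport.
Context {R: realType}.

Lemma jacobian_lsm m n (F: 'rV[R]_m -> 'rV[R]_n) z: lsm F z -> lsm (fun y => 'J F y) z.
move=> sF;have h: lsm (fun y => \matrix_(i, j) ('D_(dlt i) F y 0 j: R)) z.
 apply/lsm_mx=> i j;apply: (lsm_ext (f := fun y => 'D_(dlt i) F y 0 j: R));first by move=> y;rewrite mxE.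
 exact: ((lsm_mx _ _).1 (lsm_D (dlt i) sF) 0 j).
apply: lsm_near_eq h;apply: filterS (lsm_near sF)=> y sy.
apply/row_matrixP=> i;rewrite rowE [RHS]rowE -derive_mulJ;last exact: lsd.
by rewrite -rowE;rowext j;rewrite !mxE.
Qed.

Lemma jacobian_comp m n p (g: 'rV[R]_m -> 'rV[R]_n) (f: 'rV[R]_n -> 'rV[R]_p) x :
 lsm g x -> lsm f (g x) -> 'J (fun y => f (g y)) x = 'J g x *m 'J f (g x).
move=> sg sf;apply: mulrow_ext=> w;rewrite -derive_mulJ;last exact: lsd (lsm_comp sg sf).
rewrite (chain_rule w (lsd sg) (lsd sf)) (derive_mulJ _ (lsd sf)) (derive_mulJ _ (lsd sg)).
by rewrite mulmxA.
Qed.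

Lemma jacobian_near m n (f g: 'rV[R]_m -> 'rV[R]_n) x: (\forall y \near x, f y = g y) -> lsm g x -> 'J f x = 'J g x.
move=> E sg;have sf: lsm f x by apply: lsm_near_eq sg;apply: filterS E=> y ->.
apply: mulrow_ext=> w.
exact: etrans (esym (derive_mulJ w (lsd sf))) (etrans (derv_eq w E) (derive_mulJ w (lsd sg))).
Qed.

Variables (m: nat) (M: manifold R m).
Implicit Types e: chart R m M.

Lemma trans_lsm e e' y: atlas e -> atlas e' -> img e y -> dom e' (param e y) -> lsm (trans e e') y.
by move=> a a' iy dy;have [de <-] := imgP (atlas_ok a) iy;exact: atlas_trans. Qed.

Lemma near_trans e e' y: atlas e -> atlas e' -> img e y -> dom e' (param e y) ->
 \forall y1 \near y, img e y1 /\ dom e' (param e y1).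
move=> a a' iy dy;have oe': open (dom e') by have [] := atlas_ok a'.
by apply: (near_param (atlas_ok a) iy);exact: onbhs.
Qed.

Lemma trans_comp e e' e'' y: atlas e' -> dom e' (param e y) -> trans e' e'' (trans e e' y) = trans e e'' y.
by move=> a' dy;rewrite /trans coordK //;exact: atlas_ok. Qed.
Lemma trans_img e e' y: atlas e' -> dom e' (param e y) -> img e' (trans e e' y) /\ param e' (trans e e' y) = param e y.
by move=> a' dy;split;[exact: img_coord|rewrite /trans coordK //;exact: atlas_ok]. Qed.

Lemma trans_J e e' e'' y: atlas e -> atlas e' -> atlas e'' -> img e y -> dom e' (param e y) -> dom e'' (param e y) ->
 'J (trans e e'') y = 'J (trans e e') y *m 'J (trans e' e'') (trans e e' y).
move=> a a' a'' iy d' d'';have [i1 p1] := trans_img a' d'.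
have s1:= trans_lsm a a' iy d';have s2: lsm (trans e' e'') (trans e e' y) by apply: trans_lsm=> //;rewrite p1.
rewrite -(jacobian_comp s1 s2);apply: jacobian_near (lsm_comp s1 s2).
by apply: filterS (near_trans a a' iy d')=> y1 [_ d1];apply/esym;exact: trans_comp.
Qed.

Lemma trans_J1 e y: atlas e -> img e y -> 'J (trans e e) y = 1%:M.
move=> a iy;have [de _] := imgP (atlas_ok a) iy.
have E: \forall y1 \near y, trans e e y1 = y1.
 by apply: filterS (near_trans a a iy de)=> y1 [i1 _];have [_ h] := imgP (atlas_ok a) i1;exact: h.
rewrite (jacobian_near E (lsm_id y)).
by apply: mulrow_ext=> w;rewrite -(derive_mulJ w (lsd (lsm_id y))) derive_id mulmx1.
Qed.

Lemma trans_JV e e' y: atlas e -> atlas e' -> img e y -> dom e' (param e y) ->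
 'J (trans e e') y *m 'J (trans e' e) (trans e e' y) = 1%:M.
move=> a a' iy dy;have [de _] := imgP (atlas_ok a) iy.
by rewrite -(trans_J a a' a iy dy de) (trans_J1 a iy).
Qed.

Lemma overlap_JV e e' y: atlas e -> atlas e' -> overlap e e' y ->
 'J (trans e' e) (trans e e' y) *m 'J (trans e e') y = 1%:M.
move=> ae ae' [p [dp d'p] <-];have iy:= img_coord dp.
have dd: dom e' (param e (coord e p)) by rewrite (coordK (atlas_ok ae) dp).
by have /mulmx1C := trans_JV ae ae' iy dd.
Qed.

Variables (I: Type) (Ad: I -> Prop) (ec: I -> chart R m M) (ad: M -> I).
Context (Ada: forall t, Ad t -> atlas (ec t))
 (adP: forall p, Ad (ad p) /\ dom (ec (ad p)) p).
Variables (a b: nat) (act: 'M[R]_m -> 'M[R]_m -> 'M[R]_(a, b) -> 'M[R]_(a, b)).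
Context (act1: forall F, act 1%:M 1%:M F = F)
 (actM: forall D D' E E' F, act D D' (act E E' F) = act (D *m E) (E' *m D') F)
 (act_lsm: forall (D D': 'rV[R]_m -> 'M[R]_m) F x,
 lsm D x -> lsm D' x -> lsm F x -> lsm (fun y => act (D y) (D' y) (F y)) x).
Variable F: I -> 'rV[R]_m -> 'M[R]_(a, b).
Notation pull e e' y := (act ('J (trans e e') y) ('J (trans e' e) (trans e e' y))).
Context (Fs: forall t y, Ad t -> img (ec t) y -> lsm (F t) y)
 (Fc: forall t t' y, Ad t -> Ad t' -> img (ec t) y -> dom (ec t') (param (ec t) y) ->
 F t y = pull (ec t) (ec t') y (F t' (trans (ec t) (ec t') y))).

Definition transport e y := let t := ad (param e y) in pull e (ec t) y (F t (trans e (ec t) y)).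

Lemma pull_comp e e' e'' y A: atlas e -> atlas e' -> atlas e'' -> img e y -> dom e' (param e y) -> dom e'' (param e y) ->
 pull e e' y (pull e' e'' (trans e e' y) A) = pull e e'' y A.
move=> ae ae' ae'' iy d' d'';have [de _] := imgP (atlas_ok ae) iy.
have [i1 p1] := trans_img ae' d';have [i2 p2] := trans_img ae'' d''.
have E1:= trans_J ae ae' ae'' iy d' d'';have E3: trans e'' e' (trans e e'' y) = trans e e' y := trans_comp _ ae'' d''.
have E2: 'J (trans e'' e) (trans e e'' y) = 'J (trans e'' e') (trans e e'' y) *m 'J (trans e' e) (trans e e' y).
 by rewrite -E3;apply: trans_J;rewrite ?p2.
have E4: trans e' e'' (trans e e' y) = trans e e'' y := trans_comp _ ae' d'.
have H D1 D2 D3 D4 D5 D6 A1: D5 = D1 *m D3 -> D6 = D4 *m D2 -> act D1 D2 (act D3 D4 A1) = act D5 D6 A1.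
 by move=> -> ->;exact: actM.
by rewrite E4;exact: H E1 E2.
Qed.

Lemma transportE e t y: atlas e -> Ad t -> img e y -> dom (ec t) (param e y) ->
 transport e y = pull e (ec t) y (F t (trans e (ec t) y)).
move=> ae At iy dy;have [At' dy'] := adP (param e y);rewrite /transport.
move: At' dy';set t' := ad _=> At' dy';have [i1 p1] := trans_img (Ada At') dy'.
have at1:= Ada At';have at2:= Ada At.
have d1: dom (ec t) (param (ec t') (trans e (ec t') y)) by rewrite p1.
apply: etrans (congr1 (act _ _) (Fc At' At i1 d1)) _;apply: etrans (pull_comp _ ae at1 at2 iy dy' dy) _.
exact: (congr1 (fun z => act _ _ (F t z)) (trans_comp (ec t) at1 dy')).
Qed.

Lemma transport_self t y: Ad t -> img (ec t) y -> transport (ec t) y = F t y.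
move=> At iy;have at':= Ada At;have [de E] := imgP (atlas_ok at') iy.
have TE: trans (ec t) (ec t) y = y by rewrite /trans E.
by rewrite (transportE at' At iy de) TE (trans_J1 at' iy) act1.
Qed.

Lemma transport_sm e: atlas e -> smooth_on (img e) (transport e).
move=> ae;apply: smooth_on_lsm=> y iy;have [At dy] := adP (param e y).
move: At dy;set t := ad _=> At dy;have at':= Ada At;have [i1 p1] := trans_img at' dy.
have sT:= trans_lsm ae at' iy dy.
apply: (@lsm_near_eq _ _ _ (fun y => pull e (ec t) y (F t (trans e (ec t) y)))).
 by apply: filterS (near_trans ae at' iy dy)=> y1 [i d];apply/esym;exact: transportE.
have [de _] := imgP (atlas_ok ae) iy.
apply: act_lsm;[exact: jacobian_lsm|apply: lsm_comp => //|apply: lsm_comp => //;exact: Fs].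
by apply: jacobian_lsm;apply: (trans_lsm at' ae i1);rewrite p1.
Qed.

Lemma transport_change e e' y: atlas e -> atlas e' -> overlap e e' y ->
 transport e y = pull e e' y (transport e' (trans e e' y)).
move=> ae ae' [p [dp d'p] <-];have pE:= coordK (atlas_ok ae) dp.
have [At dy] := adP p;have iy:= img_coord dp.
have d'y: dom e' (param e (coord e p)) by rewrite pE.
have [i1 p1] := trans_img ae' d'y;have at':= Ada At.
have d1: dom (ec (ad p)) (param e (coord e p)) by rewrite pE.
have d2: dom (ec (ad p)) (param e' (trans e e' (coord e p))) by rewrite p1.
apply: etrans (transportE ae At iy d1) _;apply: esym.
apply: etrans (congr1 (act _ _) (transportE ae' At i1 d2)) _;apply: etrans (pull_comp _ ae ae' at' iy d'y d1) _.
exact: (congr1 (fun z => act _ _ (F (ad p) z)) (trans_comp (ec (ad p)) ae' d'y)).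
Qed.
End Transport.

(** * Adapted charts of the circle bundle and the contact tensors *)

Section Adapted.
Context {R: realType} {k n N: nat}.
Notation C := (cnum R).
Variables (GC: lie_group C k) (P: set GC) (X: manifold C n) (pr: GC -> X)
 (rho: GC -> 'M[C]_N) (v: 'cV[C]_N) (Gu: set GC)
 (ip: 'cV[C]_N -> 'cV[C]_N -> C) (chi: GC -> C) (q: R)
 (M: manifold R (1 + (n + n))) (j: M -> set (GC * C)).
Context (q0: 0 < q)
 (HR: smooth_rep rho)
 (hi: invariant_inner_product rho Gu ip)
 (v0: v != 0)
 (Pg: subgroup P)
 (prE: forall a b, pr a = pr b <-> P (gmul (ginv a) b))
 (Pchar: forall eps: R, 0 < eps -> nbhs (gone GC) [set p | P p ->
 exists zeta: C, [/\ `|zeta| < eps%:C, rho p *m v = cexp zeta *: v & chi p = cexp (q%:C * zeta)]])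
 (Peig: forall p, P p -> exists2 kap: C, kap != 0 & rho p *m v = kap *: v)
 (chi0: forall a, P a -> chi a != 0)
 (chiM: forall a b, P a -> P b -> chi (gmul a b) = chi a * chi b)
 (hj: circle_bundle P pr rho v ip chi q j).
Notation adapted := (adapted_chart P rho v ip chi q j).
Notation sect := (local_section pr).
Notation logn := (logvnorm2 rho v ip).

Lemma ip_real w: ip w w = (cRe (ip w w))%:C.
by apply: cpx_eq=> //=;have := ip_conj hi w w=> /(congr1 (@cIm R));case: (ip w w)=> a b /= h;
 apply/eqP;rewrite -[b == 0](mulrn_eq0 b 2) mulr2n {1}h addNr.
Qed.
Lemma ip_pos w: w != 0 -> 0 < cRe (ip w w).
by move=> w0;have [_ _ h _] := hi;have := h _ w0;rewrite ip_real ltcR. Qed.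
Lemma vnorm_sq w: vnorm ip w ^+ 2 = cRe (ip w w).
rewrite /vnorm sqr_sqrtr //;have [->|w0] := eqVneq w 0;last exact/ltW/ip_pos.
by rewrite (ip0l hi).
Qed.
Lemma rv0 g: rho g *m v != 0.
apply: contraNneq v0=> h;have E: rho (ginv g) *m rho g = 1%:M by rewrite -HR.1 gmulV HR.2.1.
by rewrite -[v]mul1mx -E -mulmxA h mulmx0.
Qed.
Lemma vnorm_gt0 w: w != 0 -> 0 < vnorm ip w.
by move=> w0;rewrite /vnorm sqrtr_gt0 ip_pos. Qed.
Lemma herm_gt0 g: 0 < Num.sqrt (herm rho v ip q g 1).
rewrite sqrtr_gt0 /herm normr1 expr1n /= mul1r powR_gt0 // vnorm_gt0 //;exact: rv0.
Qed.
Lemma chi1: chi (gone GC) = 1.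
have [P1 _ _] := Pg;have := chiM P1 P1;rewrite gmul1=> /eqP.
by rewrite -[X in X == _]mulr1 (inj_eq (mulfI (chi0 P1)))=> /eqP.
Qed.

Lemma line_eq g g' (z z': C): line_pt P chi g z = line_pt P chi g' z' ->
 exists2 p, P p & g = gmul g' p /\ z = (chi p)^-1 * z'.
move=> E;have [P1 _ _] := Pg.
have: line_pt P chi g z (g, z) by exists (gone GC)=> //;rewrite gmul1' chi1 invr1 mul1r.
by rewrite E=> -[p Pp [<- <-]];exists p.
Qed.

Lemma sect_gsm U s c x: sect U s -> atlas c -> img c x -> U (param c x) -> gsm (fun y => s (param c y)) x.
by move=> [oU sU _] ac ix Ux;apply: (@gsm_map _ _ _ _ _ _ U)=> //;exact: gsm_param. Qed.

Lemma ip_clsm (V: nmod R) (W W': V -> 'cV[C]_N) x: (forall i, clsm (fun y => W y i 0) x) ->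
 (forall i, clsm (fun y => W' y i 0) x) -> clsm (fun y => ip (W y) (W' y)) x.
move=> h h';have E y: ip (W y) (W' y) =
 \sum_i W y i 0 * \sum_l ((W' y l 0)^* * (ip (delta_mx l 0) (delta_mx i 0))^*).
 rewrite (ipE hi);sumext i;congr (_ * _).
 by rewrite (ip_conj hi) (ipE hi) rmorph_sum;sumext l;rewrite rmorphM.
apply: (clsm_ext (fun y => esym (E y)));apply: clsm_sum=> i;apply: clsm_mul=> //.
by apply: clsm_sum=> l;apply: clsm_mul;[exact: clsm_conj|exact: clsm_cst].
Qed.

Lemma W_clsm U s c x (u: 'cV[C]_N) i: sect U s -> atlas c -> img c (cplx x) -> U (param c (cplx x)) ->
 clsm (fun y => (rho (s (param c (cplx y))) *m u) i 0) x.
move=> sU ac ix Ux;have sg:= sect_gsm sU ac ix Ux.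
have h: lsm (fun y => rho (s (param c y)) *m u) (cplx x).
 by apply: lsm_mulmx;[exact: HR.2.2|exact: lsm_cst].
exact: (lsm_Re ((lsm_mx _ _).1 h i 0)).
Qed.

Lemma logn_lsm U s c x: sect U s -> atlas c -> img c (cplx x) -> U (param c (cplx x)) -> lsm (logn c s) x.
move=> sU ac ix Ux;rewrite /logvnorm2.
apply: (@lsm_ext _ _ _ (fun y => ln (cRe (ip (rho (s (param c (cplx y))) *m v) (rho (s (param c (cplx y))) *m v))))).
 by move=> y;rewrite vnorm_sq.
apply: lsm_ln;first by rewrite ip_pos // rv0.
have h i:= W_clsm v i sU ac ix Ux.
exact: (ip_clsm h h).1.
Qed.

Section Pair.
Variables (U U': set X) (s s': X -> GC) (c c': chart C n X) (e e': chart R (1 + (n + n)) M).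
Context (sU: sect U s) (sU': sect U' s') (ae: adapted U s c e) (ae': adapted U' s' c' e').

(** The equality of two unit vectors in G^C x_P C, spelled out: the sections differ by an element of
    P and the fibre coordinates by its character. *)
Lemma adapted_pair y: img e y -> dom e' (param e y) ->
 let y' := trans e e' y in let p := param c (cplx (rsubmx y)) in
 [/\ img c (cplx (rsubmx y)), U p, img c' (cplx (rsubmx y')) /\ U' p, p = param c' (cplx (rsubmx y')) &
 exists2 pi, P pi & s p = gmul (s' p) pi /\
 cexp ('i * (lsubmx y 0 0)%:C) / (Num.sqrt (herm rho v ip q (s p) 1))%:C =
 (chi pi)^-1 * (cexp ('i * (lsubmx y' 0 0)%:C) / (Num.sqrt (herm rho v ip q (s' p) 1))%:C)].
move=> iy dy y' p;have [oe _ he] := ae;have [oe' _ he'] := ae'.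
have iy': img e' y' by exact: img_coord.
have [i1 U1 j1] := he y iy;have [i2 U2 j2] := he' y' iy'.
have E: param e' y' = param e y by exact: coordK.
rewrite E j1 in j2;have [pi Ppi [E1 E2]] := line_eq j2.
have [_ _ prs] := sU;have [_ _ prs'] := sU'.
have pp: p = param c' (cplx (rsubmx y')).
 rewrite /p -[LHS](prs _ U1) -[RHS](prs' _ U2) E1;apply/esym/prE;rewrite gmulA gmulV gmul1.
 by [].
move: E1 E2 U2;rewrite -/y' -pp -/p=> E1 E2 U2.
split;[exact: i1|exact: U1|split;[exact: i2|exact: U2]|exact: erefl|].
by exists pi;[exact: Ppi|split;[exact: E1|exact: E2]].
Qed.

(** Near the point rho(s) v = kap u rho(s') v, with u holomorphic and equal to 1 at the point. So
    log ||s v||^2 changes by a constant plus 2 Re log u and theta by a constant plus q Im log u;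
    [bR] and [bI] are the gradients, tied by Cauchy-Riemann. *)
Lemma adapted_trans y: img e y -> dom e' (param e y) ->
 let f := logn c s in let f' := logn c' s' in let x := rsubmx y in let x' := rsubmx (trans e e' y) in
 exists (Aj: 'M[R]_(n + n)) (bR bI: 'cV[R]_(n + n)),
 [/\ Aj *m stdJ n = stdJ n *m Aj, stdJ n *m bI = bR, grad f x = Aj *m grad f' x' + 2%:R *: bR &
 'J (trans e e') y = block_mx 1%:M 0 (q *: bI) Aj].
move=> iy dy f f' x x'.
have atl: atlas e by have [_ _ h _] := hj;exact: (h _ _ _ _ sU ae).
have atl': atlas e' by have [_ _ h _] := hj;exact: (h _ _ _ _ sU' ae').
have [_ ac _] := ae;have [_ ac' _] := ae'.
have [ix Ux [ix' Ux'] pp [pi0 Ppi0 [sp0 th0]]] := adapted_pair iy dy.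
set p0 := param c (cplx x) in ix Ux ix' Ux' pp sp0 th0.
have [de ce] := imgP (atlas_ok atl) iy.
have tsm: lsm (trans e e') y by rewrite -ce;exact: atlas_trans.
have [dc cc] := imgP (atlas_ok ac) ix.
have dc': dom c' p0 by rewrite pp;have [] := imgP (atlas_ok ac') ix'.
pose T := trans c c'.
have Tsm: lsm T (cplx x) by rewrite -cc;exact: atlas_trans.
have nr: \forall y1 \near y, dom e (param e y1) /\ dom e' (param e y1) /\ img e y1.
 have oe': open (dom e') by have [] := atlas_ok atl'.
 have nb: nbhs (param e y) (dom e') by apply: onbhs.
 apply: filterS (near_param (atlas_ok atl) iy nb)=> y1 [iy1 dy1].
 by have [? _] := imgP (atlas_ok atl) iy1.
have xE: \forall y1 \near y, rsubmx (trans e e' y1) = realify (T (cplx (rsubmx y1))).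
 apply: filterS nr=> y1 [_ [dy1 iy1]];have [i1 u1 [i1' u1'] pp1 _] := adapted_pair iy1 dy1.
 rewrite /T /trans pp1;have [_ ->] := imgP (atlas_ok ac') i1'.
 by rewrite cplxK.
pose Aj := 'J (fun z => realify (T (cplx z))) x.
have [lT DT] := realify_holo Tsm;have dT:= lsd lT.
have AjE (w: 'rV[R]_(n + n)): w *m Aj = realify ('D_(cplx w) T (cplx x)) by rewrite -DT -derive_mulJ.
have AJ: Aj *m stdJ n = stdJ n *m Aj.
 apply: mulrow_ext=> w;rewrite !mulmxA !AjE cplx_stdJ -realify_i.
 rewrite [in RHS]deriveE;last exact: lsd.
 by rewrite linearZ /= -deriveE //;exact: lsd.
have gs: gsm (fun z => s (param c z)) (cplx x) := sect_gsm sU ac ix Ux.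
have gs': gsm (fun z => s' (param c z)) (cplx x).
 by have [oU' sU'' _] := sU';apply: (@gsm_map _ _ _ _ _ _ U')=> //;exact: gsm_param.
have [kap kap0 kapE] := Peig Ppi0.
pose W1 z := rho (s (param c z)) *m v;pose W2 z := rho (s' (param c z)) *m v.
pose pz z := gmul (ginv (s' (param c z))) (s (param c z)).
have pz0: pz (cplx x) = pi0 by rewrite /pz -/p0 sp0 gmulVK.
have nz (eps: R): 0 < eps -> \forall z \near cplx x, [/\ dom c (param c z), img c z, dom c' (param c z) &
 exists zeta: C, [/\ `|zeta| < eps%:C, W1 z = (kap * cexp zeta) *: W2 z & chi (pz z) = chi pi0 * cexp (q%:C * zeta)]].
 move=> e0;have gpi: gsm (fun z => gmul (ginv pi0) (pz z)) (cplx x).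
 by apply: gsm_mul;[exact: gsm_cst|apply: gsm_mul => //;exact: gsm_inv].
 pose Gd p := P p -> exists zeta: C,
 [/\ `|zeta| < eps%:C, rho p *m v = cexp zeta *: v & chi p = cexp (q%:C * zeta)].
 have h0: nbhs (gmul (ginv pi0) (pz (cplx x))) Gd by rewrite pz0 gmulV;exact: Pchar.
 have n1: \forall z \near cplx x, Gd (gmul (ginv pi0) (pz z)) := gpi.1 _ h0.
 have o3: nbhs p0 (U `&` U' `&` dom c').
 have [oU _ _] := sU;have [oU' _ _] := sU';have oc': open (dom c') by have [] := atlas_ok ac'.
 by apply: onbhs;split;[apply: openI=> //;exact: openI|].
 have n2:= near_param (atlas_ok ac) ix o3.
 apply: filterS2 n1 n2=> z h1 [iz [[uz u'z] dz]].
 have [dcz _] := imgP (atlas_ok ac) iz;split=> //.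
 have Ppz: P (pz z).
 have [_ _ prs] := sU;have [_ _ prs'] := sU'.
 by apply/prE;rewrite (prs _ uz) (prs' _ u'z).
 have [_ PM PV] := Pg;have [zeta [zs E1 E2]] := h1 (PM _ _ (PV _ Ppi0) Ppz).
 have pE: pz z = gmul pi0 (gmul (ginv pi0) (pz z)) by rewrite gmulKV.
 exists zeta;split=> //;last by rewrite pE chiM ?E2 //;exact: PM (PV _ Ppi0) Ppz.
 rewrite /W1 /W2 -[s (param c z)](gmulKV (s' (param c z))) -/(pz z) HR.1 -mulmxA.
 by rewrite pE HR.1 -mulmxA E1 -scalemxAr kapE scalerA mulrC -scalemxAr.
have [al W2al]: exists al, W2 (cplx x) al 0 != 0.
 apply/existsP;rewrite -negb_forall;apply: contra (rv0 (s' p0))=> /forallP h.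
 by apply/eqP/colP=> i;rewrite [RHS]mxE;apply/eqP.
(* Any coordinate of W2 that does not vanish exhibits the scalar factor as a quotient of holomorphic
   functions. *)
pose u z := W1 z al 0 / W2 z al 0 / kap.
have sW (s1: X -> GC): gsm (fun z => s1 (param c z)) (cplx x) ->
 lsm (fun z => (rho (s1 (param c z)) *m v) al 0: C) (cplx x).
 move=> g1;have h: lsm (fun z => rho (s1 (param c z)) *m v) (cplx x).
 by apply: lsm_mulmx;[exact: HR.2.2|exact: lsm_cst].
 exact: ((lsm_mx _ _).1 h al 0).
have su: lsm u (cplx x).
 apply: lsm_mul;last exact: lsm_cst.
 by apply: lsm_mul;[exact: sW|apply: lsm_inv => //;exact: sW].
have cW2: \forall z \near cplx x, W2 z al 0 != 0.
 exact: near_neq0 (sW _ gs') W2al.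
have nu (eps: R): 0 < eps -> \forall z \near cplx x, [/\ dom c (param c z), img c z, dom c' (param c z) &
 exists zeta: C, [/\ `|zeta| < eps%:C, u z = cexp zeta, W1 z = (kap * u z) *: W2 z &
 chi (pz z) = chi pi0 * cexp (q%:C * zeta)]].
 move=> e0;apply: filterS2 (nz _ e0) cW2=> z [d1 d2 d3 [zeta [z1 z2 z3]]] w0;split=> //.
 have uE: u z = cexp zeta by rewrite /u z2 mxE mulfK // mulrAC mulfV // mul1r.
 by exists zeta;split=> //;rewrite uE.
have u1: u (cplx x) = 1.
 rewrite /u (_: W1 (cplx x) = kap *: W2 (cplx x));first by rewrite mxE mulfK // mulfV.
 by rewrite /W1 /W2 -/p0 sp0 HR.1 -mulmxA kapE -scalemxAr.
have [sur sui] := lsm_Re su.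
pose ur z: R := cRe (u (cplx z));pose ui z: R := cIm (u (cplx z)).
pose bR := grad ur x;pose bI := grad ui x.
have JbI: stdJ n *m bI = bR by apply: holo_grad;exact: lsd.
pose xx (y1: 'rV[R]_(1 + (n + n))): 'rV[R]_(n + n) := rsubmx y1.
have Lx: lsm xx y by apply: lsm_linear=> a1 a2 a3;rewrite /xx linearP.
have dx: dfb xx y by exact: lsd.
have Dxx w: 'D_w xx y = rsubmx w by exact: (derive_linear (rsubmx: {linear 'rV[R]_(1 + (n + n)) -> 'rV[R]_(n + n)})).
have xcont P0: nbhs (cplx x) P0 -> \forall y1 \near y, P0 (cplx (rsubmx y1)).
 move=> /cplx_near h;have cx: {for y, continuous xx} by exact: differentiable_continuous.
 exact: (cx _ h).
pose th2 (y1: 'rV[R]_(1 + (n + n))): R := trans e e' y1 0 (lshift (n + n) 0).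
pose th1 (y1: 'rV[R]_(1 + (n + n))): R := y1 0 (lshift (n + n) 0).
have l2: lsm th2 y by exact: ((lsm_mx _ _).1 tsm 0 (lshift (n + n) 0)).
have l1: lsm th1 y by exact: ((lsm_mx (fun y1 => y1) _).1 (lsm_id y) 0 (lshift (n + n) 0)).
pose Tt y1 := q^-1 * (th2 y1 - th2 y - (th1 y1 - th1 y)).
have lT': lsm Tt y.
 apply: lsm_mul;first exact: lsm_cst.
 apply: lsm_add;first by apply: lsm_add=> //;exact: lsm_cst.
 by apply: lsm_opp;apply: lsm_add=> //;exact: lsm_cst.
(* Then q |Im zeta| is at most 1/4 and each angle moves by less than 1/4, so that the total stays
   below 1, where sin has no zero but 0. *)
have q4: 0 < (4%:R * (1 + q))^-1 by rewrite invr_gt0 mulr_gt0 ?ltr0n // addr_gt0.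
have four: 0 < (4%:R)^-1 :> R by rewrite invr_gt0 ltr0n.
(* u is parallel to exp(i Tt): the equation Tt = Im log u without a logarithm. Differentiated at the
   point, where u = 1 and Tt = 0, it gives dTt = d Im u. *)
have nT: \forall y1 \near y, ur (rsubmx y1) * sin (Tt y1) = ui (rsubmx y1) * cos (Tt y1).
 have nA:= xcont _ (nu _ q4);have nB:= lsm_near_small four l2;have nC:= lsm_near_small four l1.
 near=> y1;have [_ [dy1 iy1]]: dom e (param e y1) /\ dom e' (param e y1) /\ img e y1 by near: y1.
 have s2: `|th2 y1 - th2 y| < 4%:R^-1 by near: y1.
 have s1: `|th1 y1 - th1 y| < 4%:R^-1 by near: y1.
 have [_ _ _ [zeta [zs uz _ chz]]]: [/\ dom c (param c (cplx (rsubmx y1))), img c (cplx (rsubmx y1)),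
 dom c' (param c (cplx (rsubmx y1))) & exists zeta: C, [/\ `|zeta| < ((4%:R * (1 + q))^-1)%:C,
 u (cplx (rsubmx y1)) = cexp zeta,
 W1 (cplx (rsubmx y1)) = (kap * u (cplx (rsubmx y1))) *: W2 (cplx (rsubmx y1)) &
 chi (pz (cplx (rsubmx y1))) = chi pi0 * cexp (q%:C * zeta)]] by near: y1.
 have [i1 u1' [i1' u1''] pp1 [pi Ppi [sp th]]] := adapted_pair iy1 dy1.
 have pzE: pz (cplx (rsubmx y1)) = pi by rewrite /pz sp gmulVK.
 rewrite pzE in chz;rewrite chz in th.
 have := angle_lemma (herm_gt0 _) (herm_gt0 _) (herm_gt0 _) (herm_gt0 _) (chi0 Ppi0) th0 th.
 rewrite [lsubmx y1 0 0]mxE [lsubmx y 0 0]mxE [lsubmx (trans e e' y1) 0 0]mxE [lsubmx (trans e e' y) 0 0]mxE.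
 rewrite -/(th2 _) -/(th2 _) -/(th1 _) -/(th1 _)=> /sin0_small d0.
 have zi: `|cIm zeta| < (4%:R * (1 + q))^-1.
 by rewrite -ltcR;apply: le_lt_trans zs;exact: Im_norm.
 have TE: Tt y1 = cIm zeta.
 have /d0: `|th2 y1 - th2 y - (th1 y1 - th1 y) - q * cIm zeta| < 1.
 apply: le_lt_trans (ler_normB _ _) _;rewrite normrM (gtr0_norm q0).
 have h1: `|th2 y1 - th2 y - (th1 y1 - th1 y)| < 2%:R^-1.
 apply: le_lt_trans (ler_normB _ _) _;rewrite (_: 2%:R^-1 = 4%:R^-1 + 4%:R^-1 :> R);last by field.
 exact: ltrD.
 have h2: q * `|cIm zeta| <= 4%:R^-1.
 apply: le_trans (ler_wpM2l (ltW q0) (ltW zi)) _.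
 rewrite ler_pdivrMr;last by rewrite mulr_gt0 ?ltr0n // addr_gt0.
 by rewrite mulKf ?pnatr_eq0 // ler_wpDl.
 by lra.
 by move=> /eqP;rewrite subr_eq0=> /eqP E;rewrite /Tt E mulKf ?gt_eqF.
 by rewrite /ur /ui uz Re_cexp Im_cexp TE;ring.
have Tt0: Tt y = 0 by rewrite /Tt !subrr mulr0.
have dur:= lsd sur;have dui:= lsd sui.
have durx: dfb (fun y1 => ur (xx y1)) y by apply: dfb_comp.
have duix: dfb (fun y1 => ui (xx y1)) y by apply: dfb_comp.
have DTt w: 'D_w Tt y = (rsubmx w *m bI) 0 0.
 have D1: 'D_w (fun y1 => ur (xx y1) * sin (Tt y1)) y = 'D_w (fun y1 => ui (xx y1) * cos (Tt y1)) y.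
 exact: derv_eq.
 have dTt:= lsd lT';have ds:= lsd (lsm_sin lT');have dc1:= lsd (lsm_cos lT').
 move: D1;rewrite (derive_mulr (dfd durx) (dfd ds)) (derive_mulr (dfd duix) (dfd dc1)).
 rewrite (derive_fun _ (is_derive_sin _) dTt) (derive_fun _ (is_derive_cos _) dTt) Tt0 sin0 cos0.
 have -> : ur (xx y) = 1 by rewrite /ur /xx u1.
 have -> : ui (xx y) = 0 by rewrite /ui /xx u1.
 rewrite (@chain_rule _ _ _ _ xx ui) // Dxx [X in _ = X * _ + _]gradE // !mulr0 mul0r !mulr1 mul1r add0r addr0=> ->.
 by [].
have Dth w: 'D_w th2 y = w 0 (lshift (n + n) 0) + q * (rsubmx w *m bI) 0 0.
 have D1: 'D_w th1 y = w 0 (lshift (n + n) 0).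
 by have := (dfb_ij 0 (lshift (n + n) 0) (lsd (lsm_id y))).2 w;rewrite derive_id.
 have th2E: th2 = (fun y1 => q * Tt y1 + (th1 y1 + (th2 y - th1 y))).
 by fext y1;rewrite /Tt mulrA mulfV ?gt_eqF // mul1r;ring.
 have dTt:= lsd lT';have d1:= lsd l1.
 rewrite th2E -D1 -DTt [RHS]addrC.
 have dq:= derive_Zl q w dTt.
 rewrite (@deriveD _ _ _ (fun y1 => q * Tt y1) (fun y1 => th1 y1 + (th2 y - th1 y))).
 - rewrite dq.2 (@deriveD _ _ _ th1 (fun=> th2 y - th1 y)) ?derive_cst ?addr0 //.
 exact: dfd.
 - exact: dfd dq.1.
 - by apply: derivableD=> //;exact: dfd.
have Dx' w: rsubmx ('D_w (trans e e') y) = rsubmx w *m Aj.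
 have := derive_post (rsubmx: {linear 'rV[R]_(1 + (n + n)) -> 'rV[R]_(n + n)}) w (lsd tsm)=> <-.
 rewrite (derv_eq _ xE) (@chain_rule _ _ _ _ xx (fun z => realify (T (cplx z)))) //.
 by rewrite Dxx derive_mulJ.
exists Aj, bR, bI;split=> //;last first.
 apply: mulrow_ext=> w;rewrite -derive_mulJ;last exact: lsd.
 rewrite -[LHS]hsubmxK Dx' -[w in RHS]hsubmxK mul_row_block mulmx1 mulmx0 add0r;congr row_mx.
 mxext i l;rewrite !ord1 [LHS]mxE -(dfb_ij 0 (lshift (n + n) 0) (lsd tsm)).2.
 rewrite -/th2 Dth [RHS]mxE -scalemxAr [X in _ = X + _]mxE [X in _ = _ + X]mxE.
 by [].
have Gx: realify (T (cplx x)) = x' by rewrite -(nbhs_singleton xE).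
have Ux'': U' (param c' (cplx x')) by rewrite -pp.
have lf': lsm f' x' := logn_lsm sU' ac' ix' Ux''.
have nrm (a: C): a * a^* = (cRe a * cRe a + cIm a * cIm a)%:C.
 by case: a=> a1 a2;apply: cpx_eq=> /=;ring.
pose c0 := cRe kap * cRe kap + cIm kap * cIm kap.
have nn (a: C): a != 0 -> 0 < cRe a * cRe a + cIm a * cIm a.
 move=> a0;rewrite -ltcR -nrm lt_def mulf_neq0 ?conjc_eq0 //=.
 by rewrite nrm lecR addr_ge0 // -expr2 sqr_ge0.
have fE: \forall z \near x, f z = f' (realify (T (cplx z))) + (ln c0 + ln (ur z * ur z + ui z * ui z)).
 apply: filterS (cplx_near (nu _ ltr01))=> z [d1 d2 d3 [zeta [_ uz Wz _]]].
 rewrite /f /f' /logvnorm2 realifyK -/(W1 _) (_: param c' (T (cplx z)) = param c (cplx z));last first.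
 exact: (coordK (atlas_ok ac') d3).
 rewrite -/(W2 _) !vnorm_sq Wz (ipZl hi) (ipZr hi) mulrA nrm (ip_real (W2 _)) -rmorphM /=.
 have -> : cRe (kap * u (cplx z)) * cRe (kap * u (cplx z)) +
 cIm (kap * u (cplx z)) * cIm (kap * u (cplx z)) = c0 * (ur z * ur z + ui z * ui z).
 rewrite /c0 /ur /ui;move: (u (cplx z))=> [a1 a2];move: (kap)=> [b1 b2] /=;ring.
 have gpos: 0 < ur z * ur z + ui z * ui z by apply: nn;rewrite uz;exact: cexp_neq0.
 have c0pos: 0 < c0 by exact: nn.
 have ipos: 0 < cRe (ip (W2 (cplx z)) (W2 (cplx z))) by apply: ip_pos;exact: rv0.
 have cg: 0 < c0 * (ur z * ur z + ui z * ui z) by exact: mulr_gt0.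
 by rewrite (lnM cg ipos) (lnM c0pos gpos) addrC.
have lG: lsm f' (realify (T (cplx x))) by rewrite Gx.
rewrite -Gx;apply: (grad_log_change (logn_lsm sU ac ix Ux) lT lG sur sui _ _ fE).
 by rewrite /ur u1.
by rewrite /ui u1.
Unshelve. all: by end_near.
Qed.
End Pair.
Variable proj: M -> X.
Hypothesis hproj: bundle_projection pr j proj.

(** The form eta-bar in the coordinates (theta, x), with g the gradient of log ||s v||^2: del f -
    delbar f at w equals - i times the derivative of f along w J. *)
Definition eta_col (g: 'cV[R]_(n + n)): 'cV[R]_(1 + (n + n)) :=
 (q * n.+1%:R)^-1 *: col_mx 1%:M (- (q / 2%:R) *: (stdJ n *m g)).
Definition xi_row: 'rV[R]_(1 + (n + n)) := row_mx (q * n.+1%:R)%:M 0.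
(** J on the base; the theta column is forced by the requirement that images lie in the kernel of
    eta-bar, which is [phi_eta]. *)
Definition phi_mx (g: 'cV[R]_(n + n)): 'M[R]_(1 + (n + n)) :=
 block_mx 0 0 (- (q / 2%:R) *: g) (stdJ n).
Let eta_colE g: eta_col g = (q * n.+1%:R)^-1 *: col_mx 1%:M 0 +
 ((q * n.+1%:R)^-1 *: col_mx 0 (- (q / 2%:R) *: stdJ n)) *m g.
by rewrite -scalemxAl -scalerDr mul_col_mx mul0mx add_col_mx addr0 add0r -scalemxAl. Qed.
Let phi_mxE g: phi_mx g = block_mx 0 0 0 (stdJ n) + col_mx 0 (- (q / 2%:R))%:M *m (g *m row_mx 1%:M 0).
rewrite mul_mx_row mulmx1 mulmx0 mul_col_mx mul0mx mul_scalar_mx scale_row_mx scaler0 /block_mx add_col_mx addr0.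
by rewrite add_row_mx add0r addr0.
Qed.

Lemma eta_col_eval (w: 'rV[R]_(1 + (n + n))) g: (w *m eta_col g) 0 0 =
 (q * n.+1%:R)^-1 * (lsubmx w 0 0 - q / 2%:R * (rsubmx w *m stdJ n *m g) 0 0).
rewrite -scalemxAr -{1}[w]hsubmxK mul_row_col mulmx1 -scalemxAr mulmxA [LHS]mxE;congr (_ * _).
by rewrite mxE;congr (_ + _);rewrite [LHS]mxE mulNr.
Qed.
Let mulVK (p r: nat) (D D': 'M[R]_r) (A: 'M[R]_(p, r)): D' *m D = 1%:M -> A *m D' *m D = A.
by move=> h;rewrite -mulmxA h mulmx1. Qed.
Let xi_kill (r p: nat) (D D' ph: 'M[R]_r) (x: 'M[R]_(p, r)): D' *m D = 1%:M ->
 x *m ph = 0 -> x *m D' *m (D *m ph *m D') = 0.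
by move=> h E;rewrite !mulmxA (mulVK x h) E mul0mx. Qed.
Let phi_kill (r p u: nat) (D D' ph: 'M[R]_r) (x: 'M[R]_(p, r)) (e: 'M[R]_(r, u)): D' *m D = 1%:M ->
 ph *m e = 0 -> x *m (D *m ph *m D') *m (D *m e) = 0.
by move=> h E;rewrite !mulmxA (mulVK _ h) -[_ *m ph *m e]mulmxA E mulmx0. Qed.
Let phi_proj (r p u: nat) (D D' ph: 'M[R]_r) (x: 'M[R]_(p, r)) (p0: 'M[R]_(r, u)) Jm Bj: D' *m D = 1%:M ->
 ph *m p0 = p0 *m Jm -> Bj *m Jm = Jm *m Bj ->
 x *m (D *m ph *m D') *m (D *m (p0 *m Bj)) = x *m (D *m (p0 *m Bj)) *m Jm.
move=> h E B1;rewrite !mulmxA (mulVK _ h) -[_ *m ph *m p0]mulmxA E -[RHS]mulmxA B1.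
by rewrite !mulmxA.
Qed.
Let phi_eta g: phi_mx g *m eta_col g = 0.
rewrite /phi_mx /eta_col -scalemxAr mul_block_col !mul0mx mulmx1 addr0 -scalemxAr mulmxA stdJ2 mulNmx mul1mx.
by rewrite scalerN addrN col_mx0 scaler0.
Qed.
Let xi_phi g: xi_row *m phi_mx g = 0.
by rewrite /phi_mx /xi_row mul_row_block !mulmx0 !mul0mx !addr0 row_mx0. Qed.
Let phi_p0 g: phi_mx g *m col_mx 0 1%:M = col_mx 0 1%:M *m stdJ n.
by rewrite /phi_mx mul_block_col [in RHS]mul_col_mx !mulmx0 !mul0mx mul1mx mulmx1 !add0r. Qed.

(** The term 2 bR in the gradient cancels the entry q bI of the Jacobian, because
    [stdJ n *m bI = bR]: the change of section being holomorphic makes the formulas global. *)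
Lemma frame_change (g g' bR bI: 'cV[R]_(n + n)) Aj (D := block_mx 1%:M 0 (q *: bI) Aj: 'M[R]_(1 + (n + n))) :
 Aj *m stdJ n = stdJ n *m Aj -> stdJ n *m bI = bR -> g = Aj *m g' + 2%:R *: bR ->
 [/\ eta_col g = D *m eta_col g', xi_row *m D = xi_row & phi_mx g *m D = D *m phi_mx g'].
move=> AJ JbI ->;rewrite /eta_col /phi_mx /D;split.
- rewrite -[RHS]scalemxAr;congr (_ *: _);rewrite mul_block_col !mul0mx addr0 !mulmx1;congr col_mx.
 rewrite mulmxDr mulmxA -AJ -!scalemxAr -mulmxA scalerDr addrC;congr (_ + _).
 by rewrite -JbI mulmxA stdJ2 mulNmx mul1mx scalerN scaleNr scalerN opprK scalerA -mulrA mulVf ?mulr1 // pnatr_eq0.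
- by rewrite /xi_row mul_row_block !mul0mx !mulmx0 !addr0 mulmx1.
- rewrite !mulmx_block !mulmx0 !mul0mx !mulmx1 !addr0 !add0r AJ;congr block_mx.
 rewrite -[in LHS]scalemxAr JbI -[RHS]scalemxAr scalerDr scalerA mulNr -mulrA mulVf ?pnatr_eq0 // mulr1 scaleNr.
 by rewrite -addrA -scalerDl addNr scale0r addr0.
Qed.
Let T: Type := ((set X * (X -> GC)) * (chart C n X * chart R (1 + (n + n)) M))%type.
Let Ad (t: T) := sect t.1.1 t.1.2 /\ adapted t.1.1 t.1.2 t.2.1 t.2.2.
Let ec (t: T) := t.2.2.
Let ft (t: T) := logn t.2.1 t.1.2.
Let Ada t: Ad t -> atlas (ec t).
by move=> [sU ae];have [_ _ h _] := hj;exact: (h _ _ _ _ sU ae). Qed.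
Let eta_formula (a b d: R): ((q * n.+1%:R)^-1 * (d - q / 2%:R * b))%:C = ((q * n.+1%:R)^-1)%:C *
 (- (q%:C * 'i / 2) * (2^-1 * (a%:C - 'i * b%:C) - 2^-1 * (a%:C + 'i * b%:C)) + d%:C) :> C.
rewrite rmorphM;congr (_ * _);rewrite rmorphB rmorphM fmorph_div rmorph_nat.
have ii: 'i * 'i = -1 :> C by rewrite -expr2 sqr_i.
have -> : - (q%:C * 'i / 2) * (2^-1 * (a%:C - 'i * b%:C) - 2^-1 * (a%:C + 'i * b%:C)) = q%:C / 2 * b%:C * ('i * 'i) :> C.
 by field.
by rewrite ii mulrN1 addrC.
Qed.

Lemma adapted_at (p: M): exists t: T, Ad t /\ dom (ec t) p.
by have [_ _ _ h] := hj;have [U [s [c [e [sU ae dp]]]]] := h p;exists ((U, s), (c, e)). Qed.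
Lemma adapted_logn_lsm U s c e y: sect U s -> adapted U s c e -> img e y -> lsm (logn c s) (rsubmx y).
move=> sU [_ ac h] iy;have [ix Ux _] := h y iy.
exact: (logn_lsm sU ac ix Ux).
Qed.

Lemma adapted_change (t t': T) y: Ad t -> Ad t' -> img (ec t) y -> dom (ec t') (param (ec t) y) ->
 let D := 'J (trans (ec t) (ec t')) y in let y' := trans (ec t) (ec t') y in
 [/\ eta_col (grad (ft t) (rsubmx y)) = D *m eta_col (grad (ft t') (rsubmx y')), xi_row *m D = xi_row &
 phi_mx (grad (ft t) (rsubmx y)) *m D = D *m phi_mx (grad (ft t') (rsubmx y'))].
move=> [sU ae] [sU' ae'] iy dy.
have [Aj [bR [bI [AJ JbI Eg ED]]]] := adapted_trans sU sU' ae ae' iy dy.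
have [h1 h2 h3] := frame_change AJ JbI Eg.
by cbv zeta;rewrite /ec ED;split;[exact: h1|exact: h2|exact: h3].
Qed.
Let lsm_rsub (p r: nat) (F: 'rV[R]_(n + n) -> 'M[R]_(p, r)) (y: 'rV[R]_(1 + (n + n))) :
 lsm F (rsubmx y) -> lsm (fun y1: 'rV[R]_(1 + (n + n)) => F (rsubmx y1)) y.
by move=> h;apply: lsm_comp=> //;apply: lsm_linear=> a1 a2 a3;rewrite linearP. Qed.
Let grad_lsm t y: Ad t -> img (ec t) y -> lsm (fun x => grad (ft t) x) (rsubmx y).
move=> [sU ae] iy;have h:= adapted_logn_lsm sU ae iy.
apply/lsm_mx=> i l;apply: (lsm_ext (f := fun x => 'D_(dlt i) (ft t) x: R));first by move=> x;rewrite mxE.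
exact: lsm_D.
Qed.

Lemma proj_adapted U s c e y: sect U s -> adapted U s c e -> img e y ->
 proj (param e y) = param c (cplx (rsubmx y)).
move=> [_ _ prs] [_ _ h] iy;have [_ Ux jE] := h y iy;have [P1 _ _] := Pg.
rewrite (hproj (g := s (param c (cplx (rsubmx y)))) (z := cexp ('i * (lsubmx y 0 0)%:C) / (Num.sqrt (herm rho v ip q (s (param c (cplx (rsubmx y)))) 1))%:C)) ?prs //.
by rewrite jE;exists (gone GC)=> //;rewrite gmul1' chi1 invr1 mul1r.
Qed.

Lemma jacobian_holo (Tr: 'rV[C]_n -> 'rV[C]_n) (x: 'rV[R]_(n + n)): lsm Tr (cplx x) ->
 'J (fun z => realify (Tr (cplx z))) x *m stdJ n = stdJ n *m 'J (fun z => realify (Tr (cplx z))) x.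
move=> sT;have [lT DT] := realify_holo sT;have dT:= lsd lT.
apply: mulrow_ext=> w;rewrite !mulmxA -!derive_mulJ // !DT cplx_stdJ -realify_i;congr realify.
by rewrite [RHS]deriveE ?linearZ /= -?deriveE //;exact: lsd.
Qed.

(** In an adapted chart the projection is (theta, x) |-> x, followed by a holomorphic change of
    coordinates on the base. *)
Lemma dproj_holo (t: T) e y c1: atlas e -> Ad t -> img e y -> dom (ec t) (param e y) -> atlas c1 ->
 dom c1 (proj (param e y)) -> exists2 Bj: 'M[R]_(n + n), Bj *m stdJ n = stdJ n *m Bj &
 'J (fun y' => realify (coord c1 (proj (param e y')))) y = 'J (trans e (ec t)) y *m (col_mx 0 1%:M *m Bj).
move=> ae At iy dy ac1 d1;have at':= Ada At;have [sU aa] := At;have [_ ac h] := aa.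
have [i1 p1] := trans_img at' dy;have [ix _ _] := h _ i1.
have pE: proj (param e y) = param t.2.1 (cplx (rsubmx (trans e (ec t) y))) by rewrite -p1 (proj_adapted sU aa).
rewrite pE in d1;set x := rsubmx _ in ix d1 pE.
have sT: lsm (trans t.2.1 c1) (cplx x).
 by have [dc <-] := imgP (atlas_ok ac) ix;exact: atlas_trans.
have [lT _] := realify_holo sT.
exists ('J (fun z => realify (trans t.2.1 c1 (cplx z))) x);first exact: jacobian_holo.
have sR (z: 'rV[R]_(1 + (n + n))): lsm (fun y1: 'rV[R]_(1 + (n + n)) => rsubmx y1) z :=  (@lsm_rsub _ _ (fun z1 => z1) z (lsm_id _)).
have sTt:= trans_lsm ae at' iy dy.
pose G (y1: 'rV[R]_(1 + (n + n))) := realify (trans t.2.1 c1 (cplx (rsubmx y1))).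
have sG: lsm G (trans e (ec t) y) := @lsm_rsub _ _ (fun z => realify (trans t.2.1 c1 (cplx z))) _ lT.
rewrite (@jacobian_near _ _ _ _ (fun y1 => G (trans e (ec t) y1)));last exact: lsm_comp.
 rewrite (jacobian_comp sTt sG);congr (_ *m _).
 rewrite (@jacobian_comp _ _ _ _ (fun y1: 'rV[R]_(1 + (n + n)) => rsubmx y1) (fun z => realify (trans t.2.1 c1 (cplx z)))) //.
 congr (_ *m _);apply: mulrow_ext=> w;rewrite -derive_mulJ;last exact: lsd.
 rewrite (derive_linear (rsubmx: {linear 'rV[R]_(1 + (n + n)) -> 'rV[R]_(n + n)})) /=.
 by rewrite -[w in RHS]hsubmxK mul_row_col mulmx0 add0r mulmx1.
apply: filterS (near_trans ae at' iy dy)=> y1 [iy1 dy1].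
by have [i2 p2] := trans_img at' dy1;rewrite -p2 (proj_adapted sU aa).
Qed.

(** By [adapted_change] the local formulas are compatible, so [transport] spreads them over the
    atlas. The last clause retains the formulas in an arbitrary chart through an adapted one; the
    cone computation starts from it. *)
Lemma adapted_tensors: exists eta xi phi,
 [/\ is_eta_bar P pr rho v ip chi q j eta, is_xi P pr rho v ip chi q j xi, is_phi proj eta xi phi &
 forall U s c e' e y, sect U s -> adapted U s c e' -> atlas e -> img e y -> dom e' (param e y) ->
 let D := 'J (trans e e') y in let D' := 'J (trans e' e) (trans e e' y) in let x := rsubmx (trans e e' y) in
 [/\ eta e y = D *m eta_col (grad (logn c s) x), xi e y = xi_row *m D' & phi e y = D *m phi_mx (grad (logn c s) x) *m D']].
have [ad adP] := choice adapted_at.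
pose F1 (t: T) (y: 'rV[R]_(1 + (n + n))): 'cV[R]_(1 + (n + n)) := eta_col (grad (ft t) (rsubmx y)).
pose F2 (t: T) (y: 'rV[R]_(1 + (n + n))) := xi_row.
pose F3 (t: T) (y: 'rV[R]_(1 + (n + n))): 'M[R]_(1 + (n + n)) := phi_mx (grad (ft t) (rsubmx y)).
pose a1 (D D': 'M[R]_(1 + (n + n))) (A: 'cV[R]_(1 + (n + n))) := D *m A.
pose a2 (D D': 'M[R]_(1 + (n + n))) (A: 'rV[R]_(1 + (n + n))) := A *m D'.
pose a3 (D D': 'M[R]_(1 + (n + n))) (A: 'M[R]_(1 + (n + n))) := D *m A *m D'.
have a11 A: a1 1%:M 1%:M A = A by exact: mul1mx.
have a21 A: a2 1%:M 1%:M A = A by exact: mulmx1.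
have a31 A: a3 1%:M 1%:M A = A by rewrite /a3 mul1mx mulmx1.
have a1M D D' E E' A: a1 D D' (a1 E E' A) = a1 (D *m E) (E' *m D') A by exact: mulmxA.
have a2M D D' E E' A: a2 D D' (a2 E E' A) = a2 (D *m E) (E' *m D') A by rewrite /a2 mulmxA.
have a3M D D' E E' A: a3 D D' (a3 E E' A) = a3 (D *m E) (E' *m D') A by rewrite /a3 !mulmxA.
have a1s (D D': 'rV[R]_(1 + (n + n)) -> 'M[R]_(1 + (n + n))) A x: lsm D x -> lsm D' x -> lsm A x ->
 lsm (fun y => a1 (D y) (D' y) (A y)) x by move=> h1 h2 h3;exact: lsm_mulmx.
have a2s (D D': 'rV[R]_(1 + (n + n)) -> 'M[R]_(1 + (n + n))) A x: lsm D x -> lsm D' x -> lsm A x ->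
 lsm (fun y => a2 (D y) (D' y) (A y)) x by move=> h1 h2 h3;exact: lsm_mulmx.
have a3s (D D': 'rV[R]_(1 + (n + n)) -> 'M[R]_(1 + (n + n))) A x: lsm D x -> lsm D' x -> lsm A x ->
 lsm (fun y => a3 (D y) (D' y) (A y)) x by move=> h1 h2 h3;apply: lsm_mulmx=> //;exact: lsm_mulmx.
have F1s t y: Ad t -> img (ec t) y -> lsm (F1 t) y.
 move=> At iy;apply: (@lsm_rsub _ _ (fun x => eta_col (grad (ft t) x))).
 apply: (lsm_ext (fun x => esym (eta_colE (grad (ft t) x))));apply: lsm_add;first exact: lsm_cst.
 by apply: lsm_mulmx;[exact: lsm_cst|exact: grad_lsm].
have F2s t y: Ad t -> img (ec t) y -> lsm (F2 t) y by move=> _ _;exact: lsm_cst.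
have F3s t y: Ad t -> img (ec t) y -> lsm (F3 t) y.
 move=> At iy;apply: (@lsm_rsub _ _ (fun x => phi_mx (grad (ft t) x))).
 apply: (lsm_ext (fun x => esym (phi_mxE (grad (ft t) x))));apply: lsm_add;first exact: lsm_cst.
 by apply: lsm_mulmx;[exact: lsm_cst|apply: lsm_mulmx;[exact: grad_lsm|exact: lsm_cst]].
have JV t t' y: Ad t -> Ad t' -> img (ec t) y -> dom (ec t') (param (ec t) y) ->
 'J (trans (ec t) (ec t')) y *m 'J (trans (ec t') (ec t)) (trans (ec t) (ec t') y) = 1%:M.
 by move=> At At';apply: trans_JV;exact: Ada.
have F1c t t' y: Ad t -> Ad t' -> img (ec t) y -> dom (ec t') (param (ec t) y) -> F1 t y =
 a1 ('J (trans (ec t) (ec t')) y) ('J (trans (ec t') (ec t)) (trans (ec t) (ec t') y)) (F1 t' (trans (ec t) (ec t') y)).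
 by move=> At At' iy dy;have [] := adapted_change At At' iy dy.
have F2c t t' y: Ad t -> Ad t' -> img (ec t) y -> dom (ec t') (param (ec t) y) -> F2 t y =
 a2 ('J (trans (ec t) (ec t')) y) ('J (trans (ec t') (ec t)) (trans (ec t) (ec t') y)) (F2 t' (trans (ec t) (ec t') y)).
 move=> At At' iy dy;have [_ h _] := adapted_change At At' iy dy.
 by rewrite /F2 /a2 -[in RHS]h -mulmxA JV ?mulmx1.
have F3c t t' y: Ad t -> Ad t' -> img (ec t) y -> dom (ec t') (param (ec t) y) -> F3 t y =
 a3 ('J (trans (ec t) (ec t')) y) ('J (trans (ec t') (ec t)) (trans (ec t) (ec t') y)) (F3 t' (trans (ec t) (ec t') y)).
 move=> At At' iy dy;have [_ _ h] := adapted_change At At' iy dy.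
 by rewrite /F3 /a3 -h -mulmxA JV ?mulmx1.
have main U s c e' e y: sect U s -> adapted U s c e' -> atlas e -> img e y -> dom e' (param e y) ->
 let D := 'J (trans e e') y in let D' := 'J (trans e' e) (trans e e' y) in let x := rsubmx (trans e e' y) in
 [/\ transport ec ad a1 F1 e y = D *m eta_col (grad (logn c s) x), transport ec ad a2 F2 e y = xi_row *m D' &
 transport ec ad a3 F3 e y = D *m phi_mx (grad (logn c s) x) *m D'].
 move=> sU aa ae iy dy;pose t: T := ((U, s), (c, e'));have At: Ad t by [].
 split;[exact: (transportE Ada adP a1M F1c ae At iy dy)|exact: (transportE Ada adP a2M F2c ae At iy dy)|].
 exact: (transportE Ada adP a3M F3c ae At iy dy).
have JVo:= @overlap_JV _ _ M.
exists (transport ec ad a1 F1), (transport ec ad a2 F2), (transport ec ad a3 F3);split;[| | |exact: main].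
- split;first split.
 + by move=> e ae;exact: (transport_sm Ada adP a1M a1s F1s F1c ae).
 + by move=> e e' y ae ae' oy;exact: (transport_change Ada adP a1M F1c ae ae' oy).
 move=> U s c e y w sU aa iy f x wx dth;pose t: T := ((U, s), (c, e));have At: Ad t by [].
 have -> : (w *m transport ec ad a1 F1 e y) 0 0 = (q * n.+1%:R)^-1 * (dth - q / 2%:R * 'D_(wx *m stdJ n) f x).
 have dfx: dfb f x by apply: lsd;exact: (adapted_logn_lsm sU aa iy).
 have h:= transport_self Ada adP a11 a1M F1c At iy.
 by rewrite (gradE _ dfx) -eta_col_eval;apply: (congr1 (fun z: 'cV[R]_(1 + (n + n)) => (w *m z) 0 0) h).
 rewrite /del /delbar;move: ('D_wx f x) ('D_(wx *m stdJ n) f x) dth=> a b d;exact: eta_formula.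
- split;first split.
 + by move=> e ae;exact: (transport_sm Ada adP a2M a2s F2s F2c ae).
 + move=> e e' y ae ae' oy;rewrite (transport_change Ada adP a2M F2c ae ae' oy) /a2.
 by apply/esym/mulVK;exact: JVo.
 move=> U s c e y sU aa iy;pose t: T := ((U, s), (c, e));have At: Ad t by [].
 exact: (transport_self Ada adP a21 a2M F2c At iy).
- split;first split.
 + by move=> e ae;exact: (transport_sm Ada adP a3M a3s F3s F3c ae).
 + move=> e e' y ae ae' oy;rewrite (transport_change Ada adP a3M F3c ae ae' oy) /a3.
 by apply: mulVK;exact: JVo.
 move=> e y ae iy;have [t [At dy]] := adapted_at (param e y);have [sU aa] := At.
 have at':= Ada At;have [-> -> ->] := main _ _ _ _ e y sU aa ae iy dy.
 have /mulmx1C DD := trans_JV ae at' iy dy.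
 rewrite -/(ec t);set D := 'J (trans e (ec t)) y in DD *;set D' := 'J _ _ in DD *.
 split;first exact: xi_kill DD (xi_phi _).
 move=> w _;split;first exact: phi_kill DD (phi_eta _).
 move=> c1 ac1 d1;have [Bj BJ E] := dproj_holo ae At iy dy ac1 d1;cbv zeta;rewrite E -/D.
 exact: phi_proj DD (phi_p0 _) BJ.
Qed.
End Adapted.

(** * Conjugate frames, and evaluation of ring identities at points *)

Section RealFree.
Context {R: realType}.
Notation C := (cnum R).
Notation cj X := (map_mx (fun z: C => z^*) X).

Lemma conj_mxK p r (X: 'M[C]_(p, r)): cj (cj X) = X.
by mxext i j;rewrite !mxE conjcK. Qed.
Lemma conj_real p r (X: 'M[R]_(p, r)): cj (map_mx (real_complex R) X) = map_mx (real_complex R) X.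
by mxext i j;rewrite !mxE;apply: cpx_eq=> /=;rewrite ?oppr0. Qed.

(** A vector that kills both E and its conjugate has real and imaginary parts that kill E. *)
Lemma row_free_conj p r (E: 'M[C]_(p, r)) :
 (forall w: 'rV[R]_p, map_mx (real_complex R) w *m E = 0 -> w = 0) -> row_free (row_mx E (cj E)).
move=> wz;apply/inj_row_free=> u;rewrite mul_mx_row -[X in _ = X]row_mx0=> /eq_row_mx[u1 u2].
have u3: cj u *m E = 0 by have := congr1 (fun X => cj X) u2;rewrite map_mxM conj_mxK map_mx0.
have re: map_mx (@cRe R) u = 0.
 apply: wz;have -> : map_mx (real_complex R) (map_mx (@cRe R) u) = 2^-1 *: (u + cj u).
 rowext i;rewrite !mxE;case: (u 0 i)=> a b.
 have -> : (a +i* b) + (a +i* b)^* = 2%:R * a%:C :> C by apply: cpx_eq;rewrite ?cReM ?cImM /=;ring.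
 by rewrite mulKf // pnatr_eq0.
 by rewrite -scalemxAl mulmxDl u1 u3 addr0 scaler0.
have im: map_mx (@cIm R) u = 0.
 apply: wz;have -> : map_mx (real_complex R) (map_mx (@cIm R) u) = (- 'i / 2) *: (u - cj u).
 rowext i;rewrite !mxE;case: (u 0 i)=> a b.
 have -> : (a +i* b) - (a +i* b)^* = 'i * (2%:R * b%:C) :> C by apply: cpx_eq;rewrite ?cReM ?cImM /=;ring.
 have i2: 'i * 'i = -1 :> C by rewrite -expr2 sqr_i.
 by via (- ('i * 'i) * b%:C: C);[rewrite i2 opprK mul1r|field].
 by rewrite -scalemxAl mulmxBl u1 u3 subr0 scaler0.
rowext i;rewrite [RHS]mxE;apply: cpx_eq.
 by have /rowP/(_ i) := re;rewrite !mxE.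
by have /rowP/(_ i) := im;rewrite !mxE.
Qed.
End RealFree.

Section RingTools.
Context {R: realType} {N: nat}.
Notation C := (cnum R).
Variable O: odom R N.
Notation V := (dset O).
Implicit Types (F: 'rV[R]_N -> C) (u: 'rV[R]_N -> R) (y: 'rV[R]_N).

Lemma csm_of F: (forall y, V y -> clsm F y) -> csm V F.
by move=> h;split;apply: smooth_on_lsm=> y Vy;have [] := h y Vy. Qed.

Definition sm F (h: forall y, V y -> clsm F y): smf O := mksmf (csm_of h).

Lemma smE F h y: V y -> @sm F h y = F y.
exact: mksmfE. Qed.
Lemma der_in i (a: smf O) F y: V y -> (forall y', V y' -> a y' = F y') -> smf_der i a y = cpd i F y.
by move=> Vy h;rewrite smf_derE //;exact: cpd_in h. Qed.
Lemma der_sm i F h y: V y -> smf_der i (@sm F h) y = cpd i F y.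
by move=> Vy;apply: der_in=> // y' Vy';exact: smE. Qed.

Definition cD w F y: C := ('D_w (fun z => cRe (F z): R) y) +i* ('D_w (fun z => cIm (F z): R) y).

Lemma cD_sum w F y: clsm F y -> cD w F y = \sum_i (w 0 i)%:C * cpd i F y.
move=> [hr hm];have rs (r: 'I_N -> R): (\sum_i r i)%:C = \sum_i (r i)%:C :> C by exact: (rmorph_sum (real_complex R)).
rewrite /cD;have dr:= lsd hr;have di:= lsd hm;rewrite !deriveE // !diff_rV_sum //.
via ((\sum_i w 0 i *: 'D_(dlt i) (fun z => cRe (F z): R) y)%:C +
 'i * (\sum_i w 0 i *: 'D_(dlt i) (fun z => cIm (F z): R) y)%:C :> C).
 by apply: cpx_eq;rewrite /= ?cReM ?cImM /=;ring.
rewrite !rs mulr_sumr -big_split;sumext i;rewrite /cpd /pderiv.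
by apply: cpx_eq;rewrite /= ?cReM ?cImM /= /GRing.scale /=;ring.
Qed.

Lemma cpd_cD i F y: cpd i F y = cD (dlt i) F y.
by []. Qed.

Lemma cD_cexp w F y (a: C): clsm F y -> cD w (fun z => cexp (a * F z)) y = cexp (a * F y) * (a * cD w F y).
move=> [hr hm];have dr:= lsd hr;have di:= lsd hm.
pose p z: R := cRe a * cRe (F z) - cIm a * cIm (F z).
pose t z: R := cRe a * cIm (F z) + cIm a * cRe (F z).
have sc (c: R) (g: 'rV[R]_N -> R): lsm g y -> lsm (fun z => c * g z) y by move=> hg;apply: lsm_mul=> //;exact: lsm_cst.
have sp: lsm p y by apply: lsm_add;[exact: sc|apply: lsm_opp;exact: sc].
have st: lsm t y by apply: lsm_add;exact: sc.
have dp:= lsd sp;have dt:= lsd st.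
have Dc (c: R) (g: 'rV[R]_N -> R): lsm g y -> 'D_w (fun z => c * g z) y = c * 'D_w g y /\ derivable (fun z => c * g z) y w.
 by move=> hg;have [d1 d2] := derive_Zl c w (lsd hg);split=> //;exact: dfd.
have Dp: 'D_w p y = cRe a * 'D_w (fun z => cRe (F z): R) y - cIm a * 'D_w (fun z => cIm (F z): R) y.
 have [e1 d1] := Dc (cRe a) _ hr;have [e2 d2] := Dc (cIm a) _ hm.
 by rewrite /p (deriveB d1 d2) e1 e2.
have Dt: 'D_w t y = cRe a * 'D_w (fun z => cIm (F z): R) y + cIm a * 'D_w (fun z => cRe (F z): R) y.
 have [e1 d1] := Dc (cRe a) _ hm;have [e2 d2] := Dc (cIm a) _ hr.
 by rewrite /t (deriveD d1 d2) e1 e2.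
have re z: cRe (cexp (a * F z)) = expR (p z) * cos (t z) by rewrite Re_cexp cReM cImM.
have im z: cIm (cexp (a * F z)) = expR (p z) * sin (t z) by rewrite Im_cexp cReM cImM.
have sx:= lsm_expR sp;have sc1:= lsm_cos st;have ss:= lsm_sin st.
have D1: 'D_w (fun z => expR (p z)) y = 'D_w p y * expR (p y) := derive_fun w (is_derive_expR _) dp.
have D2: 'D_w (fun z => cos (t z)) y = 'D_w t y * - sin (t y) := derive_fun w (is_derive_cos _) dt.
have D3: 'D_w (fun z => sin (t z)) y = 'D_w t y * cos (t y) := derive_fun w (is_derive_sin _) dt.
have dx:= dfd (v := w) (lsd sx);have dc:= dfd (v := w) (lsd sc1).
have ds:= dfd (v := w) (lsd ss).
rewrite /cD;apply: cpx_eq.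
 rewrite [LHS]/= (_: (fun z => _) = fun z => expR (p z) * cos (t z));last by fext z;exact: re.
 rewrite (derive_mulr dx dc) D1 D2 Dp Dt [RHS]cReM re im cReM cImM /=;ring.
via ('D_w (fun z => expR (p z) * sin (t z)) y);first by rewrite [LHS]/=;congr ('D_w _ y);fext z;exact: im.
rewrite (derive_mulr dx ds) D1 D3 Dp Dt [RHS]cImM re im cReM cImM /=;ring.
Qed.

Lemma clsm_cexp F y (a: C): clsm F y -> clsm (fun z => cexp (a * F z)) y.
move=> hF;have [hr hm] := clsm_mul (clsm_cst a _) hF;split.
 by apply: lsm_ext (lsm_mul (lsm_expR hr) (lsm_cos hm))=> z;rewrite Re_cexp.
by apply: lsm_ext (lsm_mul (lsm_expR hr) (lsm_sin hm))=> z;rewrite Im_cexp.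
Qed.

(** The bridge to real tensor calculus: ring elements are compared with real functions term by term,
    up to Christoffel symbols and Ricci curvature. *)
Definition isR (a: smf O) u := forall y, V y -> a y = (u y)%:C.

Lemma isRD a b u w: isR a u -> isR b w -> isR (a + b) (fun y => u y + w y).
by move=> h1 h2 y Vy;rewrite smfD // h1 // h2 // rmorphD. Qed.
Lemma isRB a b u w: isR a u -> isR b w -> isR (a - b) (fun y => u y - w y).
by move=> h1 h2 y Vy;rewrite smfB // h1 // h2 // rmorphB. Qed.
Lemma isRM a b u w: isR a u -> isR b w -> isR (a * b) (fun y => u y * w y).
by move=> h1 h2 y Vy;rewrite smfM // h1 // h2 // rmorphM. Qed.
Lemma isR_sum (I: Type) (r: seq I) (P: pred I) (a: I -> smf O) (u: I -> 'rV[R]_N -> R) :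
 (forall i, isR (a i) (u i)) -> isR (\sum_(i <- r | P i) a i) (fun y => \sum_(i <- r | P i) u i y).
by move=> h y Vy;rewrite smf_sumE // rmorph_sum;sumext i;exact: h. Qed.
Lemma isR_der i a u: isR a u -> isR (smf_der i a) (fun y => pderiv i u y).
move=> h y Vy;rewrite (der_in i Vy h) /cpd /=.
by apply: cpx_eq=> //=;exact: derive_cst.
Qed.
Lemma isR_ext a u w: (forall y, V y -> u y = w y) -> isR a u -> isR a w.
by move=> h k y Vy;rewrite k // h. Qed.

Lemma evm_bar p r (A: 'M[smf O]_(p, r)) y: V y -> evm (map_mx (@smf_bar R N O) A) y = map_mx (fun z: C => z^*) (evm A y).
by move=> Vy;mxext i j;rewrite !mxE smf_barE. Qed.
Lemma evm_tr p r (A: 'M[smf O]_(p, r)) y: evm A^T y = (evm A y)^T.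
by mxext i j;rewrite !mxE. Qed.
Lemma smf_at (a b: smf O) y: a = b -> a y = b y. by move=> ->. Qed.
Lemma evm_der i p r (A: 'M[smf O]_(p, r)) y a b: evm (map_mx (@smf_der R N O i) A) y a b = smf_der i (A a b) y.
by rewrite mxE mxE. Qed.
Lemma smf_invE (a b: smf O) y: V y -> a * b = 1 -> b y = (a y)^-1.
move=> Vy E;have h: a y * b y = 1 by rewrite -(smfM _ _ Vy) E (smf1 Vy).
have a0: a y != 0 by apply: contra_eq_neq h=> ->;rewrite mul0r eq_sym oner_eq0.
by apply: (mulfI a0);rewrite h mulfV.
Qed.
Lemma smf_sign l y: V y -> ((-1: smf O) ^+ l) y = (-1) ^+ l.
by move=> Vy;elim: l=> [|l IH];rewrite ?expr0 ?(smf1 Vy) // !exprS (smfM _ _ Vy) IH (smfN _ Vy) (smf1 Vy). Qed.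
Lemma smf_nat l y: V y -> (l%:R: smf O) y = l%:R.
by move=> Vy;elim: l=> [|l IH];rewrite ?smf0 // -!natr1 (smfD _ _ Vy) IH (smf1 Vy). Qed.
Lemma smf_exp (a: smf O) l y: V y -> (a ^+ l) y = a y ^+ l.
by move=> Vy;elim: l=> [|l IH];rewrite ?expr0 ?(smf1 Vy) // !exprS (smfM _ _ Vy) IH. Qed.
Lemma evmE p r (A: 'M[smf O]_(p, r)) y i j: evm A y i j = A i j y. exact: mxE. Qed.
Lemma evmZ p r a (A: 'M[smf O]_(p, r)) y: V y -> evm (a *: A) y = a y *: evm A y.
by move=> Vy;mxext i j;rewrite !mxE smfM. Qed.
Lemma evmB p r (A B: 'M[smf O]_(p, r)) y: V y -> evm (A - B) y = evm A y - evm B y.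
by move=> Vy;mxext i j;rewrite !mxE smfB. Qed.
Lemma evmD p r (A B: 'M[smf O]_(p, r)) y: V y -> evm (A + B) y = evm A y + evm B y.
by move=> Vy;mxext i j;rewrite !mxE smfD. Qed.
Lemma evm_col p r (A: 'M[smf O]_(p, r)) j y: evm (col j A) y = col j (evm A y).
by mxext i l;rewrite !mxE. Qed.
Lemma evm_rowm p r (A: 'M[smf O]_(p, r)) j y: evm (row j A) y = row j (evm A y).
by mxext i l;rewrite !mxE. Qed.
Lemma evm_row_mx p r1 r2 (A: 'M[smf O]_(p, r1)) (B: 'M[smf O]_(p, r2)) y: evm (row_mx A B) y = row_mx (evm A y) (evm B y).
by mxext i l;rewrite mxE;case: (split_ordP l)=> b ->;rewrite ?row_mxEl ?row_mxEr mxE. Qed.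
Lemma evm_adj p (A: 'M[smf O]_p) y: V y -> evm (\adj A) y = \adj (evm A y).
move=> Vy;mxext i j;rewrite !mxE /cofactor smfM // evm_det //;congr (_ * _).
 exact: smf_sign.
by congr (\det _);mxext i' j';rewrite !mxE.
Qed.
Lemma smf_tr p (A: 'M[smf O]_p) y: V y -> (\tr A) y = \tr (evm A y).
by move=> Vy;rewrite /mxtrace smf_sumE //;sumext i;rewrite mxE. Qed.
Lemma evm_eq p r (A B: 'M[smf O]_(p, r)): (forall y, V y -> evm A y = evm B y) -> A = B.
by move=> h;mxext i j;apply: smf_eq=> y Vy;have /matrixP/(_ i j) := h y Vy;rewrite !mxE. Qed.

(** The sizes agree only through an equation between naturals; eliminating it reaches the square
    case. *)
Lemma evm_inv_rect p r (A: 'M[smf O]_(p, r)): p = r -> (forall y, V y -> row_free (evm A y)) ->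
 exists B: 'M[smf O]_(r, p), A *m B = 1%:M /\ B *m A = 1%:M.
move=> E;case: _ / E in A *=> h;have [|B AB] := @evm_inv _ _ _ _ A;last by exists B;split=> //;exact: mulmx1C.
by move=> y Vy;rewrite -row_free_unit;exact: h.
Qed.
End RingTools.

(** * From functions on an open set to a Ricci-flat Kähler metric *)

Section ConeKaehler.
Context {R: realType} {N n Nr: nat}.
Notation C := (cnum R).
Variable O: odom R N.
Notation V := (dset O).
Notation o := (lshift n 0: 'I_(1 + n)).
Notation st u := ((map_mx (fun z: C => z^*) u)^T).
Hypothesis NE: N = ((1 + n) + (1 + n))%N.
Variables (Z: 'I_(1 + n) -> 'rV[R]_N -> C) (J: 'rV[R]_N -> 'M[R]_N) (r2: 'rV[R]_N -> R) (q: R)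
 (Y: 'rV[R]_N -> 'M[C]_(Nr, 1 + n)) (H: 'M[C]_Nr) (Q: 'rV[R]_N -> 'M[C]_(n, 1 + n))
 (Phi: 'rV[R]_N -> 'cV[R]_N) (g: 'rV[R]_N -> 'M[R]_N).
Context (q0: 0 < q)
 (Zs: forall a y, V y -> clsm (Z a) y)
 (Js: forall y, V y -> lsm J y)
 (rs: forall y, V y -> lsm r2 y)
 (Ys: forall i c y, V y -> clsm (fun y => Y y i c) y)
 (Qs: forall i c y, V y -> clsm (fun y => Q y i c) y)
 (HJ: forall y w a, V y -> cD (w *m J y) (Z a) y = 'i * cD w (Z a) y)
 (Hker: forall y w, V y -> (forall a, cD w (Z a) y = 0) -> w = 0)
 (HW: forall y i l, V y -> cpd i (fun y => Y y l o) y =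
 (Y y *m ((\row_b cpd i (Z (rshift 1 b)) y) *m Q y)^T) l 0)
 (HT: forall y a c, V y -> exists t: 'I_n -> C, forall i,
 cpd i (fun y => Q y a c) y = \sum_b cpd i (Z (rshift 1 b)) y * t b)
 (HTu: forall y, V y -> \det (rsubmx (Q y)) != 0).
Let Gf y := (Y y)^T *m H *m map_mx (fun z: C => z^*) (Y y).
Context (HG: forall y i, V y -> exists (m: 'M[C]_(1 + n)) lm, [/\ \tr m = n%:R * lm,
 forall c, m o c = lm * (c == o)%:R &
 (\matrix_(a, c) cpd i (fun y => Gf y a c) y) = m *m Gf y + Gf y *m st m])
 (Gh: forall y, V y -> st (Gf y) = Gf y)
 (Gpos: forall y (u: 'rV[C]_(1 + n)), V y -> u != 0 -> 0 < (u *m Gf y *m st u) 0 0)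
 (r0: forall y, V y -> 0 < r2 y)
 (Hr: forall y, V y -> (r2 y)%:C ^+ n.+1 =
 cexp ((q^-1)%:C * Z o y) * (cexp ((q^-1)%:C * Z o y))^* * Gf y o o)
 (HPhi: forall y, V y -> Phi y = - 2^-1 *: (J y *m grad r2 y))
 (Hg: forall y, V y -> g y = 2^-1 *: extd Phi y *m (J y)^T).

Notation A := (smf O).
Notation D := (@smf_der R N O).
Notation bar := (@smf_bar R N O).
Notation bm X := (map_mx bar X).
Let cst (c: C): A := sm (fun y _ => clsm_cst c y).
Let cstE c y: V y -> cst c y = c. exact: smE. Qed.
Let Dcst i c: D i (cst c) = 0.
apply: smf_eq=> y Vy;rewrite der_sm // smf0 /cpd /pderiv;apply: cpx_eq=> /=;exact: derive_cst.
Qed.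
Let cstM c d: cst c * cst d = cst (c * d).
by apply: smf_eq=> y Vy;rewrite smfM // !cstE. Qed.
Let cst1: cst 1 = 1. by apply: smf_eq=> y Vy;rewrite smf1 // cstE. Qed.
Let barcst c: bar (cst c) = cst c^*. by apply: smf_eq=> y Vy;rewrite smf_barE // !cstE. Qed.
Let zz a: A := sm (Zs a).
Let Jm: 'M[A]_N := \matrix_(i, j) sm (fun y Vy => clsm_real ((lsm_mx J y).1 (Js Vy) i j)).
Let phi: A := sm (fun y Vy => clsm_real (rs Vy)).
Let RY: 'M[A]_(Nr, 1 + n) := \matrix_(i, c) sm (Ys i c).
Let HH: 'M[A]_Nr := \matrix_(i, j) cst (H i j).
Let QQ: 'M[A]_(n, 1 + n) := \matrix_(i, c) sm (Qs i c).
Let eps: A := sm (fun y Vy => clsm_cexp (q^-1)%:C (Zs o Vy)).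
Let half: A := cst 2^-1.
Let ii: A := cst 'i.
Let qA := cst q%:C.
Let qi := cst (q^-1)%:C.
Let ni := cst (n.+1%:R)^-1.
Let E := \matrix_(i, a) D i (zz a).
Let G := RY^T *m HH *m bm RY.
Let HD := @smf_derivations R N O.
Let barK: involutive bar := @smf_barK R N O.
Let barD: forall i x, bar (D i x) = D i (bar x) := @smf_bar_der R N O.
Let evE y i a: V y -> E i a y = cpd i (Z a) y.
by move=> Vy;rewrite mxE der_sm. Qed.
Let evY y: V y -> evm RY y = Y y. by move=> Vy;mxext i c;rewrite !mxE smE. Qed.
Let evQ y: V y -> evm QQ y = Q y. by move=> Vy;mxext i c;rewrite !mxE smE. Qed.
Let evH y: V y -> evm HH y = H. by move=> Vy;mxext i c;rewrite !mxE cstE. Qed.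
Let evJ y: V y -> evm Jm y = map_mx (real_complex R) (J y).
by move=> Vy;mxext i c;rewrite !mxE smE. Qed.
Let evG y: V y -> evm G y = Gf y.
by move=> Vy;rewrite /G (evmM _ _ Vy) (evmM _ _ Vy) evm_tr (evm_bar _ Vy) (evY Vy) (evH Vy). Qed.
Let evGe y a c: V y -> G a c y = Gf y a c.
by move=> Vy;rewrite -(evG Vy) evmE. Qed.
Let wE y (w: 'rV[R]_N): V y -> map_mx (real_complex R) w *m evm E y = \row_a cD w (Z a) y.
move=> Vy;rowext a;rewrite [RHS]mxE cD_sum;last exact: Zs.
by rewrite mxE;sumext i;rewrite mxE [evm E y i a]mxE evE.
Qed.
Let EEb_free y: V y -> row_free (evm (row_mx E (bm E)) y).
move=> Vy;rewrite evm_row_mx (evm_bar _ Vy);apply: row_free_conj=> w.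
by rewrite (wE _ Vy)=> /rowP h;apply: (Hker Vy)=> a;have := h a;rewrite !mxE.
Qed.
(** The inverse of the Jacobian of [Z] and its conjugate splits into two blocks; uniqueness of the
    inverse makes the second block the conjugate of the first. *)
Let frame: exists F: 'M[A]_(1 + n, N), [/\ F *m E = 1%:M, F *m bm E = 0, E *m F + bm E *m bm F = 1%:M & bm F *m E = 0].
have [B [EB BE]] := evm_inv_rect NE EEb_free.
rewrite -[B]vsubmxK in EB BE;move: EB BE;set F := usubmx B;set F' := dsubmx B.
rewrite mul_row_col mul_col_row scalar_mx_block=> EB /eq_block_mx[FE FEb FE' FEb'].
have bb p r (X: 'M[A]_(p, r)): bm (bm X) = X by mxext i j;rewrite !mxE barK.
have h1: bm F *m bm E = 1%:M by rewrite -map_mxM FE map_mx1.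
have h2: bm F *m E = 0 by rewrite -[E]bb -map_mxM FEb map_mx0.
have F'E: F' = bm F.
 rewrite -[LHS]mulmx1 -[RHS]mulmx1 -EB !mulmxDr !mulmxA FE' FEb' h1 h2.
 by rewrite !mul0mx !mul1mx.
by exists F;split;[exact: FE|exact: FEb|rewrite -F'E;exact: EB|exact: h2].
Qed.
Let half2: half * 2%:R = 1.
have -> : 2%:R = cst 2%:R :> A by apply: smf_eq=> y Vy;rewrite cstE // -[2%:R]/(1 + 1) smfD // smf1.
by rewrite /half cstM mulVf ?cst1 // pnatr_eq0.
Qed.
Let phib: bar phi = phi.
by apply: smf_eq=> y Vy;rewrite smf_barE // smE //;apply: cpx_eq=> /=;rewrite ?oppr0. Qed.
Let JE: Jm *m E = ii *: E.
apply: evm_eq=> y Vy;rewrite (evmM _ _ Vy) (evJ Vy) (evmZ _ _ Vy) (cstE _ Vy);apply/row_matrixP=> i.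
rewrite row_mul -map_row rowE (wE _ Vy);rowext a.
rewrite [LHS]mxE (HJ _ _ Vy) [RHS]mxE [RHS]mxE evmE (evE _ _ Vy).
by [].
Qed.
Let Jb: bm Jm = Jm.
by apply: evm_eq=> y Vy;rewrite (evm_bar _ Vy) (evJ Vy) conj_real. Qed.
Let DH i: map_mx (D i) HH = 0.
by mxext a b;rewrite [LHS]mxE [HH a b]mxE Dcst mxE. Qed.
Let DW i: map_mx (D i) (col o RY) = RY *m (row i (rsubmx (E: 'M[A]_(N, 1 + n))) *m row_mx (lsubmx QQ) (rsubmx QQ))^T.
rewrite hsubmxK;apply: evm_eq=> y Vy;apply/colP=> l;rewrite evm_der.
have -> : col o RY l 0 = sm (Ys l o) by rewrite mxE mxE.
rewrite (der_sm i (Ys l o) Vy) (HW _ _ Vy) (evmM _ _ Vy) (evY Vy) evm_tr (evmM _ _ Vy) (evQ Vy) evm_rowm.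
congr ((_ *m (_ *m _)^T) l 0);rowext b.
have ee: rsubmx E i b = E i (rshift 1 b) by rewrite mxE.
by rewrite [LHS]mxE [RHS]mxE evmE ee (evE _ _ Vy).
Qed.
Let De i: D i eps = eps * qi * D i (zz o).
apply: smf_eq=> y Vy;rewrite (der_sm _ _ Vy) (smfM _ _ Vy) (smfM _ _ Vy) (der_sm _ _ Vy) !(smE _ Vy).
by rewrite cpd_cD (cD_cexp _ _ (Zs o Vy)) mulrA.
Qed.
Let phiE: phi ^+ n.+1 = eps * bar eps * G o o.
apply: smf_eq=> y Vy;rewrite (smf_exp _ _ Vy) (smfM _ _ Vy) (smfM _ _ Vy) (smf_barE _ Vy) (evGe _ _ Vy).
by rewrite !(smE _ Vy) Hr.
Qed.
(** [Q] varies only through the base coordinates Z_b by [HT], and antiholomorphic derivatives kill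
    these. *)
Let hT (F: 'M[A]_(1 + n, N)) a i j: bm F *m E = 0 -> \sum_k bar (F a k) * D k (rsubmx QQ i j) = 0.
move=> FE;apply: smf_eq=> y Vy;rewrite smf0 (smf_sumE _ _ _ Vy).
have [t tE] := HT i (rshift 1 j) Vy.
via (\sum_k \sum_b (bar (F a k) y * cpd k (Z (rshift 1 b)) y) * t b).
 sumext k;rewrite (smfM _ _ Vy);have -> : rsubmx QQ i j = sm (Qs i (rshift 1 j)) by rewrite mxE mxE.
 by rewrite (der_sm _ _ Vy) tE mulr_sumr;sumext b;rewrite mulrA.
rewrite exchange_big big1 // => b _;rewrite -mulr_suml.
have -> : \sum_k bar (F a k) y * cpd k (Z (rshift 1 b)) y = (bm F *m E) a (rshift 1 b) y.
 rewrite mxE (smf_sumE _ _ _ Vy);sumext k;rewrite (smfM _ _ Vy) (evE _ _ Vy).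
 by rewrite [bm F a k]mxE.
by rewrite FE mxE smf0 mul0r.
Qed.
Let Goo y: V y -> 0 < Gf y o o.
move=> Vy;have d0: (dlt o: 'rV[C]_(1 + n)) != 0.
 by apply/eqP=> /rowP/(_ o);rewrite !mxE !eqxx=> /eqP;rewrite oner_eq0.
have := Gpos Vy d0;rewrite map_delta_mx trmx_delta -rowE -colE mxE.
by rewrite mxE.
Qed.
Let Gunit y: V y -> \det (Gf y) != 0.
move=> Vy;rewrite -unitfE -unitmxE -row_free_unit;apply/inj_row_free=> u u0;apply/eqP;apply: contraT=> /(Gpos Vy).
by rewrite u0 mul0mx mxE ltxx.
Qed.
Let DG i: exists mu, D i (\det G) = n%:R * mu * \det G /\ D i (G o o) = mu * G o o.
have [G' GV]: exists G', G o o * G' = 1.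
 by apply: smf_inv=> y Vy;rewrite (evGe _ _ Vy) gt_eqF // Goo.
exists (D i (G o o) * G');have E2: D i (G o o) = D i (G o o) * G' * G o o by rewrite -mulrA [G' * _]mulrC GV mulr1.
split=> //;apply: smf_eq=> y Vy;have [m [lm [trm m0 dG]]] := HG i Vy.
have dGe: evm (map_mx (D i) G) y = m *m Gf y + Gf y *m st m.
 rewrite -dG;mxext a b;rewrite evm_der [RHS]mxE;apply: (der_in i Vy)=> y' Vy';exact: evGe.
have [h1 h2] := @gram_trace C (@conjc R) n m (Gf y) _ lm trm m0 (erefl _).
have Doo: D i (G o o) y = (lm + lm^*) * Gf y o o.
 by have := congr1 (fun X: 'M[C]_(1 + n) => X o o) dGe;rewrite evm_der h2.
have muE: (D i (G o o) * G') y = lm + lm^*.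
 have G'e: G' y = (Gf y o o)^-1.
 by rewrite (smf_invE Vy GV) (evGe _ _ Vy).
 by rewrite (smfM _ _ Vy) Doo G'e mulfK // gt_eqF // Goo.
rewrite (der_det HD) (smf_tr _ Vy) (evmM _ _ Vy) (evm_adj _ Vy) dGe (evG Vy) h1.
by rewrite (smfM _ _ Vy) (smfM _ _ Vy) (smf_nat _ Vy) muE (evm_det _ Vy) (evG Vy).
Qed.
Let rC: R -> C := real_complex R.
Let rC_inj p r (X X': 'M[R]_(p, r)): map_mx rC X = map_mx rC X' -> X = X'.
by move=> /matrixP h;mxext i j;have := h i j;rewrite !mxE=> /complexI. Qed.

Notation pf := (pot_form D phi half Jm).
Notation Om := (pot_form2 D phi half Jm).
Let isR_half: isR half (fun=> 2^-1).
by move=> y Vy;rewrite (cstE _ Vy) fmorphV rmorph_nat. Qed.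
Let isR_J i j: isR (Jm i j) (fun y => J y i j).
by move=> y Vy;rewrite -evmE (evJ Vy) mxE. Qed.
Let isR_phi: isR phi r2. by move=> y Vy;exact: smE. Qed.
Let isR_pf i: isR (pf i 0) (fun y => Phi y i 0).
have -> : pf i 0 = 0 - half * \sum_l Jm i l * D l phi.
 rewrite sub0r -mulNr [LHS]mxE;congr (_ * _);rewrite [LHS]mxE;sumext l;congr (_ * _).
 by rewrite [LHS]mxE.
apply: (@isR_ext _ _ _ _ (fun y => 0 - 2^-1 * \sum_l J y i l * pderiv l r2 y)).
 move=> y Vy;rewrite (HPhi Vy) [RHS]mxE mulNr sub0r [X in _ = - (_ * X)]mxE;congr (- (_ * _)).
 by sumext l;congr (_ * _);rewrite [RHS]mxE.
apply: isRB;first by move=> y Vy;rewrite smf0.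
by apply: isRM=> //;apply: isR_sum=> l;apply: isRM=> //;exact: isR_der.
Qed.
Let isR_Om i j: isR (Om i j) (fun y => (2^-1 *: extd Phi y) i j).
rewrite [Om i j]mxE;apply: (@isR_ext _ _ _ _ (fun y => 2^-1 * (pderiv i (fun z => Phi z j 0: R) y - pderiv j (fun z => Phi z i 0: R) y))).
 by move=> y Vy;rewrite [RHS]mxE;congr (_ * _);rewrite [RHS]mxE.
apply: isRM;[exact: isR_half|apply: isRB;apply: isR_der;exact: isR_pf].
Qed.
Let evOm y: V y -> evm Om y = map_mx rC (2^-1 *: extd Phi y).
by move=> Vy;mxext i j;rewrite evmE (isR_Om i j Vy) [RHS]mxE. Qed.
Let eveps y: V y -> eps y = cexp ((q^-1)%:C * Z o y). by move=> Vy;exact: smE. Qed.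
Let evqi y: V y -> qi y = (q^-1)%:C. exact: cstE. Qed.
Let evni y: V y -> ni y = (n.+1%:R)^-1. exact: cstE. Qed.
Let ii2: ii * ii = -1.
by rewrite /ii cstM -expr2 sqr_i;apply: smf_eq=> y Vy;rewrite (cstE _ Vy) (smfN _ Vy) (smf1 Vy). Qed.
Let iib: bar ii = - ii.
rewrite /ii barcst;apply: smf_eq=> y Vy;rewrite (smfN _ Vy) !(cstE _ Vy).
by apply: cpx_eq;rewrite /= ?oppr0.
Qed.
Let halfb: bar half = half.
by apply: smf_eq=> y Vy;rewrite (smf_barE _ Vy) (isR_half Vy);apply: cpx_eq;rewrite /= ?oppr0. Qed.
Let Dii i: D i ii = 0. exact: Dcst. Qed.
Let Dhalf i: D i half = 0. exact: Dcst. Qed.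
Let Dq i: D i qi = 0. exact: Dcst. Qed.
Let Dni i: D i ni = 0. exact: Dcst. Qed.
Let qn0: q%:C != 0 :> C. by rewrite -[0]/(0%:C) (inj_eq (@complexI R)) gt_eqF. Qed.
Let qV: qA * qi = 1. by rewrite /qA /qi cstM fmorphV mulfV ?cst1. Qed.
Let nV: n.+1%:R * ni = 1.
apply: smf_eq=> y Vy;rewrite (smfM _ _ Vy) (smf_nat _ Vy) (cstE _ Vy) (smf1 Vy).
by rewrite mulfV // pnatr_eq0.
Qed.
Let barq: bar qA = qA.
by apply: smf_eq=> y Vy;rewrite (smf_barE _ Vy) (cstE _ Vy);apply: cpx_eq;rewrite /= ?oppr0. Qed.

(** The ring identities evaluated at a point. [Y] stands for rho(s) Ym, [H] for the matrix of the
    inner product, [Q] for the pair (cc, Th) of [section_law], and [Z] for the complex coordinates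
    of the cone. *)
Theorem cone_kaehler y0: V y0 ->
 [/\ J y0 *m g y0 = 2^-1 *: extd Phi y0, (g y0)^T = g y0 & J y0 *m g y0 *m (J y0)^T = g y0] /\
 [/\ closed_at (fun z => J z *m g z) y0, forall w: 'rV[R]_N, w != 0 -> 0 < (w *m g y0 *m w^T) 0 0 & ricci g y0 = 0].
move=> Vy0;have [F [FE FEb EF FbE]] := frame.
(* From here on only the proved identities about these elements count; opaque, they are not unfolded
   during unification. *)
clearbody eps phi half ii qA qi ni Jm RY HH QQ zz.
have K1:= pot_metric HD barK barD FE FEb EF half2 phib ii2 iib Dii Dhalf halfb Jb JE.
have K2:= pot_J_metric HD barK barD FE FEb EF half2 phib iib Dii Dhalf halfb Jb JE.
have K3:= kmetric_sym HD barK barD FE FEb EF half2 phib.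
have K4:= pot_closed HD phi Jm Dhalf.
move: K1 K2 K3;set K := kmetric _ _ _ _ _ _=> K1 K2 K3.
have evK y: V y -> evm K y = map_mx rC (g y).
 move=> Vy;rewrite -K1 (evmM _ _ Vy) evm_tr (evOm Vy) (evJ Vy) map_trmx -map_mxM.
 by rewrite (Hg Vy).
have c1 y: V y -> J y *m g y = 2^-1 *: extd Phi y.
 by move=> Vy;apply: rC_inj;rewrite map_mxM -(evK _ Vy) -(evJ Vy) -(evmM _ _ Vy) K2 (evOm Vy).
have isR_g i l: isR (K i l) (fun y => g y i l).
 by move=> y Vy;rewrite -evmE (evK _ Vy) mxE.
have [phi' phiV]: exists phi', phi * phi' = 1.
 by apply: smf_inv=> y Vy;rewrite (isR_phi Vy) -[0]/(0%:C) (inj_eq (@complexI R)) gt_eqF // r0.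
have [eps' epsV]: exists eps', eps * eps' = 1.
 by apply: smf_inv=> y Vy;rewrite (eveps Vy);exact: cexp_neq0.
have [G' GV]: exists G', G o o * G' = 1.
 by apply: smf_inv=> y Vy;rewrite (evGe _ _ Vy) gt_eqF // Goo.
have [t' tV]: exists t', \det (rsubmx QQ) * t' = 1.
 apply: smf_inv=> y Vy;rewrite (evm_det _ Vy).
 have -> : evm (rsubmx QQ) y = rsubmx (Q y) by rewrite -(evQ Vy);mxext i l;rewrite !mxE.
 exact: HTu.
have [dG' dGV]: exists dG', \det G * dG' = 1.
 by apply: smf_inv=> y Vy;rewrite (evm_det _ Vy) (evG Vy);exact: Gunit.
have hess:= cone_hessian HD barK barD FE FEb EF half DH DW De phiE phiV epsV GV qV nV barq.
have gi1:= cone_gram_invP (lsubmx QQ) (rsubmx QQ) phiE epsV GV qV barq.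
move: hess gi1;set hh := \matrix_(a, b) _;set NN := cone_gram _ _ _ _ _ _ _=> hess gi1.
have NEy y (TT := evm (cone_frame (lsubmx QQ) (rsubmx QQ) eps qi) y): V y -> evm NN y = TT *m Gf y *m st TT.
 by move=> Vy;rewrite /NN /cone_gram (evmM _ _ Vy) (evmM _ _ Vy) (evG Vy) evm_tr (evm_bar _ Vy).
(* [cone_pos] with t = n / (n + 1), the factor in [cone_hessian]; NN is positive, being congruent to
   the Gram matrix by the invertible frame TT. *)
have hpos y (u: 'rV[C]_(1 + n)): V y -> u != 0 -> 0 < (u *m evm hh y *m st u) 0 0.
 clearbody hh NN Gf;move=> Vy u0;set TT := evm (cone_frame (lsubmx QQ) (rsubmx QQ) eps qi) y.
 have NE':= NEy _ Vy;rewrite -/TT in NE'.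
 have Tu: TT \in unitmx.
 rewrite unitmxE unitfE -(evm_det _ Vy) (cone_frame_det (lsubmx QQ) (rsubmx QQ) eps qi).
 rewrite (smfM _ _ Vy) (smf_exp _ _ Vy) (smfM _ _ Vy) !mulf_neq0 ?expf_neq0 //.
 - by rewrite (eveps Vy);exact: cexp_neq0.
 - by rewrite (evqi Vy) fmorphV invr_eq0.
 - have h: (\det (rsubmx QQ)) y * t' y = 1 by rewrite -(smfM _ _ Vy) tV (smf1 Vy).
 by apply: contra_eq_neq h=> ->;rewrite mul0r eq_sym oner_eq0.
 have stM p r s (A1: 'M[C]_(p, r)) (A2: 'M[C]_(r, s)): st (A1 *m A2) = st A2 *m st A1 by rewrite map_mxM trmx_mul.
 have stK p r (A1: 'M[C]_(p, r)): st (st A1) = A1 by rewrite -map_trmx trmxK conj_mxK.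
 have Nh: st (evm NN y) = evm NN y by rewrite NE' !stM stK (Gh Vy) mulmxA.
 have Np (w: 'rV[C]_(1 + n)): w != 0 -> 0 < (w *m evm NN y *m st w) 0 0.
 move=> w0;have wT: w *m TT != 0.
 by apply: contraNneq w0=> wT;rewrite -[w](mulmxK Tu) wT mul0mx.
 by have := Gpos Vy wT;rewrite stM NE' !mulmxA.
 have n1: 0 < n.+1%:R :> C by rewrite ltr0n.
 have t0: 0 <= n%:R / n.+1%:R :> C by rewrite divr_ge0 // ler0n.
 have t1: n%:R / n.+1%:R < 1 :> C by rewrite ltr_pdivrMr // mul1r ltr_nat.
 have := cone_pos Nh Np t0 t1 u0.
 rewrite hess (evmZ _ _ Vy) (evmB _ _ Vy) (evmZ _ _ Vy) (evmM _ _ Vy) evm_col evm_rowm.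
 have -> : (n%:R * ni * cone_gram_inv bar qA eps' G') y = n%:R / n.+1%:R / evm NN y o o.
 rewrite (smfM _ _ Vy) (smfM _ _ Vy) (smf_nat _ Vy) (evni Vy) (smf_invE Vy gi1);congr (_ * _^-1).
 by rewrite evmE.
 move=> pos;rewrite -scalemxAr -scalemxAl mxE;apply: mulr_gt0 pos.
 rewrite (smfM _ _ Vy) (smfM _ _ Vy) (smf_exp _ _ Vy) (isR_half Vy) (evni Vy) (smf_invE Vy phiV) (isR_phi Vy).
 have rp: 0 < (r2 y)%:C :> C by rewrite -[0]/(0%:C) ltcR r0.
 have hp: 0 < (2^-1: R)%:C :> C by rewrite -[0]/(0%:C) ltcR invr_gt0 ltr0n.
 by rewrite !mulr_gt0 ?invr_gt0 ?ltr0n ?exprn_gt0 ?invr_gt0.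
(* With u = w E, the real quadratic form at w is the Hermitian form of [hh] at u plus its
   conjugate. *)
have gpos y (w: 'rV[R]_N): V y -> w != 0 -> 0 < (w *m g y *m w^T) 0 0.
 move=> Vy w0;set u := map_mx rC w *m evm E y.
 have u0: u != 0.
 apply: contraNneq w0;rewrite /u (wE _ Vy)=> /rowP h;apply/eqP/(Hker Vy)=> a.
 by have := h a;rewrite !mxE.
 have hp:= hpos y u Vy u0;rewrite -ltcR.
 have -> : ((w *m g y *m w^T) 0 0)%:C = (map_mx rC w *m evm K y *m (map_mx rC w)^T) 0 0.
 by rewrite (evK _ Vy) map_trmx -!map_mxM [RHS]mxE.
 have -> : evm K y = evm E y *m evm hh y *m st (evm E y) + map_mx (fun z: C => z^*) (evm E y *m evm hh y *m st (evm E y)).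
 rewrite /K /kmetric (evmD _ _ Vy) !(evmM _ _ Vy) !evm_tr !(evm_bar _ Vy) !map_mxM map_trmx conj_mxK.
 by [].
 have wr: map_mx rC w = map_mx (fun z: C => z^*) (map_mx rC w) by rewrite conj_real.
 have e1: map_mx rC w *m (evm E y *m evm hh y *m st (evm E y)) *m (map_mx rC w)^T = u *m evm hh y *m st u.
 by rewrite /u map_mxM trmx_mul -wr !mulmxA.
 have e2 (X: 'M[C]_N): map_mx rC w *m map_mx (fun z: C => z^*) X *m (map_mx rC w)^T = map_mx (fun z: C => z^*) (map_mx rC w *m X *m (map_mx rC w)^T).
 by rewrite !map_mxM -map_trmx -wr.
 rewrite mulmxDr mulmxDl e2 e1 mxE [X in _ + X]mxE.
 move: hp;set a := (_ *m st u) 0 0=> hp;apply: (addr_gt0 hp).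
 by have [x x0 ->] := Cpos hp;rewrite -[X in X < _]/(0%:C) /= oppr0 ltcR.
have gunit y: V y -> g y \in unitmx.
 move=> Vy;rewrite -row_free_unit;apply/inj_row_free=> w wg;apply/eqP;apply: contraT=> /(gpos _ _ Vy).
 by rewrite wg mul0mx mxE ltxx.
have [hi hhi]: exists hi: 'M[A]_(1 + n), hh *m hi = 1%:M.
 apply: evm_inv=> y Vy;rewrite -row_free_unit;apply/inj_row_free=> u uh;apply/eqP;apply: contraT=> /(hpos _ _ Vy).
 by rewrite uh mul0mx mxE ltxx.
have [gi ggi]: exists gi: 'M[A]_N, K *m gi = 1%:M.
 by apply: evm_inv=> y Vy;rewrite (evK _ Vy) map_unitmx gunit.
have isR_gi i l: isR (gi i l) (fun y => invmx (g y) i l).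
 move=> y Vy;have: evm K y *m evm gi y = 1%:M by rewrite -(evmM _ _ Vy) ggi (evm1 _ Vy).
 rewrite (evK _ Vy)=> h;have: map_mx rC (invmx (g y)) = evm gi y.
 by rewrite -[LHS]mulmx1 -h mulmxA -map_mxM mulVmx ?gunit // map_mx1 mul1mx.
 by move=> h';rewrite -evmE -h' mxE.
have isR_chr a i l: isR (chr D K gi half a i l) (fun y => christoffel g a i l y).
 apply: isRM=> //;apply: isR_sum=> b;apply: isRM=> //.
 by apply: isRB;[apply: isRD|];apply: isR_der;exact: isR_g.
have ric0:= cone_ricci HD barK barD FE FEb EF half2 phib DH DW (fun a i l => hT a i l FbE) De Dq Dni DG phiE
 phiV epsV GV tV dGV qV nV barq hhi ggi.
have gsym: (g y0)^T = g y0 by apply: rC_inj;rewrite -map_trmx -(evK _ Vy0) -evm_tr K3.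
split;split.
- exact: c1.
- exact: gsym.
- by rewrite (c1 _ Vy0) -(Hg Vy0).
- move=> i l a;have isR_om b d: isR (Om b d) (fun y => (J y *m g y) b d).
 by apply: isR_ext (isR_Om b d)=> y Vy;rewrite (c1 _ Vy).
 have := smf_at y0 (K4 i l a).
 rewrite (isRD (isRD (isR_der i (isR_om l a)) (isR_der l (isR_om a i))) (isR_der a (isR_om i l)) Vy0) smf0.
 by move=> /complexI.
- by move=> w;exact: gpos.
- mxext i l;rewrite [LHS]mxE [RHS]mxE;apply: (@complexI R).
 have h:= smf_at y0 (ric0 i l);rewrite smf0 in h;apply: etrans h;apply/esym;move: (y0) (Vy0).
 apply: isR_sum=> a;apply: isRD;first by apply: isRB;apply: isR_der;exact: isR_chr.
 by apply: isR_sum=> b;apply: isRB;apply: isRM;exact: isR_chr.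
Qed.
End ConeKaehler.

(** * Complex coordinates on the cone *)

Section ConeCoords.
Context {R: realType} {n: nat}.
Notation C := (cnum R).
Notation p := (1 + (n + n))%N.
Variables (q: R) (T: 'rV[R]_p -> 'rV[R]_p) (f: 'rV[R]_(n + n) -> R).

Definition coneX (y: 'rV[R]_(1 + p)): 'rV[R]_(n + n) := rsubmx (T (rsubmx y)).
(** z_0 = q (n+1) log r - (q/2) log ||s v||^2 + i theta is chosen so that |exp(z_0 / q)|^2 ||s v||^2
    = r^(2(n+1)). [T] is the transition to an adapted chart, which lets the coordinates be used in
    any chart. *)
Definition coneZ (a: 'I_(1 + n)) (y: 'rV[R]_(1 + p)): C :=
 match fintype.split a with
 | inl _ => (q * n.+1%:R * ln (lsubmx y 0 0) - q / 2%:R * f (coneX y)) +i* lsubmx (T (rsubmx y)) 0 0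
 | inr b => cplx (coneX y) 0 b
 end.

Lemma rsub_comp (m l: nat) (F: 'rV[R]_m -> 'rV[R]_l) (y: 'rV[R]_(1 + m)) w: lsm F (rsubmx y) ->
 lsm (fun y1: 'rV[R]_(1 + m) => F (rsubmx y1)) y /\
 'D_w (fun y1: 'rV[R]_(1 + m) => F (rsubmx y1)) y = rsubmx w *m 'J F (rsubmx y).
move=> sF;have sr: lsm (fun y1: 'rV[R]_(1 + m) => rsubmx y1) y by apply: lsm_linear=> a1 a2 a3;rewrite linearP.
split;first exact: (lsm_comp sr sF).
rewrite (@chain_rule _ _ _ _ (fun y1: 'rV[R]_(1 + m) => rsubmx y1) F _ _ (lsd sr) (lsd sF)).
rewrite (derive_linear (rsubmx: {linear 'rV[R]_(1 + m) -> 'rV[R]_m})).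
exact: derive_mulJ (lsd sF).
Qed.

Lemma lsub_derive (m: nat) (y: 'rV[R]_(1 + m)) w: lsm (fun y1: 'rV[R]_(1 + m) => lsubmx y1 0 0: R) y /\
 'D_w (fun y1: 'rV[R]_(1 + m) => lsubmx y1 0 0: R) y = lsubmx w 0 0.
have sl: lsm (fun y1: 'rV[R]_(1 + m) => lsubmx y1) y by apply: lsm_linear=> a1 a2 a3;rewrite linearP.
split;first exact: ((lsm_mx _ _).1 sl 0 0).
rewrite (dfb_ij 0 0 (lsd sl)).2.
by rewrite (derive_linear (lsubmx: {linear 'rV[R]_(1 + m) -> 'rV[R]_1})).
Qed.

Variable y: 'rV[R]_(1 + p).
Context (sT: lsm T (rsubmx y))
 (sf: lsm f (coneX y))
 (r0: 0 < lsubmx y 0 0).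
Notation Dj := ('J T (rsubmx y)).
Notation r := (lsubmx y 0 0).

Lemma coneX_D w: lsm coneX y /\ 'D_w coneX y = rsubmx (rsubmx w *m Dj).
have [s1 d1] := rsub_comp w sT;split.
 by apply: lsm_comp s1 _;apply: lsm_linear=> a1 a2 a3;rewrite linearP.
rewrite (@derive_post R 'rV[R]_(1 + p) 1 p 1 (n + n) (rsubmx: {linear 'rV[R]_p -> 'rV[R]_(n + n)})
 (fun y1 => T (rsubmx y1)) y w (lsd s1)).
by rewrite d1.
Qed.

Lemma coneZ_D (a: 'I_(1 + n)) w: clsm (coneZ a) y /\
 cD w (coneZ a) y = match fintype.split a with
 | inl _ => (q * n.+1%:R * (lsubmx w 0 0 * r^-1) - q / 2%:R * (rsubmx (rsubmx w *m Dj) *m grad f (coneX y)) 0 0) +i*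
 lsubmx (rsubmx w *m Dj) 0 0
 | inr b => cplx (rsubmx (rsubmx w *m Dj)) 0 b end.
have [sX dX] := coneX_D w;have [s1 d1] := rsub_comp w sT;have [sr dr] := lsub_derive y w.
have eX (j: 'I_(n + n)): lsm (fun y1 => coneX y1 0 j: R) y /\ 'D_w (fun y1 => coneX y1 0 j: R) y = rsubmx (rsubmx w *m Dj) 0 j.
 by split;[exact: ((lsm_mx _ _).1 sX 0 j)|rewrite (dfb_ij 0 j (lsd sX)).2 dX].
rewrite /coneZ;case: fintype.split=> [_|b];last first.
 have [l1 e1] := eX (lshift n b);have [l2 e2] := eX (rshift n b).
 split;first by split;[apply: lsm_ext l1|apply: lsm_ext l2] => y1;rewrite [cplx _ 0 b]mxE.
 rewrite /cD [RHS]mxE -e1 -e2;apply: cpx_eq=> /=;congr ('D_w _ y);by fext y1;rewrite [cplx _ 0 b]mxE.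
have sfX: lsm (fun y1 => f (coneX y1)) y by exact: lsm_compK.
have slr:= lsm_ln r0 sr.
have h0: lsm (fun y1 => lsubmx (T (rsubmx y1)) 0 0: R) y /\
 'D_w (fun y1 => lsubmx (T (rsubmx y1)) 0 0: R) y = lsubmx (rsubmx w *m Dj) 0 0.
 have e1:= dfb_ij 0 (lshift (n + n) 0) (lsd s1).
 have E: (fun y1: 'rV[R]_(1 + p) => lsubmx (T (rsubmx y1)) 0 0: R) = fun y1 => T (rsubmx y1) 0 (lshift (n + n) 0).
 by fext y1;rewrite mxE.
 rewrite E;split;first exact: ((lsm_mx _ _).1 s1 0 _).
 by rewrite e1.2 d1 [RHS]mxE.
have sc (c: R) (g: 'rV[R]_(1 + p) -> R): lsm g y -> lsm (fun z => c * g z) y by move=> hg;apply: lsm_mul=> //;exact: lsm_cst.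
split;first by split;[apply: lsm_add;[exact: sc|apply: lsm_opp;exact: sc]|exact: h0.1].
rewrite /cD;apply: cpx_eq;last exact: h0.2.
rewrite [LHS]/= [RHS]/=.
have [e1 d1'] := derive_Zl (q * n.+1%:R) w (lsd slr);have [e2 d2'] := derive_Zl (q / 2%:R) w (lsd sfX).
have il: is_derive (lsubmx y 0 0) (1: R) (@ln R) (lsubmx y 0 0)^-1 by apply: is_derive1_ln.
have dl:= derive_fun w il (lsd sr).
have df: 'D_w (fun y1 => f (coneX y1)) y = (rsubmx (rsubmx w *m Dj) *m grad f (coneX y)) 0 0.
 by rewrite (chain_rule _ (lsd sX) (lsd sf)) dX (gradE _ (lsd sf)).
by rewrite (deriveB (dfd e1) (dfd e2)) d1' d2' dl dr df.
Qed.

Hypothesis q0: 0 < q.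
Variable D': 'M[R]_p.
Hypothesis DD: D' *m Dj = 1%:M.
Let g := grad f (coneX y).
Let Jm: 'M[R]_(1 + p) := block_mx 0 (r^-1 *: (xi_row q *m D')) (- r *: (Dj *m eta_col q g)) (Dj *m phi_mx q g *m D').

(** The term - (q/2) f in z_0 compensates the horizontal parts of eta-bar and phi, so that J acts on
    the differentials of z_0 and of the base coordinates as multiplication by i. *)
Lemma coneZ_J (a: 'I_(1 + n)) w: cD (w *m Jm) (coneZ a) y = 'i * cD w (coneZ a) y.
have [_ ->] := coneZ_D a (w *m Jm);have [_ ->] := coneZ_D a w.
set w' := rsubmx w *m Dj.
have E1: lsubmx (w *m Jm) = - r *: (w' *m eta_col q g).
 by rewrite -[w in LHS]hsubmxK mul_row_block row_mxKl mulmx0 add0r -scalemxAr mulmxA.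
have E2: rsubmx (w *m Jm) *m Dj = lsubmx w *m (r^-1 *: xi_row q) + w' *m phi_mx q g.
 rewrite -[w in LHS]hsubmxK mul_row_block row_mxKr mulmxDl -!mulmxA -scalemxAl -!mulmxA DD !mulmx1.
 by rewrite /w' mulmxA.
have E3: w' *m phi_mx q g = row_mx (- (q / 2%:R) *: (rsubmx w' *m g)) (rsubmx w' *m stdJ n).
 by rewrite -{1}[w']hsubmxK /phi_mx mul_row_block !mulmx0 !add0r -scalemxAr.
have E4: rsubmx (rsubmx (w *m Jm) *m Dj) = rsubmx w' *m stdJ n.
 by rewrite E2 E3 /xi_row scale_row_mx scaler0 mul_mx_row mulmx0 add_row_mx row_mxKr add0r.
have E5: lsubmx (rsubmx (w *m Jm) *m Dj) 0 0 = r^-1 * lsubmx w 0 0 * (q * n.+1%:R) - q / 2%:R * (rsubmx w' *m g) 0 0.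
 rewrite E2 E3 /xi_row scale_row_mx mul_mx_row add_row_mx row_mxKl mxE [X in X + _]mxE big_ord1 [X in _ + X]mxE.
 by rewrite [X in _ * X]mxE [X in _ * (_ * X)]mxE eqxx mulr1n mulNr;congr (_ - _);ring.
case: fintype.split=> [_|b];last by rewrite E4 cplx_stdJ mxE.
rewrite E4 E5 E1 [X in _ * (X * _)]mxE eta_col_eval -/w'.
have rn: r != 0 by rewrite gt_eqF. have qn: q != 0 by rewrite gt_eqF.
have nn: n.+1%:R != 0 :> R by rewrite pnatr_eq0.
move: (lsubmx w 0 0) (lsubmx w' 0 0) ((rsubmx w' *m stdJ n *m g) 0 0) ((rsubmx w' *m g) 0 0)=> a1 a2 a3 a4.
move: (n.+1%:R) nn (r) rn=> m1 m0 r1 r10.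
by apply: cpx_eq;rewrite ?cReM ?cImM /=;field;rewrite ?r10 ?qn ?m0.
Qed.

Lemma coneZ_ker w: (forall a, cD w (coneZ a) y = 0) -> w = 0.
move=> h;set w' := rsubmx w *m Dj.
have hb (b: 'I_n): cplx (rsubmx w') 0 b = 0.
 have := h (rshift 1 b);have [_ ->] := coneZ_D (rshift 1 b) w.
 by case: split_ordP=> j;rewrite ?ord1=> /eqP;rewrite eq_shift // => /eqP ->.
have w'r: rsubmx w' = 0.
 have: cplx (rsubmx w') = 0 by rowext b;rewrite hb mxE.
 move/(congr1 (@realify R n));rewrite cplxK=> ->;rowext i;rewrite /realify.
 by case: (split_ordP i)=> l ->;rewrite ?row_mxEl ?row_mxEr !mxE.
have := h (lshift n 0);have [_ ->] := coneZ_D (lshift n 0) w.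
case: split_ordP=> j;last by move=> /eqP;rewrite eq_shift.
rewrite -/w' w'r mul0mx [(0: 'M[R]_1) 0 0]mxE mulr0 subr0=> _ E.
have w'l: lsubmx w' = 0.
 by mxext i l;rewrite !ord1 [RHS]mxE;have := congr1 (@cIm R) E.
have wl: lsubmx w = 0.
 mxext i l;rewrite !ord1 [RHS]mxE;have := congr1 (@cRe R) E=> /= /eqP.
 by rewrite !mulf_eq0 invr_eq0 (gt_eqF q0) (gt_eqF r0) pnatr_eq0 /= orbF=> /eqP.
have w'0: w' = 0 by rewrite -[w']hsubmxK w'l w'r row_mx0.
have wr: rsubmx w = 0 by rewrite -[rsubmx w]mulmx1 -(mulmx1C DD) mulmxA -/w' w'0 mul0mx.
by rewrite -[w]hsubmxK wl wr row_mx0.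
Qed.
End ConeCoords.

(** * Derivatives of complex functions of real variables and of inner products *)

Section CDRules.
Context {R: realType} {N: nat}.
Notation C := (cnum R).
Implicit Types (F H: 'rV[R]_N -> C) (y w: 'rV[R]_N).

Lemma cD_mul w F H y: clsm F y -> clsm H y -> cD w (fun z => F z * H z) y = cD w F y * H y + F y * cD w H y.
move=> [a b] [c d];have da:= dfd (v := w) (lsd a);have db:= dfd (v := w) (lsd b).
have dc:= dfd (v := w) (lsd c);have dd:= dfd (v := w) (lsd d).
rewrite /cD;apply: cpx_eq.
 via ('D_w (fun z => cRe (F z) * cRe (H z) - cIm (F z) * cIm (H z): R) y).
 by rewrite [LHS]/=;congr ('D_w _ y);fext z;rewrite cReM.
 by rewrite (deriveMBM da dc db dd) [RHS]cReD !cReM /=;move: ('D_w _ y) ('D_w _ y) ('D_w _ y) ('D_w _ y) (F y) (H y)=> ? ? ? ? [? ?] [? ?] /=;ring.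
via ('D_w (fun z => cRe (F z) * cIm (H z) + cIm (F z) * cRe (H z): R) y).
 by rewrite [LHS]/=;congr ('D_w _ y);fext z;rewrite cImM.
by rewrite (deriveMDM da dd db dc) [RHS]cImD !cImM /=;move: ('D_w _ y) ('D_w _ y) ('D_w _ y) ('D_w _ y) (F y) (H y)=> ? ? ? ? [? ?] [? ?] /=;ring.
Qed.

Lemma cD_conj w F y: clsm F y -> cD w (fun z => (F z)^*) y = (cD w F y)^*.
move=> [a b];rewrite /cD;apply: cpx_eq;first by rewrite /=;congr ('D_w _ y);fext z;case: (F z).
rewrite [RHS]/= -deriveN;last exact: dfd (lsd b).
have E: (fun z => cIm (F z)^* : R) = - (fun z => cIm (F z): R).
 by fext z;change (cIm (F z)^* = - cIm (F z));case: (F z).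
exact: (congr1 (fun h => 'D_w h y) E).
Qed.

Lemma cD_cst w c y: cD w (fun=> c) y = 0.
by rewrite /cD !derive_cst. Qed.

Lemma cD_bigsum (I: Type) (r: seq I) (F: I -> 'rV[R]_N -> C) w y: (forall i, clsm (F i) y) ->
 cD w (fun z => \sum_(i <- r) F i z) y = \sum_(i <- r) cD w (F i) y.
move=> h;elim: r=> [|i r IH].
 have -> : (fun z => \sum_(j <- [::]) F j z) = (fun=> 0: C) by fext z;rewrite big_nil.
 by rewrite big_nil cD_cst.
rewrite big_cons -IH;have [a b] := h i;have [c d] := clsm_sum r h.
have da:= dfd (v := w) (lsd a);have db:= dfd (v := w) (lsd b).
have dc:= dfd (v := w) (lsd c);have dd:= dfd (v := w) (lsd d).
have E: (fun z => \sum_(j <- i :: r) F j z) = fun z => F i z + \sum_(j <- r) F j z.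
 by fext z;rewrite big_cons.
rewrite E /cD;apply: cpx_eq;rewrite [RHS]/=.
 rewrite -(deriveD da dc) [LHS]/=;congr ('D_w _ y);fext z;exact: cReD.
rewrite -(deriveD db dd) [LHS]/=;congr ('D_w _ y);fext z;exact: cImD.
Qed.

Lemma cD_holo n (F: 'rV[C]_n -> C) (X: 'rV[R]_N -> 'rV[R]_(n + n)) w y: lsm X y -> lsm F (cplx (X y)) ->
 clsm (fun z => F (cplx (X z))) y /\ cD w (fun z => F (cplx (X z))) y = 'D_(cplx ('D_w X y)) F (cplx (X y)).
move=> sX sF;have [hr him] := lsm_Re sF;have [dr er] := holo_Re (lsd sF);have [di ei] := holo_Im (lsd sF).
split;first by split;[exact: (lsm_compK sX hr)|exact: (lsm_compK sX him)].
rewrite /cD;apply: cpx_eq.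
 by rewrite -er -(chain_rule _ (lsd sX) (lsd hr)).
by rewrite -ei -(chain_rule _ (lsd sX) (lsd him)).
Qed.

Context {k r: nat} {GC: lie_group C k}.
Variables (rho: GC -> 'M[C]_r) (Gu: set GC) (ip: 'cV[C]_r -> 'cV[C]_r -> C).
Hypothesis hi: invariant_inner_product rho Gu ip.
Definition gram_mx: 'M[C]_r := \matrix_(i, j) ip (delta_mx i 0) (delta_mx j 0).

Lemma gram_mxE u z: ip u z = (u^T *m gram_mx *m map_mx (fun x: C => x^*) z) 0 0.
rewrite (ipE hi) -mulmxA mxE;sumext i;rewrite mxE;congr (_ * _).
rewrite (ip_conj hi) (ipE hi) rmorph_sum mxE;sumext l.
by rewrite [X in _ = X * _]mxE [X in _ = _ * X]mxE (ip_conj hi (delta_mx i 0)) mulrC;exact: rmorphM.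
Qed.

Lemma gram_cols p (Y: 'M[C]_(r, p)) a c: (Y^T *m gram_mx *m map_mx (fun x: C => x^*) Y) a c = ip (col a Y) (col c Y).
rewrite gram_mxE;have -> : (col a Y)^T = row a Y^T by rewrite tr_col.
by rewrite -row_mul map_col -col_mulmx -row_mul [RHS]mxE [RHS]mxE.
Qed.

Lemma cD_ip w (W W': 'rV[R]_N -> 'cV[C]_r) y: (forall i, clsm (fun z => W z i 0) y) -> (forall i, clsm (fun z => W' z i 0) y) ->
 cD w (fun z => ip (W z) (W' z)) y =
 ip (\col_i cD w (fun z => W z i 0) y) (W' y) + ip (W y) (\col_i cD w (fun z => W' z i 0) y).
move=> h h'.
have E u z: ip u z = \sum_i u i 0 * \sum_l ((z l 0)^* * (ip (delta_mx l 0) (delta_mx i 0))^*).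
 rewrite (ipE hi);sumext i;congr (_ * _).
 by rewrite (ip_conj hi) (ipE hi) rmorph_sum;sumext l;rewrite rmorphM.
pose S i z := \sum_l ((W' z l 0)^* * (ip (delta_mx l 0) (delta_mx i 0))^*).
have Sc i: clsm (S i) y by apply: clsm_sum=> l;apply: clsm_mul;[exact: clsm_conj|exact: clsm_cst].
have DS i: cD w (S i) y = \sum_l ((cD w (fun z => W' z l 0) y)^* * (ip (delta_mx l 0) (delta_mx i 0))^*).
 rewrite cD_bigsum;last by move=> l;apply: clsm_mul;[exact: clsm_conj|exact: clsm_cst].
 sumext l;rewrite (cD_mul _ (clsm_conj (h' l)) (clsm_cst _ _)) cD_cst mulr0 addr0.
 by rewrite (cD_conj _ (h' l)).
have -> : (fun z => ip (W z) (W' z)) = fun z => \sum_i W z i 0 * S i z by fext z;exact: E.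
rewrite cD_bigsum;last by move=> i;exact: clsm_mul.
rewrite !E -big_split;sumext i;rewrite (cD_mul _ (h i) (Sc i)) DS mxE;congr (_ * _ + _ * _).
by sumext l;rewrite mxE.
Qed.
End CDRules.

(** Phi is r^2 times eta-bar: the prefactor 1 / (q (n+1)) cancels the q of the del-term but remains
    on dtheta. *)
Lemma Phi_alg (R: realType) (q t a d m: R) (d1 d2: (cnum R)): 0 < q -> 0 < m ->
 a%:C%C = ((q * m)^-1)%:C%C * (- (q%:C%C * 'i%C / 2) * (d1 - d2) + d%:C%C) ->
 (t * a)%:C%C = - (t%:C%C * 'i%C / (2 * m%:C%C)) * (d1 - d2) + (t / (q * m) * d)%:C%C.
move=> q0 m0 E;have -> : (t * a)%:C%C = t%:C%C * a%:C%C :> (cnum R) by exact: rmorphM.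
have c0 (x: R): 0 < x -> x%:C%C != 0 :> (cnum R).
 by move=> x0;rewrite -[0]/(0%:C%C) (inj_eq (@complexI R)) gt_eqF.
have qn:= c0 _ q0;have mn:= c0 _ m0.
rewrite E;have -> : (t / (q * m) * d)%:C%C = t%:C%C / (q%:C%C * m%:C%C) * d%:C%C :> (cnum R).
 by rewrite !rmorphM fmorphV rmorphM.
have -> : ((q * m)^-1)%:C%C = (q%:C%C * m%:C%C)^-1 :> (cnum R) by rewrite fmorphV rmorphM.
by move: (q%:C%C) qn (m%:C%C) mn=> Q Q0 m1 m10;field;rewrite Q0 m10.
Qed.

(** * The exterior derivative under changes of coordinates *)

Section Exterior.
Context {R: realType} {m: nat}.

Lemma derive_rowcol (V: nmod R) (f: V -> 'rV[R]_m) (g: V -> 'cV[R]_m) z w: lsm f z -> lsm g z ->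
 'D_w (fun t => f t *m g t) z 0 0 = ('D_w f z *m g z) 0 0 + (f z *m 'D_w g z) 0 0.
move=> sf sg;have df i:= dfb_ij 0 i (lsd sf);have dg i:= dfb_ij i 0 (lsd sg).
rewrite -(dfb_ij 0 0 (lsd (lsm_mulmx sf sg))).2.
have -> : (fun t => (f t *m g t) 0 0: R) = \sum_(i < m) (fun t => f t 0 i * g t i 0).
 by fext t;rewrite fct_sumE mxE.
have fgi i: derivable (fun t => f t 0 i * g t i 0: R) z w.
 by apply: derivableM;apply: dfd;[exact: (df i).1|exact: (dg i).1].
rewrite derive_sum // ![(_ *m _) 0 0]mxE -big_split;sumext i.
by rewrite (derive_mulr (dfd (df i).1) (dfd (dg i).1)) (df i).2 (dg i).2.
Qed.

(** The second derivatives of F enter symmetrically and cancel under antisymmetrization. *)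
Lemma extd_pull (a b: 'rV[R]_m -> 'cV[R]_m) (F: 'rV[R]_m -> 'rV[R]_m) z: lsm F z -> lsm b (F z) ->
 (\forall t \near z, a t = 'J F t *m b (F t)) -> extd a z = 'J F z *m extd b (F z) *m ('J F z)^T.
move=> sF sb near_a;have sJ:= jacobian_lsm sF;have sbF:= lsm_comp sF sb.
have sa: lsm a z by apply: lsm_near_eq (lsm_mulmx sJ sbF);apply: filterS near_a=> t ->.
pose mat (h: 'rV[R]_m -> 'cV[R]_m) t: 'M[R]_m := \matrix_(i, l) ('D_(dlt i) h t l 0).
have extE h t: lsm h t -> extd h t = mat h t - (mat h t)^T.
 move=> sh;mxext i l;rewrite !mxE /pderiv.
 by rewrite (dfb_ij l 0 (lsd sh)).2 (dfb_ij i 0 (lsd sh)).2.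
have matE h t w: lsm h t -> 'D_w h t = (w *m mat h t)^T.
 move=> sh;rewrite deriveE;last exact: lsd.
 rewrite diff_rV_sum;last exact: lsd.
 by apply/colP=> l;rewrite summxE !mxE;sumext i;rewrite !mxE.
have tr1 (B: 'M[R]_1): B 0 0 = B^T 0 0 by rewrite mxE.
have key (w u: 'rV[R]_m): (w *m mat a z *m u^T) 0 0 = ('D_w ('D_u F) z *m b (F z)) 0 0 + (w *m 'J F z *m mat b (F z) *m ('J F z)^T *m u^T) 0 0.
 have E1: (w *m mat a z *m u^T) 0 0 = (u *m 'D_w a z) 0 0.
 by rewrite (matE _ _ _ sa) [LHS]tr1 trmx_mul trmxK.
 have sU: lsm (fun t => 'D_u F t) z by exact: lsm_D.
 have E2: u *m 'D_w a z = 'D_w (fun t => 'D_u F t *m b (F t)) z.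
 rewrite -(derive_post (mulmx u: {linear 'cV[R]_m -> 'M[R]_(1, 1)}) w (lsd sa)).
 apply: derv_eq;apply: filterS2 near_a (lsm_near sF)=> t -> st.
 by rewrite /= mulmxA -(derive_mulJ u (lsd st)).
 rewrite E1 E2 (derive_rowcol w sU sbF);congr (_ + _).
 rewrite (chain_rule w (lsd sF) (lsd sb)) (matE _ _ _ sb) !(derive_mulJ _ (lsd sF)).
 by rewrite [LHS]tr1 !trmx_mul !trmxK !mulmxA.
have bil (w u: 'rV[R]_m): (w *m extd a z *m u^T) 0 0 = (w *m ('J F z *m extd b (F z) *m ('J F z)^T) *m u^T) 0 0.
 have sw (B: 'M[R]_m) (w' u': 'rV[R]_m): (w' *m B^T *m u'^T) 0 0 = (u' *m B *m w'^T) 0 0.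
 by rewrite [LHS]tr1 !trmx_mul !trmxK mulmxA.
 rewrite (extE _ _ sa) (extE _ _ sb) !mulmxBr !mulmxBl mulmxBr mulmxBl [LHS]mxE [X in _ + X]mxE [RHS]mxE [X in _ = _ + X]mxE.
 have E3: (w *m (mat a z)^T *m u^T) 0 0 = (u *m mat a z *m w^T) 0 0 := sw _ _ _.
 have S:= lsm_schwarz (@schwarzR R) w u sF.
 rewrite E3 (key w u) (key u w) S.
 have -> : (w *m ('J F z *m (mat b (F z))^T *m ('J F z)^T) *m u^T) 0 0 = (u *m 'J F z *m mat b (F z) *m ('J F z)^T *m w^T) 0 0.
 by rewrite [LHS]tr1 !trmx_mul !trmxK !mulmxA.
 by rewrite !mulmxA;ring.
mxext i l;have := bil (dlt i) (dlt l).
by rewrite !trmx_delta -!rowE -!colE !mxE.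
Qed.

Lemma pull_metric (t: R) (D B J J': 'M[R]_m): J *m D = D *m J' ->
 t *: (D *m B *m D^T) *m J^T = D *m (t *: B *m J'^T) *m D^T.
move=> h;rewrite -!scalemxAl -scalemxAr -scalemxAl;congr (_ *: _).
by rewrite -!mulmxA -trmx_mul h trmx_mul.
Qed.
End Exterior.

(** * The Calabi-Yau structure in the charts of the cone *)

Section ConeGeometry.
Context {R: realType} {k n N: nat}.
Notation C := (cnum R).
Notation p := (1 + (n + n))%N.
Notation o := (lshift n 0: 'I_(1 + n)).
Variables (GC: lie_group C k) (P: set GC) (X: manifold C n) (pr: GC -> X)
 (rho: GC -> 'M[C]_N) (v: 'cV[C]_N) (Gu: set GC)
 (ip: 'cV[C]_N -> 'cV[C]_N -> C) (chi: GC -> C) (q: R)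
 (M: manifold R p) (j: M -> set (GC * C)).
Context (q0: 0 < q)
 (HR: smooth_rep rho)
 (hi: invariant_inner_product rho Gu ip)
 (v0: v != 0).
Variables (Ym: 'M[C]_(N, 1 + n)) (Zm: 'M[C]_(1 + n, N)).
Context (hYv: col o Ym = v)
 (hZ: Zm *m Ym = 1%:M)
 (hgram: gram_law rho ip Ym)
 (hsec: section_law pr rho v Ym).
Variables (eta: chart R p M -> 'rV[R]_p -> 'cV[R]_p) (xi: chart R p M -> 'rV[R]_p -> 'rV[R]_p).
Variable phi: chart R p M -> 'rV[R]_p -> 'M[R]_p.
Notation adapted := (adapted_chart P rho v ip chi q j).
Notation sect := (local_section pr).
Notation logn := (logvnorm2 rho v ip).
Context (eta_sm: forall e, atlas e -> smooth_on (img e) (eta e))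
 (xi_sm: forall e, atlas e -> smooth_on (img e) (xi e))
 (phi_sm: forall e, atlas e -> smooth_on (img e) (phi e))
 (tens: forall U s c e' e y, sect U s -> adapted U s c e' -> atlas e -> img e y -> dom e' (param e y) ->
 let D := 'J (trans e e') y in let D' := 'J (trans e' e) (trans e e' y) in let x := rsubmx (trans e e' y) in
 [/\ eta e y = D *m eta_col q (grad (logn c s) x), xi e y = xi_row q *m D' &
 phi e y = D *m phi_mx q (grad (logn c s) x) *m D']).

Definition cone_Phi (e: chart R p M) (y: 'rV[R]_(1 + p)): 'cV[R]_(1 + p) :=
 col_mx 0 (lsubmx y 0 0 ^+ 2 *: eta e (rsubmx y)).
(** The metric is built from the prescribed form and J; its symmetry, its J-invariance and the
    identity J g = (1/2) dPhi are consequences of the potential. *)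
Definition cone_metric (e: chart R p M) (y: 'rV[R]_(1 + p)): 'M[R]_(1 + p) :=
 2^-1 *: extd (cone_Phi e) y *m (cone_J eta xi phi e y)^T.

Section Local.
Variables (U: set X) (s: X -> GC) (c: chart C n X) (e' e: chart R p M).
Context (sU: sect U s) (aa: adapted U s c e') (ae: atlas e) (ae': atlas e').
Notation T := (trans e e').
Notation f := (logn c s).
Notation x y := (cplx (coneX T y)).
(** The work is done in an arbitrary chart [e], on the part where an adapted chart [e'] is available
    to supply coordinates; an atlas chart need not be adapted. *)
Definition cone_dom: set 'rV[R]_(1 + p) :=
 [set y | 0 < lsubmx y 0 0 /\ img e (rsubmx y) /\ dom e' (param e (rsubmx y))].
Notation V := cone_dom.

Lemma cone_dom_open: open V.
rewrite openE=> y [r0 [iy dy]];have [sr _] := lsub_derive y 0.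
have cr: {for y, continuous (fun y1: 'rV[R]_(1 + p) => lsubmx y1 0 0: R)} := lsm_cont sr.
have [sx _] := @rsub_comp R p p (fun z => z) y 0 (lsm_id _).
have cx: {for y, continuous (fun y1: 'rV[R]_(1 + p) => rsubmx y1)} := lsm_cont sx.
have n0: \forall t \near (lsubmx y 0 0: R), 0 < t by apply: onbhs;split;[exact: open_gt|exact: r0].
have n1: \forall y1 \near y, 0 < lsubmx y1 0 0 :> R := cr _ n0.
have n2: \forall y1 \near y, img e (rsubmx y1) /\ dom e' (param e (rsubmx y1)) := cx _ (near_trans ae ae' iy dy).
exact: filterS2 n1 n2.
Qed.
Let sT y: V y -> lsm T (rsubmx y).
by move=> [_ [iy dy]];exact: trans_lsm. Qed.
Let base y: V y -> [/\ img e' (T (rsubmx y)), img c (x y) & U (param c (x y))].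
move=> [_ [iy dy]];have [i1 _] := trans_img ae' dy;have [_ _ h] := aa.
by have [] := h _ i1.
Qed.
Let ac: atlas c. by have [] := aa. Qed.
Let sf y: V y -> lsm f (coneX T y).
by move=> Vy;have [i1 _ _] := base Vy;exact: (adapted_logn_lsm HR hi v0 sU aa i1). Qed.
Let sX y w: V y -> lsm (coneX T) y /\ 'D_w (coneX T) y = rsubmx (rsubmx w *m 'J T (rsubmx y)).
by move=> Vy;exact: coneX_D (sT Vy) w. Qed.
Let r0 y: V y -> 0 < lsubmx y 0 0. by case. Qed.

Definition Yh z := rho (s (param c z)) *m Ym.
(** The pair (cc, Th), which [section_law] gives point by point, as an explicit function of z: a
    left inverse of rho(s) Ym applied to the partial derivatives of rho(s) v. In this form it is
    visibly holomorphic. *)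
Definition Qh z: 'M[C]_(n, 1 + n) := (Zm *m rho (ginv (s (param c z))) *m
 \matrix_(l, b) ('D_(dlt b) (fun z => rho (s (param c z)) *m v) z: 'cV[C]_N) l 0)^T.
Let gs y: V y -> gsm (fun z => s (param c z)) (x y).
by move=> Vy;have [_ ix Ux] := base Vy;have [] := hsec sU ac ix Ux. Qed.
Let Wl y (u: 'cV[C]_N): V y -> lsm (fun z => rho (s (param c z)) *m u) (x y).
by move=> Vy;apply: lsm_mulmx;[exact: HR.2.2 (gs Vy)|exact: lsm_cst]. Qed.
Let Yl y: V y -> lsm Yh (x y).
by move=> Vy;apply: lsm_mulmx;[exact: HR.2.2 (gs Vy)|exact: lsm_cst]. Qed.
Let Ql y a b: V y -> lsm (fun z => Qh z a b: C) (x y).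
move=> Vy;apply: (lsm_ext (f := fun z => (Zm *m rho (ginv (s (param c z))) *m
 \matrix_(l, b) ('D_(dlt b) (fun z => rho (s (param c z)) *m v) z: 'cV[C]_N) l 0) b a: C)).
 by move=> z;rewrite [RHS]mxE.
have h: lsm (fun z => Zm *m rho (ginv (s (param c z))) *m
 \matrix_(l, b) ('D_(dlt b) (fun z => rho (s (param c z)) *m v) z: 'cV[C]_N) l 0) (x y).
 apply: lsm_mulmx;first by apply: lsm_mulmx;[exact: lsm_cst|apply: HR.2.2;exact: gsm_inv (gs Vy)].
 apply/lsm_mx=> l d;apply: (lsm_ext (f := fun z => ('D_(dlt d) (fun z => rho (s (param c z)) *m v) z: 'cV[C]_N) l 0: C)).
 by move=> z;rewrite [RHS]mxE.
 exact: ((lsm_mx _ _).1 (lsm_D (dlt d) (Wl v Vy)) l 0).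
exact: ((lsm_mx _ _).1 h b a).
Qed.
Let QhE y: V y -> exists (Th: 'M[C]_n) (cc: 'cV[C]_n), [/\ Th \in unitmx, Qh (x y) = row_mx cc Th &
 forall w, 'D_w (fun z => rho (s (param c z)) *m v) (x y) = Yh (x y) *m (w *m Qh (x y))^T].
move=> Vy;have [_ ix Ux] := base Vy;have [_ [Th [cc [Tu hD]]]] := hsec sU ac ix Ux.
have QE: Qh (x y) = row_mx cc Th.
 have ri: rho (ginv (s (param c (x y)))) *m rho (s (param c (x y))) = 1%:M by rewrite -HR.1 gmulV HR.2.1.
 rewrite /Qh;set B := \matrix_(l, b) _;have -> : B = rho (s (param c (x y))) *m Ym *m (row_mx cc Th)^T.
 apply: matrix_colP=> b;rewrite col_mulmx -tr_row row_row_mx !rowE -hD.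
 by apply/colP=> l;rewrite !mxE.
 by rewrite !mulmxA -[Zm *m _ *m rho _]mulmxA ri mulmx1 hZ mul1mx trmxK.
by exists Th, cc;split=> // w;rewrite QE mul_mx_row;exact: hD.
Qed.
Let cpdX y i: V y -> cplx ('D_(dlt i) (coneX T) y) = \row_b cpd i (coneZ q T f (rshift 1 b)) y.
move=> Vy;rowext b;rewrite [RHS]mxE cpd_cD;have [_ ->] := coneZ_D q (sT Vy) (sf Vy) (r0 Vy) (rshift 1 b) (dlt i).
have [_ ->] := sX (dlt i) Vy.
by case: split_ordP=> l;rewrite ?ord1=> /eqP;rewrite eq_shift // => /eqP ->.
Qed.
Let HW y i l: V y -> cpd i (fun z => Yh (x z) l o) y = (Yh (x y) *m ((\row_b cpd i (coneZ q T f (rshift 1 b)) y) *m Qh (x y))^T) l 0.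
move=> Vy;have [sx _] := sX (dlt i) Vy;have [Th [cc [_ _ hD]]] := QhE Vy.
have E: (fun z => Yh (x z) l o) = fun z => (rho (s (param c (x z))) *m v) l 0.
 by fext z;rewrite -hYv -col_mulmx [RHS]mxE.
have sw: lsm (fun z => (rho (s (param c z)) *m v) l 0: C) (x y) by exact: ((lsm_mx _ _).1 (Wl v Vy) l 0).
rewrite E cpd_cD (cD_holo _ sx sw).2 (cpdX _ Vy) -hD.
exact: (dfb_ij l 0 (lsd (Wl v Vy))).2.
Qed.
Let HT y a b: V y -> exists t: 'I_n -> C, forall i,
 cpd i (fun z => Qh (x z) a b) y = \sum_d cpd i (coneZ q T f (rshift 1 d)) y * t d.
move=> Vy;exists (fun d => 'D_(dlt d) (fun z => Qh z a b: C) (x y))=> i.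
have [sx _] := sX (dlt i) Vy;rewrite cpd_cD (cD_holo _ sx (Ql a b Vy)).2 (cpdX _ Vy).
rewrite (deriveE _ (lsd (Ql a b Vy))) (diff_rV_sum _ (lsd (Ql a b Vy))).
by sumext d;rewrite mxE.
Qed.
Let Gf z := (Yh (x z))^T *m gram_mx ip *m map_mx (fun t: C => t^*) (Yh (x z)).
Let GfE z a b: Gf z a b = ip (col a (Yh (x z))) (col b (Yh (x z))).
exact: (gram_cols hi). Qed.
Let HG y i: V y -> exists (m: 'M[C]_(1 + n)) lm, [/\ \tr m = n%:R * lm, forall c, m o c = lm * (c == o)%:R &
 (\matrix_(a, b) cpd i (fun z => Gf z a b) y) = m *m Gf y + Gf y *m (map_mx (fun t: C => t^*) m)^T].
move=> Vy;have [sx _] := sX (dlt i) Vy;set w := cplx ('D_(dlt i) (coneX T) y).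
have [m [lm [h1 h2 h3]]] := hgram (s (param c (x y))) (vel (fun z => s (param c z)) (x y) w).
exists m, lm;split=> //;mxext a b;rewrite [LHS]mxE.
have colY z d: col d (Yh z) = rho (s (param c z)) *m col d Ym by exact: col_mulmx.
have cY d l: clsm (fun z => col d (Yh (x z)) l 0) y /\
 cD (dlt i) (fun z => col d (Yh (x z)) l 0) y =
 (rho (s (param c (x y))) *m dtau rho (vel (fun z => s (param c z)) (x y) w) *m col d Ym) l 0.
 have E: (fun z => col d (Yh (x z)) l 0) = fun z => (rho (s (param c (x z))) *m col d Ym) l 0.
 by fext z;rewrite colY.
 have sw: lsm (fun z => (rho (s (param c z)) *m col d Ym) l 0: C) (x y) by exact: ((lsm_mx _ _).1 (Wl (col d Ym) Vy) l 0).
 rewrite E;have [c1 c2] := cD_holo (dlt i) sx sw;split;first exact: c1.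
 rewrite c2 (dfb_ij l 0 (lsd (Wl (col d Ym) Vy))).2 (rep_vec_derive _ _ HR (gs Vy)).
 by rewrite mulmxA.
have -> : (fun z => Gf z a b) = fun z => ip (col a (Yh (x z))) (col b (Yh (x z))) by fext z;exact: GfE.
rewrite cpd_cD (cD_ip hi);[|by move=> l;exact: (cY a l).1|by move=> l;exact: (cY b l).1].
have cE d: \col_l cD (dlt i) (fun z => col d (Yh (x z)) l 0) y =
 rho (s (param c (x y))) *m dtau rho (vel (fun z => s (param c z)) (x y) w) *m col d Ym.
 by apply/colP=> l;rewrite [LHS]mxE (cY d l).2.
rewrite !cE !colY h3 big_split [RHS]mxE;congr (_ + _);rewrite [RHS]mxE;sumext d.
 by rewrite GfE !colY.
by rewrite GfE !colY mulrC [X in _ = _ * X]mxE [X in _ = _ * X]mxE.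
Qed.
Let Yinj y: V y -> exists B: 'M[C]_(1 + n, N), B *m Yh (x y) = 1%:M.
move=> Vy;exists (Zm *m rho (ginv (s (param c (x y)))));rewrite /Yh.
have ri: rho (ginv (s (param c (x y)))) *m rho (s (param c (x y))) = 1%:M by rewrite -HR.1 gmulV HR.2.1.
by rewrite !mulmxA -[Zm *m _ *m rho _]mulmxA ri mulmx1.
Qed.
Let Gh y: (map_mx (fun t: C => t^*) (Gf y))^T = Gf y.
by mxext a b;rewrite [LHS]mxE [LHS]mxE !GfE -(ip_conj hi). Qed.
Let Gpos y (u: 'rV[C]_(1 + n)): V y -> u != 0 -> 0 < (u *m Gf y *m (map_mx (fun t: C => t^*) u)^T) 0 0.
move=> Vy u0;have -> : (u *m Gf y *m (map_mx (fun t: C => t^*) u)^T) 0 0 = ip (Yh (x y) *m u^T) (Yh (x y) *m u^T).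
 by rewrite (gram_mxE hi) trmx_mul trmxK map_mxM map_trmx /Gf !mulmxA.
have [_ _ h _] := hi;apply: h;apply: contraNneq u0=> Yu;have [B BY] := Yinj Vy.
by rewrite -[u]trmxK -[u^T]mul1mx -BY -mulmxA Yu mulmx0 trmx0.
Qed.

Notation Z := (coneZ q T f).
Notation Jc := (cone_J eta xi phi e).
Let D' (y: 'rV[R]_(1 + p)) := 'J (trans e' e) (T (rsubmx y)).
Let DD y: V y -> D' y *m 'J T (rsubmx y) = 1%:M.
by move=> [_ [iy dy]];have /mulmx1C := trans_JV ae ae' iy dy. Qed.
Let cone_JE y: V y -> Jc y = block_mx 0 ((lsubmx y 0 0)^-1 *: (xi_row q *m D' y))
 (- lsubmx y 0 0 *: ('J T (rsubmx y) *m eta_col q (grad f (coneX T y)))) ('J T (rsubmx y) *m phi_mx q (grad f (coneX T y)) *m D' y).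
by move=> [_ [iy dy]];have [E1 E2 E3] := tens sU aa ae iy dy;rewrite /cone_J E1 E2 E3. Qed.
Let HJ y w a: V y -> cD (w *m Jc y) (Z a) y = 'i * cD w (Z a) y.
move=> Vy;rewrite (cone_JE Vy);have h1:= coneZ_J (sT Vy);have h2:= h1 _ _ (sf Vy);have h3:= h2 _ (r0 Vy) q0.
exact: (h3 _ (DD Vy)). Qed.
Let Hker y w: V y -> (forall a, cD w (Z a) y = 0) -> w = 0.
move=> Vy;have h1:= coneZ_ker (sT Vy);have h2:= h1 _ _ (sf Vy);have h3:= h2 _ (r0 Vy) q0.
exact: (h3 _ (DD Vy)). Qed.
Let Zs a y: V y -> clsm (Z a) y.
by move=> Vy;have [h _] := coneZ_D q (sT Vy) (sf Vy) (r0 Vy) a 0. Qed.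
Let rs2 y w: lsm (fun z: 'rV[R]_(1 + p) => lsubmx z 0 0 ^+ 2: R) y /\
 'D_w (fun z: 'rV[R]_(1 + p) => lsubmx z 0 0 ^+ 2: R) y = 2%:R * lsubmx y 0 0 * lsubmx w 0 0.
have [sr dr] := lsub_derive y w;have d:= dfd (v := w) (lsd sr).
split;first by apply: lsm_ext (lsm_mul sr sr)=> z;rewrite expr2.
have -> : (fun z: 'rV[R]_(1 + p) => lsubmx z 0 0 ^+ 2: R) = fun z => lsubmx z 0 0 * lsubmx z 0 0.
 by fext z;rewrite expr2.
by rewrite (derive_mulr d d) dr;ring.
Qed.
Let comp_sm a b (F: 'rV[R]_p -> 'M[R]_(a, b)) y: smooth_on (img e) F -> V y ->
 lsm (fun z: 'rV[R]_(1 + p) => F (rsubmx z)) y.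
move=> sF [_ [iy _]];have oi: open (img e) by have [] := atlas_ok ae.
apply: lsm_comp (smooth_on_lsmE oi iy sF).
by apply: lsm_linear=> a1 a2 a3;rewrite linearP.
Qed.

Lemma cone_J_lsm y: V y -> lsm Jc y.
move=> Vy;have [sr _] := lsub_derive y 0;have r1:= r0 Vy.
have h1:= (lsm_mx _ _).1 (comp_sm (eta_sm ae) Vy);have h2:= (lsm_mx _ _).1 (comp_sm (xi_sm ae) Vy).
have h3:= (lsm_mx _ _).1 (comp_sm (phi_sm ae) Vy).
have sri: lsm (fun z: 'rV[R]_(1 + p) => (lsubmx z 0 0)^-1: R) y by apply: lsm_inv=> //;rewrite gt_eqF.
apply/lsm_mx=> i l;case: (split_ordP i)=> i1 ->;case: (split_ordP l)=> l1 ->.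
- by apply: (lsm_ext (f := fun=> 0: R));[move=> z;rewrite block_mxEul mxE|exact: lsm_cst].
- by apply: lsm_ext (lsm_mul sri (h2 i1 l1))=> z;rewrite block_mxEur [RHS]mxE.
- by apply: lsm_ext (lsm_mul (lsm_opp sr) (h1 i1 l1))=> z;rewrite block_mxEdl [RHS]mxE.
- by apply: lsm_ext (h3 i1 l1)=> z;rewrite block_mxEdr.
Qed.
(** J maps Y tangent to M to a vector with radial part - eta(Y) r d/dr, and d(r^2) of it is - 2 r^2
    eta(Y). *)
Let HPhi y: V y -> cone_Phi e y = - 2^-1 *: (Jc y *m grad (fun z: 'rV[R]_(1 + p) => lsubmx z 0 0 ^+ 2: R) y).
move=> Vy;apply: col_ext1=> w;have [sr _] := rs2 y 0.
rewrite -scalemxAr [RHS]mxE mulmxA -(gradE _ (lsd sr)) (rs2 y _).2.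
have -> : lsubmx (w *m Jc y) = - lsubmx y 0 0 *: (rsubmx w *m eta e (rsubmx y)).
 by rewrite -[w in LHS]hsubmxK mul_row_block row_mxKl mulmx0 add0r -scalemxAr.
rewrite -{1}[w]hsubmxK mul_row_col mulmx0 add0r -scalemxAr [LHS]mxE [X in _ = _ * (_ * X)]mxE.
by field.
Qed.
Let cexp_norm (z: C): cexp z * conjc (cexp z) = (expR (cRe z) ^+ 2)%:C.
have h:= cos2Dsin2 (cIm z).
have E: forall a: C, a * conjc a = (cRe a * cRe a + cIm a * cIm a)%:C.
 by case=> a b;apply: cpx_eq=> /=;ring.
by rewrite E Re_cexp Im_cexp;congr (_%:C);rewrite -[RHS]mulr1 -h;ring.
Qed.
Let Hr y: V y -> ((lsubmx y 0 0 ^+ 2)%:C: C) ^+ n.+1 =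
 cexp ((q^-1)%:C * Z o y) * (cexp ((q^-1)%:C * Z o y))^* * Gf y o o.
move=> Vy;have r1:= r0 Vy;set w := rho (s (param c (x y))) *m v.
have w0: w != 0 by exact: rv0 HR v0 _.
have GE: Gf y o o = (expR (f (coneX T y)))%:C.
 have cW: col o (Yh (x y)) = w by rewrite col_mulmx hYv.
 rewrite GfE cW (ip_real hi) -(vnorm_sq hi);congr (_%:C);rewrite /logvnorm2 lnK // posrE.
 by rewrite exprn_gt0 // (vnorm_gt0 hi).
have ReZ: cRe ((q^-1)%:C * Z o y) = n.+1%:R * ln (lsubmx y 0 0) - f (coneX T y) / 2%:R.
 rewrite /coneZ;case: split_ordP=> l;last by move=> /eqP;rewrite eq_shift.
 by rewrite cReM /= => _;field;rewrite gt_eqF.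
via ((expR (cRe ((q^-1)%:C * Z o y)) ^+ 2)%:C * Gf y o o: C);last first.
 by congr (_ * _);exact: esym (cexp_norm _).
rewrite ReZ GE -rmorphM -rmorphXn;congr (_%:C).
move: (f (coneX T y))=> F.
have E1: expR (n.+1%:R * ln (lsubmx y 0 0) - F / 2%:R) = lsubmx y 0 0 ^+ n.+1 * expR (- (F / 2%:R)).
 by rewrite expRD expRM_natl lnK // posrE.
have E2: expR (- (F / 2%:R)) * expR (- (F / 2%:R)) * expR F = 1.
 by rewrite -!expRD (_: _ + F = 0) ?expR0 //;field.
have E3: (lsubmx y 0 0 ^+ 2) ^+ n.+1 = lsubmx y 0 0 ^+ n.+1 * lsubmx y 0 0 ^+ n.+1 by rewrite -exprM mul2n -addnn exprD.
rewrite E3;via (lsubmx y 0 0 ^+ n.+1 * lsubmx y 0 0 ^+ n.+1 * (expR (- (F / 2%:R)) * expR (- (F / 2%:R)) * expR F)).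
 by rewrite E2 mulr1.
by rewrite E1;move: (expR (- _)) (expR F) (_ ^+ n.+1)=> A B D;ring.
Qed.
Let HTu y: V y -> \det (rsubmx (Qh (x y))) != 0.
by move=> Vy;have [Th [cc [Tu -> _]]] := QhE Vy;rewrite row_mxKr -unitfE -unitmxE. Qed.

Lemma cone_local y: V y ->
 [/\ Jc y *m cone_metric e y = 2^-1 *: extd (cone_Phi e) y, (cone_metric e y)^T = cone_metric e y &
 Jc y *m cone_metric e y *m (Jc y)^T = cone_metric e y] /\
 [/\ closed_at (fun z => Jc z *m cone_metric e z) y,
 forall w: 'rV[R]_(1 + p), w != 0 -> 0 < (w *m cone_metric e y *m w^T) 0 0 & ricci (cone_metric e) y = 0].
move=> Vy;have NE: (1 + p = (1 + n) + (1 + n))%N by lia.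
have Ys i a z (Vz: V z): clsm (fun z => Yh (x z) i a) z.
 have [sx _] := sX 0 Vz;have h: lsm (fun z => Yh z i a: C) (x z) := (lsm_mx _ _).1 (Yl Vz) i a.
 exact: (cD_holo 0 sx h).1.
have Qs i a z (Vz: V z): clsm (fun z => Qh (x z) i a) z.
 by have [sx _] := sX 0 Vz;exact: (cD_holo 0 sx (Ql i a Vz)).1.
have r2p z: V z -> 0 < lsubmx z 0 0 ^+ 2 :> R by move=> Vz;rewrite exprn_gt0 // r0.
exact: (@cone_kaehler R (1 + p) n N (Odom cone_dom_open Vy) NE Z Jc _ q (fun z => Yh (x z)) (gram_mx ip) (fun z => Qh (x z))
 (cone_Phi e) (cone_metric e) q0 Zs cone_J_lsm (fun z _ => (rs2 z 0).1) Ys Qs HJ Hker HW HT HTu HG (fun z _ => Gh z) Gpos r2p Hr HPhi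
 (fun z _ => erefl _) y Vy).
Qed.

Definition cone_coord y: 'rV[R]_(n.+1 + n.+1) := realify (\row_a Z a y: 'rV[C]_n.+1).

Lemma cone_coordP y: V y -> lsm cone_coord y /\ forall w, w *m 'J cone_coord y = realify (\row_a cD w (Z a) y: 'rV[C]_n.+1).
move=> Vy;have sl: lsm cone_coord y.
 apply/lsm_mx=> i l;rewrite /cone_coord /realify;case: (split_ordP l)=> a ->.
 by apply: lsm_ext (Zs a Vy).1=> z;rewrite row_mxEl !mxE.
 by apply: lsm_ext (Zs a Vy).2=> z;rewrite row_mxEr !mxE.
split=> // w;rewrite -(derive_mulJ w (lsd sl));rowext l.
rewrite -(dfb_ij 0 l (lsd sl)).2 /cone_coord /realify;case: (split_ordP l)=> a ->.
 by rewrite row_mxEl !mxE /=;congr ('D_w _ y);fext z;rewrite row_mxEl !mxE.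
by rewrite row_mxEr !mxE /=;congr ('D_w _ y);fext z;rewrite row_mxEr !mxE.
Qed.

Lemma cone_coord_J y: V y -> Jc y *m 'J cone_coord y = 'J cone_coord y *m stdJ n.+1.
move=> Vy;have [_ h] := cone_coordP Vy;apply: mulrow_ext=> w;rewrite !mulmxA !h -realify_i;congr realify.
by rowext a;rewrite !mxE;exact: HJ.
Qed.

Lemma cone_coord_free y: V y -> row_free ('J cone_coord y) && row_full ('J cone_coord y).
move=> Vy;have [_ h] := cone_coordP Vy.
have rf: row_free ('J cone_coord y).
 apply/inj_row_free=> w;rewrite h=> /(congr1 (@cplx R n.+1));rewrite realifyK=> /rowP E.
 by apply: (Hker Vy)=> a;have := E a;rewrite !mxE.
rewrite rf /row_full;move: rf;rewrite /row_free=> /eqP ->;apply/eqP;lia.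
Qed.

(** J acts as i on the differentials of all [Z], and only the zero vector is killed by all of
    them. *)
Lemma cone_J2 y: V y -> Jc y *m Jc y = - 1%:M.
move=> Vy;apply: mulrow_ext=> w;apply/eqP;rewrite mulmxN mulmx1 -subr_eq0 opprK;apply/eqP/(Hker Vy)=> a.
have i2: 'i * 'i = -1 :> C by rewrite -expr2 sqr_i.
have: cD (w *m (Jc y *m Jc y)) (Z a) y = - cD w (Z a) y by rewrite mulmxA !HJ // mulrA i2 mulN1r.
rewrite !(cD_sum _ (Zs a Vy))=> E;rewrite -[RHS](addNr (\sum_i (w 0 i)%:C * cpd i (Z a) y)) -E -big_split.
by sumext i;rewrite [(_ + w) 0 i]mxE rmorphD mulrDl.
Qed.
End Local.

(** * Globalization over the atlas of the cone *)

Section Global.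
Context (hj: circle_bundle P pr rho v ip chi q j)
 (eta_ch: forall e e' y, atlas e -> atlas e' -> overlap e e' y -> eta e y = 'J (trans e e') y *m eta e' (trans e e' y))
 (xi_ch: forall e e' y, atlas e -> atlas e' -> overlap e e' y -> xi e' (trans e e' y) = xi e y *m 'J (trans e e') y)
 (phi_ch: forall e e' y, atlas e -> atlas e' -> overlap e e' y ->
 phi e y *m 'J (trans e e') y = 'J (trans e e') y *m phi e' (trans e e' y)).
Notation A := (@atlas _ _ M).
Notation cc := (@cone_chart R p M).
Notation Jc := (cone_J eta xi phi).

Lemma cone_imgP e y: img (cc e) y -> 0 < lsubmx y 0 0 /\ img e (rsubmx y).
by move=> [[t m] [/= t0 dm] <-];rewrite row_mxKl row_mxKr [_%:M 0 0]mxE eqxx mulr1n;split=> //;exact: img_coord. Qed.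
Lemma cone_cover e y: A e -> img (cc e) y -> exists U s c e', [/\ sect U s, adapted U s c e', A e' & cone_dom e' e y].
move=> ae /cone_imgP[r0 iy];have [_ _ h1 h2] := hj;have [U [s [c [e' [sU aa dp]]]]] := h2 (param e (rsubmx y)).
by exists U, s, c, e';split=> //;exact: h1 sU aa.
Qed.
Lemma cone_overlap e e' y: overlap (cc e) (cc e') y -> 0 < lsubmx y 0 0 /\ overlap e e' (rsubmx y).
move=> [[t m] [[/= t0 dm] [_ dm']] <-];rewrite row_mxKl row_mxKr [_%:M 0 0]mxE eqxx mulr1n;split=> //.
by exists m.
Qed.
Lemma cone_transE e e' y: trans (cc e) (cc e') y = row_mx (lsubmx y) (trans e e' (rsubmx y)).
by rewrite /trans /=;congr row_mx;mxext a b;rewrite !ord1 [LHS]mxE eqxx mulr1n. Qed.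
Lemma overlapP e e' x: A e -> overlap e e' x -> img e x /\ dom e' (param e x).
by move=> ae [m [dm dm'] <-];rewrite (coordK (atlas_ok ae) dm);split=> //;exact: img_coord. Qed.

Lemma cone_trans_J e e' y: A e -> A e' -> overlap e e' (rsubmx y) ->
 lsm (trans (cc e) (cc e')) y /\ 'J (trans (cc e) (cc e')) y = block_mx 1%:M 0 0 ('J (trans e e') (rsubmx y)).
move=> ae ae' oy;have [iy dy] := overlapP ae oy;have sT:= trans_lsm ae ae' iy dy.
have [s1 d1] := rsub_comp 0 sT.
have sl (z: 'rV[R]_(1 + p)): lsm (fun z: 'rV[R]_(1 + p) => lsubmx z) z by apply: lsm_linear=> a1 a2 a3;rewrite linearP.
have E: trans (cc e) (cc e') = fun z => row_mx (lsubmx z) (trans e e' (rsubmx z)) by fext z;exact: cone_transE.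
have sE: lsm (trans (cc e) (cc e')) y by rewrite E;exact: lsm_row (sl y) s1.
split=> //;apply: mulrow_ext=> w;rewrite -(derive_mulJ w (lsd sE)).
rewrite -[w in RHS]hsubmxK mul_row_block !mulmx0 addr0 add0r mulmx1;rowext l.
rewrite -(dfb_ij 0 l (lsd sE)).2 E;case: (split_ordP l)=> b ->.
 rewrite row_mxEl;have -> : (fun z: 'rV[R]_(1 + p) => row_mx (lsubmx z) (trans e e' (rsubmx z)) 0 (lshift p b): R) = fun z => lsubmx z 0 b.
 by fext z;rewrite row_mxEl.
 by rewrite (dfb_ij 0 b (lsd (sl y))).2 (derive_linear (lsubmx: {linear 'rV[R]_(1 + p) -> 'rV[R]_1})).
rewrite row_mxEr;have -> : (fun z: 'rV[R]_(1 + p) => row_mx (lsubmx z) (trans e e' (rsubmx z)) 0 (rshift 1 b): R) = fun z => trans e e' (rsubmx z) 0 b.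
 by fext z;rewrite row_mxEr.
by rewrite (dfb_ij 0 b (lsd s1)).2;have [_ ->] := rsub_comp w sT.
Qed.

Lemma cone_Phi_lsm e y: A e -> img (cc e) y -> lsm (cone_Phi e) y.
move=> ae /cone_imgP[_ iy];have oi: open (img e) by have [] := atlas_ok ae.
have [sr _] := lsub_derive y 0.
have h: lsm (fun z: 'rV[R]_(1 + p) => eta e (rsubmx z)) y.
 apply: lsm_comp (smooth_on_lsmE oi iy (eta_sm ae)).
 by apply: lsm_linear=> a1 a2 a3;rewrite linearP.
apply/lsm_mx=> i l;rewrite /cone_Phi;case: (split_ordP i)=> a ->.
 by apply: (lsm_ext (f := fun=> 0: R));[move=> z;rewrite col_mxEu mxE|exact: lsm_cst].
by apply: lsm_ext (lsm_mul (lsm_mul sr sr) ((lsm_mx _ _).1 h a l))=> z;rewrite col_mxEd [RHS]mxE expr2.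
Qed.

Lemma cone_Phi_change e e' y: A e -> A e' -> 0 < lsubmx y 0 0 -> overlap e e' (rsubmx y) ->
 cone_Phi e y = 'J (trans (cc e) (cc e')) y *m cone_Phi e' (trans (cc e) (cc e') y).
move=> ae ae' r0 oy;rewrite (cone_trans_J ae ae' oy).2 cone_transE /cone_Phi row_mxKl row_mxKr (eta_ch ae ae' oy).
by rewrite mul_block_col !mulmx0 !mul0mx addr0 add0r scalemxAr.
Qed.

Lemma cone_J_change e e' y: A e -> A e' -> overlap e e' (rsubmx y) ->
 Jc e y *m 'J (trans (cc e) (cc e')) y = 'J (trans (cc e) (cc e')) y *m Jc e' (trans (cc e) (cc e') y).
move=> ae ae' oy;rewrite (cone_trans_J ae ae' oy).2 cone_transE /cone_J row_mxKl row_mxKr.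
rewrite !mulmx_block !mulmx0 !mul0mx !addr0 !add0r !mulmx1 !mul1mx -scalemxAl -(xi_ch ae ae' oy) (phi_ch ae ae' oy).
by rewrite -scalemxAr -(eta_ch ae ae' oy).
Qed.

Lemma cone_metric_change e e' y: A e -> A e' -> overlap (cc e) (cc e') y ->
 cone_metric e y = 'J (trans (cc e) (cc e')) y *m cone_metric e' (trans (cc e) (cc e') y) *m ('J (trans (cc e) (cc e')) y)^T.
move=> ae ae' oy;have [r0 oy1] := cone_overlap oy;have [sT _] := cone_trans_J ae ae' oy1.
have i': img (cc e') (trans (cc e) (cc e') y).
 have [[t m] [d1 d2] E] := oy;exists (t, m);first exact: d2.
 by rewrite -E /trans /= row_mxKl row_mxKr [_%:M 0 0]mxE eqxx mulr1n (coordK (atlas_ok ae) d1.2).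
have [iy dy] := overlapP ae oy1;have ov: cone_dom e' e y by [].
have nr: \forall t \near y, cone_Phi e t = 'J (trans (cc e) (cc e')) t *m cone_Phi e' (trans (cc e) (cc e') t).
 apply: filterS (onbhs (conj (cone_dom_open ae ae') ov))=> t [t0 [it dt]].
 apply: cone_Phi_change=> //;have [d E] := imgP (atlas_ok ae) it;exists (param e (rsubmx t))=> //.
rewrite /cone_metric (extd_pull sT (cone_Phi_lsm ae' i') nr).
exact: pull_metric (cone_J_change ae ae' oy1).
Qed.

Lemma cone_metric_lsm e y: A e -> img (cc e) y -> lsm (cone_metric e) y.
move=> ae iy;have sP:= cone_Phi_lsm ae iy;have [U [s [c [e' [sU aa ae' Vy]]]]] := cone_cover ae iy.
have h1:= (lsm_mx _ _).1 sP;have sJ:= (lsm_mx _ _).1 (cone_J_lsm ae Vy).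
apply: lsm_mulmx;last by apply/lsm_mx=> i l;apply: lsm_ext (sJ l i)=> z;rewrite [RHS]mxE.
apply/lsm_mx=> i l.
apply: lsm_ext (lsm_mul (lsm_cst (2^-1: R) y) (lsm_add (lsm_D (dlt i) (h1 l 0)) (lsm_opp (lsm_D (dlt l) (h1 i 0)))))=> z.
by rewrite [RHS]mxE;congr (_ * _);rewrite [RHS]mxE.
Qed.

Lemma cone_endo_field: endo_field A cc Jc.
split=> [e ae|e e' y ae ae' oy];last by apply: cone_J_change => //;have [] := cone_overlap oy.
apply: smooth_on_lsm=> y iy;have [U [s [c [e' [sU aa ae' Vy]]]]] := cone_cover ae iy.
have h:= cone_J_lsm ae Vy;exact: h.
Qed.

(** By [cone_cover] every point of every cone chart lies in some [cone_dom], and each condition is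
    pointwise or local there; the complex coordinates are those of [cone_coord]. *)
Lemma cone_calabi_yau: calabi_yau_metric A cc n.+1 Jc cone_metric.
split;last first.
 move=> e y ae iy;have [U [s [c [e' [sU aa ae' Vy]]]]] := cone_cover ae iy.
 by have [_ [_ _ h]] := cone_local sU aa ae ae' Vy.
split.
- split;first exact: cone_endo_field.
 move=> e y ae iy;have [U [s [c [e' [sU aa ae' Vy]]]]] := cone_cover ae iy.
 have h:= cone_J2 sU aa ae ae' Vy;exact: h.
 move=> e y ae iy;have [U [s [c [e' [sU aa ae' Vy]]]]] := cone_cover ae iy.
 exists (cone_dom e' e), (cone_coord s c e' e);split.
 + exact: cone_dom_open.
 + exact: Vy.
 + by apply: smooth_on_lsm=> z Vz;have [] := cone_coordP sU aa ae ae' Vz.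
 + by move=> z Vz;have h:= cone_coord_J sU aa ae ae' Vz;exact: h.
 + by have h:= cone_coord_free sU aa ae ae' Vy;exact: h.
- split.
 + by move=> e ae;apply: smooth_on_lsm=> y iy;exact: cone_metric_lsm.
 + by move=> e e' y ae ae' oy;exact: cone_metric_change.
 + move=> e y ae iy;have [U [s [c [e' [sU aa ae' Vy]]]]] := cone_cover ae iy.
 by have [[_ h _] _] := cone_local sU aa ae ae' Vy.
 + move=> e y w ae iy;have [U [s [c [e' [sU aa ae' Vy]]]]] := cone_cover ae iy.
 by have [_ [_ h _]] := cone_local sU aa ae ae' Vy;exact: h.
- move=> e y ae iy;have [U [s [c [e' [sU aa ae' Vy]]]]] := cone_cover ae iy.
 by have [[_ _ h] _] := cone_local sU aa ae ae' Vy.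
- move=> e y ae iy;have [U [s [c [e' [sU aa ae' Vy]]]]] := cone_cover ae iy.
 by have [_ [h _ _]] := cone_local sU aa ae ae' Vy;exact: h.
Qed.

Lemma cone_kaehler_form e y: A e -> img (cc e) y -> kaehler_form Jc cone_metric e y = 2^-1 *: extd (cone_Phi e) y.
move=> ae iy;have [U [s [c [e' [sU aa ae' Vy]]]]] := cone_cover ae iy.
by have [[h _ _] _] := cone_local sU aa ae ae' Vy.
Qed.
Lemma cone_Phi_form: one_form A cc cone_Phi.
split=> [e ae|e e' y ae ae' oy];first by apply: smooth_on_lsm => y iy;exact: cone_Phi_lsm.
by have [r0 oy1] := cone_overlap oy;exact: cone_Phi_change.
Qed.

Lemma cone_Phi_formula U s: sect U s -> is_eta_bar P pr rho v ip chi q j eta -> Phi_formula P rho v ip chi q j U s cone_Phi.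
move=> sU [_ he] c e y w aa /cone_imgP[r0 iy] f r x wx dth.
have := he U s c e (rsubmx y) (rsubmx w) sU aa iy;cbv zeta;rewrite -/f -/x -/wx -/dth.
have -> : (w *m cone_Phi e y) 0 0 = r ^+ 2 * (rsubmx w *m eta e (rsubmx y)) 0 0.
 by rewrite -[w in LHS]hsubmxK mul_row_col mulmx0 add0r -scalemxAr [LHS]mxE.
have m0: 0 < n.+1%:R :> R by rewrite ltr0n.
have nE: (n.+1%:R: C) = (n.+1%:R: R)%:C by rewrite rmorph_nat.
by rewrite nE;exact: Phi_alg q0 m0.
Qed.
End Global.
End ConeGeometry.

(** * Assembly for the circle bundle over the flag manifold *)

Unset Implicit Arguments.
Set Strict Implicit.
Set Printing Implicit Defensive.
Close Scope complex_scope.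

Theorem theorem3 (R : realType) (k n N l I : nat)
  (G : lie_group R k) (GC : lie_group (R[i] : numFieldType) k)
  (B : 'M[R[i] : numFieldType]_k)
  (* Cartan subalgebra, simple roots, and the parabolic subgroup P *)
  (h : {vspace 'rV[R[i] : numFieldType]_k}) (Sig Theta : seq (weight h))
  (P : set GC)
  (* the flag manifold X = GC / P *)
  (X : manifold (R[i] : numFieldType) n) (pr : GC -> X)
  (* the module V(delta_P), its highest weight vector and its inner product *)
  (rho : GC -> 'M[R[i] : numFieldType]_N) (v : 'cV[R[i] : numFieldType]_N)
  (Gu : set GC)
  (ip : 'cV[R[i] : numFieldType]_N -> 'cV[R[i] : numFieldType]_N ->
        (R[i] : numFieldType))
  (* the character defining L = K_X^(l / I) *)
  (chi : GC -> (R[i] : numFieldType))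
  (* the contact manifold (M, eta, G), with M = Q(L) *)
  (M : manifold R (1 + (n + n)))
  (eta : chart R (1 + (n + n)) M -> 'rV[R]_(1 + (n + n)) ->
         'cV[R]_(1 + (n + n)))
  (act : G -> M -> M) (j : M -> set (GC * (R[i] : numFieldType)))
  (proj : M -> X) :
  let q : R := l%:R / I%:R in
  (1 <= n)%N -> (0 < l)%N ->
  connected [set: G] -> compact [set: G] -> semisimple G ->
  simply_connected R GC -> complexification G GC B ->
  cartan_subalgebra GC h -> simple_roots GC Sig -> {subset Theta <= Sig} ->
  closed_subgroup_of (parabolic_algebra GC Sig Theta) P ->
  quotient_manifold P pr ->
  fano_index X I ->
  highest_weight_module rho Sig (delta GC Sig Theta) v ->
  compact_real_form B Gu -> invariant_inner_product rho Gu ip ->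
  character_of P (((q%:C)%C : R[i]) *: delta GC Sig Theta) chi ->
  compact [set: M] -> homogeneous_contact eta act ->
  circle_bundle P pr rho v ip chi q j -> bundle_projection pr j proj ->
  exists eta_bar xi phi,
    [/\ is_eta_bar P pr rho v ip chi q j eta_bar,
        is_xi P pr rho v ip chi q j xi,
        is_phi proj eta_bar xi phi &
        let J := cone_J eta_bar xi phi in
        let A := @atlas R _ M in
        exists g Phi,
          [/\ calabi_yau_metric A (@cone_chart R _ M) n.+1 J g,
              one_form A (@cone_chart R _ M) Phi,
              forall e y, A e -> img (cone_chart e) y ->
                kaehler_form J g e y = 2^-1 *: extd (Phi e) y &
              forall p : X, exists U s,
                [/\ local_section pr U s, U p &
                    Phi_formula P rho v ip chi q j U s Phi]]].
Proof.
move=> q n0 l0 _ _ ssG _ cG hc hS _ hP hq hI hw cu hi hchi _ _ hj hproj.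
have q0 : 0 < q by rewrite /q divr_gt0 // ltr0n //; case: hI.
have HR : smooth_rep rho by apply: hol_rep; case: hw.
have v0 : v != 0 by case: hw.
have [Pg _ _ _] := hP; have [_ prE sects] := hq; have [chi0 chiM _] := hchi.
have [c1 _ c3] := hc.
have h1 x y : x \in h -> y \in h -> lbr (adm GC) x y = 0.
  by move=> hx hy; have := c1 x y hx hy; rewrite (lbE (@schwarzC R)).
have h3 x : x \in h -> exists2 D : 'M[R[i] : numFieldType]_k, D \in unitmx &
    forall i, exists t, lbr (adm GC) x (row i D) = t *: row i D.
  move=> hx; have [B' B'u hB] := c3 x hx; exists B' => // i; have [t ht] := hB i.
  by exists t; rewrite -ht (lbE (@schwarzC R)).
(* All the root data live on this basis of weight vectors; the group-theoretic facts below are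
   stated relative to it. *)
have [Bm [a [Bu ab]]] := @weight_basis _ _ (adm GC) (adm_lie (@schwarzC R) GC) h h1 h3.
(* [Pchar] and [Peig] govern the change of adapted charts; [lie_geometry] below supplies the frame
   and the two laws behind Ricci-flatness. *)
have Pchar := P_char ssG cG hc hS hP hq hw cu hchi Bu ab.
have Peig := P_eigen ssG cG hc hS hP hq hw cu hchi Bu ab.
have [Ym [Zm [hYv hZ hgram hsec]]] := lie_geometry ssG cG hc hS hP hq hw cu hi Bu ab.
have [eta_bar [xi [phi [he hx hp tens]]]] := adapted_tensors q0 HR hi v0 Pg prE Pchar Peig chi0 chiM hj hproj.
exists eta_bar, xi, phi; split; [exact: he|exact: hx|exact: hp|].
have [[e1 e2] _] := he; have [[x1 x2] _] := hx; have [[p1 p2] _] := hp.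
exists (cone_metric eta_bar xi phi), (cone_Phi eta_bar); split.
- have H := cone_calabi_yau q0 HR hi v0 hYv hZ hgram hsec e1 x1 p1 tens hj e2 x2 p2; exact: H.
- have H := cone_Phi_form e1 e2; exact: H.
- have H := cone_kaehler_form q0 HR hi v0 hYv hZ hgram hsec e1 x1 p1 tens hj; exact: H.
- move=> p; have [U [s [sU Up]]] := sects p; exists U, s; split; [exact: sU|exact: Up|].
  have H := cone_Phi_formula q0 sU he; exact: H.
Qed.
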